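(* Let $n\ge2$. The infimum $$C_{n,|D|}:=\inf_{\psi\in H^{1/2}(\Sigma\mathbb{S}^n)\setminus\{0\}}\frac{\displaystyle\int_{\mathbb{S}^n}\langle|D|\psi,\psi\rangle\,dv_{g_0}}{\displaystyle\left(\int_{\mathbb{S}^n}|\psi|^{\frac{2n}{n-1}}\,dv_{g_0}\right)^{\frac{n-1}{n}}}$$ is not attained by any non-zero spinor $\psi\in H^{1/2}(\Sigma\mathbb{S}^n)$.
   Context: $(\mathbb{S}^n,g_0)$ is the standard unit sphere with its spin structure, $\Sigma\mathbb{S}^n$ its spinor bundle with pointwise Hermitian inner product $\langle\cdot,\cdot\rangle$, $dv_{g_0}$ the Riemannian volume element, and $D$ the (self-adjoint) Dirac operator; $|D|:=(D^2)^{1/2}$ is defined by the spectral theorem. $H^{1/2}(\Sigma\mathbb{S}^n)$ is the form domain of $|D|$ (the domain of $|D|^{1/2}$ in $L^2$), and $\int_{\mathbb{S}^n}\langle|D|\psi,\psi\rangle\,dv_{g_0}:=\||D|^{1/2}\psi\|_{L^2}^2$ is the associated closed quadratic form. *)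

(* Defs.v *)
From HB Require Import structures.
From mathcomp Require Import all_boot all_order all_algebra complex.
From mathcomp Require Import all_classical all_reals all_analysis.
From mathcomp Require Import measurable_realfun ring zify.

Set Implicit Arguments.
Unset Strict Implicit.
Unset Printing Implicit Defensive.

Import Order.TTheory GRing.Theory Num.Theory.
Import numFieldNormedType.Exports.

Local Open Scope classical_set_scope.
Local Open Scope complex_scope.
Local Open Scope ring_scope.

(* 'rV[T]_n gets the product sigma-algebra, like n.-tuple T. *)
Section measurable_row.
Context d (T : measurableType d) (n : nat).

Definition row_coord (i : 'I_n) (x : 'rV[T]_n) : T := x ord0 i.

Let row_set0 : g_sigma_preimage row_coord set0.
Proof. exact: sigma_algebra0. Qed.

Let row_setC A :
  g_sigma_preimage row_coord A -> g_sigma_preimage row_coord (~` A).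
Proof. exact: sigma_algebraC. Qed.

Let row_bigcup (F : (set 'rV[T]_n)^nat) :
  (forall i, g_sigma_preimage row_coord (F i)) ->
  g_sigma_preimage row_coord (\bigcup_i (F i)).
Proof. exact: sigma_algebra_bigcup. Qed.

HB.instance Definition _ := @isMeasurable.Build (measure_tuple_display d)
  'rV[T]_n (g_sigma_preimage row_coord) row_set0 row_setC row_bigcup.

Lemma measurable_row_coord (i : 'I_n) :
  measurable_fun [set: 'rV[T]_n] (row_coord i).
Proof.
move=> _ Y mY; rewrite setTI; apply: sub_sigma_algebra => /=.
rewrite -bigcup_seq/=; exists i => /=; first by rewrite mem_index_enum.
by exists Y => //; rewrite setTI.
Qed.

Lemma measurable_fun_row d1 (T1 : measurableType d1) (f : T1 -> 'rV[T]_n) :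
  (forall i, measurable_fun [set: T1] (row_coord i \o f)) ->
  measurable_fun [set: T1] f.
Proof.
move=> mf _ A mA; rewrite setTI.
suff : g_sigma_preimage (fun i => row_coord i \o f) `<=` measurable.
  by apply; rewrite g_sigma_preimage_comp; exists A => //; rewrite setTI.
apply: smallest_sub; first exact: sigma_algebra_measurable.
rewrite -bigcup_seq; apply: bigcup_sub => i _.
by move=> B [C mC <-]; exact: mf.
Qed.

End measurable_row.

Section lebesgue_row.
Context (R : realType).

Definition cons_row n (p : R * 'rV[R]_n) : 'rV[R]_n.+1 :=
  \row_i oapp (p.2 ord0) p.1 (unlift ord0 i).

Lemma cons_row0 n (p : R * 'rV[R]_n) : cons_row p ord0 ord0 = p.1.
Proof. by rewrite mxE unlift_none. Qed.

Lemma cons_rowS n (p : R * 'rV[R]_n) i :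
  cons_row p ord0 (lift ord0 i) = p.2 ord0 i.
Proof. by rewrite mxE liftK. Qed.

Lemma measurable_cons_row n : measurable_fun [set: R * 'rV[R]_n] (@cons_row n).
Proof.
apply: measurable_fun_row => i; have [j ->|->] := unliftP ord0 i.
  have -> : row_coord (lift ord0 j) \o @cons_row n = row_coord j \o snd.
    by apply/funext => p; rewrite /= /row_coord cons_rowS.
  by apply: measurableT_comp => //; exact: measurable_row_coord.
by rewrite (_ : _ \o _ = fst)//; apply/funext => p; exact: cons_row0.
Qed.

Section step.
Context (n : nat) (m : {measure set 'rV[R]_n -> \bar R}).

(* Lebesgue measure on R x R^n, transported to R^(n+1). *)
Definition lebesgue_row_step : set 'rV[R]_n.+1 -> \bar R :=
  pushforward (@lebesgue_measure R \x^ m)%E (@cons_row n).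

Let pf : {measure set 'rV[R]_n.+1 -> \bar R} :=
  measure_function_pushforward__canonical__measure_function_Measure
    (@lebesgue_measure R \x^ m)%E (@measurable_cons_row n).

Let step0 : lebesgue_row_step set0 = 0%E.
Proof. exact: (measure0 pf). Qed.

Let step_ge0 A : (0 <= lebesgue_row_step A)%E.
Proof. exact: (measure_ge0 pf). Qed.

Let step_sigma_additive : semi_sigma_additive lebesgue_row_step.
Proof. exact: (@measure_semi_sigma_additive _ _ _ pf). Qed.

HB.instance Definition _ := isMeasure.Build _ _ _ lebesgue_row_step
  step0 step_ge0 step_sigma_additive.

End step.

Fixpoint lebesgue_row n : {measure set 'rV[R]_n -> \bar R} :=
  if n is n'.+1 return {measure set 'rV[R]_n -> \bar R}
  then lebesgue_row_step (lebesgue_row n')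
  else \d_ (0 : 'rV[R]_0).

End lebesgue_row.

Section sphere.
Context (R : realType).

Definition edot n (u v : 'rV[R]_n) : R := \sum_i u 0 i * v 0 i.

Definition enorm n (u : 'rV[R]_n) : R := Num.sqrt (edot u u).

(* S^n as a subset of R^(n+1). *)
Definition sphere n : set 'rV[R]_n.+1 := [set x | edot x x = 1].

(* Inverse stereographic projection from the pole e_0; its image is
   S^n minus that pole. *)
Definition stereo n (y : 'rV[R]_n) : 'rV[R]_n.+1 :=
  (1 + edot y y)^-1 *: cons_row (edot y y - 1, 2 *: y).

Lemma measurable_edot n : measurable_fun setT (fun y : 'rV[R]_n => edot y y).
Proof.
apply: measurable_sum => i.
by apply: measurable_funM; exact: (@measurable_row_coord _ R n i).
Qed.

Lemma edot_ge0 n (y : 'rV[R]_n) : 0 <= edot y y.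
Proof. by apply: sumr_ge0 => i _; rewrite -expr2 sqr_ge0. Qed.

Lemma measurable_stereo_inv n :
  measurable_fun setT (fun y : 'rV[R]_n => (1 + edot y y)^-1).
Proof.
have -> : (fun y : 'rV[R]_n => (1 + edot y y)^-1) =
          (fun y => (1 + edot y y) `^ (-1)).
  by apply/funext => y; rewrite powR_inv1// addr_ge0// edot_ge0.
apply: (measurableT_comp (measurable_powR _)).
by apply: measurable_funD => //; exact: measurable_edot.
Qed.

Lemma measurable_stereo n : measurable_fun setT (@stereo n).
Proof.
have mi := @measurable_stereo_inv n; have me := @measurable_edot n.
apply: measurable_fun_row => i; have [j ->|->] := unliftP ord0 i.
  have -> : row_coord (lift ord0 j) \o @stereo n =
            (fun y => (1 + edot y y)^-1 * (2 * row_coord j y)).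
    by apply/funext => y; rewrite /= /row_coord mxE cons_rowS mxE.
  apply: measurable_funM => //; apply: measurable_funM => //.
  exact: measurable_row_coord.
have -> : row_coord ord0 \o @stereo n =
          (fun y => (1 + edot y y)^-1 * (edot y y - 1)).
  by apply/funext => y; rewrite /= /row_coord mxE cons_row0.
by apply: measurable_funM => //; exact: measurable_funB.
Qed.

Lemma stereo_sphere n (y : 'rV[R]_n) : sphere (stereo y).
Proof.
rewrite /sphere /= {1}/edot big_ord_recl.
under eq_bigr do rewrite !mxE liftK /= mxE.
rewrite !mxE unlift_none /=; set r := edot y y; set c := (1 + r)^-1.
rewrite (eq_bigr (fun i => (c * 2) ^+ 2 * (y 0 i * y 0 i))); last first.
  by move=> i _; ring.
rewrite -mulr_sumr -/(edot y y) -/r /c; field.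
by rewrite gt_eqF// ltr_wpDr// edot_ge0.
Qed.

Lemma is_derive_coord n (j : 'I_n) (y u : 'rV[R]_n) :
  is_derive y u (fun z : 'rV[R]_n => z 0 j) (u 0 j).
Proof.
apply: DeriveDef.
  by apply: diff_derivable; exact: differentiable_coord.
rewrite /derive; apply: cvg_lim => //.
apply: cvg_near_cst; near=> h.
rewrite /= !mxE addrK /GRing.scale /= mulKf//.
near: h; exact: nbhs_dnbhs_neq.
Unshelve. all: by end_near.
Qed.

Lemma is_derive_edot n (y u : 'rV[R]_n) :
  is_derive y u (fun z : 'rV[R]_n => edot z z) (2 * edot y u).
Proof.
have h (j : 'I_n) := is_derive_coord j y u.
have -> : (fun z : 'rV[R]_n => edot z z) =
  \sum_(j < n) ((fun z : 'rV[R]_n => z 0 j) * (fun z : 'rV[R]_n => z 0 j)).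
  by apply/funext => z; rewrite /edot fct_sumE.
apply: is_derive_eq.
rewrite /edot mulr_sumr; apply: eq_bigr => j _.
by rewrite /GRing.scale /=; ring.
Qed.

Lemma is_derive_stereo_inv n (y u : 'rV[R]_n) :
  is_derive y u (fun z : 'rV[R]_n => (1 + edot z z)^-1)
    (- (1 + edot y y)^-2 * (2 * edot y u)).
Proof.
have h : is_derive y u (fun z : 'rV[R]_n => 1 + edot z z) (2 * edot y u).
  have := is_derive_edot y u => h.
  have -> : (fun z : 'rV[R]_n => 1 + edot z z) = cst 1 + (fun z => edot z z).
    by apply/funext.
  by apply: is_derive_eq; rewrite add0r.
have n0 : 1 + edot y y != 0 by rewrite gt_eqF// ltr_pwDl// edot_ge0.
apply: DeriveDef; first by apply: derivableV => //; exact: ex_derive.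
by rewrite deriveV // derive_val.
Qed.

Lemma stereo_conformal n (y u v : 'rV[R]_n) :
  \sum_i 'D_u (fun z => stereo z 0 i) y * 'D_v (fun z => stereo z 0 i) y =
  (2 / (1 + edot y y)) ^+ 2 * edot u v.
Proof.
have n0 : 1 + edot y y != 0 by rewrite gt_eqF// ltr_pwDl// edot_ge0.
set c := (1 + edot y y)^-1.
have d0 (w : 'rV[R]_n) :
    'D_w (fun z => stereo z 0 0) y = 4 * c ^+ 2 * edot y w.
  have -> : (fun z : 'rV[R]_n => stereo z 0 0) =
      (fun z => (1 + edot z z)^-1) * ((fun z => edot z z) + cst (-1)).
    by apply/funext => z; rewrite mxE cons_row0.
  have h1 := is_derive_stereo_inv y w; have h2 := is_derive_edot y w.
  by rewrite derive_val /GRing.scale /= fctE /= /c; field.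
have dS (w : 'rV[R]_n) (j : 'I_n) :
    'D_w (fun z => stereo z 0 (lift ord0 j)) y =
    2 * c * w 0 j - 4 * c ^+ 2 * edot y w * y 0 j.
  have -> : (fun z : 'rV[R]_n => stereo z 0 (lift ord0 j)) =
      (fun z => (1 + edot z z)^-1) * (2 *: (fun z : 'rV[R]_n => z 0 j)).
    by apply/funext => z; rewrite mxE cons_rowS mxE.
  have h1 := is_derive_stereo_inv y w; have h2 := is_derive_coord j y w.
  by rewrite derive_val /GRing.scale /= /GRing.scale /= /c; field.
rewrite big_ord_recl !d0.
rewrite (eq_bigr (fun j => 4 * c ^+ 2 * (u 0 j * v 0 j)
  + (- (8 * c ^+ 3 * edot y v) * (y 0 j * u 0 j)
  + (- (8 * c ^+ 3 * edot y u) * (y 0 j * v 0 j)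
  + 16 * c ^+ 4 * edot y u * edot y v * (y 0 j * y 0 j))))); last first.
  by move=> j _; rewrite !dS; ring.
rewrite !big_split /= -!mulr_sumr -!/(edot _ _) /c; field.
by [].
Qed.

(* By stereo_conformal, g_0 = (2 / (1 + |y|^2))^2 |dy|^2 in this chart, hence
   dv_{g_0} = (2 / (1 + |y|^2))^n dy. *)
Definition stereo_density n (y : 'rV[R]_n) : R := (2 / (1 + edot y y)) ^+ n.

Lemma measurable_stereo_density n : measurable_fun setT (@stereo_density n).
Proof.
apply: measurable_funX; apply: measurable_funM => //.
exact: measurable_stereo_inv.
Qed.

Lemma stereo_density_ge0 n (y : 'rV[R]_n) : 0 <= stereo_density y.
Proof. by rewrite exprn_ge0// divr_ge0// addr_ge0// edot_ge0. Qed.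

(* The Riemannian volume of S^n, seen as a measure on R^(n+1) carried by S^n. *)
Definition sphere_volume n (A : set 'rV[R]_n.+1) : \bar R :=
  (\int[lebesgue_row R n]_(y in @stereo n @^-1` A) (stereo_density y)%:E)%E.

Section measure.
Variable n : nat.
Local Notation vol := (@sphere_volume n).

Let vol0 : vol set0 = 0%E.
Proof. by rewrite /sphere_volume preimage_set0 integral_set0. Qed.

Let vol_ge0 A : (0 <= vol A)%E.
Proof. by apply: integral_ge0 => y _; rewrite lee_fin stereo_density_ge0. Qed.

Let vol_sigma_additive : semi_sigma_additive vol.
Proof.
have mpre (A : set 'rV[R]_n.+1) : measurable A ->
    measurable (@stereo n @^-1` A).
  by move=> mA; rewrite -[X in measurable X]setTI; exact: measurable_stereo.
move=> F mF tF mUF; rewrite /sphere_volume preimage_bigcup.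
apply: semi_sigma_additive_nng_induced.
- by apply/measurable_EFinP; exact: measurable_stereo_density.
- by move=> y; rewrite lee_fin stereo_density_ge0.
- by move=> i; exact: mpre.
- apply/trivIsetP => /= i j _ _ ij; rewrite -preimage_setI.
  by move/trivIsetP : tF => /(_ _ _ _ _ ij) ->//; rewrite preimage_set0.
- by rewrite -preimage_bigcup; exact: mpre.
Qed.

HB.instance Definition _ := isMeasure.Build _ _ _ vol
  vol0 vol_ge0 vol_sigma_additive.

End measure.
End sphere.

Section spinors.
Context (R : realType) (n : nat).
Local Notation C := R[i].

Definition spinor_rank : nat := (2 ^ n./2)%N.
Local Notation N := spinor_rank.

(* A complex spinor representation of the Clifford algebra Cl_n on C^N in
   which unit vectors act unitarily.  N is the dimension of the irreducible
   complex Cl_n-modules, so gamma is irreducible. *)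
Definition clifford_rep (gamma : 'I_n -> 'M[C]_N) : Prop :=
  (forall i j, gamma i *m gamma j + gamma j *m gamma i =
     (- (2 * (i == j)%:R))%:M) /\
  (forall i, (map_mx conjc (gamma i))^T = - gamma i).

Lemma clifford_matrices k : exists m, m = (2 ^ k)%N /\
    exists g : nat -> 'M[C]_m,
    (forall i j, (i < k.*2.+1)%N -> (j < k.*2.+1)%N ->
      g i *m g j + g j *m g i = (- (2 * (i == j)%:R))%:M) /\
    (forall i, (i < k.*2.+1)%N -> (map_mx conjc (g i))^T = - g i).
Proof.
have [I ii conji] : exists2 I : C, I * I = -1 & conjc I = - I.
  by exists (Complex 0 1); apply/eqP; rewrite eq_complex /=;
    apply/andP; split; apply/eqP; ring.
elim: k => [|k [m [mE [g [gE gT]]]]].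
  exists 1%N; split => //; exists (fun=> I%:M); split => [[|i] [|j]|] //=.
    by move=> _ _; rewrite -scalar_mxM -raddfD /= ii mulr1 mulr2n opprD.
  by move=> i _; rewrite map_scalar_mx tr_scalar_mx /= conji raddfN.
exists (m + m)%N; split; first by rewrite mE expnS mul2n addnn.
pose a : 'M[C]_(m + m) := block_mx 0 1%:M (- 1%:M) 0.
pose b : 'M[C]_(m + m) := block_mx 0 I%:M I%:M 0.
pose c i : 'M[C]_(m + m) := block_mx (g i) 0 0 (- g i).
have scb (z : C) : z%:M = block_mx z%:M 0 0 z%:M :> 'M[C]_(m + m).
  exact: scalar_mx_block.
have aa : a *m a = (-1)%:M.
  by rewrite scb /a mulmx_block !(mul0mx, mulmx0, mulmx1, mul1mx, add0r, addr0)
     raddfN.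
have bb : b *m b = (-1)%:M.
  by rewrite scb /b mulmx_block !(mul0mx, mulmx0, add0r, addr0) -!scalar_mxM ii.
have ab : a *m b + b *m a = 0.
  rewrite /a /b !mulmx_block add_block_mx.
  by rewrite !(mul0mx, mulmx0, mulNmx, mulmxN, mulmx1, mul1mx, add0r, addr0,
    opprK, subrr, addNr) ?block_mx0.
have ac i : a *m c i + c i *m a = 0.
  rewrite /a /c !mulmx_block add_block_mx.
  by rewrite !(mul0mx, mulmx0, mulNmx, mulmxN, mulmx1, mul1mx, add0r, addr0,
    opprK, subrr, addNr) ?block_mx0.
have bc i : b *m c i + c i *m b = 0.
  rewrite /b /c !mulmx_block add_block_mx.
  by rewrite !(mul0mx, mulmx0, mulNmx, mulmxN, mulmx1, mul1mx, add0r, addr0,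
    opprK, subrr, addNr) (scalar_mxC I (g i)) subrr addNr ?block_mx0.
have cc i j : (i < k.*2.+1)%N -> (j < k.*2.+1)%N ->
    c i *m c j + c j *m c i = (- (2 * (i == j)%:R))%:M.
  move=> ik jk; rewrite scb /c !mulmx_block.
  rewrite !(mul0mx, mulmx0, add0r, addr0) add_block_mx !mulmxN !mulNmx !opprK.
  by rewrite gE // addr0.
have sq (z : 'M[C]_(m + m)) : z *m z = (-1)%:M ->
    z *m z + z *m z = (- (2 * true%:R))%:M.
  by move=> ->; rewrite -raddfD /= mulr1 mulr2n opprD.
pose h i := if i == k.*2.+1 then a else if i == k.*2.+2 then b else c i.
exists h; split.
  move=> i j; rewrite doubleS !ltnS /h.
 have N1: (k.*2.+2 == k.*2.+1) = false by lia.
  have [->|ia] := eqVneq i k.*2.+1; have [->|ja] := eqVneq j k.*2.+1.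
  - by move=> _ _; exact: sq.
  - rewrite mulr0 oppr0 raddf0.
    by case: ifP.
  - rewrite ?(negPf ia) mulr0 oppr0 raddf0 addrC.
    by case: ifP.
  have [->|ib] := eqVneq i k.*2.+2; have [->|jb] := eqVneq j k.*2.+2.
  - by rewrite ?N1; move=> _ _; exact: sq.
  - by rewrite ?N1 mulr0 oppr0 raddf0.
  - by rewrite ?(negPf ib) ?N1 mulr0 oppr0 raddf0 addrC.
  by move=> ik jk; apply: cc; lia.
move=> i; rewrite doubleS !ltnS /h.
have [->|ia] := eqVneq i k.*2.+1.
  move=> _; rewrite /a map_block_mx tr_block_mx opp_block_mx.
  by rewrite !raddf0 map_mxN map_mx1 linearN /= trmx1 opprK.
have [->|ib] := eqVneq i k.*2.+2.
  move=> _; rewrite /b map_block_mx tr_block_mx opp_block_mx.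
  by rewrite !raddf0 !map_scalar_mx !tr_scalar_mx /= conji raddfN.
move=> ik; rewrite /c map_block_mx tr_block_mx opp_block_mx.
by rewrite !raddf0 map_mxN linearN /= gT ?opprK//; lia.
Qed.

Lemma clifford_rep_ex : exists gamma, clifford_rep gamma.
Proof.
have [m [mE [g [gE gT]]]] := clifford_matrices n./2.
rewrite /clifford_rep /spinor_rank -mE.
have lt (i : 'I_n) : (i < n./2.*2.+1)%N by have := ltn_ord i; lia.
exists (fun i => g i); split=> [i j|i]; last exact: gT.
by rewrite gE.
Qed.

Definition cdot (u v : 'cV[C]_N) : C := \sum_i u i 0 * conjc (v i 0).

Definition cnorm (u : 'cV[C]_N) : R := Num.sqrt (complex.Re (cdot u u)).

Context (gamma : 'I_n -> 'M[C]_N).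

Definition gamma_vec (u : 'rV[R]_n.+1) : 'M[C]_N :=
  \sum_i (u 0 (lift ord0 i))%:C *: gamma i.

(* The action on C^N of the product u.v of two vectors of R^(n+1), for the
   Cl^0_(n+1)-module structure given by gamma and the isomorphism
   Cl_n -> Cl^0_(n+1), e_i |-> e_i.e_0 (1 <= i <= n).  Thus e_i.e_j acts by
   gamma_i gamma_j, e_i.e_0 by gamma_i, e_0.e_i by - gamma_i, e_0.e_0 by -1. *)
Definition even_clifford (u v : 'rV[R]_n.+1) : 'M[C]_N :=
  (gamma_vec u - ((u 0 0)%:C)%:M) *m (gamma_vec v + ((v 0 0)%:C)%:M).

(* The spin structure of S^n is Spin(n+1) -> SO(n+1) -> S^n.  As Spin(n+1) lies
   in Cl^0_(n+1), its spinor bundle Spin(n+1) x_Spin(n) C^N is the trivial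
   bundle S^n x C^N, by [g, s] |-> (g e_0, g.s); the Clifford multiplication by
   a tangent vector X at x is then the action of X.x. *)
Definition clifford (x X : 'rV[R]_n.+1) : 'M[C]_N := even_clifford X x.

Section clifford_relations.
Hypothesis cl : clifford_rep gamma.

Lemma gamma_vec_comm (u v : 'rV[R]_n.+1) :
  gamma_vec u *m gamma_vec v + gamma_vec v *m gamma_vec u =
  ((2 * (u 0 0 * v 0 0 - edot u v))%:C)%:M.
Proof.
have -> : gamma_vec v *m gamma_vec u = \sum_i \sum_j
    ((u 0 (lift ord0 i))%:C * (v 0 (lift ord0 j))%:C) *: (gamma j *m gamma i).
  rewrite exchange_big /= mulmx_suml; apply: eq_bigr => j _.
  rewrite mulmx_sumr; apply: eq_bigr => i _.
  by rewrite -scalemxAl -scalemxAr scalerA mulrC.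
have -> : gamma_vec u *m gamma_vec v = \sum_i \sum_j
    ((u 0 (lift ord0 i))%:C * (v 0 (lift ord0 j))%:C) *: (gamma i *m gamma j).
  rewrite mulmx_suml; apply: eq_bigr => i _.
  rewrite mulmx_sumr; apply: eq_bigr => j _.
  by rewrite -scalemxAl -scalemxAr scalerA.
rewrite -big_split /= (eq_bigr (fun i : 'I_n =>
    ((- 2 * (u 0 (lift ord0 i) * v 0 (lift ord0 i)))%:C)%:M)); last first.
  move=> i _; rewrite -big_split /= (bigD1 i)//= -scalerDr cl.1 eqxx.
  rewrite big1 => [|j ji].
    by rewrite addr0 scale_scalar_mx; congr scalar_mx;
      rewrite !rmorphM /= rmorphN /= rmorph_nat; ring.
  by rewrite -scalerDr cl.1 eq_sym (negPf ji) mulr0 oppr0 raddf0 scaler0.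
rewrite -raddf_sum /= -raddf_sum /= -mulr_sumr.
by congr (_%:C%:M); rewrite /edot big_ord_recl; ring.
Qed.

Let cE (a b : R) : (2 * (a * b))%:C = 2 * (a%:C * b%:C) :> C.
Proof. by rewrite !rmorphM /= rmorph_nat. Qed.

Lemma gamma_vec_switch (x W : 'rV[R]_n.+1) : edot W x = 0 ->
  (gamma_vec x + ((x 0 0)%:C)%:M) *m (gamma_vec W - ((W 0 0)%:C)%:M) =
  - ((gamma_vec W + ((W 0 0)%:C)%:M) *m (gamma_vec x - ((x 0 0)%:C)%:M)).
Proof.
have scC (z : C) (A : 'M[C]_(N)) : A *m z%:M = z *: A.
  by rewrite scalar_mxC mul_scalar_mx.
move=> Wx; apply/eqP; rewrite -subr_eq0 opprK; apply/eqP.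
have := gamma_vec_comm x W.
rewrite [edot x W](_ : _ = edot W x); last first.
  by apply: eq_bigr => i _; rewrite mulrC.
rewrite Wx subr0 => xW.
rewrite !(mulmxDl, mulmxDr, mulmxN, mulNmx, mul_scalar_mx, scC)
  !scale_scalar_mx.
transitivity (gamma_vec x *m gamma_vec W + gamma_vec W *m gamma_vec x -
  ((2 * (x 0 0 * W 0 0))%:C)%:M).
  by rewrite cE; apply/matrixP => i j; rewrite !mxE; ring.
by rewrite xW subrr.
Qed.

Lemma gamma_vec_sphere (x : 'rV[R]_n.+1) : sphere x ->
  (gamma_vec x - ((x 0 0)%:C)%:M) *m (gamma_vec x + ((x 0 0)%:C)%:M) = (-1)%:M.
Proof.
have scC (z : C) (A : 'M[C]_(N)) : A *m z%:M = z *: A.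
  by rewrite scalar_mxC mul_scalar_mx.
rewrite /sphere /= => x1.
have xx := gamma_vec_comm x x; rewrite x1 in xx.
have two : (2 : C) != 0 by rewrite pnatr_eq0.
apply: (scalerI two); rewrite scaler_nat mulr2n.
rewrite !(mulmxDl, mulmxDr, mulmxN, mulNmx, mul_scalar_mx, scC)
  !scale_scalar_mx.
transitivity (gamma_vec x *m gamma_vec x + gamma_vec x *m gamma_vec x -
  ((2 * (x 0 0 * x 0 0))%:C)%:M).
  by rewrite cE; apply/matrixP => i j; rewrite !mxE; ring.
rewrite xx -raddfB; congr scalar_mx; rewrite -rmorphB /=.
by rewrite -mulrBr addrAC subrr add0r rmorphM rmorphN rmorph1 rmorph_nat.
Qed.

Lemma clifford_mul (x X Y : 'rV[R]_n.+1) : sphere x -> edot Y x = 0 ->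
  clifford x X *m clifford x Y =
  (gamma_vec X - ((X 0 0)%:C)%:M) *m (gamma_vec Y + ((Y 0 0)%:C)%:M).
Proof.
move=> x1 Yx; rewrite /clifford /even_clifford mulmxA.
rewrite -(mulmxA (gamma_vec X - _) (gamma_vec x + _)) gamma_vec_switch//.
rewrite mulmxN mulNmx -!mulmxA.
rewrite gamma_vec_sphere// raddfN /= !mulmxN mulmx1 opprK.
by [].
Qed.

Lemma clifford_tangent (x X Y : 'rV[R]_n.+1) :
  sphere x -> edot X x = 0 -> edot Y x = 0 ->
  clifford x X *m clifford x Y +
  clifford x Y *m clifford x X = ((- 2 * edot X Y)%:C)%:M.
Proof.
have scC (z : C) (A : 'M[C]_(N)) : A *m z%:M = z *: A.
  by rewrite scalar_mxC mul_scalar_mx.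
move=> x1 Xx Yx; rewrite !clifford_mul//.
rewrite !(mulmxDl, mulmxDr, mulmxN, mulNmx, mul_scalar_mx, scC)
  ?scale_scalar_mx.
transitivity (gamma_vec X *m gamma_vec Y + gamma_vec Y *m gamma_vec X -
  ((2 * (X 0 0 * Y 0 0))%:C)%:M).
  by rewrite cE; apply/matrixP => i j; rewrite !mxE; ring.
rewrite gamma_vec_comm -raddfB; congr scalar_mx; rewrite -rmorphB /=.
by congr (_%:C); ring.
Qed.

End clifford_relations.

(* Sections of the spinor bundle; only their values on S^n are relevant. *)
Definition spinor : Type := 'rV[R]_n.+1 -> 'cV[C]_N.

Implicit Types psi phi eta zeta : spinor.

(* The components of the extension of psi to R^(n+1) \ {0} that is constant on
   rays. *)
Definition re_coord psi (i : 'I_N) (y : 'rV[R]_n.+1) : R :=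
  complex.Re (psi ((enorm y)^-1 *: y) i 0).
Definition im_coord psi (i : 'I_N) (y : 'rV[R]_n.+1) : R :=
  complex.Im (psi ((enorm y)^-1 *: y) i 0).

Definition partial (i : 'I_n.+1) (f : 'rV[R]_n.+1 -> R) : 'rV[R]_n.+1 -> R :=
  fun x => 'D_(delta_mx 0 i) f x.

Definition smooth_off0 (f : 'rV[R]_n.+1 -> R) : Prop :=
  forall (s : seq 'I_n.+1) x, x != 0 -> differentiable (foldr partial f s) x.

Definition smooth_spinor psi : Prop :=
  forall i, smooth_off0 (re_coord psi i) /\ smooth_off0 (im_coord psi i).

Definition flat_deriv psi (x X : 'rV[R]_n.+1) : 'cV[C]_N :=
  \col_i ('D_X (re_coord psi i) x +i* 'D_X (im_coord psi i) x).

(* The spin connection, for X tangent to S^n at x: by the Gauss formula it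
   differs from the flat derivative by half the Clifford multiplication, the
   shape operator of S^n being plus or minus the identity. *)
Definition nabla psi (x X : 'rV[R]_n.+1) : 'cV[C]_N :=
  flat_deriv psi x X + 2^-1 *: (clifford x X *m psi x).

Definition tangent_proj (x v : 'rV[R]_n.+1) : 'rV[R]_n.+1 := v - edot v x *: x.

(* D psi = sum_k e_k . nabla_(e_k) psi over an orthonormal basis of T_x S^n.
   The projections of the standard basis of R^(n+1) form a Parseval frame
   of T_x S^n, for which the sum is the same. *)
Definition dirac_diff psi : spinor := fun x =>
  \sum_(j < n.+1) let e := tangent_proj x (delta_mx 0 j) in
    clifford x e *m nabla psi x e.

Local Notation vol := (@sphere_volume R n).
Local Notation Sn := (@sphere R n).

Definition measurable_spinor psi : Prop :=
  forall i, measurable_fun Sn (fun x => complex.Re (psi x i 0)) /\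
            measurable_fun Sn (fun x => complex.Im (psi x i 0)).

Definition l2norm2 psi : \bar R :=
  (\int[vol]_(x in Sn) (cnorm (psi x) ^+ 2)%:E)%E.

Definition in_L2 psi : Prop := measurable_spinor psi /\ (l2norm2 psi < +oo)%E.

Definition l2dot psi phi : C :=
  \int[vol]_(x in Sn) complex.Re (cdot (psi x) (phi x)) +i*
  \int[vol]_(x in Sn) complex.Im (cdot (psi x) (phi x)).

Definition spinor_eq0 psi : Prop := {ae vol, forall x, psi x = 0}.

(* Unbounded operators of L^2, as graphs (not taken modulo equality almost
   everywhere). *)
Definition operator : Type := spinor -> set spinor.

Implicit Types T A B : operator.

Definition op_comp A B : operator :=
  fun psi eta => exists2 zeta, B psi zeta & A zeta eta.

Definition densely_defined T : Prop :=
  forall psi (e : R), in_L2 psi -> 0 < e ->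
    exists phi zeta, T phi zeta /\ (l2norm2 (psi \- phi)%R < e%:E)%E.

(* T is densely defined and equal to its adjoint. *)
Definition selfadjoint T : Prop :=
  densely_defined T /\
  forall psi eta, T psi eta <->
    [/\ in_L2 psi, in_L2 eta &
        forall phi zeta, T phi zeta -> l2dot zeta psi = l2dot phi eta].

Definition nonneg_op T : Prop :=
  forall psi eta, T psi eta -> 0 <= l2dot eta psi.

(* T = A^(1/2), the nonnegative self-adjoint square root of A. *)
Definition is_op_sqrt A T : Prop :=
  [/\ selfadjoint T, nonneg_op T &
      forall psi eta, op_comp T T psi eta <-> A psi eta].

(* A^(1/2) as a graph: there is at most one T such that is_op_sqrt A T. *)
Definition op_sqrt A : operator :=
  fun psi eta => exists2 T, is_op_sqrt A T & T psi eta.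

(* A psi, for psi in the domain of A; determined up to equality almost
   everywhere when A is self-adjoint. *)
Definition op_app A psi : spinor := xget (fun=> 0) (A psi).

(* The self-adjoint Dirac operator: the closure in L^2 of dirac_diff on
   smooth spinors. *)
Definition dirac_op : operator := fun psi eta =>
  [/\ in_L2 psi, in_L2 eta &
      forall e : R, 0 < e -> exists phi, [/\ smooth_spinor phi,
        (l2norm2 (psi \- phi)%R < e%:E)%E &
        (l2norm2 (eta \- dirac_diff phi)%R < e%:E)%E]].

Definition abs_dirac : operator := op_sqrt (op_comp dirac_op dirac_op).

Definition sqrt_abs_dirac : operator := op_sqrt abs_dirac.

Definition H12 : set spinor := [set psi | exists eta, sqrt_abs_dirac psi eta].

(* The closed quadratic form of |D|, of domain H12. *)
Definition abs_dirac_form psi : \bar R := l2norm2 (op_app sqrt_abs_dirac psi).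

Definition abs_dirac_quotient psi : \bar R :=
  (abs_dirac_form psi /
   (\int[vol]_(x in Sn) (cnorm (psi x) `^ ((2 * n)%:R / n.-1%:R))%:E)
     `^ (n.-1%:R / n%:R))%E.

Definition abs_dirac_const : \bar R :=
  ereal_inf [set abs_dirac_quotient psi |
             psi in [set psi | H12 psi /\ ~ spinor_eq0 psi]].

End spinors.

(* Main.v *)
(* The spinor bundle being trivialised, D has eigenspinors whose components are
   restrictions of harmonic polynomials, and the unitary gauge transformation
   U(x) = cv gB x again maps them to such spinors, of another degree.  Hence the
   Newton kernel |x - y|^(1 - n) acts on a lambda-eigenspinor as
   const / |lambda + 1/2|, and after conjugation by U as const / |lambda - 1/2|.
   By conformal invariance of the Newton form, moving q by a conformal dilation
   and projecting back on finitely many eigenspaces preserves the L^p norm,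
   p = 2 n / (n - 1), up to a small error, does not increase the energies
   E_+-(q) = <|D +- 1/2| q, q>, and sends the L^2 norm to 0, so that E_+-(q) and
   <|D| q, q> agree in the limit.  Therefore C |q|_p^2 <= E_+(q) and
   C |q|_p^2 <= E_-(q), where C is the infimum.
   If psi is a minimizer and phi an eigenspinor, convexity of |.|_p^2 gives
     2 C |psi|_p^2 <= E_+(psi + s phi) + E_-(psi - s phi),
   and |D + 1/2| + |D - 1/2| = 2 |D| while |D + 1/2| - |D - 1/2| = sign D, so the
   right-hand side is 2 <|D| psi, psi> +- 2 s <psi, phi> + O(s^2).  Hence psi is
   orthogonal to all eigenspinors.  The Sobolev inequality on H^(1/2) is needed
   to exclude |psi|_p = oo. *)
From HB Require Import structures.
Require Import Defs.
From mathcomp Require Import all_boot all_order all_algebra complex.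
From mathcomp Require Import all_classical all_reals all_analysis.
From mathcomp Require Import measurable_realfun ring lra zify.

Set Implicit Arguments.
Unset Strict Implicit.
Unset Printing Implicit Defensive.

Import Order.TTheory GRing.Theory Num.Theory.
Import numFieldNormedType.Exports.

Local Open Scope classical_set_scope.
Local Open Scope complex_scope.
Local Open Scope ring_scope.

(** Dilations are applied not to the form of |D| but to two neighbours of it. In the trivialisation
    S^n x C^N the Newton form acts component by component, and its inverse is, up to a constant, the
    conformally covariant first-order operator with eigenvalue k + (n - 1) / 2 on harmonics of
    degree k; on a lambda-eigenspinor that number is |lambda + 1/2|. The trivialisation twisted by U
    gives |lambda - 1/2| in the same way. As |lambda| is their mean, a minimizer would have to be
    extremal for both forms at once, although they differ by the sign of D. Perturbing the two forms
    in opposite directions removes the variation of the L^p norm by mere convexity, so that no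
    Euler-Lagrange equation and no regularity of psi enters. All energies are computed on finite
    sums of eigenspinors; psi is reached only through L^2 projections, whose form is at most that of
    psi and along which the L^p norm is lower semicontinuous. No spectral theorem is invoked: a
    square root of |D| is supplied by the membership of psi in H^(1/2). *)

Section derive_rules.
Context {R : realType}.
Implicit Types (f g : R -> R) (x : R).

Lemma is_der1D f g x df dg : is_derive x 1 f df -> is_derive x 1 g dg ->
  is_derive x 1 (fun z => f z + g z) (df + dg).
Proof. by move=> hf hg; exact: is_deriveD. Qed.

Lemma is_der1M f g x df dg : is_derive x 1 f df -> is_derive x 1 g dg ->
  is_derive x 1 (fun z => f z * g z) (df * g x + f x * dg).
Proof.
by move=> hf hg; apply: (is_derive_eq (is_deriveM hf hg)); rewrite /GRing.scale/= addrC (mulrC df).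
Qed.

Lemma is_der1_cst (c x : R) : is_derive x 1 (fun _ : R => c) 0.
Proof. exact: is_derive_cst. Qed.

Lemma is_der1_id (x : R) : is_derive x 1 (fun z : R => z) 1.
Proof. exact: is_derive_id. Qed.

Lemma is_der1_comp (phi f : R -> R) x dphi df : is_derive (f x) 1 phi dphi ->
  is_derive x 1 f df -> is_derive x 1 (fun z => phi (f z)) (dphi * df).
Proof.
by move=> hp hf; apply: (is_derive_eq (is_derive1_comp hp hf)); rewrite /GRing.scale/= mulrC.
Qed.

Lemma is_der1_sum (I : Type) (r : seq I) (f df : I -> R -> R) x :
  (forall i, is_derive x 1 (f i) (df i x)) ->
  is_derive x 1 (fun z => \sum_(i <- r) f i z) (\sum_(i <- r) df i x).
Proof.
move=> h; elim: r => [|i r ih].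
  by under eq_fun do rewrite big_nil; rewrite big_nil; exact: is_der1_cst.
by under eq_fun do rewrite big_cons; rewrite big_cons; exact: is_der1D.
Qed.

End derive_rules.

(** * Total derivatives on the line *)

Section line.
Context {R : realType}.
Local Notation leb := (@lebesgue_measure R).

(** A majorant at infinity. The exponent 3/2 exceeds 1, for integrability, yet is small enough for
    the product over n >= 2 coordinates to dominate (1 + |y|^2)^(1/2 - n). *)
Definition tailb (t : R) : R := (1 + `|t|) `^ (- (3 / 2)).

Lemma tailb_gt0 t : 0 < tailb t.
Proof. by rewrite powR_gt0// ltr_wpDr. Qed.

Lemma continuous_powR_comp (f : R -> R) (c : R) :
  continuous f -> (forall x, 0 < f x) -> continuous (fun x => f x `^ c).
Proof.
move=> cf f0 x; apply: (@continuous_comp _ _ _ f (fun z => z `^ c)); first exact: cf.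
apply: differentiable_continuous; apply/derivable1_diffP.
by have := is_derive1_powR c (f0 x) => h; exact: ex_derive.
Qed.

Lemma continuous_tailb : continuous tailb.
Proof.
apply: continuous_powR_comp => [x|x]; last by rewrite ltr_wpDr.
by apply: cvgD; [exact: cvg_cst | exact: norm_continuous].
Qed.

Lemma tailb_integral_fin : (\int[leb]_t (tailb t)%:E < +oo)%E.
Proof.
rewrite ge0_symfun_integralT.
- rewrite lte_mul_pinfty// ?fin_numE//.
  have -> : [set x : R | (0 <= x)] = `[0, +oo[%classic.
    by apply/seteqP; split=> x /=; rewrite in_itv/= ?andbT.
  pose F (x : R) := - 2 * (1 + x) `^ (- (1 / 2)).
  have dF (x : R) : -1 < x -> is_derive x 1 F ((1 + x) `^ (- (3 / 2))).
    move=> x1.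
    have h1 := is_der1D (is_der1_cst (1:R) x) (is_der1_id x).
    have x0 : 0 < 1 + x by rewrite -ltrBlDl sub0r.
    have h2 := is_derive1_powR (- (1 / 2)) x0.
    have h3 := is_der1M (is_der1_cst (- 2 : R) x) (is_der1_comp h2 h1).
    apply: (is_derive_eq h3); rewrite mul0r !add0r mulr1 mulrA.
    have -> : -2 * (- (1 / 2)) = 1 :> R by field.
    by rewrite mul1r; congr (_ `^ _); field.
  rewrite (@ge0_continuous_FTC2y _ tailb F 0 0).
  + by rewrite -EFinN -EFinD ltry.
  + by move=> x _; exact/ltW/tailb_gt0.
  + by apply: continuous_subspaceT; exact: continuous_tailb.
  + apply/cvgrPdist_le => e e0; near=> x.
    rewrite sub0r normrN /F normrM (ger0_norm (powR_ge0 _ _)).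
    rewrite normrN ger0_norm// -ler_pdivlMl//.
    have e20 : 0 < 2^-1 * e by rewrite mulr_gt0.
    have x0 : 0 < 1 + x by rewrite ltr_wpDr//; near: x; exact: nbhs_pinfty_ge.
    rewrite powRN -[leRHS]invrK lef_pV2 ?posrE ?powR_gt0 ?invr_gt0//.
    have -> : (2^-1 * e)^-1 = ((2^-1 * e) `^ (-2)) `^ (1 / 2).
      rewrite -powRrM (_ : -2 * (1 / 2) = -1 :> R); last by field.
      by rewrite powR_inv1// ltW.
    apply: ge0_ler_powR; rewrite ?nnegrE ?powR_ge0// ?divr_ge0//; first exact: ltW.
    by rewrite ler_wpDl//; near: x; apply: nbhs_pinfty_ge; rewrite num_real.
  + move=> x x0; have h := dF x (lt_trans (ltrN10 _) x0).
    exact: ex_derive.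
  + apply: cvg_at_right_filter; apply: differentiable_continuous.
    by apply/derivable1_diffP; have h := dF 0 (ltrN10 _); exact: ex_derive.
  + move=> x; rewrite in_itv/= andbT => x0.
    rewrite derive1E; have h := dF x (lt_trans (ltrN10 _) x0).
    by rewrite derive_val /tailb ger0_norm// ltW.
- by move=> x; exact/ltW/tailb_gt0.
- exact: continuous_tailb.
- by move=> x; rewrite /tailb /= normrN.
Unshelve. all: by end_near. Qed.

Lemma integrable_tailb : leb.-integrable setT (EFin \o tailb).
Proof.
apply/integrableP; split.
  by apply/measurable_EFinP; apply: continuous_measurable_fun; exact: continuous_tailb.
under eq_integral do rewrite /= ger0_norm ?(ltW (tailb_gt0 _))//.
exact: tailb_integral_fin.
Qed.

Lemma tailb_cvg0 (s : bool) :
  tailb ((-1) ^+ s * k%:R) @[k --> \oo] --> (0 : R).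
Proof.
have h : (fun k => tailb ((-1) ^+ s * k%:R)) = (fun k : nat => tailb k%:R).
  by apply/funext => k; rewrite /tailb normrM normrX normrN1 expr1n mul1r.
rewrite h; apply: (@squeeze_cvgr _ _ _ _ (cst 0) (fun k : nat => (k.+1%:R)^-1)).
- near=> k; rewrite /= ltW ?tailb_gt0//=.
  rewrite /tailb ger0_norm// addrC natr1 powRN lef_pV2 ?posrE ?powR_gt0//.
  rewrite -[leLHS]powRr1//.
  by apply: ler_powR; [rewrite ler1n | rewrite ler_pdivlMr// mul1r ler_nat].
- exact: cvg_cst.
- exact: cvg_harmonic.
Unshelve. all: by end_near. Qed.

(** The fundamental theorem of calculus on [-k - 1, k + 1]: the boundary terms vanish in the limit
    because [F] is bounded by [tailb], and the integrals converge by domination. *)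
Lemma integral_derive_line (F f : R -> R) (C : R) :
  (forall x : R, is_derive x 1 F (f x)) -> continuous f ->
  leb.-integrable setT (EFin \o f) ->
  (forall x, `|F x| <= C * tailb x) -> (\int[leb]_x (f x)%:E = 0)%E.
Proof.
move=> dF cf fi FC.
have mf : measurable_fun setT f by exact: continuous_measurable_fun.
pose I (k : nat) := `[- k.+1%:R, (k.+1%:R : R)]%classic.
pose g (k : nat) x := (f x * \1_(I k) x)%:E.
have h : (\int[leb]_x g k x)%E @[k --> \oo] --> (\int[leb]_x (f x)%:E)%E.
  apply: (@dominated_cvg _ _ _ leb setT measurableT g (EFin \o f) (fun x => `|f x|%:E)).
  - move=> k; apply/measurable_EFinP; apply: measurable_funM => //; apply: measurable_indic; exact: measurable_itv.
  - move=> x _ /=; apply: cvg_near_cst.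
    near=> k; rewrite /g indicE mem_set ?mulr1// /I /= in_itv/= -ler_norml.
    rewrite (@le_trans _ _ k%:R) ?ler_nat//; near: k; exact: nbhs_infty_ger.
  - by [].
  - by move/integrable_norm : fi; apply: eq_integrable.
  - move=> k x _; rewrite /g /= lee_fin normrM ler_piMr// indicE.
    by case: (_ \in _); rewrite ?normr1 ?normr0.
have e k : (\int[leb]_x g k x = (F k.+1%:R - F (- k.+1%:R))%:E)%E.
  rewrite EFinB -(@continuous_FTC2 _ f F (- k.+1%:R) k.+1%:R).
  - rewrite [RHS]integral_mkcond; apply: eq_integral => x _.
    by rewrite /g /patch indicE /I; case: ifP => xI; rewrite ?mulr1 ?mulr0.
  - by rewrite (@lt_trans _ _ 0)// oppr_lt0.
  - exact: continuous_subspaceT.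
  - have dc x : {for x, continuous F}.
      by apply: differentiable_continuous; apply/derivable1_diffP; have := dF x => ?; exact: ex_derive.
    split.
    + by move=> x _; have := dF x => ?; exact: ex_derive.
    + by apply: cvg_at_right_filter; exact: dc.
    + by apply: cvg_at_left_filter; exact: dc.
  - by move=> x _; rewrite derive1E; have := dF x => ?; rewrite derive_val.
suff h0 : (\int[leb]_x g k x)%E @[k --> \oo] --> (0%R)%:E.
  exact: (cvg_unique _ h h0).
under eq_cvg do rewrite e.
apply: cvg_EFin; first exact: nearW.
rewrite -[X in _ --> X](subrr (0 : R)); apply: cvgB.
  apply: norm_cvg0; apply: (@squeeze_cvgr _ _ _ _ (cst 0) (fun k : nat => C * tailb ((-1) ^+ false * k.+1%:R))).
  - by near=> k; rewrite normr_ge0/= mul1r FC.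
  - exact: cvg_cst.
  - rewrite -(mulr0 C); apply: cvgMr.
    by have := @tailb_cvg0 false; rewrite -cvg_shiftS.
apply: norm_cvg0; apply: (@squeeze_cvgr _ _ _ _ (cst 0) (fun k : nat => C * tailb ((-1) ^+ true * k.+1%:R))).
- by near=> k; rewrite normr_ge0/= expr1 mulN1r FC.
- exact: cvg_cst.
- rewrite -(mulr0 C); apply: cvgMr.
  by have := @tailb_cvg0 true; rewrite -cvg_shiftS.
Unshelve. all: by end_near. Qed.

End line.

(** * Integrals under image measures *)

Section image_measure.
Local Open Scope ereal_scope.
Context {R : realType} d1 d2 (X : measurableType d1) (Y : measurableType d2).
(* The measure comes before the map: it determines the display of X. *)
Variables (m : {measure set X -> \bar R}) (phi : X -> Y).
Hypothesis mphi : measurable_fun setT phi.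

Lemma ge0_integral_image_measure (f : Y -> \bar R) : measurable_fun setT f ->
  (forall y, 0 <= f y) -> \int[pushforward m phi]_y f y = \int[m]_x f (phi x).
Proof. by move=> mf f0; rewrite ge0_integral_pushforward. Qed.

Lemma integral_image_measure (f : Y -> \bar R) : measurable_fun setT f ->
  m.-integrable setT (f \o phi) -> \int[pushforward m phi]_y f y = \int[m]_x f (phi x).
Proof. by move=> mf fi; rewrite integral_pushforward. Qed.

End image_measure.

(** * Lebesgue measure on row vectors *)

Section lebesgue_row_integral.
Context {R : realType}.
Local Notation leb := (@lebesgue_measure R).
Local Notation lrow := (lebesgue_row R).

Definition uncons_row n (y : 'rV[R]_n.+1) : R * 'rV[R]_n :=
  (y 0 0, \row_j y 0 (lift ord0 j)).

Lemma cons_rowK n : cancel (@cons_row R n) (@uncons_row n).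
Proof.
move=> [a y]; rewrite /uncons_row cons_row0; congr pair.
by apply/rowP => j; rewrite mxE cons_rowS.
Qed.

Lemma measurable_coord n (i : 'I_n) : measurable_fun setT (fun y : 'rV[R]_n => y 0 i).
Proof. exact: (@measurable_row_coord _ R n i). Qed.

Lemma measurable_uncons_row n : measurable_fun setT (@uncons_row n).
Proof.
apply/measurable_fun_pairP; split; first exact: measurable_coord.
apply: measurable_fun_row => j.
rewrite (_ : _ \o _ = fun y : 'rV[R]_n.+1 => y 0 (lift ord0 j)); first exact: measurable_coord.
by apply/funext => y; rewrite /= /row_coord mxE.
Qed.

Lemma sigma_finite_lrow n : sigma_finite setT (lrow n).
Proof.
elim: n => [|n ih].
  exists (fun=> setT); first by rewrite bigcup_const.
  by move=> k; split => //=; rewrite diracT ltry.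
have /sigma_finiteP[F [TF ndF Foo]] := sigma_finiteT leb.
have /sigma_finiteP[G [TG ndG Goo]] := ih.
exists (fun k => @uncons_row n @^-1` (F k `*` G k)).
  apply/seteqP; split=> // y _ /=.
  have [k _ Fk] : (\bigcup_k F k) (y 0 0) by rewrite -TF.
  have [l _ Gl] : (\bigcup_k G k) (\row_j y 0 (lift ord0 j)) by rewrite -TG.
  exists (maxn k l) => //; split => /=.
    by move: Fk; apply/subsetPset/ndF; exact: leq_maxl.
  by move: Gl; apply/subsetPset/ndG; exact: leq_maxr.
move=> k; have [mF F0] := Foo k; have [mG G0] := Goo k; split.
  by rewrite -[X in measurable X]setTI; apply: measurable_uncons_row => //; exact: measurableX.
rewrite /= /lebesgue_row_step /pushforward.
rewrite (_ : _ @^-1` _ = F k `*` G k); last first.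
  rewrite -comp_preimage (_ : _ \o _ = id) ?preimage_id//.
  by apply/funext => y; exact: cons_rowK.
by rewrite product_measure2E// lte_mul_pinfty// ge0_fin_numE.
Qed.

(** A named copy of [lrow n] to which the sigma-finite structure can be attached, as Fubini's
    theorem requires; the fixpoint [lebesgue_row] only returns a measure. *)
Definition lrow_sf n : set 'rV[R]_n -> \bar R := lrow n.
Arguments lrow_sf n : clear implicits.

Section lrow_sf_measure.
Variable n : nat.
Let m0 : lrow_sf n set0 = 0%E. Proof. exact: measure0. Qed.
Let m_ge0 A : (0 <= lrow_sf n A)%E. Proof. exact: measure_ge0. Qed.
Let m_sigma : semi_sigma_additive (lrow_sf n).
Proof. exact: (@measure_semi_sigma_additive _ _ _ (lrow n)). Qed.
HB.instance Definition _ := isMeasure.Build _ _ _ (lrow_sf n) m0 m_ge0 m_sigma.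
HB.instance Definition _ :=
  Measure_isSigmaFinite.Build _ _ _ (lrow_sf n) (@sigma_finite_lrow n).
End lrow_sf_measure.

Lemma measurable_cons_rowr n (y : 'rV[R]_n) : measurable_fun setT (fun s : R => cons_row (s, y)).
Proof.
have h : measurable_fun setT (fun s : R => (s, y)) by apply: measurable_fun_pair.
exact: (measurableT_comp (@measurable_cons_row R n) h).
Qed.

Lemma measurable_cons_rowl n (s : R) : measurable_fun setT (fun y : 'rV[R]_n => cons_row (s, y)).
Proof.
have h : measurable_fun setT (fun y : 'rV[R]_n => (s, y)) by apply: measurable_fun_pair.
exact: (measurableT_comp (@measurable_cons_row R n) h).
Qed.

Local Open Scope ereal_scope.

Let pm n := lebesgue_integral_fubini_product_measure2__canonical__measure_function_Measure
  leb (lrow n).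

Let lrowS n : lrow n.+1 = pushforward (pm n) (@cons_row R n) :> (set _ -> \bar R).
Proof. by []. Qed.

(** [lebesgue_row] is built on one iterated construction of the product measure, Fubini's theorem is
    applied to the other; they agree by uniqueness on rectangles. *)
Lemma integral_lrow_prod n (f : 'rV[R]_n.+1 -> \bar R) :
  (\int[leb \x lrow_sf n]_z f (cons_row z) = \int[leb \x^ lrow n]_z f (cons_row z)).
Proof.
apply: eq_measure_integral => A mA _.
apply: product_measure_unique => // A1 A2 mA1 mA2.
by rewrite /= product_measure2E.
Qed.

Lemma ge0_integral_lrowS n (f : 'rV[R]_n.+1 -> \bar R) :
  measurable_fun setT f -> (forall y, 0 <= f y) ->
  \int[lrow n.+1]_y f y = \int[lrow n]_y \int[leb]_s f (cons_row (s, y)).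
Proof.
move=> mf f0.
rewrite lrowS.
rewrite (ge0_integral_image_measure (pm n) (@measurable_cons_row R n) mf f0).
rewrite -integral_lrow_prod.
rewrite (@fubini_tonelli2 _ _ _ _ _ leb (lrow_sf n) (fun z => f (cons_row z)))//.
by apply: measurableT_comp mf _; exact: measurable_cons_row.
Qed.

(** Both orders of integration are recorded: which one makes the integral of a partial derivative
    vanish depends on whether the first coordinate is the differentiated one. *)
Lemma integral_lrowS n (f : 'rV[R]_n.+1 -> \bar R) : (lrow n.+1).-integrable setT f ->
  \int[lrow n.+1]_y f y = \int[lrow n]_y \int[leb]_s f (cons_row (s, y)) /\
  \int[lrow n.+1]_y f y = \int[leb]_s \int[lrow n]_y f (cons_row (s, y)).
Proof.
move=> fi; have mf := measurable_int _ fi.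
have mfc : measurable_fun setT (fun z => f (@cons_row R n z)).
  by apply: measurableT_comp mf _; exact: measurable_cons_row.
have fi2 : (leb \x lrow_sf n).-integrable setT (fun z => f (cons_row z)).
  apply/integrableP; split => //.
  move/integrableP : fi => [_]; rewrite ge0_integral_lrowS//; last exact: measurableT_comp.
  rewrite -(@fubini_tonelli2 _ _ _ _ _ leb (lrow_sf n) (fun z => `|f (cons_row z)|))//.
  exact: measurableT_comp.
have fi3 : (leb \x^ lrow n).-integrable setT (fun z => f (cons_row z)).
  apply/integrableP; split => //; rewrite -(integral_lrow_prod (fun z => `|f z|)).
  by move/integrableP : fi2 => [].
have e : \int[lrow n.+1]_y f y = \int[leb \x^ lrow n]_z f (cons_row z).
  by rewrite lrowS (@integral_image_measure _ _ _ _ _ (pm n) _ (@measurable_cons_row R n) f mf fi3).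
rewrite e -integral_lrow_prod; split.
  by rewrite -(@integral21_prod_meas1 _ _ _ _ _ leb (lrow_sf n) _ fi2).
by rewrite -(@integral12_prod_meas1 _ _ _ _ _ leb (lrow_sf n) _ fi2).
Qed.

Definition prod_tail n (y : 'rV[R]_n) : R := (\prod_i tailb (y ord0 i))%R.

Lemma prod_tail_gt0 n (y : 'rV[R]_n) : (0 < prod_tail y)%R.
Proof. by apply: prodr_gt0 => i _; exact: tailb_gt0. Qed.

Lemma prod_tail_cons n s (y : 'rV[R]_n) : prod_tail (cons_row (s, y)) = (tailb s * prod_tail y)%R.
Proof.
rewrite /prod_tail big_ord_recl cons_row0; congr (_ * _)%R.
by apply: eq_bigr => i _; rewrite cons_rowS.
Qed.

Lemma measurable_prod_tail n : measurable_fun setT (@prod_tail n).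
Proof.
apply: measurable_prod => i _.
apply: (measurableT_comp (continuous_measurable_fun (@continuous_tailb R))).
exact: measurable_coord.
Qed.

Lemma integrable_prod_tail n : (lrow n).-integrable setT (EFin \o @prod_tail n).
Proof.
have m := @measurable_prod_tail n.
apply/integrableP; split; first exact/measurable_EFinP.
under eq_integral do rewrite /= ger0_norm ?(ltW (prod_tail_gt0 _))//.
elim: n m => [|n ih] m.
  by rewrite integral_dirac//= ?diracT ?mul1e ?ltry//; exact/measurable_EFinP.
rewrite ge0_integral_lrowS//=; last 2 first.
  exact/measurable_EFinP.
  by move=> y; rewrite lee_fin ltW// prod_tail_gt0.
have mt : measurable_fun setT (@tailb R) by apply: continuous_measurable_fun; exact: continuous_tailb.
have t0 : 0 <= \int[leb]_s (tailb s)%:E by apply: integral_ge0 => s _; rewrite lee_fin ltW// tailb_gt0.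
have e y : \int[leb]_s (prod_tail (cons_row (s, y)))%:E =
    (\int[leb]_s (tailb s)%:E) * (@prod_tail n y)%:E.
  rewrite -ge0_integralZr//.
  - by apply: eq_integral => s _; rewrite prod_tail_cons EFinM.
  - exact/measurable_EFinP.
  - by move=> s _; rewrite lee_fin ltW// tailb_gt0.
  - by rewrite lee_fin ltW// prod_tail_gt0.
under eq_integral do rewrite e.
rewrite ge0_integralZl//=; last 2 first.
- by apply/measurable_EFinP; exact: measurable_prod_tail.
- by move=> y _; rewrite lee_fin ltW// prod_tail_gt0.
apply: lte_mul_pinfty => //; last by apply: ih; exact: measurable_prod_tail.
by rewrite ge0_fin_numE// tailb_integral_fin.
Qed.

Definition setc n (y : 'rV[R]_n) (i : 'I_n) (s : R) : 'rV[R]_n :=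
  (\row_j if j == i then s else y ord0 j)%R.

Lemma setc_cons0 n a (y : 'rV[R]_n) s : setc (cons_row (a, y)) ord0 s = cons_row (s, y).
Proof.
apply/rowP => i; rewrite !mxE; have [j ->|->] := unliftP ord0 i.
  by rewrite eq_sym (negPf (neq_lift _ _)).
by rewrite eqxx.
Qed.

Lemma setc_consS n a (y : 'rV[R]_n) j s :
  setc (cons_row (a, y)) (lift ord0 j) s = cons_row (a, setc y j s).
Proof.
apply/rowP => i; rewrite !mxE; have [k ->|->] := unliftP ord0 i.
  by rewrite (inj_eq (@lift_inj _ ord0)) /= !mxE.
by rewrite (negPf (neq_lift _ _)).
Qed.

Lemma setcE n (y : 'rV[R]_n) i s : setc y i s ord0 i = s.
Proof. by rewrite mxE eqxx. Qed.

Lemma integrable_le_prod_tail n (f : 'rV[R]_n -> R) (C : R) :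
  measurable_fun setT f -> (forall y, `|f y| <= C * prod_tail y)%R ->
  (lrow n).-integrable setT (EFin \o f).
Proof.
move=> mf fC; have := integrableZl measurableT C (@integrable_prod_tail n).
apply: le_integrable => //; first by apply/measurable_EFinP.
by move=> y _; rewrite /= lee_fin (le_trans (fC y))// ler_norm.
Qed.

(** Induction on the dimension: either the first coordinate is the differentiated one, and the inner
    integral along it vanishes, or it is a parameter. [G] only has to decay along coordinate i,
    whereas its derivative needs an integrable majorant on the whole space. *)
Lemma integral_partial_eq0 n (i : 'I_n) (G dG : 'rV[R]_n -> R) (C1 C2 : R) :
  measurable_fun setT dG ->
  (forall y, `|dG y| <= C1 * prod_tail y)%R ->
  (forall y, `|G y| <= C2 * tailb (y ord0 i))%R ->
  (forall y (s : R), is_derive s (1 : R)%R (fun s => G (setc y i s)) (dG (setc y i s))) ->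
  (forall y, continuous (fun s => dG (setc y i s))) ->
  \int[lrow n]_y (dG y)%:E = 0.
Proof.
elim: n => [|n ih] in i G dG C1 C2 *; first by case: i => ? ?.
move=> mdG bdG bG drv cont.
have dGi := integrable_le_prod_tail mdG bdG.
have [e1 e2] := integral_lrowS dGi.
have [j ij|i0] := unliftP ord0 i.
  rewrite [LHS]e2 integral0_eq// => s _ /=.
  apply: (ih j (fun y => G (cons_row (s, y))) (fun y => dG (cons_row (s, y)))
            (C1 * tailb s)%R C2).
  - by apply: measurableT_comp mdG _; exact: measurable_cons_rowl.
  - by move=> y; rewrite -mulrA -prod_tail_cons.
  - by move=> y; have := bG (cons_row (s, y)); rewrite ij cons_rowS.
  - move=> y u; have := drv (cons_row (s, y)) u; rewrite ij setc_consS.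
    by congr (is_derive _ _ _ _); apply/funext => v; rewrite setc_consS.
  - move=> y; have := cont (cons_row (s, y)); rewrite ij.
    by under eq_fun do rewrite setc_consS.
rewrite [LHS]e1 integral0_eq// => y _ /=.
have cs : (fun s => dG (setc (cons_row (0%R, y)) i s)) = (fun s => dG (cons_row (s, y))).
  by apply/funext => s; rewrite i0 setc_cons0.
apply: (@integral_derive_line _ (fun s => G (cons_row (s, y))) _ C2).
- move=> s; have := drv (cons_row (0%R, y)) s; rewrite i0 setc_cons0.
  by congr (is_derive _ _ _ _); apply/funext => v; rewrite setc_cons0.
- by have := cont (cons_row (0%R, y)); rewrite cs.
- have := integrableZl measurableT (C1 * prod_tail y)%R (@integrable_tailb R).
  apply: le_integrable => //.
    apply/measurable_EFinP; apply: measurableT_comp mdG _; exact: measurable_cons_rowr.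
  move=> s _; rewrite /= lee_fin (le_trans _ (ler_norm _))//.
  by rewrite (le_trans (bdG _))// prod_tail_cons -mulrA (mulrC (prod_tail y)).
- by move=> s; have := bG (cons_row (s, y)); rewrite i0 cons_row0.
Qed.

(** The rescaled image measure agrees with [leb] on half-open intervals, which determine it. *)
Lemma lebesgue_measure_scale (t : R) (A : set R) : (0 < t)%R -> measurable A ->
  leb (( *%R t) @^-1` A) = (t^-1)%:E * leb A.
Proof.
move=> t0 mA.
have mt : measurable_fun (setT : set (measurableTypeR R)) ( *%R t : measurableTypeR R -> measurableTypeR R).
  exact: mulrl_measurable.
pose m1 := measure_function_pushforward__canonical__measure_function_Measure leb mt.
pose m2 := measure_function_mscale__canonical__measure_function_Measure (NngNum (ltW t0)) m1.
have h : leb A = m2 A.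
  apply: (@lebesgue_measure_unique _ m2 _ A mA) => // X [[a b] _ <-].
  rewrite /m2 /= /mscale /m1 /= /pushforward.
  have -> : ( *%R t) @^-1` `]a, b] = `](t^-1 * a)%R, (t^-1 * b)%R]%classic.
    apply/seteqP; split=> x /=; rewrite !in_itv/=.
      by rewrite ltr_pdivrMl// ler_pdivlMl.
    by rewrite ltr_pdivrMl// ler_pdivlMl.
  rewrite !lebesgue_measure_itv /= !lte_fin ltr_pM2l ?invr_gt0//.
  case: ifPn => _; last by rewrite mule0.
  by rewrite -!EFinD -EFinM -!mulrBr mulrA divff ?gt_eqF// mul1r.
by rewrite h /m2 /= /mscale /= muleA -EFinM mulVf ?gt_eqF// mul1e.
Qed.

End lebesgue_row_integral.

(** * Change of variables with a density *)

Section image_density.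
Local Open Scope ereal_scope.
Context {R : realType} d1 d2 (X : measurableType d1) (Y : measurableType d2).
Variables (m : {measure set X -> \bar R}) (nu : {measure set Y -> \bar R}).
Variables (phi : X -> Y) (rho : X -> R).
Hypothesis mphi : measurable_fun setT phi.
Hypothesis mrho : measurable_fun setT rho.
Hypothesis rho0 : forall x, (0 <= rho x)%R.
Hypothesis nuE : forall A, measurable A -> nu A = \int[m]_(x in phi @^-1` A) (rho x)%:E.

Import HBNNSimple.

Let integral_image_density_nnsfun (h : {nnsfun Y >-> R}) :
  \int[nu]_y (h y)%:E = \int[m]_x ((h (phi x))%:E * (rho x)%:E).
Proof.
under [LHS]eq_integral do rewrite fimfunE -fsumEFin//.
rewrite [LHS]ge0_integral_fsum//; last 2 first.
  - by move=> r; apply/measurable_EFinP; apply: measurableT_comp.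
  - by move=> r x _; rewrite EFinM nnfun_muleindic_ge0.
transitivity (\sum_(r \in range h) \int[m]_x ((r * \1_(h @^-1` [set r]) (phi x))%:E * (rho x)%:E)).
  apply: eq_fsbigr => r _.
  rewrite integralZl_indic_nnsfun// integral_indic// setIT [nu _]nuE//.
  have [r0|r0] := ltP r 0%R.
    rewrite preimage_nnfun0// preimage_set0 integral_set0 mule0 integral0_eq// => x _.
    by rewrite indicE in_set0 mulr0 mul0e.
  have mp : measurable (phi @^-1` (h @^-1` [set r])).
    by rewrite -[X in measurable X]setTI; exact: mphi.
  rewrite integral_mkcond -ge0_integralZl//.
  - apply: eq_integral => x _; rewrite /patch indicE.
    have -> : (x \in phi @^-1` (h @^-1` [set r])) = (phi x \in h @^-1` [set r]).
      by apply/idP/idP => /set_mem ?; apply/mem_set.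
    by case: ifP => _; rewrite ?mulr1 ?mulr0 ?mule0 ?mul0e.
  - apply/(measurable_restrictT _ mp); apply: measurable_funTS; exact/measurable_EFinP.
  - by move=> x _; rewrite /patch; case: ifP => _ //; rewrite lee_fin.
rewrite -ge0_integral_fsum//; last 2 first.
  - move=> r; apply: emeasurable_funM; apply/measurable_EFinP => //.
    by apply: measurable_funM => //; apply: measurableT_comp.
  - by move=> r x _; rewrite mule_ge0 ?lee_fin//; have := nnfun_muleindic_ge0 h r (phi x); rewrite -EFinM lee_fin.
apply: eq_integral => x _.
rewrite -ge0_mule_fsuml; last by move=> r; rewrite EFinM nnfun_muleindic_ge0.
by rewrite fsumEFin// -fimfunE.
Qed.

(** From sets to simple functions to monotone limits. It underlies the scaling of the line, the
    stereographic chart and the conformal dilations of the sphere. *)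
Lemma ge0_integral_image_density (f : Y -> \bar R) : measurable_fun setT f ->
  (forall y, 0 <= f y) -> \int[nu]_y f y = \int[m]_x (f (phi x) * (rho x)%:E).
Proof.
move=> mf f0; pose g := nnsfun_approx measurableT mf.
transitivity (limn (fun n => \int[nu]_y (g n y)%:E)).
  rewrite -monotone_convergence//; last 3 first.
    - by move=> n; apply/measurable_EFinP.
    - by move=> n x _; rewrite lee_fin fun_ge0.
    - by move=> y /= _ a b ab; rewrite lee_fin; exact/lefP/nd_nnsfun_approx.
  by apply: eq_integral => /= x _; apply/esym/cvg_lim => //; exact: cvg_nnsfun_approx.
transitivity (limn (fun n => \int[m]_x ((g n (phi x))%:E * (rho x)%:E))).
  by congr (limn _); apply/funext => n; exact: integral_image_density_nnsfun.
rewrite -monotone_convergence//; last 3 first.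
  - move=> n; apply: emeasurable_funM; apply/measurable_EFinP => //.
    by apply: measurableT_comp.
  - by move=> n x _; rewrite mule_ge0// lee_fin// fun_ge0.
  - by move=> x /= _ a b ab; rewrite lee_wpmul2r// lee_fin//; exact/lefP/nd_nnsfun_approx.
apply: eq_integral => x _; apply/cvg_lim => //.
apply: cvgeZr => //.
by apply: cvg_nnsfun_approx.
Qed.

(** Positive and negative parts are transported separately, so integrability is not assumed. *)
Lemma integral_image_density (f : Y -> \bar R) : measurable_fun setT f ->
  \int[nu]_y f y = \int[m]_x (f (phi x) * (rho x)%:E).
Proof.
move=> mf; rewrite [LHS]integralE [RHS]integralE; congr (_ - _).
  rewrite ge0_integral_image_density//; last exact: measurable_funepos.
  by apply: eq_integral => x _; rewrite !funeposE maxe_pMl ?lee_fin// mul0e.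
rewrite ge0_integral_image_density//; last exact: measurable_funeneg.
by apply: eq_integral => x _; rewrite !funenegE maxe_pMl ?lee_fin// mul0e mulNe.
Qed.

End image_density.

Section derive_rules2.
Context {R : realType}.
Implicit Types (f g : R -> R) (x : R).

Lemma is_der1B f g x df dg : is_derive x 1 f df -> is_derive x 1 g dg ->
  is_derive x 1 (fun z => f z - g z) (df - dg).
Proof. by move=> hf hg; exact: is_deriveB. Qed.

Lemma is_der1X f x df k : is_derive x 1 f df ->
  is_derive x 1 (fun z => f z ^+ k) (k%:R * f x ^+ k.-1 * df).
Proof.
move=> hf; elim: k => [|k ih].
  by under eq_fun do rewrite expr0; rewrite !mul0r; exact: is_der1_cst.
under eq_fun do rewrite exprS.
apply: (is_derive_eq (is_der1M hf ih)) => /=.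
case: k ih => [|k] _; rewrite /= ?expr0 ?expr1; first by ring.
by rewrite !exprS -(natr1 k.+1); ring.
Qed.

Lemma is_der1V f x df : f x != 0 -> is_derive x 1 f df ->
  is_derive x 1 (fun z => (f z)^-1) (- (f x) ^- 2 * df).
Proof.
move=> f0 hf; apply: DeriveDef; first by apply: derivableV => //; exact: ex_derive.
by rewrite deriveV// derive_val /GRing.scale/=.
Qed.

Lemma continuous_cond (f : R -> R) : (forall x, exists l, is_derive x (1 : R) f l) -> continuous f.
Proof.
move=> h x; have [l hl] := h x.
by apply: differentiable_continuous; apply/derivable1_diffP; exact: ex_derive.
Qed.

End derive_rules2.

Section lrow_scale.
Context {R : realType}.
Local Notation leb := (@lebesgue_measure R).
Local Notation lrow := (lebesgue_row R).
Local Open Scope ereal_scope.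

Lemma measurable_integral_cons n (f : 'rV[R]_n.+1 -> \bar R) :
  measurable_fun setT f -> (forall y, 0 <= f y) ->
  measurable_fun setT (fun y => \int[leb]_s f (cons_row (s, y))).
Proof.
move=> mf f0.
apply: (@measurable_fun_fubini_tonelli_G _ _ _ _ _ leb (fun z => f (cons_row z))) => //.
by apply: measurableT_comp mf _; exact: measurable_cons_row.
Qed.

Lemma ge0_integral_lebesgue_scale (t : R) (f : R -> \bar R) : (0 < t)%R ->
  measurable_fun setT f -> (forall s, 0 <= f s) ->
  \int[leb]_s f s = \int[leb]_s (f (t * s)%R * t%:E).
Proof.
move=> t0 mf f0.
have mt : measurable_fun (setT : set (measurableTypeR R)) ( *%R t : measurableTypeR R -> measurableTypeR R).
  exact: mulrl_measurable.
have h := @ge0_integral_image_density R _ _ _ _ leb leb ( *%R t : measurableTypeR R -> measurableTypeR R) (cst t) mt.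
apply: h => //=; first by move=> _; rewrite ltW.
move=> A mA; rewrite integral_cst//=; last first.
  by rewrite -[X in measurable X]setTI; exact: mt.
by rewrite [X in _ * X](lebesgue_measure_scale t0 mA) muleA -EFinM divff ?gt_eqF// mul1e.
Qed.

Lemma scale_cons_row n (t s : R) (y : 'rV[R]_n) :
  (t *: cons_row (s, y) = cons_row (t * s, t *: y))%R.
Proof.
apply/rowP => i; rewrite mxE; have [j ->|->] := unliftP ord0 i.
  by rewrite !cons_rowS mxE.
by rewrite !cons_row0.
Qed.

Lemma measurable_scale_row n (t : R) : measurable_fun setT (fun y : 'rV[R]_n => t *: y).
Proof.
apply: measurable_fun_row => i.
rewrite (_ : _ \o _ = fun y : 'rV[R]_n => (t * y ord0 i)%R); last first.
  by apply/funext => y; rewrite /= /row_coord mxE.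
by apply: measurable_funM => //; exact: measurable_coord.
Qed.

Lemma ge0_integral_lrow_scale n (t : R) (f : 'rV[R]_n -> \bar R) : (0 < t)%R ->
  measurable_fun setT f -> (forall y, 0 <= f y) ->
  \int[lrow n]_y f y = \int[lrow n]_y (f (t *: y) * (t ^+ n)%:E).
Proof.
move=> t0; elim: n f => [|n ih] f mf f0.
  by apply: eq_integral => y _; rewrite expr0 mule1 (thinmx0 (t *: y)) (thinmx0 y).
have mft : measurable_fun setT (fun y : 'rV[R]_n.+1 => f (t *: y)).
  by apply: measurableT_comp mf _; exact: measurable_scale_row.
rewrite [LHS]ge0_integral_lrowS//.
rewrite [RHS]ge0_integral_lrowS//; last 2 first.
  by apply: emeasurable_funM.
  by move=> y; rewrite mule_ge0// lee_fin exprn_ge0// ltW.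
rewrite [LHS]ih; last 2 first.
  exact: measurable_integral_cons.
  by move=> y; apply: integral_ge0.
apply: eq_integral => y _.
rewrite (@ge0_integral_lebesgue_scale t)//; last first.
  by apply: measurableT_comp mf _; exact: measurable_cons_rowr.
rewrite -ge0_integralZr//.
- by apply: eq_integral => s _; rewrite scale_cons_row exprS EFinM muleA.
- apply: emeasurable_funM => //; apply: measurableT_comp mf _.
  have h := @measurable_cons_rowr R n (t *: y).
  have ht : measurable_fun setT ( *%R t : R -> R) by exact: mulrl_measurable.
  exact: (measurableT_comp h ht).
- by move=> s _; rewrite mule_ge0// lee_fin ltW.
- by rewrite lee_fin exprn_ge0// ltW.
Qed.

End lrow_scale.

(** * The stereographic chart and the divergence theorem *)

Section chart.
Context {R : realType} (m : nat).
Local Notation n := m.+2.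
Implicit Types (y z : 'rV[R]_n) (x : 'rV[R]_n.+1) (i j : 'I_n) (k : 'I_n.+1).

(** The conformal factor of the chart: g_0 = cfac^2 |dy|^2. *)
Definition cfac y : R := 2 / (1 + edot y y).

Lemma base_gt0 y : 0 < 1 + edot y y.
Proof. by rewrite ltr_pwDl// edot_ge0. Qed.

Lemma cfac_gt0 y : 0 < cfac y.
Proof. by rewrite divr_gt0// base_gt0. Qed.

Lemma cfac_le2 y : cfac y <= 2.
Proof. by rewrite ler_pdivrMr ?base_gt0// ler_peMr// lerDl edot_ge0. Qed.

(** Eliminates |y|^2: afterwards the identities of the chart are polynomial in [cfac y] and the
    coordinates. *)
Lemma cfac_edot y : cfac y * edot y y = 2 - cfac y.
Proof. by rewrite /cfac; field; rewrite gt_eqF// base_gt0. Qed.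

Lemma sqr_coord_le y i : y 0 i ^+ 2 <= edot y y.
Proof.
by rewrite /edot (bigD1 i)//= -expr2 lerDl sumr_ge0// => j _; rewrite -expr2 sqr_ge0.
Qed.

Lemma stereo0 y : stereo y 0 0 = 1 - cfac y.
Proof. by rewrite mxE cons_row0 /cfac /=; field; rewrite gt_eqF// base_gt0. Qed.

Lemma stereoS y j : stereo y 0 (lift ord0 j) = cfac y * y 0 j.
Proof. by rewrite mxE cons_rowS mxE /cfac /=; field; rewrite gt_eqF// base_gt0. Qed.

(** The derivative along y_i of the k-th ambient coordinate of [stereo], in closed form. *)
Definition dstereo k i y : R :=
  if unlift ord0 k is Some j then cfac y * (j == i)%:R - cfac y ^+ 2 * y 0 i * y 0 j
  else cfac y ^+ 2 * y 0 i.

Lemma dstereo0 i y : dstereo ord0 i y = cfac y ^+ 2 * y 0 i.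
Proof. by rewrite /dstereo unlift_none. Qed.

Lemma dstereoS j i y :
  dstereo (lift ord0 j) i y = cfac y * (j == i)%:R - cfac y ^+ 2 * y 0 i * y 0 j.
Proof. by rewrite /dstereo liftK. Qed.

Lemma is_derive_setc y i j (s : R) :
  is_derive s 1 (fun s => setc y i s 0 j) (j == i)%:R.
Proof.
under eq_fun do rewrite mxE.
by case: eqP => _; [exact: is_der1_id | exact: is_der1_cst].
Qed.

Lemma is_derive_edot_setc y i (s : R) :
  is_derive s 1 (fun s => edot (setc y i s) (setc y i s)) (2 * s).
Proof.
have h := @is_der1_sum R _ (index_enum 'I_n)
  (fun j s => setc y i s 0 j * setc y i s 0 j) (fun j s => 2 * (setc y i s 0 j * (j == i)%:R)) s.
apply: (is_derive_eq (h _)).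
  move=> j; apply: (is_derive_eq (is_der1M (is_derive_setc _ _ _ _) (is_derive_setc _ _ _ _))).
  by ring.
rewrite -mulr_sumr (bigD1 i)//= eqxx mulr1 setcE big1 ?addr0// => j /negPf ->.
by rewrite mulr0.
Qed.

Lemma is_derive_cfac_setc y i (s : R) :
  is_derive s 1 (fun s => cfac (setc y i s)) (- cfac (setc y i s) ^+ 2 * s).
Proof.
have h := is_der1D (is_der1_cst (1 : R) s) (is_derive_edot_setc y i s).
have b0 : 1 + edot (setc y i s) (setc y i s) != 0 by rewrite gt_eqF// base_gt0.
rewrite /cfac; apply: (is_derive_eq (is_der1M (is_der1_cst (2 : R) s) (@is_der1V R
  (fun s => 1 + edot (setc y i s) (setc y i s)) s _ b0 h))).
by field.
Qed.

Lemma is_derive_stereo_setc k y i (s : R) :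
  is_derive s 1 (fun s => stereo (setc y i s) 0 k) (dstereo k i (setc y i s)).
Proof.
have [j ->|->] := unliftP ord0 k.
  under eq_fun do rewrite stereoS.
  apply: (is_derive_eq (is_der1M (is_derive_cfac_setc _ _ _) (is_derive_setc _ _ _ _))).
  by rewrite dstereoS setcE; ring.
under eq_fun do rewrite stereo0.
apply: (is_derive_eq (is_der1B (is_der1_cst (1 : R) s) (is_derive_cfac_setc _ _ _))).
by rewrite dstereo0 setcE; ring.
Qed.

Lemma continuous_stereo_setc k y i : continuous (fun s => stereo (setc y i s) 0 k).
Proof.
by apply: continuous_cond => s; eexists; exact: is_derive_stereo_setc.
Qed.

(** The chart takes values in the sphere, so its derivatives are orthogonal to the position. *)
Lemma sum_stereo_dstereo i y : \sum_k stereo y 0 k * dstereo k i y = 0.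
Proof.
rewrite big_ord_recl stereo0 dstereo0.
under eq_bigr do rewrite stereoS dstereoS.
rewrite (eq_bigr (fun j => cfac y ^+ 2 * (y 0 j * (j == i)%:R) -
   cfac y ^+ 3 * y 0 i * (y 0 j * y 0 j))); last by move=> j _; ring.
rewrite sumrB -!mulr_sumr (bigD1 i)//= eqxx mulr1 big1 ?addr0; last first.
  by move=> j /negPf ->; rewrite mulr0.
rewrite -/(edot y y).
transitivity (cfac y ^+ 2 * y 0 i * (1 - cfac y + 1 - cfac y * edot y y)); first by ring.
by rewrite cfac_edot /=; ring.
Qed.

(** With J the Jacobian matrix of the chart, J J^T is cfac^2 times the projection onto the tangent
    space; [stereo_conformal] is the companion statement on J^T J. *)
Lemma dstereo_conformal k l y :
  \sum_i dstereo k i y * dstereo l i y =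
  cfac y ^+ 2 * ((k == l)%:R - stereo y 0 k * stereo y 0 l).
Proof.
have ev j : \sum_i y 0 i * (j == i)%:R = y 0 j.
  by rewrite (bigD1 j)//= eqxx mulr1 big1 ?addr0// => i; rewrite eq_sym => /negPf ->; rewrite mulr0.
have dd j j' : \sum_i (j == i)%:R * (j' == i)%:R = (j == j')%:R :> R.
  rewrite (bigD1 j)//= eqxx mul1r big1 ?addr0 1?eq_sym// => i.
  by rewrite eq_sym => /negPf ->; rewrite mul0r.
have [j ->|->] := unliftP ord0 k; have [j' ->|->] := unliftP ord0 l.
- rewrite (inj_eq (@lift_inj _ ord0)) !stereoS.
  under eq_bigr do rewrite !dstereoS.
  rewrite (eq_bigr (fun i => cfac y ^+ 2 * ((j == i)%:R * (j' == i)%:R)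
    - cfac y ^+ 3 * y 0 j' * (y 0 i * (j == i)%:R)
    - cfac y ^+ 3 * y 0 j * (y 0 i * (j' == i)%:R)
    + cfac y ^+ 4 * y 0 j * y 0 j' * (y 0 i * y 0 i))); last by move=> i _; ring.
  rewrite big_split/= sumrB sumrB -!mulr_sumr !ev dd -/(edot y y).
  transitivity (cfac y ^+ 2 * (j == j')%:R - 2 * cfac y ^+ 3 * y 0 j * y 0 j'
     + cfac y ^+ 3 * y 0 j * y 0 j' * (cfac y * edot y y)); first by ring.
  by rewrite cfac_edot /=; ring.
- rewrite [lift _ _ == _]eq_sym (negPf (neq_lift _ _)) stereoS stereo0.
  under eq_bigr do rewrite dstereoS dstereo0.
  rewrite (eq_bigr (fun i => cfac y ^+ 3 * (y 0 i * (j == i)%:R)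
    - cfac y ^+ 4 * y 0 j * (y 0 i * y 0 i))); last by move=> i _; ring.
  rewrite sumrB -!mulr_sumr !ev -/(edot y y).
  transitivity (cfac y ^+ 3 * y 0 j * (1 - cfac y * edot y y)); first by ring.
  by rewrite cfac_edot /=; ring.
- rewrite (negPf (neq_lift _ _)) stereoS stereo0.
  under eq_bigr do rewrite dstereoS dstereo0.
  rewrite (eq_bigr (fun i => cfac y ^+ 3 * (y 0 i * (j' == i)%:R)
    - cfac y ^+ 4 * y 0 j' * (y 0 i * y 0 i))); last by move=> i _; ring.
  rewrite sumrB -!mulr_sumr !ev -/(edot y y).
  transitivity (cfac y ^+ 3 * y 0 j' * (1 - cfac y * edot y y)); first by ring.
  by rewrite cfac_edot /=; ring.
rewrite eqxx stereo0; under eq_bigr do rewrite dstereo0.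
rewrite (eq_bigr (fun i => cfac y ^+ 4 * (y 0 i * y 0 i))); last by move=> i _; ring.
rewrite -mulr_sumr -/(edot y y).
transitivity (cfac y ^+ 3 * (cfac y * edot y y)); first by ring.
by rewrite cfac_edot /=; ring.
Qed.

(* The k-th tangential coordinate field of the sphere, read in the chart and
   weighted by the volume density. *)
Definition wfield k i y : R := cfac y ^+ m * dstereo k i y.

Definition dwfield k i y : R :=
  if unlift ord0 k is Some j then
    n%:R * cfac y ^+ m.+3 * y 0 i ^+ 2 * y 0 j - cfac y ^+ n * y 0 j
      - n%:R * cfac y ^+ n * y 0 i * (j == i)%:R
  else cfac y ^+ n - n%:R * cfac y ^+ m.+3 * y 0 i ^+ 2.

Lemma natmul_exprpred (c u : R) (p : nat) :
  p%:R * c ^+ p.-1 * (- c ^+ 2 * u) = - (p%:R * c ^+ p * c * u).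
Proof. by case: p => [|p]; rewrite ?mul0r ?oppr0// !exprS /=; ring. Qed.

Lemma is_derive_wfield k y i (s : R) :
  is_derive s 1 (fun s => wfield k i (setc y i s)) (dwfield k i (setc y i s)).
Proof.
rewrite /wfield /dwfield; have [j ->|->] := unliftP ord0 k.
  under eq_fun do rewrite dstereoS.
  have h1 := is_der1X m (is_derive_cfac_setc y i s).
  have h2 := is_der1X 2 (is_derive_cfac_setc y i s).
  have h3 := is_der1M (is_derive_cfac_setc y i s) (is_der1_cst ((j == i)%:R : R) s).
  have h4 := is_der1M (is_der1M h2 (is_derive_setc y i i s)) (is_derive_setc y i j s).
  apply: (is_derive_eq (is_der1M h1 (is_der1B h3 h4))).
  rewrite natmul_exprpred eqxx setcE -(natr1 m.+1) -(natr1 m) !exprS.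
  by case: eqP => [->|_]; rewrite ?setcE/=; ring.
under eq_fun do rewrite dstereo0.
have h1 := is_der1X m (is_derive_cfac_setc y i s).
have h2 := is_der1X 2 (is_derive_cfac_setc y i s).
apply: (is_derive_eq (is_der1M h1 (is_der1M h2 (is_derive_setc y i i s)))).
by rewrite natmul_exprpred eqxx setcE -(natr1 m.+1) -(natr1 m) !exprS /=; ring.
Qed.

(** The coordinate x_k is an eigenfunction of the Laplacian of the sphere, with eigenvalue -n: in
    [wfield], cfac^m is the density cfac^n times the inverse metric cfac^-2. *)
Lemma div_wfield k y : \sum_i dwfield k i y = - n%:R * stereo y 0 k * cfac y ^+ n.
Proof.
rewrite /dwfield; have [j ->|->] := unliftP ord0 k.
  rewrite sumrB sumrB stereoS.
  rewrite (eq_bigr (fun i => n%:R * cfac y ^+ m.+3 * y 0 j * (y 0 i * y 0 i))); last by move=> i _; ring.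
  rewrite -mulr_sumr -/(edot y y) sumr_const card_ord.
  rewrite [X in _ - X](bigD1 j)//= eqxx big1 ?addr0; last first.
    by move=> i; rewrite eq_sym => /negPf ->; rewrite mulr0.
  transitivity (n%:R * cfac y ^+ n * y 0 j * (cfac y * edot y y) - 2 * n%:R * cfac y ^+ n * y 0 j).
    by rewrite -[cfac y ^+ n * y 0 j *+ n]mulr_natr !exprS /=; ring.
  by rewrite cfac_edot /=; ring.
rewrite sumrB sumr_const card_ord stereo0.
rewrite (eq_bigr (fun i => n%:R * cfac y ^+ m.+3 * (y 0 i * y 0 i))); last by move=> i _; ring.
rewrite -mulr_sumr -/(edot y y) -mulr_natr.
transitivity (n%:R * cfac y ^+ n - n%:R * cfac y ^+ n * (cfac y * edot y y)).
  by rewrite !exprS; ring.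
by rewrite cfac_edot /=; ring.
Qed.

End chart.

Section sphere_integral.
Context {R : realType} (n : nat).
Local Notation lrow := (lebesgue_row R).
Local Notation vol := (@sphere_volume R n).
Local Notation S := (@sphere R n).
Local Open Scope ereal_scope.

Lemma measurable_sphere : measurable S.
Proof.
have -> : S = (fun y : 'rV[R]_n.+1 => edot y y) @^-1` [set 1%R] by [].
rewrite -[X in measurable X]setTI; apply: (@measurable_edot R n.+1) => //.
Qed.

Lemma patch_sphere_stereo (f : 'rV[R]_n.+1 -> \bar R) y : (f \_ S) (stereo y) = f (stereo y).
Proof. by rewrite patchE mem_set//; exact: stereo_sphere. Qed.

Lemma integral_vol (f : 'rV[R]_n.+1 -> \bar R) : measurable_fun S f ->
  \int[vol]_(x in S) f x = \int[lrow n]_y (f (stereo y) * (stereo_density y)%:E).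
Proof.
move=> mf; rewrite integral_mkcond.
rewrite (@integral_image_density R _ _ _ _ (lrow n) vol (@stereo R n) (@stereo_density R n)).
- by apply: eq_integral => y _; rewrite patch_sphere_stereo.
- exact: measurable_stereo.
- exact: measurable_stereo_density.
- exact: stereo_density_ge0.
- by [].
- by apply/(measurable_restrictT _ measurable_sphere).
Qed.

End sphere_integral.

Section tail_bounds.
Context {R : realType} (m : nat).
Local Notation n := m.+2.
Implicit Types (y : 'rV[R]_n).

(** The decay of [dwfield]: half a power of 1 + |y|^2 worse than the density. *)
Definition wbound y : R := cfac y ^+ n * Num.sqrt (1 + edot y y).

Lemma sqrt_base_ge1 y : 1 <= Num.sqrt (1 + edot y y).
Proof. by rewrite -[leLHS]sqrtr1 ler_sqrt ?lerDl ?edot_ge0// ltW// base_gt0. Qed.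

Lemma coord_le_sqrt_base y i : `|y 0 i| <= Num.sqrt (1 + edot y y).
Proof.
rewrite -sqrtr_sqr ler_wsqrtr// ltW//.
by rewrite (le_lt_trans (sqr_coord_le y i))// ltrDr.
Qed.

Lemma sqr_onem_coord_le y i : (1 + `|y 0 i|) ^+ 2 <= 2 * (1 + edot y y).
Proof.
apply: (@le_trans _ _ (2 * (1 + `|y 0 i| ^+ 2))).
  by have := sqr_ge0 (1 - `|y 0 i|); nra.
by rewrite ler_pM2l// lerD2l real_normK ?num_real// sqr_coord_le.
Qed.

Lemma cfac_le_tailb y i : cfac y <= 4 * tailb (y 0 i).
Proof.
have a1 : 1 <= 1 + `|y 0 i| by rewrite lerDl.
have a0 := lt_le_trans ltr01 a1.
have h : (1 + `|y 0 i|) ^- 2 <= tailb (y 0 i).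
  rewrite /tailb powRN lef_pV2 ?posrE ?powR_gt0 ?exprn_gt0//.
  rewrite -(powR_mulrn 2 (ltW a0)).
  by apply: ler_powR => //; rewrite ler_pdivrMr//; lra.
apply: le_trans (ler_wpM2l _ h) => //.
rewrite /cfac ler_pdivrMr ?base_gt0// -mulrA -ler_pdivrMl//.
rewrite ler_pdivlMl ?exprn_gt0//.
have := sqr_onem_coord_le y i; lra.
Qed.

(** Each factor of the product is at least (2 (1 + |y|^2))^(-3/4), so what is needed is n - 1/2 >= 3
    n / 4, that is n >= 2. *)
Lemma wbound_le_prod_tail y : wbound y <= 2 ^+ n * 2 `^ (3 / 4 * n%:R) * prod_tail y.
Proof.
set B := 1 + edot y y.
have B0 : 0 < B by exact: base_gt0.
have B1 : 1 <= B by rewrite lerDl edot_ge0.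
have tl i : (2 * B) `^ (- (3 / 4)) <= tailb (y 0 i).
  have a0 : 0 < 1 + `|y 0 i| by rewrite ltr_wpDr.
  rewrite /tailb !powRN lef_pV2 ?posrE ?powR_gt0// ?mulr_gt0//.
  have -> : (2 * B) `^ (3 / 4) = ((2 * B) `^ (1 / 2)) `^ (3 / 2).
    by rewrite -powRrM; congr (_ `^ _); field.
  apply: ge0_ler_powR; rewrite ?nnegrE ?powR_ge0 ?(ltW a0)//.
  have -> : 1 + `|y 0 i| = ((1 + `|y 0 i|) `^ 2) `^ (1 / 2).
    by rewrite -powRrM (_ : 2 * (1 / 2) = 1); [rewrite powRr1// ltW | field].
  apply: ge0_ler_powR; rewrite ?nnegrE ?powR_ge0 ?mulr_ge0 ?(ltW B0)//.
  by rewrite powR_mulrn ?(ltW a0)// sqr_onem_coord_le.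
have pl : (2 * B) `^ (- (3 / 4) * n%:R) <= prod_tail y.
  rewrite powRrM powR_mulrn ?powR_ge0//.
  have -> : ((2 * B) `^ (- (3 / 4))) ^+ n = \prod_(i < n) (2 * B) `^ (- (3 / 4)).
    by rewrite prodr_const card_ord.
  by apply: ler_prod => i _; rewrite powR_ge0 tl.
apply: le_trans (ler_wpM2l _ pl); last by rewrite mulr_ge0 ?exprn_ge0 ?powR_ge0.
rewrite powRM ?(ltW B0)// mulNr !powRN.
have p0 : 2 `^ (3 / 4 * n%:R) != 0 :> R by rewrite gt_eqF// powR_gt0.
rewrite mulrA -[X in _ <= X * _]mulrA (divff p0) mulr1.
rewrite /wbound /cfac -/B expr_div_n -mulrA ler_pM2l ?exprn_gt0//.
rewrite -(powR12_sqrt (ltW B0)) -(powR_mulrn n (ltW B0)) -!powRN -powRD; last first.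
  by rewrite (gt_eqF B0) implybT.
apply: ler_powR => //.
by rewrite -(natr1 m.+1) -(natr1 m); have : (0 : R) <= m%:R by []; lra.
Qed.

End tail_bounds.

Section divergence.
Context {R : realType} (m : nat).
Local Notation n := m.+2.
Local Notation lrow := (lebesgue_row R).
Local Notation vol := (@sphere_volume R n).
Local Notation S := (@sphere R n).
Implicit Types (y : 'rV[R]_n) (x : 'rV[R]_n.+1).

Lemma stereo_density_cfac y : stereo_density y = cfac y ^+ n.
Proof. by []. Qed.

Lemma cfacn_le_wbound y : cfac y ^+ n <= wbound y.
Proof. by rewrite /wbound ler_peMr ?exprn_ge0 ?sqrt_base_ge1// ltW// cfac_gt0. Qed.

Lemma integrable_density : (lrow n).-integrable setT (fun y => (cfac y ^+ n)%:E).
Proof.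
apply: (@integrable_le_prod_tail _ _ (fun y => cfac y ^+ n) (2 ^+ n * 2 `^ (3 / 4 * n%:R))).
  exact: (@measurable_stereo_density R n).
move=> y; rewrite ger0_norm ?exprn_ge0 ?(ltW (cfac_gt0 _))//.
exact: le_trans (cfacn_le_wbound y) (wbound_le_prod_tail y).
Qed.

Let vol_fin : fin_num_fun vol.
Proof.
move=> A mA; rewrite ge0_fin_numE// /sphere_volume.
have /integrableP[mi] := integrable_density; apply: le_lt_trans.
under [leRHS]eq_integral do rewrite /= ger0_norm ?exprn_ge0// ?(ltW (cfac_gt0 _))//.
apply: ge0_subset_integral => //.
- by rewrite -[X in measurable X]setTI; exact: measurable_stereo.
- by move=> y _; rewrite lee_fin exprn_ge0// ltW// cfac_gt0.
Qed.

HB.instance Definition _ := @Measure_isFinite.Build _ _ _ vol vol_fin.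

(* [v] is the tangential gradient of [f], known through its chart derivatives. *)
Record tderiv (f : 'rV[R]_n.+1 -> R) (v : 'I_n.+1 -> 'rV[R]_n.+1 -> R) : Prop := Tderiv {
  td_meas : measurable_fun setT f;
  td_measv : forall k, measurable_fun setT (v k);
  td_bnd : exists C : R, forall x, S x -> `|f x| <= C /\ forall k, `|v k x| <= C;
  td_tan : forall x, S x -> \sum_k x 0 k * v k x = 0;
  td_der : forall y i (s : R), is_derive s 1 (fun s => f (stereo (setc y i s)))
     (\sum_k v k (stereo (setc y i s)) * dstereo k i (setc y i s));
  td_cont : forall y i k, continuous (fun s => v k (stereo (setc y i s))) }.

Lemma norm_dstereo_le k i y : `|dstereo k i y| <= 3 * cfac y.
Proof.
have c0 := cfac_gt0 y; have c2 := cfac_le2 y.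
have ab (a b : R) : `|a * b| <= (a ^+ 2 + b ^+ 2) / 2.
  by rewrite ler_norml; have := sqr_ge0 (a - b); have := sqr_ge0 (a + b); nra.
have [j ->|->] := unliftP ord0 k.
  rewrite dstereoS (le_trans (ler_normB _ _))//.
  have h1 : `|cfac y * (j == i)%:R| <= cfac y.
    by rewrite normrM gtr0_norm// ler_piMr ?(ltW c0)//; case: eqP; rewrite ?normr1 ?normr0.
  have h2 : `|cfac y ^+ 2 * y 0 i * y 0 j| <= 2 * cfac y.
    rewrite -mulrA normrM (ger0_norm (sqr_ge0 _)).
    have h3 : `|y 0 i * y 0 j| <= edot y y.
      apply: le_trans (ab _ _) _; rewrite ler_pdivrMr//.
      by have := sqr_coord_le y i; have := sqr_coord_le y j; nra.
    apply: le_trans (ler_wpM2l (sqr_ge0 _) h3) _.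
    by rewrite expr2 -mulrA cfac_edot; nra.
  lra.
rewrite dstereo0 normrM (ger0_norm (sqr_ge0 _)).
have h3 : `|y 0 i| <= (1 + edot y y) / 2.
  by have := ab (y 0 i) 1; rewrite mulr1; have := sqr_coord_le y i; nra.
apply: le_trans (ler_wpM2l (sqr_ge0 _) h3) _.
have : cfac y * (1 + edot y y) = 2 by rewrite mulrDr cfac_edot mulr1; lra.
by move=> e; rewrite expr2 mulrA -(mulrA _ _ (1 + _)) e; nra.
Qed.

Lemma norm_wfield_le k i y : `|wfield k i y| <= 3 * cfac y ^+ m.+1.
Proof.
rewrite /wfield normrM ger0_norm ?exprn_ge0 ?(ltW (cfac_gt0 _))//.
by rewrite exprSr mulrCA ler_wpM2l ?exprn_ge0 ?(ltW (cfac_gt0 _))// norm_dstereo_le.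
Qed.

Lemma norm_dwfield_le k i y : `|dwfield k i y| <= (4 * n%:R + 1) * wbound y.
Proof.
have c0 := cfac_gt0 y; have cn0 : 0 <= cfac y ^+ n by rewrite exprn_ge0// ltW.
set s := Num.sqrt (1 + edot y y).
have s1 : 1 <= s := sqrt_base_ge1 y; have s0 := le_trans ler01 s1.
have ys j : `|y 0 j| <= s := coord_le_sqrt_base y j.
have cy2 : cfac y * y 0 i ^+ 2 <= 2.
  apply: le_trans (ler_wpM2l (ltW c0) (sqr_coord_le y i)) _.
  by rewrite cfac_edot; lra.
have cy0 : 0 <= cfac y * y 0 i ^+ 2 by rewrite mulr_ge0 ?sqr_ge0// ltW.
rewrite /wbound -/s /dwfield.
have bn (a : R) : `|a| <= (4 * n%:R + 1) * s -> `|cfac y ^+ n * a| <= (4 * n%:R + 1) * (cfac y ^+ n * s).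
  by move=> ha; rewrite normrM ger0_norm// mulrCA ler_wpM2l.
have n0 : (0 : R) <= n%:R by [].
case: unliftP => [j _|_].
  rewrite (_ : _ - _ = cfac y ^+ n * (n%:R * (cfac y * y 0 i ^+ 2) * y 0 j - y 0 j - n%:R * y 0 i * (j == i)%:R)); last first.
    by rewrite !exprS; ring.
  apply: bn; rewrite (le_trans (ler_normB _ _))//.
  have h1 : `|n%:R * (cfac y * y 0 i ^+ 2) * y 0 j - y 0 j| <= (2 * n%:R + 1) * s.
    rewrite -{2}(mul1r (y 0 j)) -mulrBl normrM ler_pM// ler_norml.
    by apply/andP; split; nra.
  have h2 : `|n%:R * y 0 i * (j == i)%:R| <= n%:R * s.
    rewrite !normrM (ger0_norm n0) -mulrA ler_wpM2l//.
    by case: (j == i); rewrite ?normr1 ?normr0 ?mulr1 ?mulr0.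
  nra.
rewrite (_ : _ - _ = cfac y ^+ n * (1 - n%:R * (cfac y * y 0 i ^+ 2))); last first.
  by rewrite !exprS; ring.
by apply: bn; rewrite ler_norml; apply/andP; split; nra.
Qed.

End divergence.

Section continuous_rules.
Context {R : realType}.
Implicit Types f g : R -> R.
Lemma contD f g : continuous f -> continuous g -> continuous (fun s => f s + g s).
Proof. by move=> cf cg s; apply: cvgD; [exact: cf | exact: cg]. Qed.
Lemma contB f g : continuous f -> continuous g -> continuous (fun s => f s - g s).
Proof. by move=> cf cg s; apply: cvgB; [exact: cf | exact: cg]. Qed.
Lemma contM f g : continuous f -> continuous g -> continuous (fun s => f s * g s).
Proof. by move=> cf cg s; apply: cvgM; [exact: cf | exact: cg]. Qed.
Lemma contC (c : R) : continuous (fun _ : R => c).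
Proof. by move=> s; exact: cvg_cst. Qed.
Lemma contX f k : continuous f -> continuous (fun s => f s ^+ k).
Proof.
move=> cf; elim: k => [|k ih]; first by under eq_fun do rewrite expr0; exact: contC.
by under eq_fun do rewrite exprS; exact: contM.
Qed.
Lemma cont_sum (I : Type) (r : seq I) (F : I -> R -> R) :
  (forall i, continuous (F i)) -> continuous (fun s => \sum_(i <- r) F i s).
Proof.
move=> h; elim: r => [|i r ih].
  by under eq_fun do rewrite big_nil; exact: contC.
by under eq_fun do rewrite big_cons; apply: contD.
Qed.
End continuous_rules.

Section divergence_theorem.
Context {R : realType} (m : nat).
Local Notation n := m.+2.
Local Notation lrow := (lebesgue_row R).
Local Notation vol := (@sphere_volume R n).
Local Notation S := (@sphere R n).
Implicit Types (y : 'rV[R]_n) (x : 'rV[R]_n.+1).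

Lemma measurable_cfac : measurable_fun setT (@cfac R m).
Proof. by apply: measurable_funM => //; exact: measurable_stereo_inv. Qed.

Lemma measurable_dstereo k i : measurable_fun setT (@dstereo R m k i).
Proof.
have mc := measurable_cfac.
have [j ->|->] := unliftP ord0 k.
  rewrite /dstereo liftK.
  apply: measurable_funB; first exact: measurable_funM.
  apply: measurable_funM; last exact: measurable_coord.
  by apply: measurable_funM; [exact: measurable_funX | exact: measurable_coord].
rewrite /dstereo unlift_none.
by apply: measurable_funM; [exact: measurable_funX | exact: measurable_coord].
Qed.

Lemma measurable_wfield k i : measurable_fun setT (@wfield R m k i).
Proof.
apply: measurable_funM; last exact: measurable_dstereo.
by apply: measurable_funX; exact: measurable_cfac.
Qed.

Lemma measurable_dwfield k i : measurable_fun setT (@dwfield R m k i).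
Proof.
have mc := measurable_cfac; have my := @measurable_coord R n.
rewrite /dwfield; case: unliftP => [j _|_].
  apply: measurable_funB; first apply: measurable_funB.
  - apply: measurable_funM; last exact: my.
    apply: measurable_funM; last by apply: measurable_funX; exact: my.
    by apply: measurable_funM => //; exact: measurable_funX.
  - by apply: measurable_funM; [exact: measurable_funX | exact: my].
  - apply: measurable_funM => //; apply: measurable_funM; last exact: my.
    by apply: measurable_funM => //; exact: measurable_funX.
apply: measurable_funB; first exact: measurable_funX.
apply: measurable_funM; last by apply: measurable_funX; exact: my.
by apply: measurable_funM => //; exact: measurable_funX.
Qed.

Lemma cont_cfac y i : continuous (fun s => cfac (setc y i s)).
Proof. by apply: continuous_cond => s; eexists; exact: is_derive_cfac_setc. Qed.

Lemma cont_setc y i j : continuous (fun s : R => setc y i s 0 j).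
Proof. by apply: continuous_cond => s; eexists; exact: is_derive_setc. Qed.

Lemma cont_dstereo k i y j : continuous (fun s => dstereo k i (setc y j s)).
Proof.
have cc := @cont_cfac y j; have cy := @cont_setc y j.
have [l ->|->] := unliftP ord0 k.
  under eq_fun do rewrite dstereoS.
  by apply: contB; [apply: contM => //; exact: contC | apply: contM => //; apply: contM => //; exact: contX].
by under eq_fun do rewrite dstereo0; apply: contM => //; exact: contX.
Qed.

Lemma cont_wfield k i y j : continuous (fun s => wfield k i (setc y j s)).
Proof. by apply: contM; [apply: contX; exact: cont_cfac | exact: cont_dstereo]. Qed.

Lemma cont_dwfield k i y j : continuous (fun s => dwfield k i (setc y j s)).
Proof.
have cc := @cont_cfac y j; have cy := @cont_setc y j.
rewrite /dwfield; case: unliftP => [l _|_].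
  apply: contB; first apply: contB.
  - apply: contM => //; apply: contM; last exact: contX.
    by apply: contM; [exact: contC | exact: contX].
  - by apply: contM => //; exact: contX.
  - apply: contM; last exact: contC.
    by apply: contM => //; apply: contM; [exact: contC | exact: contX].
apply: contB; first exact: contX.
by apply: contM; [apply: contM; [exact: contC | exact: contX] | exact: contX].
Qed.

(** In the chart the integrand is the divergence of [f] times [wfield k]: by [div_wfield] and
    [dstereo_conformal] that divergence equals cfac^n (v_k - n x_k f), the normal part dropping out
    since [v] is tangential. Each partial derivative integrates to 0. *)
Lemma sphere_divergence (f : 'rV[R]_n.+1 -> R) v k : tderiv f v ->
  (\int[vol]_(x in S) (v k x - n%:R * (x 0 k * f x))%:E = 0)%E.
Proof.
case=> mf mv [C bC] tan der cnt.
have C0 : 0 <= C by have := (bC _ (stereo_sphere 0)).1; apply: le_trans.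
have mst := @measurable_stereo R n.
rewrite integral_vol; last first.
  apply: measurable_funTS; apply/measurable_EFinP; apply: measurable_funB => //.
  apply: measurable_funM => //; apply: measurable_funM => //; exact: measurable_coord.
pose G i y := wfield k i y * f (stereo y).
pose dG i y := dwfield k i y * f (stereo y) +
   wfield k i y * \sum_l v l (stereo y) * dstereo l i y.
have mdG i : measurable_fun setT (dG i).
  apply: measurable_funD; apply: measurable_funM.
  - exact: measurable_dwfield.
  - exact: measurableT_comp mf mst.
  - exact: measurable_wfield.
  - apply: measurable_sum => l; apply: measurable_funM; last exact: measurable_dstereo.
    exact: measurableT_comp (mv l) mst.
have bsum i y : `|\sum_l v l (stereo y) * dstereo l i y| <= n.+1%:R * (C * (3 * cfac y)).
  apply: le_trans (ler_norm_sum _ _ _) _.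
  apply: (@le_trans _ _ (\sum_(l < n.+1) C * (3 * cfac y))).
    apply: ler_sum => l _; rewrite normrM ler_pM//; last exact: norm_dstereo_le.
    exact: (bC _ (stereo_sphere y)).2.
  by rewrite sumr_const card_ord -[leLHS]mulr_natl.
pose K := (4 * n%:R + 1) * C + 9 * n.+1%:R * C.
have bdG i y : `|dG i y| <= K * (2 ^+ n * 2 `^ (3 / 4 * n%:R)) * prod_tail y.
  have K0 : 0 <= K.
    by apply: addr_ge0; apply: mulr_ge0.
  rewrite -mulrA; apply: le_trans (ler_wpM2l K0 (wbound_le_prod_tail y)).
  have c0 := ltW (cfac_gt0 y).
  rewrite (le_trans (ler_normD _ _))// (normrM (dwfield _ _ _)) (normrM (wfield _ _ _)).
  rewrite /K mulrDl lerD//.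
    rewrite [leRHS]mulrAC ler_pM//; first exact: norm_dwfield_le.
    exact: (bC _ (stereo_sphere y)).1.
  apply: le_trans (ler_pM _ _ (norm_wfield_le k i y) (bsum i y)) _ => //.
  rewrite [leLHS](_ : _ = 9 * n.+1%:R * C * cfac y ^+ n); last by rewrite !exprS; ring.
  by rewrite ler_wpM2l ?cfacn_le_wbound ?mulr_ge0.
have iG i : (\int[lrow n]_y (dG i y)%:E = 0)%E.
  (* [wfield] is at most 3 cfac^(m + 1), where m factors are bounded by 2 and the last one by 4
     times [tailb] of the i-th coordinate. *)
  apply: (@integral_partial_eq0 _ _ i (G i) (dG i) _ (12 * 2 ^+ m * C) (mdG i) (bdG i)).
  - move=> y; rewrite /G (normrM (wfield _ _ _)).
    apply: le_trans (ler_pM _ _ (norm_wfield_le k i y) (bC _ (stereo_sphere y)).1) _ => //.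
    rewrite exprSr; have := cfac_le_tailb y i => ct.
    have cm : cfac y ^+ m <= 2 ^+ m.
      by rewrite lerXn2r ?nnegrE ?cfac_le2 ?(ltW (cfac_gt0 y)).
    apply: (@le_trans _ _ (3 * (2 ^+ m * (4 * tailb (y 0 i))) * C)); last first.
      by rewrite le_eqVlt; apply/orP; left; apply/eqP; ring.
    by rewrite ler_wpM2r// ler_wpM2l// ler_pM ?exprn_ge0 ?(ltW (cfac_gt0 y)).
  - move=> y s; rewrite /G /dG.
    apply: (is_derive_eq (is_der1M (is_derive_wfield k y i s) (der y i s))).
    by [].
  - move=> y; rewrite /dG; apply: contD; apply: contM.
    + exact: cont_dwfield.
    + by apply: continuous_cond => s; eexists; exact: der.
    + exact: cont_wfield.
    + by apply: cont_sum => l; apply: contM; [exact: cnt | exact: cont_dstereo].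
transitivity (\int[lrow n]_y \sum_i (dG i y)%:E)%E; last first.
  rewrite integral_sum//; first by rewrite big1.
  by move=> i; exact: integrable_le_prod_tail (mdG i) (bdG i).
apply: eq_integral => y _; rewrite sumEFin -EFinM; congr (_%:E).
rewrite stereo_density_cfac /dG big_split/= -mulr_suml div_wfield.
under eq_bigr do rewrite mulr_sumr.
rewrite exchange_big/=.
rewrite (eq_bigr (fun l => cfac y ^+ n * (v l (stereo y) * (k == l)%:R) -
   cfac y ^+ n * stereo y 0 k * (stereo y 0 l * v l (stereo y)))); last first.
  move=> l _; rewrite (eq_bigr (fun i => cfac y ^+ m * v l (stereo y) * (dstereo k i y * dstereo l i y))).
    by rewrite -mulr_sumr dstereo_conformal !exprS; ring.
  by move=> i _; rewrite /wfield; ring.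
rewrite sumrB -!mulr_sumr (tan _ (stereo_sphere y)) mulr0 subr0.
rewrite (bigD1 k)//= eqxx mulr1 big1 ?addr0; last first.
  by move=> l; rewrite eq_sym => /negPf ->; rewrite mulr0.
ring.
Qed.

End divergence_theorem.

(** * Tangential calculus and Green's formula *)

Section tderiv_rules.
Context {R : realType} (m : nat).
Local Notation n := m.+2.
Local Notation vol := (@sphere_volume R n).
Local Notation S := (@sphere R n).
Local Notation X := 'rV[R]_n.+1.
Implicit Types (x : X) (f g : X -> R) (v w : 'I_n.+1 -> X -> R).

Lemma sphere_sum x : S x -> \sum_k x 0 k * x 0 k = 1.
Proof. by []. Qed.

Lemma sphere_coord_le x k : S x -> `|x 0 k| <= 1.
Proof.
move=> /sphere_sum h; rewrite -(@ler_pXn2r _ 2)// ?nnegrE// expr1n real_normK ?num_real//.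
by rewrite -h (bigD1 k)//= -expr2 lerDl sumr_ge0// => i _; rewrite -expr2 sqr_ge0.
Qed.

Lemma edotC d (x y : 'rV[R]_d) : edot x y = edot y x.
Proof. by apply: eq_bigr => i _; rewrite mulrC. Qed.

Lemma sphere_edot_sqr x y : S x -> S y -> \sum_k (x 0 k - y 0 k) ^+ 2 = 2 - 2 * edot x y.
Proof.
move=> /sphere_sum hx /sphere_sum hy.
rewrite (eq_bigr (fun k => x 0 k * x 0 k + y 0 k * y 0 k - 2 * (x 0 k * y 0 k))); last first.
  by move=> k _; ring.
by rewrite sumrB big_split/= -mulr_sumr hx hy -/(edot x y); ring.
Qed.

Lemma sphere_edot_le1 x y : S x -> S y -> edot x y <= 1.
Proof.
move=> Sx Sy; have := sphere_edot_sqr Sx Sy.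
have : 0 <= \sum_k (x 0 k - y 0 k) ^+ 2 by apply: sumr_ge0 => k _; exact: sqr_ge0.
lra.
Qed.

Lemma sphere_oppr x : S x -> S (- x).
Proof.
by move=> /sphere_sum h; rewrite /sphere/= -h; apply: eq_bigr => i _; rewrite !mxE mulrNN.
Qed.

Lemma sphere_edot_ge x y : S x -> S y -> -1 <= edot x y.
Proof.
move=> Sx Sy; have := sphere_edot_le1 Sx (sphere_oppr Sy).
have -> : edot x (- y) = - edot x y.
  by rewrite /edot -sumrN; apply: eq_bigr => i _; rewrite mxE mulrN.
lra.
Qed.

Lemma tderiv_cst (c : R) : tderiv (fun _ : X => c) (fun _ _ => 0).
Proof.
split => //.
- by exists `|c| => x _; split => // k; rewrite normr0.
- by move=> x _; rewrite big1// => k _; rewrite mulr0.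
- move=> y i s; rewrite big1; first exact: is_der1_cst.
  by move=> k _; rewrite mul0r.
- by move=> y i k; exact: contC.
Qed.

Lemma tderiv_coord j : tderiv (fun x : X => x 0 j) (fun k x => (k == j)%:R - x 0 k * x 0 j).
Proof.
split.
- exact: measurable_coord.
- by move=> k; apply: measurable_funB => //; apply: measurable_funM; exact: measurable_coord.
- exists 2 => x Sx; split; first by rewrite (le_trans (sphere_coord_le j Sx))// ler1n.
  move=> k; rewrite (le_trans (ler_normB _ _))//.
  have h1 : `|(k == j)%:R| <= 1 :> R by case: (k == j); rewrite ?normr1 ?normr0.
  have h2 : `|x 0 k * x 0 j| <= 1 by rewrite normrM mulr_ile1// sphere_coord_le.
  lra.
- move=> x /sphere_sum Sx.
  rewrite (eq_bigr (fun k => x 0 k * (k == j)%:R - x 0 j * (x 0 k * x 0 k))); last by move=> k _; ring.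
  rewrite sumrB -mulr_sumr Sx (bigD1 j)//= eqxx big1 ?addr0; first by rewrite /=; ring.
  by move=> k /negPf ->; rewrite mulr0.
- move=> y i s; apply: (is_derive_eq (is_derive_stereo_setc j y i s)).
  set z := setc y i s.
  rewrite (eq_bigr (fun k => (k == j)%:R * dstereo k i z - stereo z 0 j * (stereo z 0 k * dstereo k i z))); last by move=> k _; ring.
  rewrite sumrB -mulr_sumr sum_stereo_dstereo mulr0 subr0 (bigD1 j)//= eqxx mul1r.
  by rewrite big1 ?addr0// => k /negPf ->; rewrite mul0r.
- move=> y i k; apply: contB; first exact: contC.
  by apply: contM; exact: continuous_stereo_setc.
Qed.

Lemma tderiv_line_cont f v : tderiv f v -> forall y i, continuous (fun s => f (stereo (setc y i s))).
Proof. by case=> _ _ _ _ d _ y i; apply: continuous_cond => s; eexists; exact: d. Qed.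

Lemma tderivD f g v w : tderiv f v -> tderiv g w ->
  tderiv (fun x => f x + g x) (fun k x => v k x + w k x).
Proof.
move=> [mf mv [C bf] tf df cf] [mg mw [D bg] tg dg cg]; split.
- exact: measurable_funD.
- by move=> k; exact: measurable_funD.
- exists (C + D) => x Sx; split.
    by rewrite (le_trans (ler_normD _ _))// lerD// ?(bf x Sx).1 ?(bg x Sx).1.
  by move=> k; rewrite (le_trans (ler_normD _ _))// lerD// ?(bf x Sx).2 ?(bg x Sx).2.
- move=> x Sx; under eq_bigr do rewrite mulrDr.
  by rewrite big_split/= tf// tg// addr0.
- move=> y i s; apply: (is_derive_eq (is_der1D (df y i s) (dg y i s))).
  by rewrite -big_split/=; apply: eq_bigr => k _; rewrite mulrDl.
- by move=> y i k; apply: contD.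
Qed.

Lemma tderivM f g v w : tderiv f v -> tderiv g w ->
  tderiv (fun x => f x * g x) (fun k x => v k x * g x + f x * w k x).
Proof.
move=> Hf Hg; have lf := tderiv_line_cont Hf; have lg := tderiv_line_cont Hg.
move: Hf Hg => [mf mv [C bf] tf df cf] [mg mw [D bg] tg dg cg]; split.
- exact: measurable_funM.
- by move=> k; apply: measurable_funD; exact: measurable_funM.
- have C0 : 0 <= C by have := (bf _ (stereo_sphere 0)).1; apply: le_trans.
  have D0 : 0 <= D by have := (bg _ (stereo_sphere 0)).1; apply: le_trans.
  exists (C * D + C * D) => x Sx; split.
    rewrite normrM -[leLHS]addr0 lerD ?mulr_ge0//.
    by rewrite ler_pM// ?(bf x Sx).1 ?(bg x Sx).1.
  move=> k; rewrite (le_trans (ler_normD _ _))// !normrM lerD// ler_pM//.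
  + exact: (bf x Sx).2.
  + exact: (bg x Sx).1.
  + exact: (bf x Sx).1.
  + exact: (bg x Sx).2.
- move=> x Sx.
  rewrite (eq_bigr (fun k => g x * (x 0 k * v k x) + f x * (x 0 k * w k x))); last by move=> k _; ring.
  by rewrite big_split/= -!mulr_sumr tf// tg// !mulr0 addr0.
- move=> y i s; apply: (is_derive_eq (is_der1M (df y i s) (dg y i s))).
  set z := stereo _.
  rewrite [RHS](eq_bigr (fun k => v k z * dstereo k i (setc y i s) * g z + f z * (w k z * dstereo k i (setc y i s)))); last first.
    by move=> k _; ring.
  by rewrite big_split/= mulr_suml mulr_sumr.
- by move=> y i k; apply: contD; apply: contM.
Qed.

Lemma tderiv_comp (phi dphi : R -> R) f v : tderiv f v ->
  measurable_fun setT phi -> measurable_fun setT dphi ->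
  (exists C : R, forall x, S x -> `|phi (f x)| <= C /\ `|dphi (f x)| <= C) ->
  (forall x, S x -> is_derive (f x) (1 : R) phi (dphi (f x))) ->
  (forall x, S x -> {for f x, continuous dphi}) ->
  tderiv (fun x => phi (f x)) (fun k x => dphi (f x) * v k x).
Proof.
move=> Hf mp mdp [D bp] dp cp; have lf := tderiv_line_cont Hf.
move: Hf => [mf mv [C bf] tf df cf]; split.
- exact: measurableT_comp mp mf.
- by move=> k; apply: measurable_funM => //; exact: measurableT_comp mdp mf.
- have C0 : 0 <= C by have := (bf _ (stereo_sphere 0)).1; apply: le_trans.
  have D0 : 0 <= D by have := (bp _ (stereo_sphere 0)).1; apply: le_trans.
  exists (D + D * C) => x Sx; split.
    by rewrite -[leLHS]addr0 lerD ?mulr_ge0// (bp x Sx).1.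
  move=> k; rewrite normrM -[leLHS]add0r lerD// ler_pM//.
    exact: (bp x Sx).2.
  exact: (bf x Sx).2.
- move=> x Sx; rewrite (eq_bigr (fun k => dphi (f x) * (x 0 k * v k x))); last by move=> k _; ring.
  by rewrite -mulr_sumr tf// mulr0.
- move=> y i s; apply: (is_derive_eq (is_der1_comp (dp _ (stereo_sphere _)) (df y i s))).
  by rewrite mulr_sumr; apply: eq_bigr => k _; rewrite mulrA.
- move=> y i k; apply: contM => // s.
  apply: (@continuous_comp _ _ _ (fun s => f (stereo (setc y i s))) dphi); first exact: lf.
  by apply: cp; exact: stereo_sphere.
Qed.

Lemma tderiv_eq f g v w : tderiv f v -> (forall x, f x = g x) ->
  (forall k x, v k x = w k x) -> tderiv g w.
Proof.
move=> h e1 e2; have <- : f = g by apply/funext.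
by have <- : v = w by apply/funext => k; apply/funext => x.
Qed.

Lemma tderiv_sum (I : Type) (r : seq I) (F : I -> X -> R) (V : I -> 'I_n.+1 -> X -> R) :
  (forall i, tderiv (F i) (V i)) ->
  tderiv (fun x => \sum_(i <- r) F i x) (fun k x => \sum_(i <- r) V i k x).
Proof.
move=> h; elim: r => [|i r ih].
  by apply: (tderiv_eq (tderiv_cst 0)) => *; rewrite big_nil.
by apply: (tderiv_eq (tderivD (h i) ih)) => *; rewrite big_cons.
Qed.

Lemma tderiv_scale (c : R) f v : tderiv f v -> tderiv (fun x => c * f x) (fun k x => c * v k x).
Proof.
move=> h; by apply: (tderiv_eq (tderivM (tderiv_cst c) h)) => // k x; rewrite mul0r add0r.
Qed.

Lemma integrable_sphere_bounded f (C : R) : measurable_fun S f ->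
  (forall x, S x -> `|f x| <= C) -> vol.-integrable S (EFin \o f).
Proof.
move=> mf bf; have mS := @measurable_sphere R n.
apply: (@le_integrable _ _ _ vol S mS _ (EFin \o cst C)).
- exact/measurable_EFinP.
- by move=> x Sx; rewrite /= lee_fin (le_trans (bf x Sx))// ler_norm.
- exact: finite_measure_integrable_cst.
Qed.

(* [sphlap f Lf]: Lf is the spherical Laplacian of f, computed from two
   successive tangential gradients. *)
Definition sphlap f (Lf : X -> R) : Prop :=
  exists (v : 'I_n.+1 -> X -> R) (w : 'I_n.+1 -> 'I_n.+1 -> X -> R),
  [/\ tderiv f v, forall k, tderiv (v k) (w k) & forall x, S x -> \sum_k w k k x = Lf x].

(** [sphere_divergence] is applied to the components of F = f grad g - g grad f and summed over k;
    this field is tangential, so the terms n x_k F_k sum to 0. *)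
Lemma green_sphere f g Lf Lg : sphlap f Lf -> sphlap g Lg ->
  \int[vol]_(x in S) (f x * Lg x - g x * Lf x) = 0.
Proof.
move=> [v [v2 [fv vv fL]]] [w [w2 [gw ww gL]]].
pose F k x := f x * w k x + -1 * (g x * v k x).
have dF k := tderivD (tderivM fv (ww k)) (tderiv_scale (-1) (tderivM gw (vv k))).
have iF k : (\int[vol]_(x in S) (f x * w2 k k x - g x * v2 k k x - n%:R * (x 0 k * F k x))%:E = 0)%E.
  rewrite -(sphere_divergence k (dF k)); apply: eq_integral => x _; congr (_%:E).
  by rewrite /F; ring.
rewrite /Rintegral (_ : (\int[vol]_(x in S) _ = 0)%E)//.
transitivity (\int[vol]_(x in S) \sum_k (f x * w2 k k x - g x * v2 k k x - n%:R * (x 0 k * F k x))%:E)%E.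
  apply: eq_integral => x /set_mem Sx; rewrite sumEFin; congr (_%:E).
  rewrite sumrB sumrB -!mulr_sumr fL// gL//.
  rewrite [X in _ = _ - _ * X](_ : _ = 0) ?mulr0 ?subr0//.
  rewrite (eq_bigr (fun k => f x * (x 0 k * w k x) - g x * (x 0 k * v k x))); last by move=> k _; rewrite /F; ring.
  by rewrite sumrB -!mulr_sumr (td_tan fv)// (td_tan gw)// !mulr0 subr0.
rewrite integral_sum; first by rewrite big1.
- exact: measurable_sphere.
- move=> k; have mw := td_measv (ww k) k; have mv := td_measv (vv k) k.
  have [mF _ [C bF] _ _ _] := dF k.
  have [_ _ [C1 b1] _ _ _] := tderivM fv (ww k).
  have [_ _ [C2 b2] _ _ _] := tderivM gw (vv k).
  have h := sphere_divergence k (dF k).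
  have [_ mV [D bD] _ _ _] := dF k.
  apply: (@integrable_sphere_bounded _ (D + n%:R * C)).
    apply: measurable_funTS; apply: measurable_funB.
      by apply: measurable_funB; apply: measurable_funM => //; [exact: td_meas fv | exact: td_meas gw].
    by apply: measurable_funM => //; apply: measurable_funM => //; exact: measurable_coord.
  move=> x Sx; rewrite (le_trans (ler_normB _ _))// lerD//.
    apply: le_trans ((bD x Sx).2 k).
    by rewrite le_eqVlt; apply/orP; left; apply/eqP; congr (`|_|); ring.
  rewrite normrM ger0_norm// ler_wpM2l// normrM -[leRHS]mul1r ler_pM//.
    exact: sphere_coord_le.
  exact: (bF x Sx).1.
Qed.

End tderiv_rules.

(** * Newton and Poisson kernels *)

Section kernel_function.
Context {R : realType}.
Implicit Types (r t b : R).

(* For x, y in S^n, kq r (x.y) = |x - r y|^2: kP ((n - 1) / 2) is the Newton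
   kernel and (1 - r^2) kP ((n + 1) / 2) the Poisson kernel. *)
Definition kq r t : R := 1 + r ^+ 2 - 2 * r * t.
Definition kP b r t : R := kq r t `^ (- b).

Lemma kq_ge r t : `|r| < 1 -> -1 <= t -> t <= 1 -> (1 - `|r|) ^+ 2 <= kq r t.
Proof.
move=> r1 t1 t2; rewrite /kq sqrrB expr1n mul1r real_normK ?num_real//.
suff : r * t <= `|r| by lra.
by apply: le_trans (ler_norm _) _; rewrite normrM ler_piMr// ler_norml t1.
Qed.

Lemma kq_gt0 r t : `|r| < 1 -> -1 <= t -> t <= 1 -> 0 < kq r t.
Proof. by move=> r1 t1 t2; apply: lt_le_trans (kq_ge r1 t1 t2); rewrite exprn_gt0// subr_gt0. Qed.

Lemma kP_ge0 b r t : 0 <= kP b r t. Proof. exact: powR_ge0. Qed.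

Lemma kPS b r t : 0 < kq r t -> kP b r t = kq r t * kP (b + 1) r t.
Proof.
move=> q0; rewrite /kP -{2}(powRr1 (ltW q0)) -powRD; last by rewrite (gt_eqF q0) implybT.
by congr (_ `^ _); ring.
Qed.

Lemma kP_le b r t rho : 0 <= b -> rho < 1 -> `|r| <= rho -> -1 <= t -> t <= 1 ->
  kP b r t <= ((1 - rho) ^+ 2) `^ (- b).
Proof.
move=> b0 rho1 rr t1 t2; have r1 := le_lt_trans rr rho1.
have q0 := kq_gt0 r1 t1 t2.
have p0 : 0 < (1 - rho) ^+ 2 by rewrite exprn_gt0// subr_gt0.
rewrite /kP !powRN lef_pV2 ?posrE ?powR_gt0//.
apply: ge0_ler_powR; rewrite ?nnegrE ?(ltW p0) ?(ltW q0)//.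
apply: le_trans (kq_ge r1 t1 t2); rewrite lerXn2r ?nnegrE ?subr_ge0//.
- exact: ltW.
- exact: ltW.
- by rewrite lerD2l lerN2.
Qed.

Lemma is_derive_kP_t b r t : 0 < kq r t ->
  is_derive t 1 (kP b r) (2 * b * r * kP (b + 1) r t).
Proof.
move=> q0; have h1 : is_derive t 1 (kq r) (- (2 * r)).
  apply: (is_derive_eq (is_der1B (is_der1_cst (1 + r ^+ 2) t) (is_der1M (is_der1_cst (2 * r) t) (is_der1_id t)))).
  by ring.
apply: (is_derive_eq (is_der1_comp (is_derive1_powR (- b) q0) h1)).
by rewrite /kP (_ : - b - 1 = - (b + 1)); ring.
Qed.

Lemma is_derive_kP_r b r t : 0 < kq r t ->
  is_derive r 1 (fun r => kP b r t) (- b * (2 * r - 2 * t) * kP (b + 1) r t).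
Proof.
move=> q0; have h1 : is_derive r 1 (fun r => kq r t) (2 * r - 2 * t).
  have h2 := is_der1X 2 (is_der1_id r).
  apply: (is_derive_eq (is_der1B (is_der1D (is_der1_cst (1 : R) r) h2)
    (is_der1M (is_der1M (is_der1_cst (2 : R) r) (is_der1_id r)) (is_der1_cst t r)))).
  by rewrite /= expr1; ring.
apply: (is_derive_eq (@is_der1_comp _ (fun q => q `^ (- b)) (fun r => kq r t) _ _ _ (is_derive1_powR (- b) q0) h1)).
by rewrite /kP (_ : - b - 1 = - (b + 1)); ring.
Qed.

Lemma continuous_kP_t b r t : 0 < kq r t -> {for t, continuous (kP b r)}.
Proof.
move=> q0; apply: differentiable_continuous; apply/derivable1_diffP.
by have := is_derive_kP_t b q0 => ?; exact: ex_derive.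
Qed.

Lemma measurable_kP b r : measurable_fun setT (kP b r).
Proof.
apply: (measurableT_comp (measurable_powR _)).
by apply: measurable_funB => //; apply: measurable_funM.
Qed.

Lemma is_derive0_itv_cst (f : R -> R) (a b x y : R) :
  (forall z, a < z < b -> is_derive z 1 f 0) -> a < x < b -> a < y < b -> f x = f y.
Proof.
move=> df; wlog xy : x y / x <= y.
  move=> H xI yI; have [xy|/ltW yx] := leP x y; first exact: H.
  by apply/esym; exact: H.
move: xy; rewrite le_eqVlt => /orP[/eqP-> //|xy] /andP[ax xb] /andP[ay yb].
have d z : z \in `]x, y[ -> is_derive z 1 f ((fun _ => 0) z).
  by rewrite in_itv/= => /andP[xz zy]; apply: df; rewrite (lt_trans ax xz) (lt_trans zy yb).
have c : {within `[x, y], continuous f}.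
  apply: derivable_within_continuous => z; rewrite in_itv/= => /andP[xz zy].
  have := df z; rewrite (lt_le_trans ax xz) (le_lt_trans zy yb) => /(_ isT) ?.
  exact: ex_derive.
have [z _] := MVT xy d c.
by rewrite mul0r => /eqP; rewrite subr_eq0 => /eqP.
Qed.

(* An Euler equation r^2 u'' + n r u' = k (k + n - 1) u without singularity at 0
   forces u = alpha r^k, the other solution being r^(1 - n - k). *)
Lemma euler_ode (k d : nat) (u u1 u2 : R -> R) : (0 < d)%N ->
  (forall r, -1 < r < 1 -> is_derive r 1 u (u1 r)) ->
  (forall r, -1 < r < 1 -> is_derive r 1 u1 (u2 r)) ->
  (forall r, -1 < r < 1 -> r ^+ 2 * u2 r + d.+1%:R * r * u1 r = k%:R * (k + d)%:R * u r) ->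
  (forall r, -1 < r < 1 -> r * u1 r = k%:R * u r) /\
  exists alpha, forall r, 0 < r < 1 -> u r = alpha * r ^+ k.
Proof.
move=> d0 du du1 ode.
(* [w] measures the failure of [u] to be homogeneous of degree k. The equation makes r^(k + d) w
   constant, and this is 0 at the origin since k + d > 0. *)
pose w r := r * u1 r - k%:R * u r.
have w0 r : -1 < r < 1 -> r ^+ (k + d) * w r = 0.
  move=> rI; have zI : -1 < (0 : R) < 1 by rewrite ltrN10 ltr01.
  transitivity (0 ^+ (k + d) * w 0); last first.
    by rewrite expr0n; case: (k + d)%N (leq_trans d0 (leq_addl k d)) => // p _; rewrite mul0r.
  apply: (@is_derive0_itv_cst (fun r => r ^+ (k + d) * w r) (-1) 1) => //.
  move=> z zz; have hw : is_derive z 1 w (u1 z + z * u2 z - k%:R * u1 z).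
    apply: (is_derive_eq (is_der1B (is_der1M (is_der1_id z) (du1 z zz)) (is_der1M (is_der1_cst k%:R z) (du z zz)))).
    by ring.
  apply: (is_derive_eq (is_der1M (is_der1X (k + d) (is_der1_id z)) hw)).
  have [p kd] : exists p, (k + d = p.+1)%N.
    by exists (k + d).-1; rewrite prednK// (leq_trans d0)// leq_addl.
  have e := ode z zz; rewrite kd in e *; rewrite /w /= exprS.
  have {}kd : p%:R = k%:R + d%:R - 1 :> R.
    by have := congr1 (fun q => q%:R : R) kd; rewrite natrD -natr1 => ->; ring.
  transitivity (z ^+ p * (z ^+ 2 * u2 z + d.+1%:R * z * u1 z - k%:R * p.+1%:R * u z)); last by rewrite e; ring.
  by rewrite -!natr1 kd; ring.
have w1 r : -1 < r < 1 -> r * u1 r = k%:R * u r.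
  (* At r = 0 the power of r cannot be cancelled; there the equation itself gives k (k + d) u(0) =
     0. *)
  move=> rI; have [->|r0] := eqVneq r 0.
    have zI : -1 < (0 : R) < 1 by rewrite ltrN10 ltr01.
    have := ode 0 zI; rewrite expr0n/= !(mul0r, mulr0, addr0) => /eqP.
    rewrite eq_sym -mulrA mulf_eq0 => /orP[/eqP->|]; first by rewrite mul0r.
    by rewrite mulf_eq0 pnatr_eq0 addn_eq0 (gtn_eqF d0) andbF/= => /eqP ->; rewrite mulr0.
  have /eqP := w0 r rI; rewrite mulf_eq0 expf_eq0 (negPf r0) andbF/= subr_eq0 => /eqP.
  by [].
split => //; exists (u (1 / 2) * (1 / 2) ^- k) => r rI.
have c r' : 0 < r' < 1 -> u r' * r' ^- k = u (1 / 2) * (1 / 2) ^- k.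
  move=> r'I; apply: (@is_derive0_itv_cst (fun r => u r * r ^- k) 0 1) => //; last first.
    by apply/andP; split; lra.
  move=> z /andP[z0 z1]; have zz : -1 < z < 1 by rewrite z1 (lt_trans _ z0)// ltrN10.
  have zk : z ^+ k != 0 by rewrite expf_neq0// gt_eqF.
  apply: (is_derive_eq (is_der1M (du z zz) (@is_der1V _ (fun z => z ^+ k) z _ zk (is_der1X k (is_der1_id z))))).
  have := w1 z zz; case: (k) zk => [|p] zk e.
    move: e; rewrite mul0r => /eqP; rewrite mulf_eq0 (gt_eqF z0)/= => /eqP ->; ring.
  rewrite /=; have zp : z ^+ p != 0 by rewrite expf_neq0// gt_eqF.
  have -> : u1 z = p.+1%:R * u z / z by rewrite -e mulrAC divff ?mul1r// gt_eqF.
  by rewrite exprS; field; rewrite zp gt_eqF.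
rewrite -(c r rI) mulfVK//; case/andP: rI => r0 _.
by rewrite expf_neq0// gt_eqF.
Qed.

End kernel_function.

(** * Bounded measurable functions on the sphere *)

Section poisson.
Context {R : realType} (m : nat).
Local Notation n := m.+2.
Local Notation vol := (@sphere_volume R n).
Local Notation S := (@sphere R n).
Local Notation X := 'rV[R]_n.+1.
Implicit Types (x y : X) (h f g : X -> R) (r : R).

Local Notation a := (m.+1%:R / 2 : R).
Local Notation I f := (\int[vol]_(y in S) f y).

(** Measurability is required everywhere, so that it survives composition with maps of the ambient
    space, but boundedness on the sphere only. *)
Definition bmeas f := measurable_fun setT f /\ exists C : R, forall x, S x -> `|f x| <= C.

Lemma bmeas_int f : bmeas f -> vol.-integrable S (EFin \o f).
Proof. by move=> [mf [C hC]]; apply: (@integrable_sphere_bounded _ _ _ C) => //; exact: measurable_funTS. Qed.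

Lemma bmeas_cst (c : R) : bmeas (fun _ => c).
Proof. by split => //; exists `|c|. Qed.

Lemma bmeasD f g : bmeas f -> bmeas g -> bmeas (fun x => f x + g x).
Proof.
move=> [mf [C hC]] [mg [D hD]]; split; first exact: measurable_funD.
by exists (C + D) => x Sx; rewrite (le_trans (ler_normD _ _))// lerD ?hC ?hD.
Qed.

Lemma bmeasM f g : bmeas f -> bmeas g -> bmeas (fun x => f x * g x).
Proof.
move=> [mf [C hC]] [mg [D hD]]; split; first exact: measurable_funM.
by exists (C * D) => x Sx; rewrite normrM ler_pM ?hC ?hD.
Qed.

Lemma bmeasZ (c : R) f : bmeas f -> bmeas (fun x => c * f x).
Proof. by apply: bmeasM; exact: bmeas_cst. Qed.

Lemma bmeasB f g : bmeas f -> bmeas g -> bmeas (fun x => f x - g x).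
Proof.
move=> bf bg; have := bmeasD bf (bmeasZ (-1) bg).
by under [X in bmeas X -> _]eq_fun do rewrite mulN1r.
Qed.

Lemma bmeasX f k : bmeas f -> bmeas (fun x => f x ^+ k).
Proof.
move=> bf; elim: k => [|k ih]; first by under eq_fun do rewrite expr0; exact: bmeas_cst.
by under eq_fun do rewrite exprS; exact: bmeasM.
Qed.

Lemma bmeas_norm f : bmeas f -> bmeas (fun x => `|f x|).
Proof.
by move=> [mf [C hC]]; split; [exact: measurableT_comp | exists C => x Sx; rewrite normr_id hC].
Qed.

Lemma bmeas_sum (J : Type) (s : seq J) (F : J -> X -> R) :
  (forall j, bmeas (F j)) -> bmeas (fun x => \sum_(j <- s) F j x).
Proof.
move=> bF; elim: s => [|j s ih]; first by under eq_fun do rewrite big_nil; exact: bmeas_cst.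
by under eq_fun do rewrite big_cons; exact: bmeasD.
Qed.

Lemma bmeas_coord k : bmeas (fun x => x 0 k).
Proof.
by split; [exact: measurable_coord | exists 1 => x Sx; exact: sphere_coord_le].
Qed.

Lemma bmeas_edot x : bmeas (fun y => edot x y).
Proof. by apply: bmeas_sum => k; apply: bmeasZ; exact: bmeas_coord. Qed.

Lemma edot_itv x y : S x -> S y -> -1 <= edot x y /\ edot x y <= 1.
Proof. by move=> Sx Sy; split; [exact: sphere_edot_ge | exact: sphere_edot_le1]. Qed.

Lemma bmeas_kP b r x : 0 <= b -> `|r| < 1 -> S x -> bmeas (fun y => kP b r (edot x y)).
Proof.
move=> b0 r1 Sx; split.
  by apply: measurableT_comp; [exact: measurable_kP | exact: (bmeas_edot x).1].
exists (((1 - `|r|) ^+ 2) `^ (- b)) => y Sy; have [t1 t2] := edot_itv Sx Sy.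
by rewrite ger0_norm ?kP_ge0// kP_le.
Qed.

Lemma IntD f g : bmeas f -> bmeas g -> I (fun y => f y + g y) = I f + I g.
Proof. by move=> bf bg; rewrite RintegralD//; [exact: measurable_sphere | exact: bmeas_int | exact: bmeas_int]. Qed.

Lemma IntZ (c : R) f : bmeas f -> I (fun y => c * f y) = c * I f.
Proof. by move=> bf; rewrite RintegralZl//; [exact: measurable_sphere | exact: bmeas_int]. Qed.

Lemma IntB f g : bmeas f -> bmeas g -> I (fun y => f y - g y) = I f - I g.
Proof. by move=> bf bg; rewrite RintegralB//; [exact: measurable_sphere | exact: bmeas_int | exact: bmeas_int]. Qed.

Lemma eq_Int f g : (forall y, S y -> f y = g y) -> I f = I g.
Proof. by move=> e; apply: eq_Rintegral => y /set_mem; exact: e. Qed.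

Lemma le_Int f g : bmeas f -> bmeas g -> (forall y, S y -> f y <= g y) -> I f <= I g.
Proof.
by move=> bf bg h; apply: le_Rintegral => //; [exact: measurable_sphere | exact: bmeas_int | exact: bmeas_int].
Qed.

Lemma Int_ge0 f : (forall y, S y -> 0 <= f y) -> 0 <= I f.
Proof. by move=> h; apply: Rintegral_ge0. Qed.

Lemma Int_norm f : bmeas f -> `|I f| <= I (fun y => `|f y|).
Proof. by move=> bf; apply: le_normr_Rintegral; [exact: measurable_sphere | exact: bmeas_int]. Qed.

Lemma is_derive_Int (F G : R -> X -> R) (C rho r : R) : -rho < r < rho ->
  (forall s, -rho < s < rho -> bmeas (F s)) ->
  (forall s y, -rho < s < rho -> S y -> is_derive s 1 (F ^~ y) (G s y)) ->
  (forall s y, -rho < s < rho -> S y -> `|G s y| <= C) ->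
  is_derive r 1 (fun s => I (F s)) (I (G r)).
Proof.
move=> rI bF dF bG.
have mS := @measurable_sphere R n.
have C0 : 0 <= C.
  by have := bG r (stereo 0) rI (stereo_sphere 0); apply: le_trans.
have Ir : `]-rho, rho[%classic r by rewrite /= in_itv.
have h1 s : `]-rho, rho[%classic s -> vol.-integrable S (EFin \o F s).
  by rewrite /= in_itv/= => sI; apply: bmeas_int; exact: bF.
have h2 s y : `]-rho, rho[%classic s -> S y -> derivable (F ^~ y) s 1.
  by rewrite /= in_itv/= => sI Sy; have := dF s y sI Sy => ?; exact: ex_derive.
have h3 : vol.-integrable S (EFin \o cst C) by exact: finite_measure_integrable_cst.
have d1 s y : -rho < s < rho -> S y -> partial1of2 F s y = G s y.
  by move=> sI Sy; rewrite partial1of2E; have := dF s y sI Sy => ?; rewrite derive_val.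
have h4 s y : `]-rho, rho[%classic s -> S y -> `|partial1of2 F s y| <= cst C y.
  by rewrite /= in_itv/= => sI Sy; rewrite d1// bG.
have hd := @derivable_under_integral R _ _ vol F S mS r (-rho) rho Ir h1 h2 (cst C) (fun _ => C0) h3 h4.
have he := @differentiation_under_integral R _ _ vol F S mS r (-rho) rho Ir h1 h2 (cst C) (fun _ => C0) h3 h4.
apply: DeriveDef => //; rewrite -derive1E he.
by apply: eq_Int => y Sy; exact: d1.
Qed.

Lemma tderiv_edot x : tderiv (fun y => edot x y) (fun k y => x 0 k - y 0 k * edot x y).
Proof.
have h := @tderiv_sum R m _ (index_enum 'I_n.+1) _ _
  (fun j => tderiv_scale (x 0 j) (@tderiv_coord R m j)).
apply: (tderiv_eq h) => // k y.
rewrite (eq_bigr (fun j => x 0 j * (k == j)%:R - y 0 k * (x 0 j * y 0 j))); last by move=> j _; ring.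
rewrite sumrB -mulr_sumr (bigD1 k)//= eqxx mulr1 big1 ?addr0// => j.
by rewrite eq_sym => /negPf ->; rewrite mulr0.
Qed.

(** For a function phi of t = x.y the spherical Laplacian is (1 - t^2) phi'' - n t phi'. *)
Lemma sphlap_kP x r : S x -> `|r| < 1 ->
  sphlap (fun y => kP a r (edot x y))
    (fun y => let t := edot x y in
      4 * a * (a + 1) * r ^+ 2 * (1 - t ^+ 2) * kP (a + 2) r t - n%:R * t * (2 * a * r) * kP (a + 1) r t).
Proof.
move=> Sx r1.
have q0 y : S y -> 0 < kq r (edot x y) by move=> Sy; have [? ?] := edot_itv Sx Sy; exact: kq_gt0.
have a0 : 0 <= a by rewrite divr_ge0.
have h (b c : R) : 0 <= b -> tderiv (fun y => c * kP b r (edot x y))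
    (fun k y => c * (2 * b * r * kP (b + 1) r (edot x y)) * (x 0 k - y 0 k * edot x y)).
  move=> b0.
  have := @tderiv_comp R m (kP b r) (fun t => 2 * b * r * kP (b + 1) r t) _ _ (tderiv_edot x) (measurable_kP b r).
  have mk : measurable_fun setT (fun t : R => 2 * b * r * kP (b + 1) r t).
    by apply: measurable_funM => //; exact: measurable_kP.
  move=> /(_ mk) hh.
  have [_ [C1 b1]] := bmeas_kP b0 r1 Sx.
  have [_ [C2 b2]] := bmeasZ (2 * b * r) (bmeas_kP (addr_ge0 b0 ler01) r1 Sx).
  have h0 : tderiv (fun y => kP b r (edot x y)) (fun k y => 2 * b * r * kP (b + 1) r (edot x y) * (x 0 k - y 0 k * edot x y)).
    apply: hh.
    - exists (Num.max C1 C2) => y Sy.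
      by rewrite !le_max b1// b2// orbT.
    - by move=> y Sy; exact: is_derive_kP_t (q0 y Sy).
    - move=> y Sy; apply: cvgM; first exact: cvg_cst.
      exact: continuous_kP_t (q0 y Sy).
  by apply: (tderiv_eq (tderiv_scale c h0)) => // k y; ring.
have a1 : 0 <= a + 1 by rewrite addr_ge0.
have e1 : tderiv (fun y => kP a r (edot x y)) (fun k y => (2 * a * r) * kP (a + 1) r (edot x y) * (x 0 k - y 0 k * edot x y)).
  by apply: (tderiv_eq (h a 1 a0)) => [y|k y]; rewrite ?mul1r.
pose v2 k l y : R := (2 * a * r) * (2 * (a + 1) * r * kP (a + 1 + 1) r (edot x y)) * (x 0 l - y 0 l * edot x y) * (x 0 k - y 0 k * edot x y)
   + (2 * a * r) * kP (a + 1) r (edot x y) * (- (((l == k)%:R - y 0 l * y 0 k) * edot x y + y 0 k * (x 0 l - y 0 l * edot x y))).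
exists (fun k y => (2 * a * r) * kP (a + 1) r (edot x y) * (x 0 k - y 0 k * edot x y)), v2; split; first exact: e1.
  move=> k.
  have h2 := tderivD (@tderiv_cst R m (x 0 k)) (tderiv_scale (-1) (tderivM (@tderiv_coord R m k) (tderiv_edot x))).
  apply: (tderiv_eq (tderivM (h (a + 1) (2 * a * r) a1) h2)) => [y|l y].
    by rewrite mulN1r.
  by rewrite /v2; ring.
move=> y Sy; rewrite /v2 /=; set t := edot x y.
rewrite (eq_bigr (fun k => 4 * a * (a + 1) * r ^+ 2 * kP (a + 1 + 1) r t * (x 0 k * x 0 k - 2 * t * (x 0 k * y 0 k) + t ^+ 2 * (y 0 k * y 0 k))
   - 2 * a * r * kP (a + 1) r t * (t - 2 * t * (y 0 k * y 0 k) + x 0 k * y 0 k))); last first.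
  by move=> k _; rewrite eqxx /=; ring.
rewrite sumrB -!mulr_sumr big_split/= sumrB big_split/= sumrB -!mulr_sumr -/(edot x y) -/t.
rewrite (sphere_sum Sx) (sphere_sum Sy) sumr_const card_ord -[t *+ _]mulr_natr -(natr1 n).
rewrite (_ : a + 1 + 1 = a + 2); ring.
Qed.

End poisson.

(** * Poisson and Newton integrals of spherical harmonics *)

Section poisson_theorem.
Context {R : realType} (m : nat).
Local Notation n := m.+2.
Local Notation vol := (@sphere_volume R n).
Local Notation S := (@sphere R n).
Local Notation X := 'rV[R]_n.+1.
Implicit Types (x y : X) (h f g : X -> R) (r : R).

Local Notation a := (m.+1%:R / 2 : R).
Local Notation I f := (\int[vol]_(y in S) f y).

Definition omega : R := I (fun _ => 1).

(** On the sphere 2 - 2 x.y is |x - y|^2, so [L] is the square of a Lipschitz constant. *)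
Definition sph_lipschitz h := exists2 L : R, 0 <= L &
  forall x y, S x -> S y -> (h y - h x) ^+ 2 <= L * (2 - 2 * edot x y).

(* The Lipschitz bound makes the Poisson integrals of [h] converge to [h]. *)
Definition harmonic_comp (k : nat) h := [/\ bmeas h, sph_lipschitz h &
  sphlap h (fun y => - (k%:R * (k + m.+1)%:R * h y))].

Lemma harmonic_comp1 : harmonic_comp 0 (fun _ => 1).
Proof.
split; first exact: bmeas_cst.
  by exists 0 => // x y _ _; rewrite subrr expr0n mul0r.
exists (fun _ _ => 0), (fun _ _ _ => 0); split; [exact: tderiv_cst | by move=> k; exact: tderiv_cst |].
by move=> x _; rewrite big1// !mul0r oppr0.
Qed.

Let a_gt0 : 0 < a. Proof. by rewrite divr_gt0. Qed.

Section fixed_point.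
Variables (x : X) (k : nat) (h : X -> R).
Hypotheses (Sx : S x) (hh : harmonic_comp k h).

Let t y := edot x y.
(** [u r] is the Newton potential of [h] at the point r x; [g1], [g2] are the derivatives of the
    kernel in r, [u1], [u2] those of [u]. *)
Let u r := I (fun y => kP a r (t y) * h y).
Let g1 r y := - a * (2 * r - 2 * t y) * kP (a + 1) r (t y).
Let g2 r y := - a * 2 * kP (a + 1) r (t y) +
  - a * (2 * r - 2 * t y) * (- (a + 1) * (2 * r - 2 * t y) * kP (a + 1 + 1) r (t y)).
Let u1 r := I (fun y => g1 r y * h y).
Let u2 r := I (fun y => g2 r y * h y).

Let tI y : S y -> -1 <= t y /\ t y <= 1. Proof. exact: edot_itv. Qed.

Let norm_itv r : -1 < r < 1 -> `|r| < 1. Proof. by rewrite ltr_norml. Qed.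

Let bt : bmeas t. Proof. exact: bmeas_edot. Qed.

Let b_kP b r : 0 <= b -> -1 < r < 1 -> bmeas (fun y => kP b r (t y)).
Proof. by move=> b0 rI; apply: bmeas_kP => //; exact: norm_itv. Qed.

Let b_rt r : bmeas (fun y => 2 * r - 2 * t y).
Proof. by apply: bmeasB; [exact: bmeas_cst | exact: bmeasZ]. Qed.

Let b_g1 r : -1 < r < 1 -> bmeas (g1 r).
Proof. by move=> rI; apply: bmeasM; [apply: bmeasZ; exact: b_rt | exact: b_kP]. Qed.

Let b_g2 r : -1 < r < 1 -> bmeas (g2 r).
Proof.
move=> rI; apply: bmeasD; first by apply: bmeasZ; exact: b_kP.
by apply: bmeasM; [apply: bmeasZ; exact: b_rt | apply: bmeasM; [apply: bmeasZ; exact: b_rt | exact: b_kP]].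
Qed.

Let bh : bmeas h. Proof. by case: hh. Qed.

Let rho_ex r : -1 < r < 1 -> exists2 rho, rho < 1 & - rho < r < rho.
Proof.
move=> /norm_itv r1; exists ((1 + `|r|) / 2); first lra.
by rewrite -ltr_norml; lra.
Qed.

Let sub_rho (rho s : R) : rho < 1 -> - rho < s < rho -> -1 < s < 1 /\ `|s| <= rho.
Proof.
move=> rho1; rewrite -ltr_norml => sr; split; last exact: ltW.
by rewrite -ltr_norml (lt_trans sr).
Qed.

Let rt_le (s : R) y : -1 < s < 1 -> S y -> `|2 * s - 2 * t y| <= 4.
Proof. by move=> /andP[s1 s2] Sy; have [t1 t2] := tI Sy; rewrite ler_norml; apply/andP; split; lra. Qed.

Let du r : -1 < r < 1 -> is_derive r 1 u (u1 r).
Proof.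
move=> rI; have [rho rho1 rr] := rho_ex rI; have [_ [H bH]] := bh.
have H0 : 0 <= H by have := bH _ Sx; apply: le_trans.
apply: (@is_derive_Int _ _ (fun r y => kP a r (t y) * h y) (fun r y => g1 r y * h y)
   (a * 4 * ((1 - rho) ^+ 2) `^ (- (a + 1)) * H) rho _ rr).
- move=> s sI; have [s1 _] := sub_rho rho1 sI; apply: bmeasM => //; exact: b_kP.
- move=> s y sI Sy; have [s1 _] := sub_rho rho1 sI; have [t1 t2] := tI Sy.
  apply: (is_derive_eq (is_der1M (is_derive_kP_r a (kq_gt0 (norm_itv s1) t1 t2)) (is_der1_cst (h y) s))).
  by rewrite mulr0 addr0.
- move=> s y sI Sy; have [s1 sr] := sub_rho rho1 sI; have [t1 t2] := tI Sy.
  rewrite /g1 normrM ler_pM ?bH// normrM ler_pM//; last by rewrite ger0_norm ?kP_ge0// kP_le.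
  by rewrite normrM ler_pM ?rt_le// normrN ger0_norm// ltW.
Qed.

Let du1 r : -1 < r < 1 -> is_derive r 1 u1 (u2 r).
Proof.
move=> rI; have [rho rho1 rr] := rho_ex rI; have [_ [H bH]] := bh.
have H0 : 0 <= H by have := bH _ Sx; apply: le_trans.
pose K1 := ((1 - rho) ^+ 2) `^ (- (a + 1)); pose K2 := ((1 - rho) ^+ 2) `^ (- (a + 1 + 1)).
apply: (@is_derive_Int _ _ (fun r y => g1 r y * h y) (fun r y => g2 r y * h y)
   ((a * 2 * K1 + a * 4 * ((a + 1) * 4 * K2)) * H) rho _ rr).
- by move=> s sI; have [s1 _] := sub_rho rho1 sI; apply: bmeasM => //; exact: b_g1.
- move=> s y sI Sy; have [s1 _] := sub_rho rho1 sI; have [t1 t2] := tI Sy.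
  have q0 := kq_gt0 (norm_itv s1) t1 t2.
  have e := is_der1M (is_der1_cst (- a) s) (is_der1B (is_der1M (is_der1_cst (2 : R) s) (is_der1_id s)) (is_der1_cst (2 * t y) s)).
  apply: (is_derive_eq (is_der1M (is_der1M e (is_derive_kP_r (a + 1) q0)) (is_der1_cst (h y) s))).
  by rewrite /g2; ring.
- move=> s y sI Sy; have [s1 sr] := sub_rho rho1 sI; have [t1 t2] := tI Sy.
  have k1 : `|kP (a + 1) s (t y)| <= K1 by rewrite ger0_norm ?kP_ge0// kP_le.
  have k2 : `|kP (a + 1 + 1) s (t y)| <= K2 by rewrite ger0_norm ?kP_ge0// kP_le.
  have na : `|- a| <= a by rewrite normrN ger0_norm// ltW.
  have na1 : `|- (a + 1)| <= a + 1 by rewrite normrN ger0_norm.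
  rewrite /g2 normrM ler_pM ?bH// (le_trans (ler_normD _ _))// lerD//.
    by rewrite normrM ler_pM// normrM ler_pM// ger0_norm.
  rewrite normrM ler_pM//; first by rewrite normrM ler_pM// rt_le.
  by rewrite normrM ler_pM// normrM ler_pM// rt_le.
Qed.

(** The Newton kernel is harmonic in r x, so its radial derivatives trade against its spherical
    Laplacian, which Green's formula moves onto [h]. *)
Let ode r : -1 < r < 1 -> r ^+ 2 * u2 r + n%:R * r * u1 r = k%:R * (k + m.+1)%:R * u r.
Proof.
move=> rI; have [_ _ hL] := hh.
have := green_sphere (sphlap_kP Sx (norm_itv rI)) hL.
pose LN y := 4 * a * (a + 1) * r ^+ 2 * (1 - t y ^+ 2) * kP (a + 2) r (t y) - n%:R * t y * (2 * a * r) * kP (a + 1) r (t y).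
have bL : bmeas LN.
  have bq := bmeasB (@bmeas_cst R m 1) (bmeasX 2 bt).
  apply: bmeasB; first by apply: bmeasM; [exact: bmeasZ | apply: b_kP => //; rewrite addr_ge0// ltW].
  rewrite (_ : (fun x => _) = (fun y => (n%:R * (2 * a * r)) * t y * kP (a + 1) r (t y))).
    by apply: bmeasM; [exact: bmeasZ | exact: b_kP].
  by apply/funext => y; ring.
rewrite (@eq_Int _ _ _ (fun y => - (k%:R * (k + m.+1)%:R) * (kP a r (t y) * h y) - h y * LN y)); last first.
  by move=> y Sy; rewrite /LN /t; ring.
rewrite IntB; last 2 first.
- by apply: bmeasZ; apply: bmeasM => //; exact: b_kP.
- exact: bmeasM.
rewrite IntZ -/(u r); last by apply: bmeasM => //; exact: b_kP.
move=> e.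
have -> : r ^+ 2 * u2 r + n%:R * r * u1 r = - I (fun y => h y * LN y).
  have bu1 := bmeasM (b_g1 rI) bh; have bu2 := bmeasM (b_g2 rI) bh.
  rewrite /u2 /u1 -(IntZ (r ^+ 2) bu2) -(IntZ (n%:R * r) bu1).
  rewrite -mulN1r -(IntZ (-1) (bmeasM bh bL)).
  rewrite -(IntD (bmeasZ (r ^+ 2) bu2) (bmeasZ (n%:R * r) bu1)).
  apply: eq_Int => y Sy; have [t1 t2] := tI Sy.
  rewrite /LN /g1 /g2 (_ : a + 2 = a + 1 + 1); last by ring.
  rewrite (kPS (a + 1) (kq_gt0 (norm_itv rI) t1 t2)) /kq.
  by rewrite -(natr1 m.+1); field.
by move: e; lra.
Qed.

(** [euler_ode] leaves alpha undetermined. Both integrals share it, so the limit of the Poisson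
    integral at r = 1 can fix it later. *)
Lemma newton_pow : exists alpha, forall r, 0 < r < 1 ->
  I (fun y => kP a r (edot x y) * h y) = alpha * r ^+ k /\
  I (fun y => (1 - r ^+ 2) * kP (a + 1) r (edot x y) * h y) = (1 + k%:R / a) * alpha * r ^+ k.
Proof.
have [w [alpha ua]] := euler_ode (ltn0Sn m) du du1 ode.
exists alpha => r /andP[r0 r1]; have rI : -1 < r < 1 by rewrite r1 (lt_trans _ r0)// ltrN10.
have e := ua r; rewrite r0 r1 in e; have {}e := e isT; split; first exact: e.
(* The Poisson kernel is kP a + a^-1 r d/dr (kP a). *)
transitivity (u r + a^-1 * (r * u1 r)).
  have bu1 := bmeasM (b_g1 rI) bh.
  have bu : bmeas (fun y => kP a r (t y) * h y) by apply: bmeasM => //; exact: b_kP.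
  rewrite /u /u1 -(IntZ r bu1) -(IntZ a^-1 (bmeasZ r bu1)) -(IntD bu (bmeasZ a^-1 (bmeasZ r bu1))).
  apply: eq_Int => y Sy; have [t1 t2] := tI Sy.
  rewrite (kPS a (kq_gt0 (norm_itv rI) t1 t2)) /g1 /kq -/(t y).
  by move: (a) (gt_eqF a_gt0) => A /negbT A0; field.
by rewrite w// e; move: (a) (gt_eqF a_gt0) => A /negbT A0; field.
Qed.

(** [newton_pow] says nothing at r = 0, where the kernel is 1 and the potential of the constant 1 is
    the volume. *)
Lemma newton_at0 r : k = 0%N -> 0 < r < 1 -> u r = u 0.
Proof.
move=> k0 /andP[r0 r1]; have [w _] := euler_ode (ltn0Sn m) du du1 ode.
have dd z : z \in `]0, r[ -> is_derive z 1 u (u1 z).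
  rewrite in_itv/= => /andP[z0 zr]; apply: du.
  by rewrite (lt_trans zr r1) (lt_trans _ z0)// ltrN10.
have cc : {within `[0, r], continuous u}.
  apply: derivable_within_continuous => z; rewrite in_itv/= => /andP[z0 zr].
  have zI : -1 < z < 1 by rewrite (le_lt_trans zr r1) (lt_le_trans _ z0)// ltrN10.
  by have := du zI => ?; exact: ex_derive.
have [z] := MVT r0 dd cc; rewrite in_itv/= => /andP[z0 zr].
have zI : -1 < z < 1 by rewrite (lt_trans zr r1) (lt_trans _ z0)// ltrN10.
have := w z zI; rewrite k0 mul0r => /eqP; rewrite mulf_eq0 (gt_eqF z0)/= => /eqP ->.
by rewrite mul0r => /eqP; rewrite subr_eq0 => /eqP.
Qed.

End fixed_point.

Lemma newton1 x r : S x -> 0 < r < 1 -> I (fun y => kP a r (edot x y)) = omega.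
Proof.
move=> Sx rI; have := newton_at0 Sx harmonic_comp1 (erefl 0%N) rI.
rewrite (@eq_Int _ _ _ (fun y => kP a r (edot x y))) => [->|y _]; last by rewrite mulr1.
by apply: eq_Int => y Sy; rewrite mulr1 /kP /kq mulr0 mul0r expr0n addr0 subr0 powR1.
Qed.

Lemma poisson1 x r : S x -> 0 < r < 1 ->
  I (fun y => (1 - r ^+ 2) * kP (a + 1) r (edot x y)) = omega.
Proof.
move=> Sx rI; have [al h] := newton_pow Sx harmonic_comp1.
have [e1 e2] := h r rI; rewrite -(newton1 Sx rI).
rewrite (@eq_Int _ _ _ (fun y => (1 - r ^+ 2) * kP (a + 1) r (edot x y) * 1)); last by move=> y _; rewrite mulr1.
rewrite e2 [RHS](@eq_Int _ _ _ (fun y => kP a r (edot x y) * 1)); last by move=> y _; rewrite mulr1.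
by rewrite e1 mul0r addr0 mul1r.
Qed.

End poisson_theorem.

Section poisson_formula.
Context {R : realType} (m : nat).
Local Notation n := m.+2.
Local Notation vol := (@sphere_volume R n).
Local Notation S := (@sphere R n).
Local Notation X := 'rV[R]_n.+1.
Implicit Types (x y : X) (h f g : X -> R) (r : R).

Local Notation a := (m.+1%:R / 2 : R).
Local Notation I f := (\int[vol]_(y in S) f y).
Local Notation omega := (@omega R m).

Let a_gt0 : 0 < a. Proof. by rewrite divr_gt0. Qed.

Lemma omega_ge0 : 0 <= omega. Proof. exact: Int_ge0. Qed.

Let itvN r : 0 < r < 1 -> `|r| < 1.
Proof. by move=> /andP[r0 r1]; rewrite gtr0_norm. Qed.

(* The second moment of the Poisson kernel is controlled by the Newton kernel,
   since r |x - y|^2 <= kq r. *)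
Lemma poisson_approx x r h (L : R) (e : R) : S x -> 0 < r < 1 -> bmeas h -> 0 <= L -> 0 < e ->
  (forall y, S y -> (h y - h x) ^+ 2 <= L * (2 - 2 * edot x y)) ->
  `|I (fun y => (1 - r ^+ 2) * kP (a + 1) r (edot x y) * h y) - omega * h x| <=
  e * omega + L / (4 * e) * ((1 - r ^+ 2) / r) * omega.
Proof.
move=> Sx rI bh L0 e0 hL; have /andP[r0 r1] := rI.
pose K y := (1 - r ^+ 2) * kP (a + 1) r (edot x y).
have bK : bmeas K by apply: bmeasZ; apply: bmeas_kP => //; exact: itvN.
have bN : bmeas (fun y => kP a r (edot x y)) by apply: bmeas_kP => //; exact: itvN.
have r2 : 0 < 1 - r ^+ 2 by rewrite subr_gt0 expr_lt1// ltW.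
have K0 y : 0 <= K y by rewrite mulr_ge0 ?kP_ge0// ltW.
have eK : I K = omega := poisson1 Sx rI.
have -> : I (fun y => (1 - r ^+ 2) * kP (a + 1) r (edot x y) * h y) - omega * h x =
    I (fun y => K y * h y - h x * K y).
  by rewrite (IntB (bmeasM bK bh) (bmeasZ (h x) bK)) (IntZ (h x) bK) eK (mulrC (h x)).
apply: le_trans (Int_norm _) _; first by apply: bmeasB; [exact: bmeasM | exact: bmeasZ].
have -> : e * omega + L / (4 * e) * ((1 - r ^+ 2) / r) * omega =
    I (fun y => e * K y + L / (4 * e) * ((1 - r ^+ 2) / r) * kP a r (edot x y)).
  by rewrite (IntD (bmeasZ e bK) (bmeasZ _ bN)) (IntZ e bK) (IntZ _ bN) eK newton1.
apply: le_Int.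
- by apply: bmeas_norm; apply: bmeasB; [exact: bmeasM | exact: bmeasZ].
- by apply: bmeasD; exact: bmeasZ.
move=> y Sy; have [t1 t2] := edot_itv Sx Sy; have q0 := kq_gt0 (itvN rI) t1 t2.
rewrite (mulrC (h x)) -mulrBr normrM ger0_norm//.
have h1 : `|h y - h x| <= e + (h y - h x) ^+ 2 / (4 * e).
  set d := h y - h x; rewrite -(real_normK (num_real d)).
  have e4 : 0 < 4 * e by rewrite mulr_gt0.
  rewrite -lerBlDl ler_pdivlMr//; have := sqr_ge0 (`|d| - 2 * e); nra.
apply: le_trans (ler_wpM2l (K0 y) h1) _; rewrite mulrDr lerD//; first by rewrite mulrC.
have h2 : K y * (2 - 2 * edot x y) <= (1 - r ^+ 2) / r * kP a r (edot x y).
  rewrite /K (kPS a q0) -!mulrA ler_pM2l// mulrC mulrA ler_wpM2r ?kP_ge0//.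
  rewrite ler_pdivlMl// /kq; have := sqr_ge0 (1 - r); nra.
have e4 : 0 < (4 * e)^-1 by rewrite invr_gt0 mulr_gt0.
rewrite mulrA.
apply: (@le_trans _ _ (K y * (L * (2 - 2 * edot x y)) / (4 * e))).
  by rewrite ler_pM2r// ler_wpM2l// hL.
have Le : 0 <= L / (4 * e) by rewrite mulr_ge0// ltW.
by have := ler_wpM2l Le h2; congr (_ <= _); ring.
Qed.

Section formula.
Variables (x : X) (k : nat) (h : X -> R).
Hypotheses (Sx : S x) (hh : harmonic_comp k h).

(** With A the left-hand side, the Poisson integral equals A r^k, which tends to A as r tends to 1,
    and it tends to omega h(x) by [poisson_approx]; the limit is taken with explicit rates. *)
Lemma newton_coef alpha :
  (forall r, 0 < r < 1 ->
    I (fun y => (1 - r ^+ 2) * kP (a + 1) r (edot x y) * h y) = (1 + k%:R / a) * alpha * r ^+ k) ->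
  (1 + k%:R / a) * alpha = omega * h x.
Proof.
move=> hP; set A := _ * alpha; have [bh [L L0 hL] _] := hh.
have w0 := omega_ge0.
pose M := `|A| * k%:R + omega + L * omega.
have M0 : 0 <= M by rewrite /M !addr_ge0// mulr_ge0.
suff H e : 0 < e -> e < 1 -> `|A - omega * h x| <= e * M.
  apply/eqP; rewrite -subr_eq0 -normr_le0; apply/ler_addgt0Pl => e e0; rewrite addr0.
  pose e1 := Num.min (1 / 2) (e / (M + 1)).
  have M1 : 0 < M + 1 by rewrite ltr_wpDl.
  have e10 : 0 < e1 by rewrite lt_min !divr_gt0.
  have e11 : e1 < 1 by rewrite gt_min; apply/orP; left; lra.
  apply: le_trans (H _ e10 e11) _.
  have : e1 * (M + 1) <= e by rewrite -ler_pdivlMr// ge_min lexx orbT.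
  have := ltW e10; nra.
(* With 1 - r of order e^2, the second error term of [poisson_approx], of order (1 - r) / e, is of
   order e like the first. *)
move=> e0 e1; pose d := e ^+ 2 / 2; pose r := 1 - d.
have e20 : 0 < e ^+ 2 by rewrite exprn_gt0.
have e21 : e ^+ 2 <= e by rewrite expr2 ler_piMr// ltW.
have d0 : 0 < d by rewrite divr_gt0.
have d1 : d <= 1 / 2 by rewrite /d; nra.
have rI : 0 < r < 1 by rewrite /r; apply/andP; split; lra.
have /andP[r0 r1] := rI.
have := poisson_approx Sx rI bh L0 e0 (hL x ^~ Sx); rewrite hP// -/A => hA.
have {}hA : `|A * r ^+ k - omega * h x| <= e * omega + L / (4 * e) * ((1 - r ^+ 2) / r) * omega.
  by apply: hA => y; exact: hL.
have h1 : `|A - A * r ^+ k| <= `|A| * (k%:R * d).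
  rewrite -{1}(mulr1 A) -mulrBr normrM ler_wpM2l// ger0_norm; last first.
    by rewrite subr_ge0 exprn_ile1// ltW.
  elim: (k) => [|p ih]; first by rewrite expr0 subrr mul0r.
  have rp : r ^+ p <= 1 by rewrite exprn_ile1// ltW.
  have rp0 : 0 <= r ^+ p by rewrite exprn_ge0// ltW.
  by rewrite exprS -natr1 /r; rewrite /r in ih rp rp0; nra.
have h2 : L / (4 * e) * ((1 - r ^+ 2) / r) * omega <= e * (L * omega).
  have h3 : (1 - r ^+ 2) / r <= 4 * e ^+ 2.
    rewrite ler_pdivrMr// /r -/d; have -> : e ^+ 2 = 2 * d by rewrite /d; field.
    by nra.
  have h4 : L / (4 * e) * ((1 - r ^+ 2) / r) <= L / (4 * e) * (4 * e ^+ 2).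
    by rewrite ler_wpM2l// divr_ge0// mulr_ge0// ltW.
  apply: le_trans (ler_wpM2r w0 h4) _.
  by rewrite le_eqVlt; apply/orP; left; apply/eqP; field; rewrite gt_eqF.
have -> : A - omega * h x = (A - A * r ^+ k) + (A * r ^+ k - omega * h x) by ring.
rewrite (le_trans (ler_normD _ _))//.
have h5 : `|A| * (k%:R * d) <= e * (`|A| * k%:R).
  rewrite mulrA mulrC ler_wpM2r ?mulr_ge0//.
  by rewrite /d; lra.
rewrite /M; lra.
Qed.

Lemma poisson_formula r : 0 < r < 1 ->
  I (fun y => (1 - r ^+ 2) * kP (a + 1) r (edot x y) * h y) = omega * r ^+ k * h x.
Proof.
have [al H] := newton_pow Sx hh; move=> rI.
rewrite (H r rI).2 (newton_coef (fun r rI => (H r rI).2)).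
by rewrite mulrAC.
Qed.

Lemma newton_r_formula r : 0 < r < 1 ->
  I (fun y => kP a r (edot x y) * h y) = omega * a / (a + k%:R) * r ^+ k * h x.
Proof.
have [al H] := newton_pow Sx hh; move=> rI; rewrite (H r rI).1.
have e := newton_coef (fun r rI => (H r rI).2).
have ak : 0 < a + k%:R by rewrite ltr_wpDr.
have -> : al = omega * h x * a / (a + k%:R).
  by rewrite -e; move: (a) (k%:R : R) a_gt0 ak => A K A0 AK; field; rewrite !gt_eqF.
ring.
Qed.

End formula.
End poisson_formula.

Section integral_cut.
Context {R : realType} d (T : measurableType d) (mu : {measure set T -> \bar R}).
Local Open Scope ereal_scope.

Lemma measurable_ge_nat (f : T -> R) (c : R) : measurable_fun setT f ->
  measurable_fun setT (fun x => (c <= f x)%R%:R : R).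
Proof.
move=> mf; have -> : (fun x => (c <= f x)%R%:R : R) = \1_(f @^-1` `[c, +oo[%classic).
  apply/funext => x; rewrite indicE; congr (nat_of_bool _)%:R%R.
  by apply/idP/idP; rewrite inE /= in_itv /= andbT.
by apply: measurable_indic; rewrite -[X in measurable X]setTI; exact: mf.
Qed.

(* Monotone convergence for the cut-offs [phi >= 1 / (j + 1)]. *)
Lemma integral_le_cut (D : set T) (f phi : T -> R) (M : \bar R) : measurable D ->
  measurable_fun setT f -> measurable_fun setT phi ->
  (forall x, D x -> (0 <= f x)%R) -> (forall x, D x -> (phi x <= 0 -> f x = 0)%R) ->
  (forall j : nat, \int[mu]_(x in D) (f x * (j.+1%:R^-1 <= phi x)%R%:R)%:E <= M) ->
  \int[mu]_(x in D) (f x)%:E <= M.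
Proof.
move=> mD mf mphi f0 fphi fM.
pose g j x := (f x * (j.+1%:R^-1 <= phi x)%R%:R)%:E.
have mg j : measurable_fun D (g j).
  by apply/measurable_EFinP; apply/measurable_funTS; apply: measurable_funM => //;
     exact: measurable_ge_nat.
have g0 j x : D x -> 0 <= g j x by move=> Dx; rewrite lee_fin mulr_ge0 ?f0.
have hg x : D x -> {homo g^~ x : i j / (i <= j)%N >-> i <= j}.
  move=> Dx i j ij; rewrite lee_fin ler_wpM2l ?f0// ler_nat.
  case h : (i.+1%:R^-1 <= phi x)%R => //.
  by rewrite (le_trans _ h)// lef_pV2 ?posrE// ler_nat.
have hl x : D x -> limn (g^~ x) = (f x)%:E.
  move=> Dx; apply/cvg_lim => //; apply: cvg_near_cst.
  have [p0|p0] := leP (phi x) 0%R.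
    by near=> j; rewrite /g fphi// mul0r.
  near=> j; rewrite /g (_ : (_ <= _)%R) ?mulr1//.
  by apply/ltW; near: j; exact: (near_infty_natSinv_lt (PosNum p0)).
have := @cvg_monotone_convergence _ _ _ mu D mD g mg g0 hg.
rewrite (eq_integral (fun x => (f x)%:E)); last by move=> x /set_mem; exact: hl.
move=> h; rewrite -(cvg_lim _ h)//; apply: lime_le; first by apply/cvg_ex; eexists; exact: h.
by apply: nearW => j; exact: fM.
Unshelve. all: by end_near.
Qed.

End integral_cut.

(** * The Newton kernel for two points of the sphere *)

Section newton.
Context {R : realType} (m : nat).
Local Notation n := m.+2.
Local Notation vol := (@sphere_volume R n).
Local Notation S := (@sphere R n).
Local Notation X := 'rV[R]_n.+1.
Local Notation a := (m.+1%:R / 2 : R).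
Local Notation I f := (\int[vol]_(y in S) f y).
Local Notation omega := (@omega R m).
Implicit Types (x y : X) (h : X -> R).

Let a_gt0 : 0 < a. Proof. by rewrite divr_gt0. Qed.
Let mS : measurable S := @measurable_sphere R n.
Let itvN r : 0 < r < 1 -> `|r : R| < 1. Proof. by case/andP=> r0 r1; rewrite ger0_norm ?ltW. Qed.

Lemma measurable_edotl x : measurable_fun setT (fun y => edot x y).
Proof. by have [] := @bmeas_edot R m x. Qed.

Lemma bmeas_ge (f : X -> R) (c : R) : measurable_fun setT f -> bmeas (fun y => (c <= f y)%R%:R : R).
Proof.
move=> mf; split; first exact: measurable_ge_nat.
by exists 1 => y _; case: (c <= f y) => /=; rewrite ?normr0 ?normr1.
Qed.

(** Points are null: at the pole e kP a (1 - e) equals e^(-m) >= 1, while its integral is only e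
    omega. *)
Lemma Int_pole x : S x -> I (fun y => (1 <= edot x y)%R%:R) = 0.
Proof.
move=> Sx; set z := I _.
have z0 : 0 <= z by apply: Int_ge0 => y _; rewrite ler0n.
suff h (e : R) : 0 < e < 1 -> z <= e * omega.
  apply/eqP; rewrite eq_le z0 andbT; apply/ler_addgt0Pr => e e0; rewrite add0r.
  have w0 : 0 <= omega := @omega_ge0 R m.
  have d0 : 0 < 1 + omega + e by lra.
  apply: le_trans (h (e / (1 + omega + e)) _) _.
    by rewrite divr_gt0//= ltr_pdivrMr// mul1r; lra.
  by rewrite mulrAC ler_pdivrMr//; nra.
move=> /andP[e0 e1]; have rI : 0 < 1 - e < 1 by apply/andP; split; lra.
rewrite -(newton1 Sx rI) -IntZ; last by apply: bmeas_kP; rewrite ?itvN// ltW.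
apply: le_Int; [exact: (bmeas_ge _ (measurable_edotl x))| |move=> y Sy].
  by apply: bmeasZ; apply: bmeas_kP; rewrite ?itvN// ltW.
have [_ t1] := edot_itv Sx Sy.
have k0 : 0 <= e * kP a (1 - e) (edot x y) by rewrite mulr_ge0 ?kP_ge0// ltW.
case h : (1 <= edot x y) => //=.
have -> : edot x y = 1 by apply/eqP; rewrite eq_le t1 h.
rewrite /kP (_ : kq (1 - e) 1 = e ^+ 2); last by rewrite /kq; ring.
rewrite -powR_mulrn; last exact: ltW.
have -> : e * (e `^ 2) `^ (- a) = e `^ (- m%:R).
  rewrite -powRrM -{1}(powRr1 (ltW e0)) -powRD; last by rewrite (gt_eqF e0) implybT.
  by congr (_ `^ _); rewrite -natr1; field.
rewrite powRN powR_mulrn; last exact: ltW.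
by rewrite -[1]invr1 lef_pV2 ?posrE ?exprn_gt0// exprn_ile1// ltW.
Qed.

Lemma cvg_1Binv : (1 - j.+2%:R^-1 : R) @[j --> \oo] --> (1 : R).
Proof.
have h : (j.+2%:R^-1 : R) @[j --> \oo] --> (0 : R).
  have := @cvg_harmonic R; rewrite -(cvg_shiftS _ _).
  by apply: cvg_trans; apply: near_eq_cvg; apply: nearW => j.
have : (1 - j.+2%:R^-1 : R) @[j --> \oo] --> (1 - 0 : R) by apply: cvgB => //; exact: cvg_cst.
by rewrite subr0.
Qed.

Lemma kq1 t : kq 1 t = 2 - 2 * t :> R. Proof. by rewrite /kq; ring. Qed.

(** [kq r t] is (1 - r)^2 + r (2 - 2 t), which away from the pole is at most twice [kq 1 t]. *)
Lemma kP1_cut b r t : 0 <= b -> 0 < r < 1 -> t <= 1 -> (1 - r) ^+ 2 <= 2 - 2 * t ->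
  kP b 1 t <= 2 `^ b * kP b r t :> R.
Proof.
move=> b0 /andP[r0 r1] t1 h.
have p0 : 0 < (1 - r) ^+ 2 by rewrite exprn_gt0// subr_gt0.
have q0 : 0 < 2 - 2 * t by lra.
have q1 : 0 < kq r t by rewrite /kq; nra.
rewrite /kP kq1 !powRN -[_ * _^-1]invf_div lef_pV2 ?posrE ?divr_gt0 ?powR_gt0//.
rewrite ler_pdivrMr ?powR_gt0// mulrC -powRM ?(ltW q0) ?(ltW q1)//.
apply: ge0_ler_powR; rewrite // ?nnegrE; first exact: ltW.
  by rewrite mulr_ge0 ?(ltW q0) ?(ltW q1).
by rewrite /kq; nra.
Qed.

(** At t = 1 and b > 0 the right-hand side is a negative power of 0, which is 0 for [powR]; the
    factor on the left removes this point. *)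
Lemma kP_dom b r t : 0 <= b -> 2^-1 <= r -> r < 1 -> t <= 1 -> (t < 1)%R%:R * kP b r t <= 4 `^ b * kP b 1 t :> R.
Proof.
move=> b0 r0 r1; rewrite le_eqVlt => /orP[/eqP ->|t1].
  by rewrite ltxx mul0r mulr_ge0 ?powR_ge0.
rewrite t1 mul1r; have q0 : 0 < 2 - 2 * t by lra.
have q1 : 0 < kq r t by rewrite /kq; nra.
rewrite /kP kq1 !powRN -[_ * _^-1]invf_div lef_pV2 ?posrE ?divr_gt0 ?powR_gt0//.
rewrite ler_pdivrMr ?powR_gt0// -powRM ?(ltW q0) ?(ltW q1)//.
apply: ge0_ler_powR; rewrite // ?nnegrE.
- exact: ltW.
- by rewrite mulr_ge0 ?(ltW q1).
by rewrite /kq; nra.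
Qed.

(** Away from the pole the kernel is compared with a kernel at some r < 1, whose integral is omega
    whatever r is; monotone convergence removes the cut. *)
Lemma integrable_newton x : S x -> vol.-integrable S (fun y => (kP a 1 (edot x y))%:E).
Proof.
move=> Sx; have mk : measurable_fun setT (fun y => kP a 1 (edot x y)).
  by apply: measurableT_comp; [exact: measurable_kP|exact: measurable_edotl].
apply/integrableP; split; first by apply/measurable_EFinP; exact: measurable_funTS.
have /le_lt_trans : (\int[vol]_(y in S) `|(kP a 1 (edot x y))%:E| <= (2 `^ a * omega)%:E)%E.
  under eq_integral do rewrite gee0_abs ?lee_fin ?kP_ge0//.
  apply: (@integral_le_cut _ _ _ _ _ _ (fun y => 2 - 2 * edot x y)) => //.
  - apply: measurable_funB => //; apply: measurable_funM => //; exact: measurable_edotl.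
  - by move=> y _; exact: kP_ge0.
  - move=> y Sy h; have [_ t1] := edot_itv Sx Sy.
    have -> : edot x y = 1 by apply/eqP; rewrite eq_le t1/=; lra.
    by rewrite /kP kq1 mulr1 subrr powR0// oppr_eq0 gt_eqF.
  move=> j; set c : R := j.+1%:R^-1.
  have c0 : 0 < c by rewrite invr_gt0.
  have c1 : c <= 1 by rewrite invf_le1// ler1n.
  have [r rI rc] : exists2 r : R, 0 < r < 1 & (1 - r) ^+ 2 <= c.
    exists (1 - c / 2); first by apply/andP; split; lra.
    by rewrite opprB addrC subrK; nra.
  have bk : bmeas (fun y => 2 `^ a * kP a r (edot x y)).
    by apply: bmeasZ; apply: bmeas_kP; rewrite ?itvN// ltW.
  rewrite -(newton1 Sx rI) -IntZ; last by apply: bmeas_kP; rewrite ?itvN// ltW.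
  rewrite /Rintegral fineK; last first.
    by apply: integrable_fin_num => //; exact: bmeas_int.
  apply: ge0_le_integral => //.
  - by move=> y _; rewrite lee_fin mulr_ge0 ?kP_ge0.
  - apply/measurable_EFinP; apply: measurable_funTS; apply: measurable_funM => //.
    apply: measurable_ge_nat; apply: measurable_funB => //; apply: measurable_funM => //; exact: measurable_edotl.
  - by apply/measurable_EFinP; apply: measurable_funTS; case: bk.
  move=> y Sy; rewrite lee_fin; have [_ t1] := edot_itv Sx Sy.
  case h : (c <= _) => /=; last by rewrite mulr0 mulr_ge0 ?kP_ge0 ?powR_ge0.
  by rewrite mulr1 kP1_cut ?(ltW a_gt0)//; exact: le_trans rc h.
by apply; exact: ltry.
Qed.

Lemma integrable_newtonM x h : S x -> bmeas h ->
  vol.-integrable S (fun y => (kP a 1 (edot x y) * h y)%:E).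
Proof.
move=> Sx [mh [C hC]].
have mk : measurable_fun setT (fun y => kP a 1 (edot x y)).
  by apply: measurableT_comp; [exact: measurable_kP|exact: measurable_edotl].
apply: (le_integrable mS _ _ (integrableZl mS C (integrable_newton Sx))).
  by apply/measurable_EFinP; apply: measurable_funTS; exact: measurable_funM.
move=> y Sy; rewrite -EFinM !abse_EFin lee_fin normrM (ger0_norm (kP_ge0 _ _ _)) mulrC.
rewrite normrM (ger0_norm (kP_ge0 _ _ _)) ler_wpM2r ?kP_ge0//.
by rewrite (le_trans (hC y Sy))// ler_norm.
Qed.

(** Dominated convergence along r = 1 - 1 / (j + 2), which stays above 1/2. The kernels are cut at
    the pole, a null set, because there they blow up while the kernel at r = 1 is 0 by
    convention. *)
Lemma newton_limit x h l : S x -> bmeas h ->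
  (forall r, 0 < r < 1 -> I (fun y => kP a r (edot x y) * h y) = l r) ->
  (l (1 - j.+2%:R^-1) @[j --> \oo] --> I (fun y => kP a 1 (edot x y) * h y)).
Proof.
move=> Sx bh hl; pose r (j : nat) : R := 1 - j.+2%:R^-1.
have rI j : 2^-1 <= r j /\ 0 < r j < 1.
  have h1 : j.+2%:R^-1 <= 2^-1 :> R by rewrite lef_pV2 ?posrE// ler_nat.
  have h2 : 0 < j.+2%:R^-1 :> R by rewrite invr_gt0.
  by rewrite /r; move: (j.+2%:R^-1) h1 h2 => c h1 h2; split; [|apply/andP; split]; lra.
have [mh [C0 hC0]] := bh; pose C := `|C0|.
have hC y : S y -> `|h y| <= C by move=> /hC0 /le_trans; apply; exact: ler_norm.
have Cge : 0 <= C := normr_ge0 C0.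
pose f j y := (edot x y < 1)%R%:R * kP a (r j) (edot x y) * h y.
have bcut : bmeas (fun y => (edot x y < 1)%R%:R : R).
  have -> : (fun y => (edot x y < 1)%R%:R : R) = (fun y => 1 - (1 <= edot x y)%R%:R).
    by apply/funext => y; rewrite ltNge; case: (_ <= _); rewrite /= ?subr0 ?subrr.
  by apply: bmeasB; [exact: bmeas_cst|exact: (bmeas_ge _ (measurable_edotl x))].
have bk j : bmeas (fun y => kP a (r j) (edot x y)).
  by have [_ rj] := rI j; apply: bmeas_kP; rewrite ?itvN// ltW.
have bf j : bmeas (f j) by apply: bmeasM => //; exact: bmeasM.
have fl j : I (f j) = l (r j).
  have [_ rj] := rI j; rewrite -hl//.
  have e : forall y, S y -> kP a (r j) (edot x y) * h y =
      f j y + (1 <= edot x y)%R%:R * (kP a (r j) (edot x y) * h y).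
    by move=> y _; rewrite /f ltNge; case: (_ <= _); rewrite /= ?mul0r ?mul1r ?addr0 ?add0r.
  rewrite (eq_Int e) IntD//; last by apply: bmeasM; [exact: (bmeas_ge _ (measurable_edotl x))|exact: bmeasM].
  have bb : bmeas (fun y => kP a (r j) (edot x y) * h y) by exact: bmeasM.
  have [_ [D0 hD0]] := bb; suff -> : I (fun y => (1 <= edot x y)%R%:R * (kP a (r j) (edot x y) * h y)) = 0 by rewrite addr0.
  apply/eqP; rewrite -normr_le0.
  have bge := bmeas_ge 1 (measurable_edotl x).
  apply: le_trans (Int_norm (bmeasM bge bb)) _.
  have -> : 0 = D0 * I (fun y => (1 <= edot x y)%R%:R) by rewrite Int_pole// mulr0.
  rewrite -IntZ//; apply: le_Int; [exact/bmeas_norm/bmeasM|exact: bmeasZ|move=> y Sy].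
  by rewrite normrM mulrC; case: (1 <= edot x y) => /=; rewrite ?normr1 ?normr0 ?mulr1 ?mulr0 ?hD0.
have -> : (fun j => l (1 - j.+2%:R^-1)) = (fun j => fine (\int[vol]_(y in S) (f j y)%:E)%E).
  by apply/funext => j; rewrite -/(r j) -fl.
apply: fine_cvg; rewrite fineK; last first.
  by apply: integrable_fin_num => //; exact: integrable_newtonM.
apply: (@dominated_cvg _ _ _ _ _ mS _ _ (fun y => (C * 4 `^ a * kP a 1 (edot x y))%:E)).
- by move=> j; apply/measurable_EFinP; apply: measurable_funTS; case: (bf j).
- move=> y Sy; apply: cvg_EFin; first exact: nearW.
  rewrite (_ : fine \o _ = (fun j => f j y))//; rewrite /f.
  have [_ t1] := edot_itv Sx Sy; apply: cvgM; last exact: cvg_cst.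
  move: t1; rewrite le_eqVlt => /orP[/eqP ->|t1].
    rewrite ltxx; under eq_fun do rewrite mul0r.
    by rewrite /kP kq1 mulr1 subrr powR0 ?oppr_eq0 ?(gt_eqF a_gt0)//; exact: cvg_cst.
  rewrite t1; under eq_fun do rewrite mul1r.
  have q0 : 0 < kq 1 (edot x y) by rewrite kq1; lra.
  have dd := is_derive_kP_r a q0.
  have cc : {for 1, continuous (fun r => kP a r (edot x y))}.
    by apply: differentiable_continuous; apply/derivable1_diffP; exact: ex_derive.
  apply: (cvg_comp r (fun r => kP a r (edot x y)) _ cc).
  exact: cvg_1Binv.
- by [].
- by rewrite (_ : (fun y => _) = (fun y => (C * 4 `^ a)%:E * (kP a 1 (edot x y))%:E)%E)//;
   apply: integrableZl => //; exact: integrable_newton.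
move=> j y Sy; rewrite lee_fin; have [r0 /andP[_ r1]] := rI j; have [_ t1] := edot_itv Sx Sy.
rewrite /f normrM mulrC -mulrA ler_pM//; first exact: hC.
rewrite ger0_norm ?mulr_ge0 ?kP_ge0//.
by apply: kP_dom => //; exact: ltW.
Qed.

Lemma newton_formula x k h : S x -> harmonic_comp k h ->
  I (fun y => kP a 1 (edot x y) * h y) = omega * a / (a + k%:R) * h x.
Proof.
move=> Sx hh; have [bh _ _] := hh.
have := newton_limit Sx bh (fun r rI => newton_r_formula Sx hh rI).
move/(cvg_unique (@Rhausdorff R)); apply.
rewrite -[X in X * h x]mulr1 -[X in _ * X * h x](expr1n _ k); 
apply: cvgM; [apply: cvgM; first exact: cvg_cst|exact: cvg_cst].
apply: (cvg_comp (fun j : nat => 1 - j.+2%:R^-1) (fun r : R => r ^+ k) _ (@exprn_continuous R k 1)).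
exact: cvg_1Binv.
Qed.

End newton.

(** * Conformal dilations *)

Section dilation.
Context {R : realType} (m : nat).
Local Notation n := m.+2.
Local Notation lrow := (lebesgue_row R).
Local Notation vol := (@sphere_volume R n).
Local Notation S := (@sphere R n).
Local Notation X := 'rV[R]_n.+1.
Local Notation a := (m.+1%:R / 2 : R).
Local Notation I f := (\int[vol]_(y in S) f y).
Local Notation omega := (@omega R m).
Implicit Types (x y : X) (t : R).

Let a_gt0 : 0 < a. Proof. by rewrite divr_gt0. Qed.
Let mS : measurable S := @measurable_sphere R n.

Lemma integral_volT (f : X -> \bar R) : measurable_fun setT f ->
  (\int[vol]_x f x = \int[vol]_(x in S) f x)%E.
Proof.
move=> mf; rewrite integral_vol; last exact: measurable_funTS.
apply: (@integral_image_density _ _ _ _ _ (lrow n) vol (@stereo R n) (@stereo_density R n)) => //.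
- exact: measurable_stereo.
- exact: measurable_stereo_density.
- by move=> y; exact: stereo_density_ge0.
Qed.

(* [dil t] is the dilation y |-> t y in the stereographic chart, and [kap t] its
   conformal factor. *)
Definition dilw t x : R := (1 - x 0 0) + t ^+ 2 * (1 + x 0 0).

(* The real power makes the inverse measurable. *)
Definition kap t x : R := 2 * t * dilw t x `^ (-1).

Definition dil t x : X :=
  \row_i if i == ord0 then 1 - kap t x * (1 - x 0 0) / t else kap t x * x 0 i.

Lemma dil0 t x : dil t x 0 0 = 1 - kap t x * (1 - x 0 0) / t.
Proof. by rewrite mxE eqxx. Qed.

Lemma dilS t x j : dil t x 0 (lift ord0 j) = kap t x * x 0 (lift ord0 j).
Proof. by rewrite mxE. Qed.

Lemma kap_ge0 t x : 0 <= t -> 0 <= kap t x.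
Proof. by move=> t0; rewrite mulr_ge0 ?powR_ge0// mulr_ge0. Qed.

Lemma measurable_kap t : measurable_fun setT (kap t).
Proof.
apply: measurable_funM => //; apply: (measurableT_comp (measurable_powR _)).
apply: measurable_funD; first by apply: measurable_funB => //; exact: measurable_coord.
apply: measurable_funM => //; apply: measurable_funD => //; exact: measurable_coord.
Qed.

Lemma measurable_dil t : measurable_fun setT (dil t).
Proof.
apply: measurable_fun_row => i; have mk := measurable_kap t.
have [->|i0] := eqVneq i ord0.
  have -> : row_coord ord0 \o dil t = (fun x => 1 - kap t x * (1 - x 0 0) / t).
    by apply/funext => x; rewrite /row_coord /= dil0.
  apply: measurable_funB => //; apply: measurable_funM => //; apply: measurable_funM => //.
  by apply: measurable_funB => //; exact: measurable_coord.
have -> : row_coord i \o dil t = (fun x => kap t x * x 0 i).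
  by apply/funext => x; rewrite /row_coord /= mxE (negPf i0).
by apply: measurable_funM => //; exact: measurable_coord.
Qed.

(** [c] and [d] are the conformal factors at the two points. The Jacobian d^n splits as d^a d^(a +
    1): the first power is absorbed by the kernel together with c^a, the second stays with the
    charge. *)
Lemma kP_conformal (c d s : R) : 0 < c -> 0 < d -> s <= 1 ->
  kP a 1 (1 - c * d * (1 - s)) * d ^+ n * c `^ a = kP a 1 s * d `^ (a + 1).
Proof.
move=> c0 d0 s1; rewrite /kP !kq1.
have -> : 2 - 2 * (1 - c * d * (1 - s)) = c * d * (2 - 2 * s) by ring.
have q0 : 0 <= 2 - 2 * s by lra.
rewrite powRM ?mulr_ge0 ?(ltW c0) ?(ltW d0)// (powRM _ (ltW c0) (ltW d0)).
rewrite -powR_mulrn ?(ltW d0)//.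
have -> : n%:R = a + (a + 1) :> R by rewrite -!natr1; field.
rewrite (@powRD _ _ a) ?(gt_eqF d0) ?implybT// !powRN.
have px : 0 < c `^ a by rewrite powR_gt0.
have py : 0 < d `^ a by rewrite powR_gt0.
move: (c `^ a) (d `^ a) (((2 - 2 * s) `^ a)^-1) (d `^ (a + 1)) px py => u v p q u0 v0.
by field; rewrite !gt_eqF.
Qed.

Section fixed_dilation.
Variable t : R.
Hypothesis t1 : 1 <= t.
Let t0 : 0 < t. Proof. exact: lt_le_trans t1. Qed.

Let coord0 x : S x -> -1 <= x 0 0 <= 1.
Proof. by move=> /(sphere_coord_le 0); rewrite ler_norml. Qed.

Lemma dilw_ge2 x : S x -> 2 <= dilw t x.
Proof.
move=> /coord0/andP[h1 h2]; rewrite /dilw.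
have : 1 <= t ^+ 2 by rewrite exprn_ege1.
by move: (t ^+ 2) => T T1; nra.
Qed.

Lemma kapE x : S x -> kap t x = 2 * t / dilw t x.
Proof.
move=> /dilw_ge2 h; rewrite /kap powR_inv1//.
by apply: le_trans h.
Qed.

Lemma kap_gt0 x : S x -> 0 < kap t x.
Proof.
move=> Sx; rewrite kapE// divr_gt0 ?mulr_gt0//.
exact: lt_le_trans (dilw_ge2 Sx).
Qed.

Lemma kap_le x : S x -> kap t x <= t.
Proof.
move=> Sx; rewrite kapE// ler_pdivrMr; last exact: lt_le_trans (dilw_ge2 Sx).
by rewrite mulrC ler_wpM2l ?dilw_ge2// ltW.
Qed.

(** This is |dil x - dil y|^2 = kap x kap y |x - y|^2, the distance law of a conformal map, written
    with scalar products. *)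
Lemma edot_dil x y : S x -> S y ->
  edot (dil t x) (dil t y) = 1 - kap t x * kap t y * (1 - edot x y).
Proof.
move=> Sx Sy; have wx : dilw t x != 0 by rewrite gt_eqF// (lt_le_trans _ (dilw_ge2 Sx)).
have wy : dilw t y != 0 by rewrite gt_eqF// (lt_le_trans _ (dilw_ge2 Sy)).
pose s := \sum_(i < n) x 0 (lift ord0 i) * y 0 (lift ord0 i).
have -> : edot x y = x 0 0 * y 0 0 + s by rewrite /edot big_ord_recl.
have -> : edot (dil t x) (dil t y) = dil t x 0 0 * dil t y 0 0 + kap t x * kap t y * s.
  rewrite /edot big_ord_recl mulr_sumr; congr (_ + _); apply: eq_bigr => i _.
  by rewrite !dilS mulrACA.
rewrite !dil0 !kapE//; move: wx wy; rewrite /dilw; move: (x 0 0) (y 0 0) s => u v s wx wy.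
by field; rewrite wx wy gt_eqF.
Qed.

Lemma sphere_dil x : S x -> S (dil t x).
Proof. by move=> Sx; rewrite /sphere /= edot_dil// (_ : edot x x = 1)// subrr mulr0 subr0. Qed.

Lemma cfac_scale (y : 'rV[R]_n) : cfac (t *: y) * (1 + t ^+ 2 * edot y y) = 2.
Proof.
rewrite /cfac.
have -> : edot (t *: y) (t *: y) = t ^+ 2 * edot y y.
  by rewrite /edot mulr_sumr; apply: eq_bigr => i _; rewrite !mxE; ring.
by rewrite mulfVK// gt_eqF// ltr_wpDr// mulr_ge0 ?sqr_ge0 ?edot_ge0.
Qed.

Lemma kap_stereo (y : 'rV[R]_n) : kap t (stereo y) * cfac y = t * cfac (t *: y).
Proof.
have c0 := cfac_gt0 y; have ce := cfac_edot y; have cs := cfac_scale y.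
have q0 : 0 < 1 + t ^+ 2 * edot y y by rewrite ltr_wpDr// mulr_ge0 ?sqr_ge0 ?edot_ge0.
have c'E : cfac (t *: y) = 2 / (1 + t ^+ 2 * edot y y) by rewrite -cs mulfK// gt_eqF.
rewrite kapE; last exact: stereo_sphere.
have -> : dilw t (stereo y) = cfac y * (1 + t ^+ 2 * edot y y).
  rewrite /dilw stereo0; transitivity (cfac y + t ^+ 2 * (cfac y * edot y y)); last by ring.
  by rewrite ce; ring.
by rewrite c'E; field; rewrite !gt_eqF.
Qed.

Lemma dil_stereo (y : 'rV[R]_n) : dil t (stereo y) = stereo (t *: y).
Proof.
apply/rowP => i; have ks := kap_stereo y; have [j ->|->] := unliftP ord0 i.
  by rewrite dilS !stereoS mulrA ks mxE; ring.
rewrite dil0 !stereo0 opprB addrCA subrr addr0 ks.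
by rewrite mulrAC divff ?mul1r// gt_eqF.
Qed.

(** In the chart the dilation is y -> t y; by [kap_stereo] its Jacobian t^n and the quotient of the
    densities combine to kap^n. *)
Lemma vol_dil (A : set X) : measurable A ->
  vol A = (\int[vol]_(x in dil t @^-1` A) (kap t x ^+ n)%:E)%E.
Proof.
move=> mA; have mk := measurable_kap t; have md := measurable_dil t.
have mdA : measurable (dil t @^-1` A) by rewrite -[X in measurable X]setTI; exact: md.
have m1 : measurable_fun setT (fun x : X => (\1_A x : R)%:E).
  by apply/measurable_EFinP; exact: measurable_indic.
have m2 : measurable_fun setT (fun x : X => (\1_A (dil t x) * kap t x ^+ n)%:E).
  apply/measurable_EFinP; apply: measurable_funM; last exact: measurable_funX.
  by apply: (measurableT_comp _ md); exact: measurable_indic.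
rewrite integral_mkcond; transitivity (\int[vol]_x (\1_A (dil t x) * kap t x ^+ n)%:E)%E; last first.
  apply: eq_integral => x _; rewrite patchE indicE.
  have -> : (x \in dil t @^-1` A) = (dil t x \in A) by apply/idP/idP; rewrite !inE.
  by case: (_ \in A); rewrite ?mul1r ?mul0r.
rewrite integral_volT// integral_vol; last exact: measurable_funTS.
rewrite -{1}(setIT A) -integral_indic// integral_volT// integral_vol; last exact: measurable_funTS.
have ms := @measurable_stereo R n.
rewrite (@ge0_integral_lrow_scale _ _ t)//.
- apply: eq_integral => y _; rewrite -dil_stereo -!EFinM !stereo_density_cfac.
  have e : cfac (t *: y) ^+ n * t ^+ n = kap t (stereo y) ^+ n * cfac y ^+ n.
    by rewrite -[LHS]exprMn -[RHS]exprMn kap_stereo mulrC.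
  move: (cfac (t *: y) ^+ n) (t ^+ n) (kap t (stereo y) ^+ n) (cfac y ^+ n) e => p q r s e.
  by congr EFin; rewrite -mulrA e mulrA.
- apply: emeasurable_funM; first exact: (measurableT_comp m1).
  by apply/measurable_EFinP; exact: measurable_stereo_density.
by move=> y; rewrite -EFinM lee_fin mulr_ge0 ?stereo_density_ge0.
Qed.

Lemma Int_dil (f : X -> R) : measurable_fun setT f ->
  I f = I (fun x => f (dil t x) * kap t x ^+ n).
Proof.
move=> mf; have mk := measurable_kap t; have md := measurable_dil t.
have mfd : measurable_fun setT (fun x => f (dil t x) * kap t x ^+ n).
  by apply: measurable_funM; [exact: (measurableT_comp mf)|exact: measurable_funX].
have mE : measurable_fun setT (fun x => (f x)%:E) by apply/measurable_EFinP.
rewrite /Rintegral -!integral_volT//; last by apply/measurable_EFinP.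
rewrite (@integral_image_density _ _ _ _ _ vol vol (dil t) (fun x => kap t x ^+ n))//.
- exact: measurable_funX.
- by move=> x; rewrite exprn_ge0 ?kap_ge0// ltW.
- exact: vol_dil.
Qed.

Lemma bmeas_kap : bmeas (kap t).
Proof.
split; first exact: measurable_kap.
by exists t => x Sx; rewrite ger0_norm ?kap_le// kap_ge0// ltW.
Qed.

Lemma bmeas_dil (f : X -> R) : bmeas f -> bmeas (f \o dil t).
Proof.
move=> [mf [C hC]]; split; first exact: (measurableT_comp mf (measurable_dil t)).
by exists C => x Sx; exact/hC/sphere_dil.
Qed.

Lemma bmeas_powR (f : X -> R) b : bmeas f -> (forall x, S x -> 0 <= f x) -> 0 <= b ->
  bmeas (fun x => f x `^ b).
Proof.
move=> [mf [C hC]] f0 b0; split; first exact: (measurableT_comp (measurable_powR _)).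
exists (`|C| `^ b) => x Sx; rewrite ger0_norm ?powR_ge0// ge0_ler_powR ?nnegrE ?f0//.
by rewrite (le_trans (ler_norm _))// (le_trans (hC x Sx))// ler_norm.
Qed.

(** The substitution z = dil y. The charge carries the weight kap^(a + 1) and its potential kap^a,
    as [kP_conformal] dictates. *)
Lemma newton_dil x (h : X -> R) : S x -> bmeas h ->
  I (fun y => kP a 1 (edot x y) * (kap t y `^ (a + 1) * h (dil t y))) =
  kap t x `^ a * I (fun z => kP a 1 (edot (dil t x) z) * h z).
Proof.
move=> Sx bh; have Sd := sphere_dil Sx.
have [mh _] := bh.
rewrite (Int_dil (f := fun z => kP a 1 (edot (dil t x) z) * h z)); last first.
  apply: measurable_funM => //; apply: measurableT_comp; first exact: measurable_kP.
  exact: measurable_edotl.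
have pw y : S y -> kP a 1 (edot (dil t x) (dil t y)) * kap t y ^+ n * kap t x `^ a =
    kP a 1 (edot x y) * kap t y `^ (a + 1).
  move=> Sy; rewrite (edot_dil Sx Sy).
  by apply: kP_conformal; [exact: kap_gt0|exact: kap_gt0|case: (edot_itv Sx Sy)].
have hint : vol.-integrable S (EFin \o (fun y => kP a 1 (edot (dil t x) (dil t y)) * h (dil t y) * kap t y ^+ n)); last first.
  rewrite -[RHS](RintegralZl (kap t x `^ a) mS hint).
  apply: eq_Rintegral => y /set_mem Sy; rewrite mulrA -(pw y Sy); ring.
apply: (eq_integrable mS (fun y => (kap t x `^ a)^-1%:E * (kP a 1 (edot x y) * (kap t y `^ (a + 1) * h (dil t y)))%:E)%E).
  move=> y /set_mem Sy; rewrite -EFinM; congr EFin; rewrite mulrA -pw//.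
  have px : 0 < kap t x `^ a by rewrite powR_gt0// kap_gt0.
  move: (kap t x `^ a) px (kP _ _ _) => u u0 q; field.
  by rewrite gt_eqF.
apply: integrableZl => //; apply: integrable_newtonM => //.
apply: bmeasM; last exact: bmeas_dil.
apply: bmeas_powR; rewrite ?addr_ge0 ?(ltW a_gt0)//; first exact: bmeas_kap.
by move=> y Sy; exact/ltW/kap_gt0.
Qed.

Lemma Int_kap : I (fun x => kap t x ^+ n) = omega.
Proof. by rewrite /omega (@Int_dil (cst 1))//; apply: eq_Int => x _; rewrite mul1r. Qed.

End fixed_dilation.

Lemma Int_poleM x (g : X -> R) : S x -> bmeas g -> I (fun y => (1 <= edot x y)%R%:R * g y) = 0.
Proof.
move=> Sx bg; have [_ [D0 hD0]] := bg; apply/eqP; rewrite -normr_le0.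
have bge : bmeas (fun y => (1 <= edot x y)%R%:R : R) := bmeas_ge _ (measurable_edotl x).
apply: le_trans (Int_norm (bmeasM bge bg)) _.
have -> : 0 = D0 * I (fun y => (1 <= edot x y)%R%:R) by rewrite Int_pole// mulr0.
rewrite -IntZ//; apply: le_Int; [exact/bmeas_norm/bmeasM|exact: bmeasZ|move=> y Sy].
by rewrite normrM mulrC; case: (1 <= edot x y) => /=; rewrite ?normr1 ?normr0 ?mulr1 ?mulr0 ?hD0.
Qed.

(** [e] is the point where kap^n concentrates, and kap |x - e|^2 <= 4 / t; hence kap^a is at most (4
    / t)^a times the Newton kernel with pole [e]. *)
Lemma Int_kap_a t : 1 <= t -> I (fun x => kap t x `^ a) <= (4 / t) `^ a * omega.
Proof.
move=> t1; have t0 : 0 < t by exact: lt_le_trans t1.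
pose e : X := - delta_mx 0 0.
have eE x : edot e x = - x 0 0.
  rewrite /edot big_ord_recl !mxE /= big1 ?addr0 ?mulN1r// => i _.
  by rewrite !mxE /= oppr0 mul0r.
have Se : S e by rewrite /sphere /= eE !mxE /= opprK.
have bk : bmeas (fun x => kap t x `^ a).
  apply: bmeas_powR; rewrite ?(ltW a_gt0)//; first exact: bmeas_kap.
  by move=> y Sy; exact/ltW/kap_gt0.
have bp : bmeas (fun y => (1 <= edot e y)%R%:R : R) := bmeas_ge _ (measurable_edotl e).
have bq : bmeas (fun x => kap t x `^ a - (1 <= edot e x)%R%:R * kap t x `^ a).
  by apply: bmeasB => //; exact: bmeasM.
have -> : I (fun x => kap t x `^ a) =
    I (fun x => kap t x `^ a - (1 <= edot e x)%R%:R * kap t x `^ a).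
  by rewrite IntB//; [rewrite Int_poleM// subr0|exact: bmeasM].
have h1 : omega * a / (a + 0%:R) * 1 = omega.
  by rewrite addr0 mulr1 mulfK// gt_eqF.
have hint := integrable_newtonM Se (bmeas_cst m 1).
rewrite -h1 -(newton_formula Se (@harmonic_comp1 R m)) -(RintegralZl _ mS hint).
apply: le_Rintegral => //; first exact: bmeas_int.
  rewrite (_ : EFin \o _ = (fun y => ((4 / t) `^ a)%:E * (kP a 1 (edot e y) * 1)%:E)%E)//.
  by apply: integrableZl => //; apply: integrable_newtonM => //; exact: bmeas_cst.
move=> x Sx; have [_ e1] := edot_itv Se Sx; rewrite mulr1.
have [h|h] := leP 1 (edot e x); first by rewrite mul1r subrr mulr_ge0 ?powR_ge0.
rewrite mul0r subr0 /kP kq1 powRN.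
have q0 : 0 < 2 - 2 * edot e x by lra.
rewrite -[X in _ <= _ * X^-1]invrK invrK.
rewrite ler_pdivlMr ?powR_gt0// -powRM ?(ltW q0) ?(ltW (kap_gt0 t1 Sx))//.
apply: ge0_ler_powR; rewrite // ?nnegrE ?(ltW a_gt0)//.
- by rewrite mulr_ge0 ?(ltW q0) ?(ltW (kap_gt0 t1 Sx)).
- by rewrite divr_ge0 ?(ltW t0).
have w0 : 0 < dilw t x by rewrite (lt_le_trans _ (dilw_ge2 t1 Sx)).
rewrite kapE// (_ : _ * _ = 4 * t * (1 - edot e x) / dilw t x); last by field; rewrite gt_eqF.
rewrite ler_pdivrMr// [4 / t * _]mulrAC ler_pdivlMr// eE /dilw.
have := sphere_coord_le 0 Sx; rewrite ler_norml => /andP[].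
by move: (x 0 0) => u; nra.
Qed.

(** If d s >= 1 the first term dominates; otherwise s^(m + 1) = s^a s^a and s^a <= d^(-a). *)
Lemma kap_split (s d : R) : 0 <= s -> 0 < d -> s ^+ m.+1 <= d * s ^+ n + d `^ (- a) * s `^ a.
Proof.
move=> s0 d0; have [h|h] := leP 1 (d * s).
  rewrite (@exprS _ s m.+1) mulrA ler_wpDr ?mulr_ge0 ?powR_ge0//.
  by rewrite ler_peMl ?exprn_ge0.
apply: ler_wpDl; first by rewrite mulr_ge0 ?exprn_ge0 ?(ltW d0).
rewrite powRN.
have [->|sn] := eqVneq s 0.
  by rewrite expr0n /= mulr_ge0 ?invr_ge0 ?powR_ge0.
have sp : 0 < s by rewrite lt_neqAle eq_sym sn.
have -> : s ^+ m.+1 = s `^ a * s `^ a.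
  rewrite -powR_mulrn// -powRD ?sn ?implybT//.
  by congr (_ `^ _); field.
rewrite ler_wpM2r ?powR_ge0//.
rewrite -[X in _ <= X]mul1r ler_pdivlMr ?powR_gt0// -(powRM _ s0 (ltW d0)).
have := @ge0_ler_powR _ _ (ltW a_gt0) (s * d) 1.
rewrite !nnegrE mulr_ge0 ?(ltW d0)// ler01 powR1 => /(_ isT isT); apply.
by rewrite mulrC ltW.
Qed.

(** kap^(m + 1) = kap^(2 a) is the weight in the L^2 norm of a dilated spinor. It is interpolated
    between kap^n, of constant integral, and kap^a, whose integral tends to 0. *)
Lemma kap_small (e : R) : 0 < e -> exists2 t, 1 <= t & I (fun x => kap t x ^+ m.+1) <= e.
Proof.
move=> e0; have w0 : 0 <= omega := @omega_ge0 R m.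
pose d := e / (2 * (1 + omega + e)).
have d0 : 0 < d by rewrite divr_gt0// mulr_gt0//; lra.
have d1 : d <= 1 by rewrite ler_pdivrMr; lra.
have dw : d * omega <= e / 2.
  by rewrite /d mulrAC ler_pdivrMr; [nra|lra].
(* With t = 4 / (d r) the second term of the splitting becomes d^(-a) (d r)^a omega = r^a omega = d
   omega. *)
pose r := d `^ a^-1.
have r0 : 0 < r by rewrite powR_gt0.
have ra : r `^ a = d by rewrite -powRrM mulVf ?powRr1 ?ltW// gt_eqF.
have r1 : r <= 1.
  have := @ge0_ler_powR _ a^-1 _ d 1; rewrite !nnegrE invr_ge0 (ltW a_gt0) (ltW d0) ler01 powR1.
  by move=> /(_ isT isT isT); apply.
pose t := 4 / (d * r).
have dr0 : 0 < d * r by rewrite mulr_gt0.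
have t1 : 1 <= t by rewrite ler_pdivlMr// mul1r; nra.
exists t => //.
have bk := bmeas_kap t1.
have bka : bmeas (fun x => kap t x `^ a).
  apply: bmeas_powR; rewrite ?(ltW a_gt0)//.
  by move=> y Sy; exact/ltW/kap_gt0.
apply: (@le_trans _ _ (I (fun x => d * kap t x ^+ n + d `^ (- a) * kap t x `^ a))).
  apply: le_Int; first exact: bmeasX.
    by apply: bmeasD; apply: bmeasZ => //; exact: bmeasX.
  by move=> x Sx; apply: kap_split => //; exact/ltW/kap_gt0.
rewrite IntD; [|by apply: bmeasZ; exact: bmeasX|exact: bmeasZ].
rewrite !IntZ//; last exact: bmeasX.
rewrite Int_kap//.
have h : d `^ (- a) * I (fun x => kap t x `^ a) <= d * omega.
  apply: le_trans (ler_wpM2l (powR_ge0 _ _) (Int_kap_a t1)) _.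
  rewrite mulrA powRN (_ : 4 / t = d * r); last first.
    by rewrite /t invf_div mulrCA divff ?mulr1.
  by rewrite (powRM _ (ltW d0) (ltW r0)) ra mulKf ?gt_eqF ?powR_gt0.
lra.
Qed.

End dilation.

Lemma near_eq_differentiable (R : realType) (V W : normedModType R) (f g : V -> W) (x : V) :
  (\forall y \near x, f y = g y) -> differentiable f x -> differentiable g x.
Proof.
move=> fg df; have [cdf fE] := (diff_locallyP x f).1 df.
have gE : g \o shift x = cst (g x) + 'd f x +o_ (0 : V) id.
  apply/eqaddoP => e e0.
  have /eqaddoP/(_ e e0) fe := fE.
  have fg0 : \forall h \near (0 : V), f (h + x) = g (h + x).
    by have := fg; rewrite (near_shift 0 x) /= subr0.
  apply: filterS2 fg0 fe => h; rewrite !fctE /= => ->.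
  by rewrite (nbhs_singleton fg).
by apply/diff_locallyP; rewrite (diff_unique cdf gE).
Qed.

Lemma differentiable_exprn (R : realType) (V : normedModType R) (f : V -> R) (x : V) k :
  differentiable f x -> differentiable (fun y => f y ^+ k) x.
Proof.
move=> df; elim: k => [|k ih].
  by rewrite (_ : (fun y => _) = cst 1)//; exact: differentiable_cst.
rewrite (_ : (fun y => _) = f * (fun y => f y ^+ k)); first exact: differentiableM.
by apply/funext => y; rewrite exprS.
Qed.

(** * Polynomial spinors *)

Section homogeneous_polynomials.
Context {R : realType} (m : nat).
Local Notation n := m.+2.
Local Notation S := (@sphere R n).
Local Notation X := 'rV[R]_n.+1.
Implicit Types (f g h : X -> R) (x y : X) (d : nat).

(** Homogeneous polynomial functions, presented by generators so that Euler's identity, the symmetry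
    of second derivatives and the rest are inductions over three cases. *)
Inductive hpol : nat -> (X -> R) -> Prop :=
| hpol_cst c : hpol 0 (fun _ => c)
| hpol_coord k d f : hpol d f -> hpol d.+1 (fun x => x 0 k * f x)
| hpol_add d f g : hpol d f -> hpol d g -> hpol d (fun x => f x + g x).

Lemma hpol_eq d f g : hpol d f -> f =1 g -> hpol d g.
Proof. by move=> + /funext <-. Qed.

Lemma hpol0 d : hpol d (fun _ => 0).
Proof.
elim: d => [|d ih]; first exact: hpol_cst.
by apply: (hpol_eq (hpol_coord 0 ih)) => x; rewrite mulr0.
Qed.

Lemma hpolZ c d f : hpol d f -> hpol d (fun x => c * f x).
Proof.
elim=> {d f} [c'|k d f _ ih|d f g _ ihf _ ihg]; first exact: hpol_cst.
  by apply: (hpol_eq (hpol_coord k ih)) => x; rewrite mulrCA.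
by apply: (hpol_eq (hpol_add ihf ihg)) => x; rewrite mulrDr.
Qed.

Lemma hpol_sum (J : Type) (r : seq J) (F : J -> X -> R) d :
  (forall j, hpol d (F j)) -> hpol d (fun x => \sum_(j <- r) F j x).
Proof.
move=> hF; elim: r => [|j r ih].
  by apply: (hpol_eq (hpol0 d)) => x; rewrite big_nil.
by apply: (hpol_eq (hpol_add (hF j) ih)) => x; rewrite big_cons.
Qed.

Lemma hpol_diff d f : hpol d f -> forall x, differentiable f x.
Proof.
elim=> {d f} [c|k d f _ ih|d f g _ ihf _ ihg] x; first exact: differentiable_cst.
  by apply: differentiableM => //; exact: differentiable_coord.
exact: differentiableD.
Qed.

Lemma partial_cst j c x : partial j (fun _ : X => c) x = 0.
Proof. by rewrite /partial derive_cst. Qed.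

Lemma partialD j f g x : differentiable f x -> differentiable g x ->
  partial j (fun x => f x + g x) x = partial j f x + partial j g x.
Proof. by move=> df dg; rewrite /partial deriveD//; exact: diff_derivable. Qed.

Lemma partial_coord j k x : partial j (fun x : X => x 0 k) x = (k == j)%:R.
Proof.
rewrite /partial; have h := is_derive_coord k x (delta_mx 0 j).
by rewrite derive_val mxE eqxx.
Qed.

Lemma partialM j f g x : differentiable f x -> differentiable g x ->
  partial j (fun x => f x * g x) x = partial j f x * g x + f x * partial j g x.
Proof.
move=> df dg; rewrite /partial deriveM; [|exact: diff_derivable|exact: diff_derivable].
by rewrite /GRing.scale /= addrC mulrC.
Qed.

Lemma partial_coordM j k f x : differentiable f x ->
  partial j (fun x => x 0 k * f x) x = (k == j)%:R * f x + x 0 k * partial j f x.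
Proof. by move=> df; rewrite partialM ?partial_coord//; exact: differentiable_coord. Qed.

Lemma partialZ j c f x : differentiable f x -> partial j (fun x => c * f x) x = c * partial j f x.
Proof. by move=> df; rewrite partialM ?partial_cst ?mul0r ?add0r//; exact: differentiable_cst. Qed.

(** [d.-1] is 0 for d = 0, so the vanishing of derivatives in degree 0 has to be carried along:
    without it the coordinate step would produce degree 1 instead of 0. *)
Lemma hpol_partial_both j d f : hpol d f ->
  hpol d.-1 (partial j f) /\ (d = 0%N -> forall x, partial j f x = 0).
Proof.
elim=> {d f} [c|k d f hf [ih ih0]|d f g hf [ihf ihf0] hg [ihg ihg0]].
- split; last by move=> _ x; rewrite partial_cst.
  by apply: (hpol_eq (hpol_cst 0)) => x; rewrite partial_cst.
- split=> //=; apply: (@hpol_eq _ (fun x => (k == j)%:R * f x + x 0 k * partial j f x)).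
    apply: hpol_add; first exact: hpolZ.
    case: d hf ih ih0 => [|d] hf ih ih0; last exact: hpol_coord.
    by apply: (hpol_eq (hpol_cst 0)) => x; rewrite ih0// mulr0.
  by move=> x; rewrite partial_coordM//; exact: hpol_diff hf x.
have e x : partial j f x + partial j g x = partial j (fun x => f x + g x) x.
  by rewrite partialD//; [exact: hpol_diff hf x|exact: hpol_diff hg x].
split; first by apply: (hpol_eq (hpol_add ihf ihg)).
by move=> d0 x; rewrite -e ihf0// ihg0// addr0.
Qed.

Lemma hpol_partial j d f : hpol d f -> hpol d.-1 (partial j f).
Proof. by move=> /(hpol_partial_both j)[]. Qed.

Lemma hpol0_partial j f x : hpol 0 f -> partial j f x = 0.
Proof. by move=> /(hpol_partial_both j)[_ ->]. Qed.

Lemma hpol_euler d f x : hpol d f -> \sum_j x 0 j * partial j f x = d%:R * f x.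
Proof.
elim=> {d f} [c|k d f hf ih|d f g hf ihf hg ihg].
- by rewrite mul0r big1// => j _; rewrite partial_cst mulr0.
- under eq_bigr => j _ do rewrite (partial_coordM _ _ (hpol_diff hf x)) mulrDr [x 0 j * (x 0 k * _)]mulrCA.
  rewrite big_split /= -mulr_sumr ih (bigD1 k)//= eqxx mul1r big1 ?addr0.
    by rewrite -natr1; ring.
  by move=> j /negPf jk; rewrite eq_sym jk mul0r mulr0.
under eq_bigr => j _ do rewrite (partialD _ (hpol_diff hf x) (hpol_diff hg x)) mulrDr.
by rewrite big_split /= ihf ihg mulrDr.
Qed.

Lemma hpol_partialC d f i j x : hpol d f ->
  partial i (partial j f) x = partial j (partial i f) x.
Proof.
move=> hf; elim: hf x => {d f} [c|k d f hf ih|d f g hf ihf hg ihg] x.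
- have e l : partial l (fun _ : X => c) = fun _ => 0 by apply/funext => z; rewrite partial_cst.
  by rewrite !e !partial_cst.
- have e l : partial l (fun x => x 0 k * f x) = fun x => (k == l)%:R * f x + x 0 k * partial l f x.
    by apply/funext => z; rewrite partial_coordM//; exact: hpol_diff hf z.
  have dp l z := hpol_diff (hpol_partial l hf) z; have df := hpol_diff hf.
  have e2 i' j' z : partial i' (partial j' (fun x => x 0 k * f x)) z =
      (k == j')%:R * partial i' f z + ((k == i')%:R * partial j' f z + z 0 k * partial i' (partial j' f) z).
    rewrite e partialD; first by rewrite (partialZ _ _ (df z)) (partial_coordM _ _ (dp j' z)).
      by apply: differentiableM; [exact: differentiable_cst|exact: df].
    by apply: differentiableM; [exact: differentiable_coord|exact: dp].
  by rewrite !e2 ih; ring.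
have e l : partial l (fun x => f x + g x) = fun x => partial l f x + partial l g x.
  by apply/funext => z; rewrite partialD//; [exact: hpol_diff hf z|exact: hpol_diff hg z].
rewrite !e !partialD ?ihf ?ihg//.
all: by [exact: (hpol_diff (hpol_partial _ hf))|exact: (hpol_diff (hpol_partial _ hg))].
Qed.

Lemma hpol_scale d f c x : hpol d f -> f (c *: x) = c ^+ d * f x.
Proof.
elim=> {d f} [c'|k d f _ ih|d f g _ ihf _ ihg]; first by rewrite mul1r.
  by rewrite mxE ih exprS; ring.
by rewrite ihf ihg mulrDr.
Qed.

Lemma hpol_edot d f : hpol d f -> hpol d.+2 (fun x => edot x x * f x).
Proof.
move=> hf; apply: (@hpol_eq _ (fun x => \sum_k x 0 k * (x 0 k * f x))).
  by apply: hpol_sum => k; do 2!apply: hpol_coord.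
by move=> x; rewrite mulr_suml; apply: eq_bigr => k _; rewrite mulrA.
Qed.

Lemma hpol_bmeas d f : hpol d f -> bmeas f.
Proof.
elim=> {d f} [c|k d f _ ih|d f g _ ihf _ ihg]; first exact: bmeas_cst.
  by apply: bmeasM => //; exact: bmeas_coord.
exact: bmeasD.
Qed.

Lemma hpol_lipschitz d f : hpol d f -> sph_lipschitz f.
Proof.
elim=> {d f} [c|k d f hf [L L0 ih]|d f g _ [L L0 ihf] _ [M M0 ihg]].
- by exists 0 => // x y _ _; rewrite subrr expr0n /= mul0r.
- have [_ [C hC]] := hpol_bmeas hf; exists (2 * L + 2 * C ^+ 2) => [|x y Sx Sy].
    by rewrite addr_ge0// mulr_ge0// sqr_ge0.
  have h1 := ih x y Sx Sy; set q := 2 - 2 * edot x y in h1 *.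
  have h2 : (y 0 k - x 0 k) ^+ 2 <= q.
    rewrite /q -sphere_edot_sqr// (bigD1 k)//= -opprB sqrrN.
    by rewrite lerDl sumr_ge0// => j _; rewrite sqr_ge0.
  have h3 : f x ^+ 2 <= C ^+ 2.
    by rewrite -real_normK ?num_real// lerXn2r ?nnegrE ?hC// (le_trans _ (hC _ Sx)).
  have h4 : y 0 k ^+ 2 <= 1.
    by rewrite -real_normK ?num_real// expr_le1 ?sphere_coord_le.
  have -> : y 0 k * f y - x 0 k * f x = y 0 k * (f y - f x) + f x * (y 0 k - x 0 k) by ring.
  have h5 : (y 0 k * (f y - f x)) ^+ 2 <= L * q.
    rewrite exprMn; apply: le_trans h1; rewrite ler_piMl ?sqr_ge0//.
  have h6 : (f x * (y 0 k - x 0 k)) ^+ 2 <= C ^+ 2 * q.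
    by rewrite exprMn ler_pM ?sqr_ge0.
  move: (y 0 k * _) (f x * _) h5 h6 => u v h5 h6.
  by have := sqr_ge0 (u - v); nra.
exists (2 * L + 2 * M) => [|x y Sx Sy]; first by rewrite addr_ge0 ?mulr_ge0.
have := ihf x y Sx Sy; have := ihg x y Sx Sy; move: (2 - 2 * _) => q.
have := sqr_ge0 ((f y - f x) - (g y - g x)); nra.
Qed.

(** The tangential gradient is grad f - x (x . grad f), and x . grad f = d f by Euler's identity. *)
Lemma hpol_tderiv d f : hpol d f -> tderiv f (fun k x => partial k f x - x 0 k * (d%:R * f x)).
Proof.
elim=> {d f} [c|j d f hf ih|d f g hf ihf hg ihg].
- by apply: (tderiv_eq (tderiv_cst _ c)) => // k x; rewrite partial_cst mul0r mulr0 subr0.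
- apply: (tderiv_eq (tderivM (tderiv_coord j) ih)) => // k x.
  by rewrite (partial_coordM _ _ (hpol_diff hf x)) -natr1 eq_sym; ring.
apply: (tderiv_eq (tderivD ihf ihg)) => // k x.
by rewrite (partialD _ (hpol_diff hf x) (hpol_diff hg x)); ring.
Qed.

Definition lap f x : R := \sum_k partial k (partial k f) x.

(** Each component of the tangential gradient is a combination of polynomials of degrees d - 1 and d
    + 1, to which [hpol_tderiv] applies again; Euler's identity evaluates the trace. *)
Lemma hpol_sphlap d f : hpol d f -> sphlap f (fun x => lap f x - d%:R * (d + m.+1)%:R * f x).
Proof.
move=> hf; exists (fun k x => partial k f x - x 0 k * (d%:R * f x)).
pose w1 k l x := partial l (partial k f) x - x 0 l * (d.-1%:R * partial k f x).
pose w2 k l x := partial l (fun x => x 0 k * f x) x - x 0 l * (d.+1%:R * (x 0 k * f x)).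
exists (fun k l x => w1 k l x + - d%:R * w2 k l x); split; first exact: hpol_tderiv.
  move=> k; have t1 := hpol_tderiv (hpol_partial k hf).
  have t2 := tderiv_scale (- d%:R) (hpol_tderiv (hpol_coord k hf)).
  by apply: (tderiv_eq (tderivD t1 t2)) => // x; ring.
move=> x Sx; rewrite /w1 /w2.
under eq_bigr => k _ do rewrite (partial_coordM _ _ (hpol_diff hf x)) eqxx mul1r.
have e1 := hpol_euler x hf; have s1 := sphere_sum Sx.
transitivity (lap f x - d.-1%:R * (\sum_k x 0 k * partial k f x)
  - d%:R * (\sum_(k < n.+1) f x + \sum_k x 0 k * partial k f x
            - d.+1%:R * f x * \sum_k x 0 k * x 0 k)).
  rewrite /lap !mulr_sumr -!sumrB -?big_split /= -!sumrB mulr_sumr -!sumrB.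
  by apply: eq_bigr => k _; ring.
rewrite e1 s1 sumr_const card_ord -[f x *+ _]mulr_natl natrD.
have : (d.-1%:R * (d%:R * f x) = (d%:R - 1) * (d%:R * f x) :> R).
  by case: (d) => [|e]; rewrite ?mul0r ?mulr0// -natr1 addrK.
by move=> ->; rewrite -!natr1; ring.
Qed.

Lemma hpol_harmonic d f k : hpol d f ->
  (forall x, S x -> lap f x - d%:R * (d + m.+1)%:R * f x = - (k%:R * (k + m.+1)%:R * f x)) ->
  harmonic_comp k f.
Proof.
move=> hf e; split; [exact: hpol_bmeas hf|exact: hpol_lipschitz hf|].
have [v [w [h1 h2 h3]]] := hpol_sphlap hf; exists v, w; split => // x Sx.
by rewrite h3// e.
Qed.

Let N x : R := (edot x x) `^ (- 2^-1).

Lemma edot_eq0 x : (edot x x == 0) = (x == 0).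
Proof.
apply/idP/eqP => [|->]; last by apply/eqP; rewrite /edot big1// => i _; rewrite mxE mul0r.
rewrite /edot psumr_eq0 => [/allP h|i _]; last by rewrite -expr2 sqr_ge0.
apply/rowP => i; rewrite mxE; apply/eqP.
by have := h i (mem_index_enum i); rewrite mulf_eq0 orbb.
Qed.

Lemma edot_gt0 x : x != 0 -> 0 < edot x x.
Proof. by move=> x0; rewrite lt_neqAle edot_ge0 andbT eq_sym edot_eq0. Qed.

Let NE x : (enorm x)^-1 = N x.
Proof. by rewrite /N /enorm powRN -powR12_sqrt// edot_ge0. Qed.

Let dN x : x != 0 -> differentiable N x /\ forall j, partial j N x = - x 0 j * N x ^+ 3.
Proof.
move=> x0; have e0 := edot_gt0 x0.
have dp := is_derive1_powR (- 2^-1) e0.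
have d1 : differentiable (fun t : R => t `^ (- 2^-1)) (edot x x) by apply/derivable1_diffP; exact: ex_derive.
have d2 : differentiable (fun z : X => edot z z) x.
  by apply: (@hpol_diff 2); apply: (hpol_eq (hpol_edot (hpol_cst 1))) => z; rewrite mulr1.
have dN : differentiable N x by exact: (differentiable_comp d2 d1).
split=> // j; rewrite /partial deriveE// /N.
rewrite (_ : (fun x : X => _) = (fun t : R => t `^ (- 2^-1)) \o (fun z : X => edot z z))//.
have e2 : 'd (fun z : X => edot z z) x (delta_mx 0 j) = 2 * x 0 j.
  rewrite -deriveE//; have h := is_derive_edot x (delta_mx 0 j).
  rewrite derive_val /edot (bigD1 j)//= big1 ?addr0; first by rewrite mxE !eqxx mulr1.
  by move=> i ij; rewrite mxE (negPf ij) andbF mulr0.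
rewrite (diff_comp d2 d1) /= e2 diff1E// /= derive1E derive_val /GRing.scale /=.
rewrite -powR_mulrn ?powR_ge0// -powRrM.
have -> : - 2^-1 - 1 = - 2^-1 * 3%:R :> R by field.
by field.
Qed.

(* Closed under partial derivatives, and contains the extensions constant on
   rays of homogeneous polynomials. *)
Definition ray_class f := exists e h k, hpol e h /\ forall x, x != 0 -> f x = h x * (enorm x)^-1 ^+ k.

Let near_neq0 x : x != 0 -> \forall y \near x, y != 0.
Proof.
move=> x0; have : open [set y : X | y != 0].
  rewrite (_ : [set y : X | y != 0] = ~` [set 0]); last by apply/seteqP; split => y /= /eqP.
  exact/closed_openC/accessible_closed_set1/hausdorff_accessible/norm_hausdorff.
by rewrite openE => /(_ x x0).
Qed.

Lemma ray_class_diff f x : ray_class f -> x != 0 -> differentiable f x.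
Proof.
move=> [e [h [k [hh fE]]]] x0.
have : differentiable (fun y => h y * N y ^+ k) x.
  apply: differentiableM; first exact: hpol_diff hh x.
  by apply: differentiable_exprn; have [] := dN x0.
have /near_eq_differentiable : \forall y \near x, h y * N y ^+ k = f y.
  by near=> y; rewrite fE -?NE//; near: y; exact: near_neq0.
by apply.
Unshelve. all: by end_near.
Qed.

Lemma ray_class_partial f j : ray_class f -> ray_class (partial j f).
Proof.
move=> [e [h [k [hh fE]]]].
exists e.+1, (fun x => edot x x * partial j h x - k%:R * (x 0 j * h x)), k.+2; split.
  apply: (@hpol_eq _ (fun x => edot x x * partial j h x + - k%:R * (x 0 j * h x))); last first.
    by move=> x; rewrite mulNr.
  apply: hpol_add; last exact/hpolZ/hpol_coord.
  case: e hh => [|e] hh; last exact/hpol_edot/(hpol_partial j hh).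
  by apply: (hpol_eq (hpol0 1)) => x; rewrite hpol0_partial// mulr0.
move=> x x0; have [d1 d2] := dN x0.
have dX : partial j (fun y => N y ^+ k) x = k%:R * (- x 0 j * N x ^+ k.+2).
  elim: (k) => [|l ih].
    by rewrite mul0r (_ : (fun y => _) = fun _ => 1) ?partial_cst//; apply/funext => y; rewrite expr0.
  rewrite (_ : (fun y => _) = fun y => N y * N y ^+ l); last by apply/funext => y; rewrite exprS.
  rewrite partialM// ?d2 ?ih; last exact: differentiable_exprn.
  by rewrite -(natr1 l) !exprS; ring.
have -> : partial j f x = partial j (fun y => h y * N y ^+ k) x.
  apply: near_eq_derive.
  by near=> y; rewrite fE -?NE//; near: y; exact: near_neq0.
rewrite partialM ?dX ?NE; [|exact: hpol_diff hh x|exact: differentiable_exprn].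
have e1 : edot x x * N x ^+ 2 = 1.
  have e0 := edot_gt0 x0.
  rewrite -powR_mulrn ?powR_ge0// -powRrM -{1}(powRr1 (ltW e0)) -powRD ?(gt_eqF e0) ?implybT//.
  by rewrite (_ : 1 + _ = 0) ?powRr0//; field.
rewrite -[partial j h x * _]mul1r -e1; move: (edot x x) (partial j h x) (h x) (x 0 j) => u v w z.
by rewrite !exprS expr0; ring.
Unshelve. all: by end_near.
Qed.

Lemma smooth_ray d h : hpol d h -> smooth_off0 (fun y => h ((enorm y)^-1 *: y)).
Proof.
move=> hh s x x0; apply: ray_class_diff => //; elim: s => [|j s ih] /=; last exact: ray_class_partial.
by exists d, h, d; split => // y y0; rewrite (hpol_scale _ _ hh) mulrC.
Qed.

Lemma partial_ray d h j x : hpol d h -> S x ->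
  differentiable (fun y => h ((enorm y)^-1 *: y)) x /\
  partial j (fun y => h ((enorm y)^-1 *: y)) x = partial j h x - x 0 j * (d%:R * h x).
Proof.
move=> hh Sx; have x0 : x != 0 by rewrite -edot_eq0 (_ : edot x x = 1)// oner_eq0.
have -> : (fun y => h ((enorm y)^-1 *: y)) = (fun y => h y * N y ^+ d).
  by apply/funext => y; rewrite (hpol_scale _ _ hh) NE mulrC.
have [d1 d2] := dN x0; have N1 : N x = 1 by rewrite /N (_ : edot x x = 1)// powR1.
have dX : partial j (fun y => N y ^+ d) x = - (d%:R * x 0 j).
  elim: (d) => [|l ih].
    by rewrite mul0r oppr0 (_ : (fun y => _) = fun _ => 1) ?partial_cst//; apply/funext => y; rewrite expr0.
  rewrite (_ : (fun y => _) = fun y => N y * N y ^+ l); last by apply/funext => y; rewrite exprS.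
  rewrite partialM// ?d2 ?ih; last exact: differentiable_exprn.
  by rewrite N1 !expr1n -(natr1 l); ring.
split; first by apply: differentiableM; [exact: hpol_diff hh x|exact: differentiable_exprn].
rewrite partialM ?dX ?N1 ?expr1n; [|exact: hpol_diff hh x|exact: differentiable_exprn].
by ring.
Qed.

End homogeneous_polynomials.

Section spinor_polynomials.
Context {R : realType} (m N : nat).
Local Notation n := m.+2.
Local Notation X := 'rV[R]_n.+1.
Local Notation C := R[i].
Local Notation V := 'cV[C]_N.
Implicit Types (f g : X -> C) (p q : X -> V) (x : X) (d : nat) (c : C).

Lemma complex_ReM (c z : C) : complex.Re (c * z) = complex.Re c * complex.Re z + - complex.Im c * complex.Im z.
Proof. by case: c => a b; case: z => u v /=; rewrite mulNr. Qed.

Lemma complex_ImM (c z : C) : complex.Im (c * z) = complex.Re c * complex.Im z + complex.Im c * complex.Re z.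
Proof. by case: c => a b; case: z => u v /=. Qed.

Lemma complexE (z : C) : z = complex.Re z +i* complex.Im z. Proof. by case: z. Qed.

Definition chpol d f := hpol d (fun x => complex.Re (f x)) /\ hpol d (fun x => complex.Im (f x)).

Definition dC j f x : C :=
  partial j (fun x => complex.Re (f x)) x +i* partial j (fun x => complex.Im (f x)) x.

Lemma dC_ext j f g x : f =1 g -> dC j f x = dC j g x.
Proof. by move=> /funext ->. Qed.

Lemma chpol_eq d f g : chpol d f -> f =1 g -> chpol d g.
Proof. by move=> + /funext <-. Qed.

Lemma chpol0 d : chpol d (fun _ => 0).
Proof. by split; exact: hpol0. Qed.

Lemma chpolD d f g : chpol d f -> chpol d g -> chpol d (fun x => f x + g x).
Proof.
move=> [f1 f2] [g1 g2]; split.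
  by apply: (hpol_eq (hpol_add f1 g1)) => x; case: (f x) (g x) => ? ? [].
by apply: (hpol_eq (hpol_add f2 g2)) => x; case: (f x) (g x) => ? ? [].
Qed.

Lemma chpolZ d c f : chpol d f -> chpol d (fun x => c * f x).
Proof.
move=> [f1 f2]; split.
  by apply: (hpol_eq (hpol_add (hpolZ (complex.Re c) f1) (hpolZ (- complex.Im c) f2))) => x; rewrite complex_ReM.
by apply: (hpol_eq (hpol_add (hpolZ (complex.Re c) f2) (hpolZ (complex.Im c) f1))) => x; rewrite complex_ImM.
Qed.

Lemma chpol_coord d k f : chpol d f -> chpol d.+1 (fun x => (x 0 k)%:C * f x).
Proof.
move=> [f1 f2]; split.
  by apply: (hpol_eq (hpol_coord k f1)) => x; rewrite complex_ReM /= oppr0 mul0r addr0.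
by apply: (hpol_eq (hpol_coord k f2)) => x; rewrite complex_ImM /= mul0r addr0.
Qed.

Lemma chpol_sum (J : Type) (r : seq J) (F : J -> X -> C) d :
  (forall j, chpol d (F j)) -> chpol d (fun x => \sum_(j <- r) F j x).
Proof.
move=> hF; elim: r => [|j r ih].
  by apply: (chpol_eq (chpol0 d)) => x; rewrite big_nil.
by apply: (chpol_eq (chpolD (hF j) ih)) => x; rewrite big_cons.
Qed.

Lemma chpol_dC d j f : chpol d f -> chpol d.-1 (dC j f).
Proof. by move=> [f1 f2]; split; exact: hpol_partial. Qed.

Lemma dC0 j x : dC j (fun _ => 0) x = 0.
Proof. by rewrite /dC !partial_cst. Qed.

Lemma chpol0_dC j f x : chpol 0 f -> dC j f x = 0.
Proof. by move=> [f1 f2]; rewrite /dC !hpol0_partial. Qed.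

Lemma dCD d j f g x : chpol d f -> chpol d g ->
  dC j (fun x => f x + g x) x = dC j f x + dC j g x.
Proof.
move=> [f1 f2] [g1 g2]; rewrite /dC.
have -> : (fun x => complex.Re (f x + g x)) = (fun x => complex.Re (f x) + complex.Re (g x)).
  by apply/funext => z; case: (f z) (g z) => ? ? [].
have -> : (fun x => complex.Im (f x + g x)) = (fun x => complex.Im (f x) + complex.Im (g x)).
  by apply/funext => z; case: (f z) (g z) => ? ? [].
by rewrite (partialD _ (hpol_diff f1 x) (hpol_diff g1 x)) (partialD _ (hpol_diff f2 x) (hpol_diff g2 x)).
Qed.

Lemma dCZ d j c f x : chpol d f -> dC j (fun x => c * f x) x = c * dC j f x.
Proof.
move=> [f1 f2]; rewrite /dC.
have -> : (fun x => complex.Re (c * f x)) =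
    (fun x => complex.Re c * complex.Re (f x) + - complex.Im c * complex.Im (f x)).
  by apply/funext => z; rewrite complex_ReM.
have -> : (fun x => complex.Im (c * f x)) =
    (fun x => complex.Re c * complex.Im (f x) + complex.Im c * complex.Re (f x)).
  by apply/funext => z; rewrite complex_ImM.
rewrite !partialD ?partialZ; do ?[exact: hpol_diff f1 x|exact: hpol_diff f2 x];
  do ?[exact: (hpol_diff (hpolZ _ f1))|exact: (hpol_diff (hpolZ _ f2))].
by rewrite [RHS]complexE complex_ReM complex_ImM.
Qed.

Lemma dC_coordM d j k f x : chpol d f ->
  dC j (fun x => (x 0 k)%:C * f x) x = (k == j)%:R * f x + (x 0 k)%:C * dC j f x.
Proof.
move=> [f1 f2]; rewrite /dC.
have -> : (fun x : X => complex.Re ((x 0 k)%:C * f x)) = (fun x => x 0 k * complex.Re (f x)).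
  by apply/funext => z; rewrite complex_ReM /= oppr0 mul0r addr0.
have -> : (fun x : X => complex.Im ((x 0 k)%:C * f x)) = (fun x => x 0 k * complex.Im (f x)).
  by apply/funext => z; rewrite complex_ImM /= mul0r addr0.
rewrite (partial_coordM _ _ (hpol_diff f1 x)) (partial_coordM _ _ (hpol_diff f2 x)).
rewrite -(rmorph_nat (real_complex R)) [RHS]complexE; case: (f x) => u v /=.
by congr (_ +i* _); ring.
Qed.

Lemma dC_sum (J : Type) (r : seq J) (F : J -> X -> C) d j x : (forall l, chpol d (F l)) ->
  dC j (fun x => \sum_(l <- r) F l x) x = \sum_(l <- r) dC j (F l) x.
Proof.
move=> hF; elim: r => [|l r ih].
  rewrite big_nil (_ : (fun x => _) = fun _ => 0) ?dC0//.
  by apply/funext => z; rewrite big_nil.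
rewrite big_cons -ih -(dCD _ _ (hF l)); last exact: chpol_sum.
by apply: dC_ext => z; rewrite big_cons.
Qed.

Lemma dC_euler d f x : chpol d f -> \sum_j (x 0 j)%:C * dC j f x = d%:R * f x.
Proof.
move=> [f1 f2]; rewrite [RHS]complexE -(rmorph_nat (real_complex R)) complex_ReM complex_ImM /=.
rewrite oppr0 !mul0r !addr0 -(hpol_euler x f1) -(hpol_euler x f2).
rewrite [LHS]complexE !raddf_sum /=; congr (_ +i* _); apply: eq_bigr => j _.
  by rewrite /= mul0r subr0.
by rewrite /= mul0r addr0.
Qed.

Lemma dCC d f i j x : chpol d f -> dC i (dC j f) x = dC j (dC i f) x.
Proof.
move=> [f1 f2].
have e k l : dC k (dC l f) x = partial k (partial l (fun x => complex.Re (f x))) x +i*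
    partial k (partial l (fun x => complex.Im (f x))) x by [].
by rewrite !e (hpol_partialC i j x f1) (hpol_partialC i j x f2).
Qed.

Definition hspin d p := forall i, chpol d (fun x => p x i 0).

Definition sd j p x : V := \col_i dC j (fun x => p x i 0) x.

Lemma hspin_eq d p q : hspin d p -> p =1 q -> hspin d q.
Proof. by move=> + /funext <-. Qed.

Lemma hspin0 d : hspin d (fun _ => 0).
Proof. by move=> i; apply: (chpol_eq (chpol0 d)) => x; rewrite mxE. Qed.

Lemma hspinD d p q : hspin d p -> hspin d q -> hspin d (fun x => p x + q x).
Proof. by move=> hp hq i; apply: (chpol_eq (chpolD (hp i) (hq i))) => x; rewrite mxE. Qed.

Lemma hspinZ d c p : hspin d p -> hspin d (fun x => c *: p x).
Proof. by move=> hp i; apply: (chpol_eq (chpolZ c (hp i))) => x; rewrite mxE. Qed.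

Lemma hspinB d p q : hspin d p -> hspin d q -> hspin d (fun x => p x - q x).
Proof.
move=> hp hq; apply: (hspin_eq (hspinD hp (hspinZ (-1) hq))) => x.
by rewrite scaleN1r.
Qed.

Lemma hspin_sum (J : Type) (r : seq J) (F : J -> X -> V) d :
  (forall j, hspin d (F j)) -> hspin d (fun x => \sum_(j <- r) F j x).
Proof.
by move=> hF i; apply: (chpol_eq (chpol_sum r (fun j => hF j i))) => x; rewrite summxE.
Qed.

Lemma hspin_coord d k p : hspin d p -> hspin d.+1 (fun x => (x 0 k)%:C *: p x).
Proof. by move=> hp i; apply: (chpol_eq (chpol_coord k (hp i))) => x; rewrite mxE. Qed.

Lemma hspin_mul d (M : 'M[C]_N) p : hspin d p -> hspin d (fun x => M *m p x).
Proof.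
move=> hp i; apply: (chpol_eq (chpol_sum (index_enum _) (fun l => chpolZ (M i l) (hp l)))) => x.
by rewrite mxE.
Qed.

Lemma hspin_sd d j p : hspin d p -> hspin d.-1 (sd j p).
Proof. by move=> hp i; apply: (chpol_eq (chpol_dC j (hp i))) => x; rewrite mxE. Qed.

Lemma hspin0_sd j p x : hspin 0 p -> sd j p x = 0.
Proof. by move=> hp; apply/colP => i; rewrite !mxE chpol0_dC. Qed.

Lemma sdE j p x i : sd j p x i 0 = dC j (fun x => p x i 0) x.
Proof. by rewrite mxE. Qed.

Lemma sd_ext j p q x : p =1 q -> sd j p x = sd j q x.
Proof. by move=> /funext ->. Qed.

Lemma sdD d j p q x : hspin d p -> hspin d q ->
  sd j (fun x => p x + q x) x = sd j p x + sd j q x.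
Proof.
move=> hp hq; apply/colP => i; rewrite !mxE -(dCD _ _ (hp i) (hq i)).
by apply: dC_ext => z; rewrite mxE.
Qed.

Lemma sdZ d j c p x : hspin d p -> sd j (fun x => c *: p x) x = c *: sd j p x.
Proof.
move=> hp; apply/colP => i; rewrite !mxE -(dCZ _ _ _ (hp i)).
by apply: dC_ext => z; rewrite mxE.
Qed.

Lemma sd_coordM d j k p x : hspin d p ->
  sd j (fun x => (x 0 k)%:C *: p x) x = (k == j)%:R *: p x + (x 0 k)%:C *: sd j p x.
Proof.
move=> hp; apply/colP => i; rewrite !mxE -(dC_coordM _ _ _ (hp i)).
by apply: dC_ext => z; rewrite mxE.
Qed.

Lemma sd_sum (J : Type) (r : seq J) (F : J -> X -> V) d j x : (forall l, hspin d (F l)) ->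
  sd j (fun x => \sum_(l <- r) F l x) x = \sum_(l <- r) sd j (F l) x.
Proof.
move=> hF; apply/colP => i; rewrite summxE mxE.
under [RHS]eq_bigr do rewrite mxE.
rewrite -(dC_sum _ _ _ (fun l => hF l i)).
by apply: dC_ext => z; rewrite summxE.
Qed.

Lemma sd_mul d j (M : 'M[C]_N) p x : hspin d p -> sd j (fun x => M *m p x) x = M *m sd j p x.
Proof.
move=> hp; apply/colP => i; rewrite !mxE.
under [RHS]eq_bigr => l _ do rewrite mxE -(dCZ _ _ _ (hp l)).
rewrite -(dC_sum _ _ _ (fun l => chpolZ _ (hp l))).
by apply: dC_ext => z; rewrite mxE.
Qed.

Lemma sd_euler d p x : hspin d p -> \sum_j (x 0 j)%:C *: sd j p x = d%:R *: p x.
Proof.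
move=> hp; apply/colP => i; rewrite summxE !mxE -(dC_euler x (hp i)).
by apply: eq_bigr => j _; rewrite !mxE.
Qed.

Lemma sdC d p i j x : hspin d p -> sd i (sd j p) x = sd j (sd i p) x.
Proof.
move=> hp.
have e k l i0 : sd k (sd l p) x i0 0 = dC k (dC l (fun x => p x i0 0)) x.
  exact: (etrans (sdE k (sd l p) x i0) (dC_ext k x (fun z => sdE l p z i0))).
apply/matrixP => k l; rewrite ord1.
exact: (etrans (e i j k) (etrans (dCC i j x (hp k)) (esym (e j i k)))).
Qed.

Definition lapS p x : V := \sum_k sd k (sd k p) x.

Lemma hspin_edot d p : hspin d p -> hspin d.+2 (fun x => (edot x x)%:C *: p x).
Proof.
move=> hp; apply: (@hspin_eq _ (fun x => \sum_k (x 0 k)%:C *: ((x 0 k)%:C *: p x))).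
  by apply: hspin_sum => k; do 2!apply: hspin_coord.
move=> x; rewrite rmorph_sum /= scaler_suml; apply: eq_bigr => k _.
by rewrite scalerA rmorphM.
Qed.

Lemma sd_edotM d j p x : hspin d p ->
  sd j (fun x => (edot x x)%:C *: p x) x = (2 * (x 0 j)%:C) *: p x + (edot x x)%:C *: sd j p x.
Proof.
move=> hp.
have -> : (fun x : X => (edot x x)%:C *: p x) = (fun x => \sum_k (x 0 k)%:C *: ((x 0 k)%:C *: p x)).
  apply/funext => z; rewrite rmorph_sum /= scaler_suml; apply: eq_bigr => k _.
  by rewrite scalerA rmorphM.
rewrite (@sd_sum _ _ _ d.+2); last by move=> k; do 2!apply: hspin_coord.
under eq_bigr => k _ do rewrite (sd_coordM _ _ _ (hspin_coord k hp)) (sd_coordM _ _ _ hp) scalerDr addrA !scalerA.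
under eq_bigr => k _ do rewrite -scalerDl.
rewrite big_split /= -!scaler_suml; congr (_ *: _ + _ *: _).
  rewrite (bigD1 j)//= eqxx mul1r mulr1 big1 ?addr0; first by rewrite mulr2n mulrDl mul1r.
  by move=> k kj; rewrite (negPf kj) mul0r mulr0 addr0.
by rewrite /edot rmorph_sum; apply: eq_bigr => k _; rewrite /= rmorphM.
Qed.

End spinor_polynomials.

(** * Dirac operators on polynomial spinors *)

Section clifford_pair.
Context {R : realType} (m N : nat).
Local Notation n := m.+2.
Local Notation S := (@sphere R n).
Local Notation X := 'rV[R]_n.+1.
Local Notation C := R[i].
Local Notation V := 'cV[C]_N.
Implicit Types (p q : X -> V) (x : X) (d : nat) (c : C).

Local Opaque sd.

(** [A] and [B] are the two off-diagonal blocks of Clifford multiplication by R^(n+1) on a graded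
    module. Exchanging them is the symmetry behind the gauge transformation [cv B]. *)
Definition clifford_pair (A B : 'I_n.+1 -> 'M[C]_N) := forall j k,
  A j *m B k + A k *m B j = (- (2 * (j == k)%:R))%:M /\
  B j *m A k + B k *m A j = (- (2 * (j == k)%:R))%:M.

Lemma clifford_pairC A B : clifford_pair A B -> clifford_pair B A.
Proof. by move=> h j k; have [] := h j k. Qed.

Definition cv (A : 'I_n.+1 -> 'M[C]_N) x : 'M[C]_N := \sum_j (x 0 j)%:C *: A j.

(** One half of the Euclidean Dirac operator of R^(n+1): for a pair, [dir A] after [dir B] is minus
    the Laplacian. *)
Definition dir (B : 'I_n.+1 -> 'M[C]_N) p x : V := \sum_k B k *m sd k p x.

(* On S^n this is the Dirac operator plus n/2; [E p = d p] for homogeneous [p]. *)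
Definition bop A B d p x : V := - (cv A x *m dir B p x) - d%:R *: p x.

Lemma hspin_dir B d p : hspin d p -> hspin d.-1 (dir B p).
Proof. by move=> hp; apply: hspin_sum => k; apply: hspin_mul; exact: hspin_sd. Qed.

Lemma hspin_cv A d p : hspin d p -> hspin d.+1 (fun x => cv A x *m p x).
Proof.
move=> hp; apply: (@hspin_eq _ _ _ _ (fun x => \sum_j (x 0 j)%:C *: (A j *m p x))).
  by apply: hspin_sum => j; apply: hspin_coord; exact: hspin_mul.
by move=> x; rewrite /cv mulmx_suml; apply: eq_bigr => j _; rewrite scalemxAl.
Qed.

Lemma dir0 B p x : hspin 0 p -> dir B p x = 0.
Proof. by move=> hp; rewrite /dir big1// => k _; rewrite hspin0_sd// mulmx0. Qed.

Lemma hspin_cvdir A B d p : hspin d p -> hspin d (fun x => cv A x *m dir B p x).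
Proof.
case: d => [|d] hp; last exact/hspin_cv/(hspin_dir B hp).
by apply: (hspin_eq (@hspin0 R m N 0)) => x; rewrite dir0// mulmx0.
Qed.

Lemma hspin_bop A B d p : hspin d p -> hspin d (bop A B d p).
Proof.
move=> hp; apply: (hspin_eq (hspinB (hspinZ (-1) (hspin_cvdir A B hp)) (hspinZ d%:R hp))) => x.
by rewrite scaleN1r.
Qed.

Lemma sd_cv k A d p x : hspin d p ->
  sd k (fun x => cv A x *m p x) x = A k *m p x + cv A x *m sd k p x.
Proof.
move=> hp.
rewrite (@sd_ext _ _ _ k _ (fun x => \sum_j (x 0 j)%:C *: (A j *m p x))); last first.
  by move=> z; rewrite /cv mulmx_suml; apply: eq_bigr => j _; rewrite scalemxAl.
rewrite (@sd_sum _ _ _ _ _ _ d.+1); last by move=> j; apply: hspin_coord; exact: hspin_mul.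
under eq_bigr => j _ do rewrite (sd_coordM _ _ _ (hspin_mul (A j) hp)) (sd_mul _ _ _ hp).
rewrite big_split /= (bigD1 k)//= eqxx scale1r big1 ?addr0.
  by rewrite /cv mulmx_suml; congr (_ + _); apply: eq_bigr => j _; rewrite scalemxAl.
by move=> j /negPf ->; rewrite scale0r.
Qed.

Section pair.
Variables A B : 'I_n.+1 -> 'M[C]_N.
Hypothesis hAB : clifford_pair A B.

Let two : (2 : C) != 0. Proof. by rewrite pnatr_eq0. Qed.

Lemma pair_sq k : B k *m A k = (-1)%:M.
Proof.
have := (hAB k k).2; rewrite eqxx mulr1 => h.
by apply: (scalerI two); rewrite scaler_nat mulr2n h scale_scalar_mx mulrN1.
Qed.

Lemma pair_cv k x (v : V) : B k *m (cv A x *m v) = - (2 * (x 0 k)%:C) *: v - cv B x *m (A k *m v).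
Proof.
rewrite !mulmxA -[_ *: v]mul_scalar_mx -mulmxBl; congr (_ *m v).
rewrite /cv mulmx_sumr mulmx_suml.
transitivity (\sum_j (x 0 j)%:C *: ((- (2 * (k == j)%:R))%:M - B j *m A k)).
  by apply: eq_bigr => j _; rewrite -scalemxAr -(hAB k j).2 addrK.
under eq_bigr => j _ do rewrite scalerBr.
rewrite sumrB; congr (_ - _); last by apply: eq_bigr => j _; rewrite scalemxAl.
rewrite (bigD1 k)//= eqxx big1 ?addr0; last first.
  by move=> j jk; rewrite eq_sym (negPf jk) mulr0 oppr0 raddf0 scaler0.
by rewrite scale_scalar_mx; congr (_%:M); rewrite /=; ring.
Qed.

(** For symmetric [F] only the symmetrised products A_j B_k + A_k B_j enter. *)
Lemma pair_sum2 (F : 'I_n.+1 -> 'I_n.+1 -> V) : (forall j k, F j k = F k j) ->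
  \sum_j \sum_k (A j *m B k) *m F j k = - \sum_k F k k.
Proof.
move=> FC; apply: (scalerI two); rewrite scaler_nat mulr2n {2}exchange_big /= -big_split /=.
transitivity (\sum_j (- 2) *: F j j); last by rewrite -scaler_sumr scaleNr scalerN.
apply: eq_bigr => j _; rewrite -big_split /=.
transitivity (\sum_k (- (2 * (j == k)%:R)) *: F j k).
  by apply: eq_bigr => k _; rewrite (FC k j) -mulmxDl (hAB j k).1 mul_scalar_mx.
rewrite (bigD1 j)//= eqxx mulr1 big1 ?addr0// => k kj.
by rewrite eq_sym (negPf kj) mulr0 oppr0 scale0r.
Qed.

Lemma cv_mul x (v : V) : cv A x *m (cv B x *m v) = - (edot x x)%:C *: v.
Proof.
transitivity (\sum_j \sum_k (A j *m B k) *m (((x 0 j)%:C * (x 0 k)%:C) *: v)).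
  rewrite mulmxA /cv mulmx_suml mulmx_suml; apply: eq_bigr => j _.
  rewrite mulmx_sumr mulmx_suml; apply: eq_bigr => k _.
  by rewrite -scalemxAl -scalemxAr scalerA -scalemxAl -[RHS]scalemxAr.
rewrite pair_sum2; last by move=> j k; rewrite mulrC.
by rewrite -scaler_suml scaleNr /edot rmorph_sum /=; under [in RHS]eq_bigr do rewrite rmorphM.
Qed.

Lemma dir_dir d p x : hspin d p -> dir A (dir B p) x = - lapS p x.
Proof.
move=> hp; rewrite -(@pair_sum2 (fun j k => sd j (sd k p) x)); last by move=> j k; exact: sdC hp.
apply: eq_bigr => j _.
have -> : sd j (dir B p) x = \sum_k sd j (fun x => B k *m sd k p x) x.
  by apply: (@sd_sum _ _ _ _ _ _ d.-1) => k; apply: hspin_mul; exact: hspin_sd.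
rewrite mulmx_sumr; apply: eq_bigr => k _.
by rewrite (sd_mul _ _ _ (hspin_sd k hp)) mulmxA.
Qed.

Lemma dir_cv d p x : hspin d p ->
  dir B (fun x => cv A x *m p x) x = - (n.+1 + d.*2)%:R *: p x - cv B x *m dir A p x.
Proof.
move=> hp; rewrite /dir.
under eq_bigr => k _ do rewrite (sd_cv _ _ _ hp) mulmxDr mulmxA pair_sq pair_cv mul_scalar_mx.
rewrite big_split /= sumr_const card_ord sumrB -mulmx_sumr addrA; congr (_ - _).
under eq_bigr => k _ do rewrite -mulNr -scalerA.
rewrite -scaler_sumr (sd_euler x hp); apply/matrixP => i j.
by rewrite -scaler_nat !mxE natrD -addnn natrD; ring.
Qed.

Lemma dirD d p q x : hspin d p -> hspin d q ->
  dir B (fun x => p x + q x) x = dir B p x + dir B q x.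
Proof.
move=> hp hq; rewrite /dir -big_split /=; apply: eq_bigr => k _.
by rewrite (sdD _ _ hp hq) mulmxDr.
Qed.

Lemma dirZ d c p x : hspin d p -> dir B (fun x => c *: p x) x = c *: dir B p x.
Proof.
move=> hp; rewrite /dir scaler_sumr; apply: eq_bigr => k _.
by rewrite (sdZ _ _ _ hp) scalemxAr.
Qed.

Lemma bopD d p q x : hspin d p -> hspin d q ->
  bop A B d (fun x => p x + q x) x = bop A B d p x + bop A B d q x.
Proof.
move=> hp hq; rewrite /bop (dirD x hp hq) mulmxDr scalerDr.
by apply/matrixP => i j; rewrite !mxE; ring.
Qed.

Lemma bopZ d c p x : hspin d p -> bop A B d (fun x => c *: p x) x = c *: bop A B d p x.
Proof.
move=> hp; rewrite /bop (dirZ c x hp) -scalemxAr.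
by apply/matrixP => i j; rewrite !mxE; ring.
Qed.

Lemma bop0 p x : hspin 0 p -> bop A B 0 p x = 0.
Proof. by move=> hp; rewrite /bop (dir0 _ _ hp) mulmx0 scale0r oppr0 addr0. Qed.

Lemma dir_bop d p x : hspin d p ->
  dir B (bop A B d p) x = (m.+1 + d)%:R *: dir B p x - cv B x *m lapS p x.
Proof.
move=> hp; case: d hp => [|d] hp.
  rewrite (dir0 B x (hspin_bop A B hp)) dir0// scaler0 sub0r.
  rewrite /lapS big1 ?mulmx0 ?oppr0// => k _; rewrite (@hspin0_sd _ _ _ k)//.
  exact: (hspin_sd k hp).
have hd := hspin_dir B hp; rewrite /= in hd.
have h1 := hspin_cv A hd.
have -> : dir B (bop A B d.+1 p) x =
    dir B (fun x => (-1) *: (cv A x *m dir B p x) + (- d.+1%:R) *: p x) x.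
  by congr (dir B _ x); apply/funext => z; rewrite /bop scaleN1r scaleNr.
rewrite (dirD x (hspinZ _ h1) (hspinZ _ hp)) (dirZ _ x h1) (dirZ _ x hp).
rewrite (dir_cv x hd) (dir_dir x hp) mulmxN opprK scalerDr.
move: (dir B p x) (cv B x *m lapS p x) => s w.
by apply/matrixP => i j; rewrite !mxE -addnn !natrD -!natr1; ring.
Qed.

(* The Lichnerowicz-type identity [B (B - (n - 1)) = E (E + n - 1) - |x|^2 Lap]. *)
Lemma bop_square d p x : hspin d p ->
  bop A B d (bop A B d p) x - m.+1%:R *: bop A B d p x =
  (d%:R * (d + m.+1)%:R) *: p x - (edot x x)%:C *: lapS p x.
Proof.
move=> hp; rewrite {1}/bop (dir_bop x hp) mulmxBr cv_mul -scalemxAr /bop.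
move: (cv A x *m dir B p x) (lapS p x) => w l.
by apply/matrixP => i j; rewrite !mxE !natrD -!natr1; ring.
Qed.

(** [bop] has no radial part: the term in d cancels the radial derivative of the Dirac term, so
    |x|^2 passes through. *)
Lemma bop_edot d p x : hspin d p ->
  bop A B d.+2 (fun x => (edot x x)%:C *: p x) x = (edot x x)%:C *: bop A B d p x.
Proof.
move=> hp; rewrite /bop.
have -> : dir B (fun x => (edot x x)%:C *: p x) x = 2 *: (cv B x *m p x) + (edot x x)%:C *: dir B p x.
  rewrite /dir; under eq_bigr => k _ do rewrite (sd_edotM _ _ hp) mulmxDr -!scalemxAr -scalerA.
  rewrite big_split /= -!scaler_sumr; congr (_ *: _ + _).
  by rewrite /cv mulmx_suml; apply: eq_bigr => k _; rewrite scalemxAl.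
rewrite mulmxDr -!scalemxAr cv_mul; move: (cv A x *m _) => w.
by apply/matrixP => i j; rewrite !mxE -!natr1; ring.
Qed.

End pair.

(** The Dirac eigenvalue is b - n/2, so b -> n - b is a change of sign: the gauge transformation
    exchanges D with minus its counterpart for the swapped pair. *)
Lemma bop_swap A B d p x (b : C) : clifford_pair A B -> hspin d p -> bop A B d p x = b *: p x ->
  bop B A d.+1 (fun x => cv B x *m p x) x = (n%:R - b) *: (cv B x *m p x).
Proof.
move=> /clifford_pairC hBA hp e; rewrite /bop (dir_cv hBA x hp).
have h : cv A x *m dir B p x = - (b *: p x) - d%:R *: p x by rewrite -e /bop opprD !opprK addrK.
rewrite h.
have -> : - (n.+1 + d.*2)%:R *: p x - (- (b *: p x) - d%:R *: p x) = (b - (n.+1 + d)%:R) *: p x.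
  by apply/matrixP => i j; rewrite !mxE -addnn !natrD -!natr1; ring.
rewrite -scalemxAr; move: (cv B x *m p x) => w.
by apply/matrixP => i j; rewrite !mxE !natrD -!natr1; ring.
Qed.

Lemma hspin_bop_sum A B d (J : Type) (r : seq J) (F : J -> X -> V) x : (forall l, hspin d (F l)) ->
  bop A B d (fun x => \sum_(l <- r) F l x) x = \sum_(l <- r) bop A B d (F l) x.
Proof.
move=> hF; elim: r => [|l r ih].
  rewrite big_nil (_ : (fun x => _) = fun x => 0 *: (0 : V)); last first.
    by apply/funext => z; rewrite big_nil scale0r.
  by rewrite (bopZ A B 0 x (@hspin0 R m N d)) scale0r.
rewrite big_cons -ih -(bopD A B x (hF l)); last exact: hspin_sum.
by congr (bop _ _ _ _ x); apply/funext => z; rewrite big_cons.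
Qed.

(** The eigenvalues of [bop], symmetric about n/2: even indices give 0, -1, -2, ..., odd ones n, n +
    1, ... *)
Definition beta (i : nat) : C := if odd i then (i./2 + n)%:R else - (i./2)%:R.

Definition eigp A B d i p := hspin d p /\ forall x, bop A B d p x = beta i *: p x.

Section decomposition.
Variables A B : 'I_n.+1 -> 'M[C]_N.
Hypothesis hAB : clifford_pair A B.
Local Notation bopAB := (bop A B).

Lemma eigp0 d i : eigp A B d i (fun _ => 0).
Proof.
split; first exact: hspin0.
move=> x; rewrite (_ : (fun _ => 0) = fun x => 0 *: (0 : V)); last by apply/funext => z; rewrite scale0r.
by rewrite (bopZ A B 0 x (@hspin0 R m N d)) !scale0r scaler0.
Qed.

Lemma eigpZ d i c p : eigp A B d i p -> eigp A B d i (fun x => c *: p x).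
Proof.
move=> [hp e]; split; first exact: hspinZ.
by move=> x; rewrite (bopZ A B c x hp) e !scalerA mulrC.
Qed.

Lemma eigp_edot d i p : eigp A B d i p -> eigp A B d.+2 i (fun x => (edot x x)%:C *: p x).
Proof.
move=> [hp e]; split; first exact: hspin_edot.
by move=> x; rewrite (bop_edot hAB x hp) e !scalerA mulrC.
Qed.

(** ([bop] - (d + n - 1)) ([bop] + d) applied to p; where it vanishes, p splits into two
    eigenspinors. *)
Let defect d p x := bopAB d (bopAB d p) x - m.+1%:R *: bopAB d p x - (d%:R * (d + m.+1)%:R) *: p x.

(** The two Lagrange projectors for the roots d + n and - (d + 1) of the quadratic polynomial in
    degree d + 1; their difference is 1 / c. *)
Lemma eigp_split d r : hspin d.+1 r -> (forall x, defect d.+1 r x = 0) ->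
  exists u v, [/\ eigp A B d.+1 d.*2.+1 u, eigp A B d.+1 d.*2.+2 v & forall x, r x = u x + v x].
Proof.
move=> hr hd; have hb := hspin_bop A B hr.
pose c : C := (d.*2 + n.+1)%:R^-1.
have c0 : (d.*2 + n.+1)%:R != 0 :> C by rewrite pnatr_eq0 addnS.
have cD : (d.+1%:R + (d.+1 + m.+1)%:R) = (d.*2 + n.+1)%:R :> C.
  by rewrite -natrD; congr _%:R; lia.
have b1 : beta d.*2.+1 = (d.+1 + m.+1)%:R :> C.
  by rewrite /beta /= odd_double /= uphalf_double; congr _%:R; lia.
have b2 : beta d.*2.+2 = - d.+1%:R :> C by rewrite /beta /= odd_double /= doubleK.
have bb x : bopAB d.+1 (bopAB d.+1 r) x = m.+1%:R *: bopAB d.+1 r x + (d.+1%:R * (d.+1 + m.+1)%:R) *: r x.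
  by apply/eqP; rewrite -subr_eq0 opprD addrA; apply/eqP; exact: hd.
exists (fun x => c *: (bopAB d.+1 r x + d.+1%:R *: r x)),
       (fun x => (- c) *: (bopAB d.+1 r x + (- (d.+1 + m.+1)%:R) *: r x)); split.
- split; first by apply: hspinZ; apply: hspinD => //; exact: hspinZ.
  move=> x; rewrite (bopZ A B c x (hspinD hb (hspinZ _ hr))) (bopD A B x hb (hspinZ _ hr)).
  rewrite (bopZ A B _ x hr) bb b1; move: (bopAB d.+1 r x) (r x) => u v.
  by apply/matrixP => i j; rewrite !mxE !natrD -!natr1; ring.
- split; first by apply: hspinZ; apply: hspinD => //; exact: hspinZ.
  move=> x; rewrite (bopZ A B _ x (hspinD hb (hspinZ _ hr))) (bopD A B x hb (hspinZ _ hr)).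
  rewrite (bopZ A B _ x hr) bb b2; move: (bopAB d.+1 r x) (r x) => u v.
  by apply/matrixP => i j; rewrite !mxE !natrD -!natr1; ring.
move=> x; move: (bopAB d.+1 r x) (r x) => u v.
transitivity (c *: ((d.+1%:R + (d.+1 + m.+1)%:R) *: v)).
  by rewrite cD scalerA mulVf// scale1r.
rewrite scaleNr -scalerBr; congr (c *: _); apply/matrixP => i j; rewrite !mxE; ring.
Qed.

(** Minus the inverse, at [beta i], of the quadratic polynomial for degree d + 2; it has no zero at
    the indices coming from degree d. *)
Let coef d i : C := - ((beta i + d.+2%:R) * (beta i - (d.+2 + m.+1)%:R))^-1.

Let coefE d i : (i < d.*2.+1)%N -> coef d i * ((beta i + d.+2%:R) * (beta i - (d.+2 + m.+1)%:R)) = -1.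
Proof.
move=> id; rewrite mulNr mulVf// mulf_neq0// /beta; case: ifP => oi.
- by rewrite -natrD pnatr_eq0 !addnS.
- rewrite addrC subr_eq0 eqr_nat; apply/eqP => h.
  by have := odd_double_half i; rewrite oi; lia.
- rewrite subr_eq0 eqr_nat; apply/eqP => h.
  by have := odd_double_half i; rewrite oi; lia.
by rewrite -opprD oppr_eq0 -natrD pnatr_eq0 !addnS.
Qed.

(** Strong induction on the degree. The defect of p is -|x|^2 times its Laplacian, which has degree
    two less and is decomposed already; subtracting a multiple of each of those components, times
    |x|^2, leaves a remainder without defect, to which [eigp_split] applies. *)
Lemma eigp_decomp d p : hspin d p -> exists phi : nat -> X -> V,
  (forall i, eigp A B d i (phi i)) /\ forall x, p x = \sum_(i < d.*2.+1) phi i x.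
Proof.
elim/ltn_ind: d p => -[|d] ih p hp.
  exists (fun i => if i == 0%N then p else fun _ => 0); split.
    case=> [|i] /=; last exact: eigp0.
    by split=> // x; rewrite bop0// /beta /= oppr0 scale0r.
  by move=> x; rewrite big_ord_recl big_ord0 addr0.
(* [d.*2.-1] counts the indices for degree d - 1, and is 0 for d = 0, where the Laplacian
   vanishes. *)
have [phi [phiE lapE]] : exists phi : nat -> X -> V, (forall i, eigp A B d.+1 i (phi i)) /\
    forall x, defect d.+1 p x = \sum_(i < d.*2.-1)
      ((beta i + d.+1%:R) * (beta i - (d.+1 + m.+1)%:R)) *: phi i x.
  have dE x : defect d.+1 p x = - ((edot x x)%:C *: lapS p x).
    by rewrite /defect (bop_square hAB x hp) addrAC subrr add0r.
  case: d ih hp dE => [|d] ih hp dE.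
    exists (fun _ _ => 0); split=> [i|x]; first exact: eigp0.
    rewrite big_ord0 dE /lapS big1 ?scaler0 ?oppr0// => k _.
    by rewrite (@hspin0_sd _ _ _ k)//; exact: (hspin_sd k hp).
  have hl : hspin d (lapS p).
    apply: hspin_sum => k; exact: (hspin_sd k (hspin_sd k hp)).
  have [phi [phiE lE]] := ih d (leqnSn _) _ hl.
  exists (fun i x => coef d i *: ((edot x x)%:C *: phi i x)); split.
    by move=> i; apply: eigpZ; exact: eigp_edot.
  move=> x; rewrite dE lE scaler_sumr -sumrN doubleS /=; apply: eq_bigr => i _.
  by rewrite [RHS]scalerA mulrC coefE ?scaleN1r//; have := ltn_ord i; lia.
pose q x := \sum_(i < d.*2.-1) phi i x.
have hq : hspin d.+1 q by apply: hspin_sum => i; case: (phiE i).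
have hr : hspin d.+1 (fun x => p x + (-1) *: q x) by apply: hspinD => //; exact: hspinZ.
have defD u v x : hspin d.+1 u -> hspin d.+1 v ->
    defect d.+1 (fun x => u x + (-1) *: v x) x = defect d.+1 u x - defect d.+1 v x.
  move=> hu hv; have hv' := hspinZ (-1) hv.
  have e z : bopAB d.+1 (fun x => u x + (-1) *: v x) z = bopAB d.+1 u z + (-1) *: bopAB d.+1 v z.
    by rewrite (bopD A B z hu hv') (bopZ A B _ z hv).
  have -> : defect d.+1 (fun x => u x + (-1) *: v x) x =
     bopAB d.+1 (fun z => bopAB d.+1 u z + (-1) *: bopAB d.+1 v z) x
     - m.+1%:R *: (bopAB d.+1 u x + (-1) *: bopAB d.+1 v x)
     - (d.+1%:R * (d.+1 + m.+1)%:R) *: (u x + (-1) *: v x).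
    by rewrite /defect (funext e).
  rewrite (bopD A B x (hspin_bop A B hu) (hspinZ _ (hspin_bop A B hv))) (bopZ A B _ x (hspin_bop A B hv)).
  rewrite /defect; move: (bopAB _ (bopAB _ u) x) (bopAB _ (bopAB _ v) x) (bopAB _ u x) (bopAB _ v x) => a1 a2 a3 a4.
  by apply/matrixP => i j; rewrite !mxE; ring.
have defq x : defect d.+1 q x = \sum_(i < d.*2.-1)
      ((beta i + d.+1%:R) * (beta i - (d.+1 + m.+1)%:R)) *: phi i x.
  have e z : bopAB d.+1 q z = \sum_(i < d.*2.-1) beta i *: phi i z.
    rewrite (hspin_bop_sum A B _ z (fun i => (phiE (nat_of_ord i)).1)).
    by apply: eq_bigr => i _; rewrite (phiE i).2.
  have -> : defect d.+1 q x = bopAB d.+1 (fun z => \sum_(i < d.*2.-1) beta i *: phi i z) x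
     - m.+1%:R *: (\sum_(i < d.*2.-1) beta i *: phi i x)
     - (d.+1%:R * (d.+1 + m.+1)%:R) *: \sum_(i < d.*2.-1) phi i x.
    by rewrite /defect (funext e).
  rewrite (hspin_bop_sum A B _ x (fun i => hspinZ _ (phiE (nat_of_ord i)).1)) !scaler_sumr -!sumrB.
  apply: eq_bigr => i _; rewrite (bopZ A B _ x (phiE i).1) (phiE i).2.
  move: (beta i) (phi i x) => b v.
  by apply/matrixP => k l; rewrite !mxE !natrD -!natr1; ring.
have [u [v [hu hv rE]]] := eigp_split hr (fun x => etrans (defD p q x hp hq) (etrans (f_equal2 (fun a b => a - b) (lapE x) (defq x)) (subrr _))).
exists (fun i => if (i < d.*2.-1)%N then phi i else if i == d.*2.+1 then u else if i == d.*2.+2 then v else fun _ => 0).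
split.
  move=> i; case: ifP => // _; case: eqP => [->//|_]; case: eqP => [->//|_]; exact: eigp0.
move=> x; have := rE x; rewrite scaleN1r => /eqP; rewrite subr_eq => /eqP ->.
rewrite doubleS big_ord_recr big_ord_recr /= ltnNge (_ : (d.*2.-1 <= d.*2.+1)%N) /=; last by lia.
rewrite eqxx ltnNge (_ : (d.*2.-1 <= d.*2.+2)%N) /=; last by lia.
rewrite (_ : (d.*2.+2 == d.*2.+1) = false); last by lia.
rewrite eqxx [u x + v x + _]addrC addrA; congr (_ + _ + _).
rewrite -!(big_mkord xpredT (fun i => (if (i < d.*2.-1)%N then phi i else if i == d.*2.+1 then u else if i == d.*2.+2 then v else fun _ => 0) x)).
rewrite /q -(big_mkord xpredT (fun i => phi i x)).
rewrite [RHS](@big_cat_nat _ _ _ d.*2.-1)//=; last by lia.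
rewrite [X in _ = _ + X](_ : _ = 0) ?addr0; last first.
  rewrite big_nat_cond big1// => i /andP[/andP[h1 h2] _]; rewrite ltnNge h1 /= (_ : (i == d.*2.+1) = false); last by lia.
  by rewrite (_ : (i == d.*2.+2) = false)//; lia.
by apply: eq_big_nat => i /andP[_ ->].
Qed.

(** On |x| = 1 [bop_square] expresses the Laplacian through the eigenvalue. The degree k of the
    harmonics is read off b and not off the degree d of p, which may contain factors |x|^2. *)
Lemma eigp_harmonic d p (b : R) k i : hspin d p -> (forall x, bopAB d p x = b%:C *: p x) ->
  b * (b - m.+1%:R) = k%:R * (k + m.+1)%:R ->
  harmonic_comp k (fun x => complex.Re (p x i 0)) /\ harmonic_comp k (fun x => complex.Im (p x i 0)).
Proof.
move=> hp e be; have [h1 h2] := hp i.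
have lE x : S x -> lapS p x = ((d%:R * (d + m.+1)%:R - k%:R * (k + m.+1)%:R : R))%:C *: p x.
  move=> Sx; have := bop_square hAB x hp; rewrite (_ : edot x x = 1)// scale1r.
  have -> : bopAB d (bopAB d p) x = (b * b)%:C *: p x.
    have -> : bopAB d p = fun x => b%:C *: p x by apply/funext.
    by rewrite (bopZ A B _ x hp) e scalerA -rmorphM.
  rewrite e => /eqP; rewrite eq_sym subr_eq addrC -subr_eq => /eqP <-.
  rewrite -be; apply/matrixP => u v; rewrite !mxE !rmorphB !rmorphM /= rmorphB /= !rmorph_nat.
  by ring.
have lR x : S x -> lap (fun x => complex.Re (p x i 0)) x +i* lap (fun x => complex.Im (p x i 0)) x =
    ((d%:R * (d + m.+1)%:R - k%:R * (k + m.+1)%:R : R))%:C * p x i 0.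
  move=> Sx; have := lE x Sx => /(congr1 (fun v : V => v i 0)); rewrite mxE => <-.
  pose f x := p x i 0.
  have e2 j : sd j (sd j p) x i 0 = dC j (dC j f) x.
    exact: (etrans (sdE j (sd j p) x i) (dC_ext j x (fun z => sdE j p z i))).
  rewrite /lapS summxE (eq_bigr _ (fun j _ => e2 j)) [RHS]complexE !raddf_sum /=.
  by [].
split; apply: (hpol_harmonic _ (d := d)) => // x Sx.
  by have := congr1 (@complex.Re R) (lR x Sx); rewrite complex_ReM /= => ->; ring.
by have := congr1 (@complex.Im R) (lR x Sx); rewrite complex_ImM /= => ->; ring.
Qed.

End decomposition.
End clifford_pair.

Section complex_rows.
Context {R : realType} (n : nat).
Local Notation N := (spinor_rank n).
Local Notation C := R[i].
Implicit Types (u v w : 'cV[C]_N).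

(** The argument runs in the underlying real Hilbert space; the Hermitian product is recovered by
    [l2dotE]. *)
Definition rdot u v : R := complex.Re (cdot u v).

Lemma rdotE u v : rdot u v =
  \sum_i (complex.Re (u i 0) * complex.Re (v i 0) + complex.Im (u i 0) * complex.Im (v i 0)).
Proof.
rewrite /rdot /cdot raddf_sum; apply: eq_bigr => i _ /=.
by case: (u i 0) (v i 0) => a b [c d] /=; rewrite mulrN opprK.
Qed.

Lemma rdotC u v : rdot u v = rdot v u.
Proof. by rewrite !rdotE; apply: eq_bigr => i _; ring. Qed.

Lemma rdotDl u v w : rdot (u + v) w = rdot u w + rdot v w.
Proof. by rewrite !rdotE -big_split /=; apply: eq_bigr => i _; rewrite mxE !raddfD /=; ring. Qed.

Lemma rdotZl (c : R) u v : rdot (c%:C *: u) v = c * rdot u v.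
Proof.
rewrite !rdotE mulr_sumr; apply: eq_bigr => i _; rewrite mxE complex_ReM complex_ImM /=.
by ring.
Qed.

Lemma cnorm_sqr u : cnorm u ^+ 2 = rdot u u.
Proof.
rewrite /cnorm sqr_sqrtr// -/(rdot u u) rdotE sumr_ge0// => i _.
by rewrite addr_ge0// -expr2 sqr_ge0.
Qed.

Lemma cnorm_ge0 u : 0 <= cnorm u. Proof. exact: sqrtr_ge0. Qed.

Lemma cdot_mx u v : cdot u v = ((map_mx conjc v)^T *m u) 0 0.
Proof. by rewrite mxE; apply: eq_bigr => i _; rewrite !mxE mulrC. Qed.

End complex_rows.

Lemma derive_partial {R : realType} n (f : 'rV[R]_n.+1 -> R) (x v : 'rV[R]_n.+1) :
  differentiable f x -> 'D_v f x = \sum_k v 0 k * partial k f x.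
Proof.
move=> df; rewrite deriveE// {1}[v]row_sum_delta linear_sum; apply: eq_bigr => k _.
by rewrite linearZ /partial deriveE.
Qed.

(** * Eigenspinors of the Dirac operator *)

Section spinor_eigen.
Context {R : realType} (m : nat).
Local Notation n := m.+2.
Local Notation N := (spinor_rank n).
Local Notation S := (@sphere R n).
Local Notation X := 'rV[R]_n.+1.
Local Notation C := R[i].
Local Notation V := 'cV[C]_N.
Variable gamma : 'I_n -> 'M[C]_N.
Hypothesis cl : clifford_rep gamma.
Implicit Types (x : X) (p q : spinor R n).

Local Opaque sd.

(* Clifford multiplication by X at x is cv gA X *m cv gB x. *)
Definition gA (j : 'I_n.+1) : 'M[C]_N := if unlift ord0 j is Some i then gamma i else (-1)%:M.
Definition gB (j : 'I_n.+1) : 'M[C]_N := if unlift ord0 j is Some i then gamma i else 1%:M.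

Lemma cv_gA x : cv gA x = gamma_vec gamma x - ((x 0 0)%:C)%:M.
Proof.
rewrite /cv big_ord_recl /gA unlift_none scale_scalar_mx mulrN1 addrC.
have -> : (- (x 0 0)%:C)%:M = - ((x 0 0)%:C)%:M :> 'M[C]_N by rewrite raddfN.
by congr (_ - _); rewrite /gamma_vec; apply: eq_bigr => i _; rewrite liftK.
Qed.

Lemma cv_gB x : cv gB x = gamma_vec gamma x + ((x 0 0)%:C)%:M.
Proof.
rewrite /cv big_ord_recl /gB unlift_none scale_scalar_mx mulr1 addrC.
by congr (_ + _); rewrite /gamma_vec; apply: eq_bigr => i _; rewrite liftK.
Qed.

Lemma gpair : clifford_pair gA gB.
Proof.
have [c1 _] := cl; move=> j k; rewrite /gA /gB.
have [j' ->|->] := unliftP ord0 j; have [k' ->|->] := unliftP ord0 k.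
- by rewrite (inj_eq (@lift_inj _ ord0)); split; exact: c1.
- rewrite [lift _ _ == _]eq_sym (negPf (neq_lift _ _)) /= mulr0 oppr0 raddf0.
  by rewrite !mul_scalar_mx !mul_mx_scalar scaleN1r scale1r; split; [rewrite subrr|rewrite addNr].
- rewrite (negPf (neq_lift _ _)) /= mulr0 oppr0 raddf0.
  by rewrite !mul_scalar_mx !mul_mx_scalar scaleN1r scale1r; split; [rewrite addNr|rewrite subrr].
by rewrite eqxx mulr1 !mul_scalar_mx !scale_scalar_mx mulr1 mul1r -raddfD /= -opprD; split.
Qed.

Lemma cvBAK x (v : V) : S x -> cv gA x *m (cv gB x *m v) = - v.
Proof. by move=> Sx; rewrite (cv_mul gpair) (_ : edot x x = 1)// scaleN1r. Qed.

Lemma cvB_adj x : (map_mx conjc (cv gB x))^T = - cv gA x.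
Proof.
have [_ c2] := cl; rewrite /cv map_mx_sum raddf_sum /= -sumrN; apply: eq_bigr => j _.
rewrite map_mxZ linearZ /= oppr0 -scalerN; congr (_ *: _); rewrite /gA /gB.
case: (unlift _ _) => [i|]; first exact: c2.
by rewrite map_scalar_mx tr_scalar_mx /= oppr0 raddfN opprK.
Qed.

Lemma cdot_cvB x (u v : V) : S x -> cdot (cv gB x *m u) (cv gB x *m v) = cdot u v.
Proof.
move=> Sx; rewrite !cdot_mx map_mxM trmx_mul cvB_adj -mulmxA mulNmx cvBAK// opprK.
by [].
Qed.

Lemma tangent_edot x j : S x -> edot (tangent_proj x (delta_mx 0 j)) x = 0.
Proof.
move=> Sx; have e : edot (delta_mx 0 j) x = x 0 j.
  rewrite /edot (bigD1 j)//= mxE !eqxx mul1r big1 ?addr0// => i ij.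
  by rewrite mxE (negPf ij) andbF mul0r.
rewrite /tangent_proj e /edot; under eq_bigr => i _ do rewrite !mxE mulrBl.
rewrite sumrB; have -> : \sum_(i < n.+1) ((0 == 0 :> 'I_1) && (i == j))%:R * x 0 i = x 0 j.
  rewrite (bigD1 j)//= eqxx mul1r big1 ?addr0// => i ij.
  by rewrite (negPf ij) mul0r.
by under eq_bigr => i _ do rewrite -mulrA; rewrite -mulr_sumr sphere_sum// mulr1 subrr.
Qed.

Lemma tangentE x j k : tangent_proj x (delta_mx 0 j) 0 k = (k == j)%:R - x 0 j * x 0 k.
Proof.
rewrite /tangent_proj !mxE eqxx /=; congr (_ - _ * _).
rewrite /edot (bigD1 j)//= mxE !eqxx mul1r big1 ?addr0// => i ij.
by rewrite mxE (negPf ij) andbF mul0r.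
Qed.

Lemma flat_deriv_hom d p x (v : X) : hspin d p -> S x -> edot v x = 0 ->
  flat_deriv p x v = \sum_k (v 0 k)%:C *: sd k p x.
Proof.
move=> hp Sx vx; apply/colP => i; rewrite mxE summxE.
under [RHS]eq_bigr => k _ do rewrite mxE sdE.
have [h1 h2] := hp i.
have key h : hpol d h -> 'D_v (fun y => h ((enorm y)^-1 *: y)) x = \sum_k v 0 k * partial k h x.
  move=> hh; rewrite derive_partial; last by have [] := partial_ray 0 hh Sx.
  under eq_bigr => k _ do rewrite (partial_ray k hh Sx).2 mulrBr [v 0 k * (x 0 k * _)]mulrA.
  by rewrite sumrB -mulr_suml -/(edot v x) vx mul0r subr0.
rewrite /re_coord /im_coord (key _ h1) (key _ h2) [RHS]complexE !raddf_sum /=.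
by congr (_ +i* _); apply: eq_bigr => k _; rewrite mul0r ?subr0 ?addr0.
Qed.

(** The flat part of the connection gives [bop]. The spin part is half the sum of the squares of
    Clifford multiplication by a Parseval frame of the n-dimensional tangent space, that is -n/2. *)
Lemma dirac_hom d p x : hspin d p -> S x ->
  dirac_diff gamma p x = bop gA gB d p x - (n%:R / 2 : R)%:C *: p x.
Proof.
move=> hp Sx; rewrite /dirac_diff.
pose e j : X := tangent_proj x (delta_mx 0 j).
have ce j : clifford gamma x (e j) = (gA j + (x 0 j)%:C *: - cv gA x) *m cv gB x.
  rewrite /clifford /even_clifford -cv_gA -cv_gB; congr (_ *m _).
  rewrite /cv; under eq_bigr => k _ do rewrite tangentE rmorphB rmorphM /= scalerBl -scalerA.
  rewrite sumrB -scaler_sumr scalerN; congr (_ - _).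
  rewrite (bigD1 j)//= eqxx scale1r big1 ?addr0// => k /negPf ->; exact: scale0r.
have csq j (v : V) : clifford gamma x (e j) *m (clifford gamma x (e j) *m v) = - (edot (e j) (e j))%:C *: v.
  have two : (2 : C) != 0 by rewrite pnatr_eq0.
  have h := clifford_tangent cl Sx (tangent_edot j Sx) (tangent_edot j Sx).
  rewrite mulmxA; apply: (scalerI two); rewrite scalemxAl scaler_nat mulr2n h mul_scalar_mx scalerA.
  by rewrite mulNr !rmorphN rmorphM rmorph_nat mulrN.
under eq_bigr => j _ do rewrite -/(e j) /nabla (flat_deriv_hom hp Sx (tangent_edot j Sx)) mulmxDr -scalemxAr csq.
rewrite big_split /= -scaler_sumr.
(* The squared norms of the frame sum to n, the trace of the tangential projection. *)
have -> : \sum_j - (edot (e j) (e j))%:C *: p x = - n%:R *: p x.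
  rewrite -scaler_suml; congr (_ *: _); rewrite sumrN -rmorph_sum /= -(rmorph_nat (real_complex R)).
  congr (- _%:C).
  transitivity (\sum_(j < n.+1) (1 - x 0 j * x 0 j)).
    apply: eq_bigr => j _; rewrite /edot; under eq_bigr => k _ do rewrite !tangentE.
    transitivity (\sum_(k < n.+1) ((k == j)%:R * (1 - 2 * (x 0 j * x 0 j)) + (x 0 j * x 0 j) * (x 0 k * x 0 k))).
      by apply: eq_bigr => k _; case: eqP => [->|_] /=; ring.
    have s1 : \sum_(k < n.+1) (k == j)%:R = 1 :> R.
      by rewrite (bigD1 j)//= eqxx big1 ?addr0// => k /negPf ->.
    by rewrite big_split /= -mulr_suml -mulr_sumr s1 sphere_sum//; ring.
  by rewrite sumrB sphere_sum// sumr_const card_ord -[n.+1%:R]natr1 addrK.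
have -> : 2^-1 *: (- n%:R *: p x) = - ((n%:R / 2 : R)%:C *: p x).
  by rewrite scalerA mulrN scaleNr rmorphM fmorphV !rmorph_nat mulrC.
congr (_ - _).
under eq_bigr => j _ do rewrite mulmx_sumr.
rewrite exchange_big /=.
transitivity (\sum_k (gA k + (x 0 k)%:C *: - cv gA x) *m (cv gB x *m sd k p x)).
  apply: eq_bigr => k _.
  under eq_bigr => j _ do rewrite -scalemxAr ce -mulmxA scalemxAl.
  rewrite -mulmx_suml; congr (_ *m _).
  under eq_bigr => j _ do rewrite tangentE rmorphB rmorphM /= scalerBl scalerDr.
  rewrite sumrB big_split /= (bigD1 k)//= eqxx scale1r big1 ?addr0; last first.
    by move=> j jk; rewrite eq_sym (negPf jk) scale0r.
  have -> : \sum_(i < n.+1) (k == i)%:R%:C *: ((x 0 i)%:C *: - cv gA x) = (x 0 k)%:C *: - cv gA x.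
    rewrite (bigD1 k)//= eqxx scale1r big1 ?addr0// => j jk.
    by rewrite eq_sym (negPf jk) scale0r.
  rewrite [X in _ - X](_ : _ = 0) ?subr0//.
  transitivity ((x 0 k)%:C *: \sum_(i < n.+1) ((x 0 i)%:C *: gA i + ((x 0 i * x 0 i)%:C *: - cv gA x))).
    rewrite scaler_sumr; apply: eq_bigr => i _; rewrite [(x 0 i)%:C * (x 0 k)%:C]mulrC.
    by rewrite -scalerA scalerDr scalerA -rmorphM.
  rewrite big_split /= -scaler_suml -rmorph_sum /= sphere_sum// scale1r -/(cv gA x) subrr.
  by rewrite scaler0.
under eq_bigr => k _ do rewrite mulmxDl -scalemxAl mulNmx (cvBAK _ Sx) opprK (pair_cv (clifford_pairC gpair)).
rewrite /bop.
under eq_bigr => k _ do rewrite -addrA [- _ + _]addrC addrA -scalerDl.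
rewrite sumrB -mulmx_sumr -/(dir gB p x) addrC; congr (_ + _).
rewrite (eq_bigr (fun i => -1 *: ((x 0 i)%:C *: sd i p x))).
  by rewrite -scaler_sumr (sd_euler x hp) scaleN1r.
by move=> i _; rewrite scalerA; congr (_ *: _); ring.
Qed.

Definition bspin p := forall i, bmeas (fun x => complex.Re (p x i 0)) /\ bmeas (fun x => complex.Im (p x i 0)).

Lemma bmeas_rdot p q : bspin p -> bspin q -> bmeas (fun x => rdot (p x) (q x)).
Proof.
move=> bp bq; have -> : (fun x => rdot (p x) (q x)) = (fun x =>
    \sum_i (complex.Re (p x i 0) * complex.Re (q x i 0) + complex.Im (p x i 0) * complex.Im (q x i 0))).
  by apply/funext => x; rewrite rdotE.
by apply: bmeas_sum => i; have [? ?] := bp i; have [? ?] := bq i; apply: bmeasD; exact: bmeasM.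
Qed.

Lemma bspin_L2 p : bspin p -> in_L2 p.
Proof.
move=> bp; split.
  by move=> i; have [[h1 _] [h2 _]] := bp i; split; exact: measurable_funTS.
have /bmeas_int/integrableP[_] := bmeas_rdot bp bp; apply: le_lt_trans.
rewrite /l2norm2; under eq_integral do rewrite cnorm_sqr.
apply: ge0_le_integral; first exact: measurable_sphere.
- by move=> x _; rewrite -cnorm_sqr lee_fin sqr_ge0.
- by apply/measurable_EFinP; apply: measurable_funTS; case: (bmeas_rdot bp bp).
- apply: measurableT_comp => //; apply/measurable_EFinP; apply: measurable_funTS.
  by case: (bmeas_rdot bp bp).
by move=> x _; rewrite /= lee_fin ler_norm.
Qed.

Lemma hspin_bspin d p : hspin d p -> bspin p.
Proof. by move=> hp i; have [h1 h2] := hp i; split; [exact: hpol_bmeas h1|exact: hpol_bmeas h2]. Qed.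

Lemma smooth_hspin d p : hspin d p -> smooth_spinor p.
Proof. by move=> hp i; have [h1 h2] := hp i; split; [exact: smooth_ray h1|exact: smooth_ray h2]. Qed.

Lemma l2norm2_eq0 p : (forall x, S x -> p x = 0) -> l2norm2 p = 0%E.
Proof.
move=> p0; rewrite /l2norm2 (eq_integral (fun _ => 0%E)) ?integral0// => x /set_mem /p0 ->.
rewrite cnorm_sqr rdotE big1// => i _.
by rewrite mxE /= !mul0r addr0.
Qed.

(** The Dirac eigenvalues, plus or minus (k + n/2); odd indices carry the positive ones. *)
Definition lam (i : nat) : R := if odd i then i./2%:R + n%:R / 2 else - (i./2%:R + n%:R / 2).

Lemma beta_lam i : beta m i - (n%:R / 2 : R)%:C = (lam i)%:C.
Proof.
rewrite /beta /lam; case: ifP => _; last by rewrite opprD rmorphB rmorphN /= !rmorph_nat.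
rewrite natrD rmorphD -!(rmorph_nat (real_complex R)) -addrA -rmorphB /=; congr (_ + _%:C).
by rewrite {1}(splitr n%:R) addrK.
Qed.

Lemma eigp_dirac d i p : eigp gA gB d i p -> dirac_op gamma p (fun x => (lam i)%:C *: p x).
Proof.
move=> [hp e]; split; [exact/bspin_L2/hspin_bspin/hp|exact/bspin_L2/hspin_bspin/hspinZ/hp|].
move=> r r0; exists p; split; first exact: smooth_hspin hp.
  by rewrite l2norm2_eq0 ?lte_fin// => x _; rewrite /= subrr.
rewrite l2norm2_eq0 ?lte_fin// => x Sx /=.
by rewrite (dirac_hom hp Sx) e -scalerBl beta_lam subrr.
Qed.

Definition betaR (i : nat) : R := if odd i then (i./2 + n)%:R else - (i./2)%:R.

Lemma betaRE i : beta m i = (betaR i)%:C.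
Proof. by rewrite /beta /betaR; case: ifP => _; rewrite ?rmorphN /= rmorph_nat. Qed.

(* The components of an eigenspinor of index [i] are spherical harmonics of
   degree [uphalf i], and those of its image under [cv gB] of degree [dgU i]. *)
Definition dgU (i : nat) : nat := i./2 + ~~ odd i.

Lemma eigp_harm d i p : eigp gA gB d i p -> forall l,
  harmonic_comp (uphalf i) (fun x => complex.Re (p x l 0)) /\
  harmonic_comp (uphalf i) (fun x => complex.Im (p x l 0)).
Proof.
move=> [hp e] l; apply: (eigp_harmonic gpair l hp (b := betaR i)) => [x|].
  by rewrite e betaRE.
rewrite uphalf_half /betaR; case: (odd i) => /=; last by rewrite add0n natrD -natr1; ring.
by rewrite !natrD -!natr1; ring.
Qed.

Lemma eigp_harmU d i p : eigp gA gB d i p -> forall l,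
  harmonic_comp (dgU i) (fun x => complex.Re ((cv gB x *m p x) l 0)) /\
  harmonic_comp (dgU i) (fun x => complex.Im ((cv gB x *m p x) l 0)).
Proof.
move=> [hp e] l.
apply: (eigp_harmonic (clifford_pairC gpair) l (hspin_cv gB hp) (b := n%:R - betaR i)) => [x|].
  by rewrite (bop_swap gpair hp (e x)) betaRE rmorphB /= rmorph_nat.
rewrite /dgU /betaR; case: (odd i) => /=; first by rewrite addn0 !natrD -!natr1; ring.
by rewrite !natrD -!natr1; ring.
Qed.

End spinor_eigen.

(** * The real Hilbert space of spinors and its self-adjoint operators *)

Section spinor_L2.
Context {R : realType} (m : nat).
Local Notation n := m.+2.
Local Notation N := (spinor_rank n).
Local Notation vol := (@sphere_volume R n).
Local Notation S := (@sphere R n).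
Local Notation X := 'rV[R]_n.+1.
Local Notation C := R[i].
Local Notation V := 'cV[C]_N.
Local Notation spin := (spinor R n).
Implicit Types (x : X) (p q u v w : spin) (s : R).

Let mS : measurable S := @measurable_sphere R n.

Lemma rdot_le (a b : V) : 2 * `|rdot a b| <= cnorm a ^+ 2 + cnorm b ^+ 2.
Proof.
have h1 : 0 <= rdot (a + b) (a + b) by rewrite -cnorm_sqr sqr_ge0.
have h2 : 0 <= rdot (a + (-1)%:C *: b) (a + (-1)%:C *: b) by rewrite -cnorm_sqr sqr_ge0.
have p1 : 0 <= rdot a a by rewrite -cnorm_sqr sqr_ge0.
have p2 : 0 <= rdot b b by rewrite -cnorm_sqr sqr_ge0.
move: h1 h2; rewrite !rdotDl !rdotZl ![rdot _ (_ + _)]rdotC !rdotDl !rdotZl (rdotC b a) => h1 h2.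
by rewrite !cnorm_sqr; case: (ger0P (rdot a b)) => _; lra.
Qed.

Lemma measurable_rdot p q : measurable_spinor p -> measurable_spinor q ->
  measurable_fun S (fun x => rdot (p x) (q x)).
Proof.
move=> mp mq; have -> : (fun x => rdot (p x) (q x)) = (fun x =>
    \sum_i (complex.Re (p x i 0) * complex.Re (q x i 0) + complex.Im (p x i 0) * complex.Im (q x i 0))).
  by apply/funext => x; rewrite rdotE.
apply: measurable_sum => i; have [? ?] := mp i; have [? ?] := mq i.
by apply: measurable_funD; exact: measurable_funM.
Qed.

Lemma L2_sqr p : in_L2 p -> vol.-integrable S (fun x => (cnorm (p x) ^+ 2)%:E).
Proof.
move=> [mp lp]; apply/integrableP; split.
  apply/measurable_EFinP.
  rewrite (_ : (fun x => _) = fun x => rdot (p x) (p x)); first exact: measurable_rdot.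
  by apply/funext => x; rewrite cnorm_sqr.
by under eq_integral do rewrite gee0_abs ?lee_fin ?sqr_ge0//.
Qed.

Lemma L2_rdot p q : in_L2 p -> in_L2 q -> vol.-integrable S (fun x => (rdot (p x) (q x))%:E).
Proof.
move=> lp lq; apply: (le_integrable mS _ _ (integrableD mS (L2_sqr lp) (L2_sqr lq))).
  by apply/measurable_EFinP; apply: measurable_rdot; [case: lp|case: lq].
move=> x _; rewrite /= lee_fin; apply: le_trans (ler_norm _).
have := rdot_le (p x) (q x); have := normr_ge0 (rdot (p x) (q x)); lra.
Qed.

Lemma in_L2E p : measurable_spinor p ->
  vol.-integrable S (fun x => (cnorm (p x) ^+ 2)%:E) -> in_L2 p.
Proof.
move=> mp /integrableP[_]; under eq_integral do rewrite gee0_abs ?lee_fin ?sqr_ge0//.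
by [].
Qed.

Lemma L2D p q : in_L2 p -> in_L2 q -> in_L2 (fun x => p x + q x).
Proof.
move=> lp lq; have mpq : measurable_spinor (fun x => p x + q x).
  have [mp _] := lp; have [mq _] := lq => i; have [p1 p2] := mp i; have [q1 q2] := mq i; split.
    rewrite (_ : (fun x => _) = fun x => complex.Re (p x i 0) + complex.Re (q x i 0)); first exact: measurable_funD.
    by apply/funext => x; rewrite mxE raddfD.
  rewrite (_ : (fun x => _) = fun x => complex.Im (p x i 0) + complex.Im (q x i 0)); first exact: measurable_funD.
  by apply/funext => x; rewrite mxE raddfD.
apply: in_L2E => //.
apply: (le_integrable mS _ _ (integrableZl mS 2 (integrableD mS (L2_sqr lp) (L2_sqr lq)))).
  apply/measurable_EFinP; rewrite (_ : (fun x => _) = fun x => rdot (p x + q x) (p x + q x)).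
    exact: (measurable_rdot mpq mpq).
  by apply/funext => x; rewrite cnorm_sqr.
move=> x _; rewrite -EFinD -EFinM !abse_EFin lee_fin !ger0_norm ?sqr_ge0 ?mulr_ge0 ?addr_ge0 ?sqr_ge0//.
rewrite !cnorm_sqr !rdotDl ![rdot _ (_ + _)]rdotC !rdotDl (rdotC (q x) (p x)).
have := rdot_le (p x) (q x); rewrite !cnorm_sqr; have := ler_norm (rdot (p x) (q x)); lra.
Qed.

Lemma L2Z (c : C) p : in_L2 p -> in_L2 (fun x => c *: p x).
Proof.
move=> lp; have mpq : measurable_spinor (fun x => c *: p x).
  have [mp _] := lp => i; have [p1 p2] := mp i; split.
    rewrite (_ : (fun x => _) = fun x => complex.Re c * complex.Re (p x i 0) + - complex.Im c * complex.Im (p x i 0)).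
      by apply: measurable_funD; exact: measurable_funM.
    by apply/funext => x; rewrite mxE complex_ReM.
  rewrite (_ : (fun x => _) = fun x => complex.Re c * complex.Im (p x i 0) + complex.Im c * complex.Re (p x i 0)).
    by apply: measurable_funD; exact: measurable_funM.
  by apply/funext => x; rewrite mxE complex_ImM.
apply: in_L2E => //.
apply: (le_integrable mS _ _ (integrableZl mS (complex.Re c ^+ 2 + complex.Im c ^+ 2) (L2_sqr lp))).
  apply/measurable_EFinP; rewrite (_ : (fun x => _) = fun x => rdot (c *: p x) (c *: p x)).
    exact: (measurable_rdot mpq mpq).
  by apply/funext => x; rewrite cnorm_sqr.
move=> x _; rewrite -EFinM !abse_EFin lee_fin !ger0_norm ?sqr_ge0 ?mulr_ge0 ?addr_ge0 ?sqr_ge0 ?cnorm_ge0//.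
rewrite !cnorm_sqr !rdotE mulr_sumr le_eqVlt; apply/orP; left; apply/eqP; apply: eq_bigr => i _.
by rewrite mxE complex_ReM complex_ImM; ring.
Qed.

Lemma L20 : in_L2 (fun _ => 0 : V).
Proof.
have h0 : bmeas (fun _ : X => 0 : R) by exact: bmeas_cst.
by apply: bspin_L2 => i; split; apply: (eq_ind _ (@bmeas R m) h0); apply/funext => x; rewrite mxE.
Qed.

Lemma L2lin p q s : in_L2 p -> in_L2 q -> in_L2 (fun x => p x + s%:C *: q x).
Proof. by move=> lp lq; apply: L2D => //; exact: L2Z. Qed.

Lemma L2_sum (J : Type) (r : seq J) (F : J -> spin) : (forall j, in_L2 (F j)) ->
  in_L2 (fun x => \sum_(j <- r) F j x).
Proof.
move=> hF; elim: r => [|j r ih].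
  rewrite (_ : (fun x => _) = fun _ => 0); first exact: L20.
  by apply/funext => x; rewrite big_nil.
rewrite (_ : (fun x => _) = fun x => F j x + \sum_(j <- r) F j x); first exact: L2D.
by apply/funext => x; rewrite big_cons.
Qed.

Definition ip p q : R := \int[vol]_(x in S) rdot (p x) (q x).

Lemma ipC p q : ip p q = ip q p.
Proof. by apply: eq_Rintegral => x _; exact: rdotC. Qed.

Lemma ipDl p q w : in_L2 p -> in_L2 q -> in_L2 w -> ip (fun x => p x + q x) w = ip p w + ip q w.
Proof.
move=> lp lq lw; rewrite -RintegralD//; [|exact: L2_rdot|exact: L2_rdot].
by apply: eq_Rintegral => x _; exact: rdotDl.
Qed.

Lemma ipZl s p w : in_L2 p -> in_L2 w -> ip (fun x => s%:C *: p x) w = s * ip p w.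
Proof.
move=> lp lw; rewrite -(RintegralZl _ mS (L2_rdot lp lw)).
by apply: eq_Rintegral => x _; exact: rdotZl.
Qed.

Lemma ipDr p q w : in_L2 p -> in_L2 q -> in_L2 w -> ip w (fun x => p x + q x) = ip w p + ip w q.
Proof. by move=> lp lq lw; rewrite !(ipC w) ipDl. Qed.

Lemma ipZr s p w : in_L2 p -> in_L2 w -> ip w (fun x => s%:C *: p x) = s * ip w p.
Proof. by move=> lp lw; rewrite !(ipC w) ipZl. Qed.

Lemma ip_lin p q w s : in_L2 p -> in_L2 q -> in_L2 w ->
  ip w (fun x => p x + s%:C *: q x) = ip w p + s * ip w q.
Proof. by move=> lp lq lw; rewrite ipDr ?ipZr//; exact: L2Z. Qed.

Lemma ip_sumr (J : Type) (r : seq J) (F : J -> spin) w : in_L2 w -> (forall j, in_L2 (F j)) ->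
  ip w (fun x => \sum_(j <- r) F j x) = \sum_(j <- r) ip w (F j).
Proof.
move=> lw hF; elim: r => [|j r ih].
  rewrite big_nil (_ : (fun x => _) = fun x => 0%:C *: w x) ?ipZr ?mul0r//.
  by apply/funext => x; rewrite big_nil scale0r.
rewrite big_cons -ih -ipDr//; last exact: L2_sum.
by congr (ip w _); apply/funext => x; rewrite big_cons.
Qed.

Lemma ip_ge0 p : 0 <= ip p p.
Proof. by apply: Rintegral_ge0 => x _; rewrite -cnorm_sqr sqr_ge0. Qed.

Lemma l2norm2E p : in_L2 p -> l2norm2 p = (ip p p)%:E.
Proof.
move=> lp; rewrite /ip /Rintegral fineK; last exact/(integrable_fin_num mS)/L2_rdot.
by apply: eq_integral => x _; rewrite cnorm_sqr.
Qed.

Lemma ip_expand p q s : in_L2 p -> in_L2 q ->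
  ip (fun x => p x + s%:C *: q x) (fun x => p x + s%:C *: q x) = ip p p + 2 * s * ip p q + s ^+ 2 * ip q q.
Proof.
move=> lp lq; have ll := L2lin s lp lq.
rewrite (ip_lin s lp lq ll) (ipC _ p) (ipC _ q) (ip_lin s lp lq lp) (ip_lin s lp lq lq) (ipC q p).
by ring.
Qed.

(** Spinors are functions and not classes, so [ip] is only semidefinite and null vectors have to be
    dealt with. *)
Lemma ip_null p q : in_L2 p -> in_L2 q -> ip q q = 0 -> ip p q = 0.
Proof.
move=> lp lq q0; apply/eqP/negPn/negP => pq.
(* The coefficient makes the squared norm ip p p - (ip p p + 1) = -1. *)
have := ip_ge0 (fun x => p x + (- (ip p p + 1) / (2 * ip p q))%:C *: q x).
rewrite ip_expand// q0 mulr0 addr0 (_ : 2 * _ * _ = - (ip p p + 1)); last by field.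
by lra.
Qed.

Definition ci : C := 0 +i* 1.

Lemma l2dotE p q : l2dot p q = ip p q +i* ip p (fun x => ci *: q x).
Proof.
congr (_ +i* _); apply: eq_Rintegral => x _.
rewrite /rdot /cdot !raddf_sum; apply: eq_bigr => i _ /=.
rewrite mxE; case: (p x i 0) (q x i 0) => a b [c d] /=; ring.
Qed.

Lemma rdot_ci (a b : V) : rdot (ci *: a) (ci *: b) = rdot a b.
Proof. by rewrite !rdotE; apply: eq_bigr => i _; rewrite !mxE !complex_ReM !complex_ImM /=; ring. Qed.

Lemma ip_ci p q : ip (fun x => ci *: p x) (fun x => ci *: q x) = ip p q.
Proof. by apply: eq_Rintegral => x _; exact: rdot_ci. Qed.

Lemma l2dot_lin p u w s : in_L2 p -> in_L2 u -> in_L2 w ->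
  l2dot w (fun x => p x + s%:C *: u x) = l2dot w p + s%:C * l2dot w u.
Proof.
move=> lp lu lw; rewrite !l2dotE.
have -> : (fun x => ci *: (p x + s%:C *: u x)) = (fun x => (ci *: p x) + s%:C *: (ci *: u x)).
  by apply/funext => x; rewrite scalerDr !scalerA mulrC.
rewrite (ip_lin s lp lu lw) (ip_lin s (L2Z ci lp) (L2Z ci lu) lw).
by apply/eqP; rewrite eq_complex /=; apply/andP; split; apply/eqP; ring.
Qed.

Lemma l2dot_null p q v : in_L2 p -> in_L2 q -> in_L2 v ->
  ip (fun x => q x + (-1)%:C *: v x) (fun x => q x + (-1)%:C *: v x) = 0 -> l2dot p q = l2dot p v.
Proof.
move=> lp lq lv d0; have ld := L2lin (-1) lq lv.
have e : l2dot p (fun x => q x + (-1)%:C *: v x) = 0.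
  by rewrite l2dotE ip_null// ip_null ?ip_ci//; exact: L2Z.
move: e; rewrite l2dot_lin// rmorphN rmorph1 mulN1r => /eqP.
by rewrite subr_eq0 => /eqP.
Qed.

Lemma l2dot0 p : in_L2 p -> l2dot p (fun _ => 0) = 0.
Proof.
move=> lp; have := l2dot_lin (-1) lp lp lp; rewrite rmorphN rmorph1 mulN1r subrr.
by rewrite (_ : (fun x => _) = fun _ => 0)//; apply/funext => x; rewrite scaleN1r subrr.
Qed.

Section selfadjoint_operator.
Variable T : operator R n.
Hypothesis sT : selfadjoint T.

Lemma sa_L2 p q : T p q -> in_L2 p /\ in_L2 q.
Proof. by move=> /(sT.2 p q)[]. Qed.

Lemma sa_sym p q u v : T p q -> T u v -> ip v p = ip u q.
Proof.
move=> /(sT.2 p q)[lp lq h] uv; have := h _ _ uv; rewrite !l2dotE.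
by move=> /(congr1 (@complex.Re R)).
Qed.

Lemma sa_lin p q u v s : T p q -> T u v ->
  T (fun x => p x + s%:C *: u x) (fun x => q x + s%:C *: v x).
Proof.
move=> /(sT.2 p q)[lp lq h] /(sT.2 u v)[lu lv k]; apply/(sT.2 _ _); split; [exact: L2lin|exact: L2lin|].
move=> a b Tab; have [la lb] := sa_L2 Tab.
by rewrite !l2dot_lin// (h _ _ Tab) (k _ _ Tab).
Qed.

(** A self-adjoint graph is characterised by integrals, hence stable under changes on null sets. *)
Lemma sa_ae p q v : T p q -> in_L2 v ->
  ip (fun x => q x + (-1)%:C *: v x) (fun x => q x + (-1)%:C *: v x) = 0 -> T p v.
Proof.
move=> /(sT.2 p q)[lp lq h] lv d0; apply/(sT.2 _ _); split=> // a b Tab.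
by have [la lb] := sa_L2 Tab; rewrite (h _ _ Tab); exact: l2dot_null.
Qed.

Lemma sa0 : T (fun _ => 0) (fun _ => 0).
Proof.
apply/(sT.2 _ _); split; [exact: L20|exact: L20|] => a b Tab.
by have [la lb] := sa_L2 Tab; rewrite !l2dot0.
Qed.

(* [u = T p - l p] satisfies [T u = - l u], so it vanishes by positivity. *)
Lemma sa_sqrt p (l : R) : nonneg_op T -> 0 < l ->
  op_comp T T p (fun x => (l ^+ 2)%:C *: p x) -> T p (fun x => l%:C *: p x).
Proof.
move=> nT l0 [z Tpz Tz]; have [lp lz] := sa_L2 Tpz.
have lu := L2lin (- l) lz lp.
have Tu : T (fun x => z x + (- l)%:C *: p x) (fun x => (- l)%:C *: (z x + (- l)%:C *: p x)).
  rewrite (_ : (fun x => (- l)%:C *: _) = fun x => (l ^+ 2)%:C *: p x + (- l)%:C *: z x).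
    exact: (sa_lin (- l) Tz Tpz).
  apply/funext => x; rewrite scalerDr scalerA addrC; congr (_ *: _ + _).
  by rewrite -rmorphM /=; congr (_%:C); ring.
have := nT _ _ Tu; rewrite l2dotE lecE /= => /andP[_].
rewrite ipZl// mulNr oppr_ge0 => h.
have u0 : ip (fun x => z x + (- l)%:C *: p x) (fun x => z x + (- l)%:C *: p x) = 0.
  by apply/eqP; rewrite eq_le ip_ge0 andbT -(pmulr_rle0 _ l0).
apply: (sa_ae Tpz); first exact: L2Z.
by rewrite -[RHS]u0; congr ip; apply/funext => x; rewrite scalerA -rmorphM /= mulN1r.
Qed.

End selfadjoint_operator.

Lemma sphere_volumeC0 : vol (~` S) = 0%E.
Proof.
rewrite /sphere_volume (_ : _ @^-1` _ = set0) ?integral_set0//.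
by apply/seteqP; split => // y /=; apply; exact: stereo_sphere.
Qed.

Lemma spinor_eq0E p : in_L2 p -> (spinor_eq0 p <-> ip p p = 0).
Proof.
move=> lp; have [mp _] := lp.
have mc : measurable_fun S (fun x => (cnorm (p x) ^+ 2)%:E) by case/integrableP: (L2_sqr lp).
have c0 (v : V) : cnorm v ^+ 2 = 0 -> v = 0.
  rewrite cnorm_sqr rdotE => /eqP; rewrite psumr_eq0 => [/allP h|i _]; last first.
    by rewrite addr_ge0// -expr2 sqr_ge0.
  apply/colP => i; rewrite mxE; have := h i (mem_index_enum i).
  rewrite paddr_eq0 -?expr2 ?sqr_ge0// !sqrf_eq0 => /andP[/eqP e1 /eqP e2].
  by rewrite [v i 0]complexE e1 e2.
have := ae_eq_integral_abs vol mS mc; under eq_integral do rewrite gee0_abs ?lee_fin ?sqr_ge0//.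
rewrite -/(l2norm2 p) l2norm2E// => h; split.
- move=> p0; have : ae_eq vol S (fun x => (cnorm (p x) ^+ 2)%:E) (cst 0%E).
    apply: filterS p0 => x -> _; rewrite cnorm_sqr rdotE big1// => i _.
    by rewrite mxE /= mul0r addr0.
  by move=> /h [].
move=> p0; have /h : (ip p p)%:E = 0%E by rewrite p0.
move=> ae0; have aeS : {ae vol, forall x, S x}.
  by exists (~` S); split; [exact: measurableC|exact: sphere_volumeC0|].
apply: filterS2 ae0 aeS => x px Sx; apply: c0.
by have [] := px Sx.
Qed.

End spinor_L2.

(** * Eigenspaces and finite sums of eigenspinors *)

Section eigenspaces.
Context {R : realType} (m : nat).
Local Notation n := m.+2.
Local Notation N := (spinor_rank n).
Local Notation vol := (@sphere_volume R n).
Local Notation S := (@sphere R n).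
Local Notation X := 'rV[R]_n.+1.
Local Notation C := R[i].
Local Notation V := 'cV[C]_N.
Local Notation spin := (spinor R n).
Local Notation I f := (\int[vol]_(y in S) f y).
Implicit Types (x : X) (p q u v w : spin) (s : R).

Lemma harmonic_comp_lin k (h g : X -> R) s : harmonic_comp k h -> harmonic_comp k g ->
  harmonic_comp k (fun x => h x + s * g x).
Proof.
move=> [bh [L L0 hL] [v [w [h1 h2 h3]]]] [bg [M M0 gM] [v' [w' [g1 g2 g3]]]]; split.
- by apply: bmeasD => //; exact: bmeasZ.
- exists (2 * L + 2 * s ^+ 2 * M) => [|x y Sx Sy].
    by apply: addr_ge0; [exact: mulr_ge0|rewrite mulr_ge0// mulr_ge0// sqr_ge0].
  have e1 := hL x y Sx Sy; have e2 := gM x y Sx Sy; move: (2 - 2 * edot x y) e1 e2 => q e1 e2.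
  have e3 : (s * (g y - g x)) ^+ 2 <= s ^+ 2 * (M * q) by rewrite exprMn ler_wpM2l ?sqr_ge0.
  have := sqr_ge0 ((h y - h x) - s * (g y - g x)).
  have -> : h y + s * g y - (h x + s * g x) = (h y - h x) + s * (g y - g x) by ring.
  by move: (h y - h x) (s * (g y - g x)) e1 e3 => a b e1 e3 e4; nra.
exists (fun k x => v k x + s * v' k x), (fun k l x => w k l x + s * w' k l x); split.
- by apply: tderivD => //; exact: tderiv_scale.
- by move=> j; apply: tderivD => //; exact: tderiv_scale.
by move=> x Sx; rewrite big_split /= -mulr_sumr h3// g3//; ring.
Qed.

Lemma harmonic_comp0 k : harmonic_comp k (fun _ : X => 0).
Proof.
split; [exact: bmeas_cst|by exists 0 => // x y _ _; rewrite subrr expr0n /= mul0r|].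
exists (fun _ _ => 0), (fun _ _ _ => 0); split.
- exact: tderiv_cst.
- by move=> j; exact: tderiv_cst.
by move=> x _; rewrite big1// mulr0 oppr0.
Qed.

(** Green's formula; k (k + n - 1) is strictly increasing in k. *)
Lemma harmonic_comp_orth k l (h g : X -> R) : harmonic_comp k h -> harmonic_comp l g -> k != l ->
  I (fun x => h x * g x) = 0.
Proof.
move=> [bh _ lh] [bg _ lg] kl; have bb := bmeasM bh bg.
have := green_sphere lh lg.
rewrite (eq_Int (g := fun x => (k%:R * (k + m.+1)%:R - l%:R * (l + m.+1)%:R) * (h x * g x))); last first.
  by move=> x _; ring.
rewrite IntZ// => /eqP; rewrite mulf_eq0 => /orP[|/eqP //].
rewrite -!natrM subr_eq0 eqr_nat => /eqP e; exfalso; move: kl; rewrite neq_ltn => /orP[kl|kl].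
  have : (k * (k + m.+1) < l * (l + m.+1))%N by apply: ltn_mul => //; rewrite ltn_add2r.
  by rewrite e ltnn.
have : (l * (l + m.+1) < k * (k + m.+1))%N by apply: ltn_mul => //; rewrite ltn_add2r.
by rewrite e ltnn.
Qed.

Definition cRe p l x : R := complex.Re (p x l 0).
Definition cIm p l x : R := complex.Im (p x l 0).

Definition harm_spin k p := forall l, harmonic_comp k (cRe p l) /\ harmonic_comp k (cIm p l).

Lemma harm_bspin k p : harm_spin k p -> bspin p.
Proof. by move=> hp l; have [[h1 _ _] [h2 _ _]] := hp l. Qed.

Lemma harm_spin_lin k p q s : harm_spin k p -> harm_spin k q ->
  harm_spin k (fun x => p x + s%:C *: q x).
Proof.
move=> hp hq l; have [p1 p2] := hp l; have [q1 q2] := hq l; split.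
  rewrite (_ : cRe _ l = fun x => cRe p l x + s * cRe q l x); first exact: harmonic_comp_lin.
  by apply/funext => x; rewrite /cRe !mxE raddfD /= complex_ReM /= oppr0 mul0r addr0.
rewrite (_ : cIm _ l = fun x => cIm p l x + s * cIm q l x); first exact: harmonic_comp_lin.
by apply/funext => x; rewrite /cIm !mxE raddfD /= complex_ImM /= mul0r addr0.
Qed.

Lemma ip_comp p q : bspin p -> bspin q ->
  ip p q = \sum_l (I (fun x => cRe p l x * cRe q l x) + I (fun x => cIm p l x * cIm q l x)).
Proof.
move=> bp bq; rewrite /ip.
have e : forall x, S x -> rdot (p x) (q x) =
    \sum_l (cRe p l x * cRe q l x + cIm p l x * cIm q l x) by move=> x _; rewrite rdotE.
rewrite (eq_Int e); elim: (index_enum _) => [|l r ih].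
  rewrite big_nil (eq_Int (g := fun _ => 0 * 0)) ?IntZ ?mul0r//; first exact: bmeas_cst.
  by move=> x _; rewrite big_nil ?mul0r.
have b1 : bmeas (fun x => cRe p l x * cRe q l x).
  by have [? _] := bp l; have [? _] := bq l; exact: bmeasM.
have b2 : bmeas (fun x => cIm p l x * cIm q l x).
  by have [_ ?] := bp l; have [_ ?] := bq l; exact: bmeasM.
have b3 : bmeas (fun x => \sum_(l <- r) (cRe p l x * cRe q l x + cIm p l x * cIm q l x)).
  apply: bmeas_sum => j; have [? ?] := bp j; have [? ?] := bq j.
  by apply: bmeasD; exact: bmeasM.
rewrite big_cons -ih -IntD// -IntD//; last exact: bmeasD.
by apply: eq_Int => x _; rewrite big_cons.
Qed.

Lemma harm_spin_orth k l p q : harm_spin k p -> harm_spin l q -> k != l -> ip p q = 0.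
Proof.
move=> hp hq kl; rewrite ip_comp; [|exact: harm_bspin hp|exact: harm_bspin hq].
rewrite big1// => j _; have [p1 p2] := hp j; have [q1 q2] := hq j.
by rewrite (harmonic_comp_orth p1 q1 kl) (harmonic_comp_orth p2 q2 kl) addr0.
Qed.

Variable gamma : 'I_n -> 'M[C]_N.
Hypothesis cl : clifford_rep gamma.

Definition uspin p : spin := fun x => cv (gB gamma) x *m p x.

Lemma ip_uspin p q : ip (uspin p) (uspin q) = ip p q.
Proof. by apply: eq_Int => x Sx; rewrite /rdot cdot_cvB. Qed.

Lemma uspin_lin p q s : uspin (fun x => p x + s%:C *: q x) = fun x => uspin p x + s%:C *: uspin q x.
Proof. by apply/funext => x; rewrite /uspin mulmxDr scalemxAr. Qed.

Definition al (i : nat) : R := i./2%:R + n%:R / 2.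

Lemma al_gt0 i : 0 < al i.
Proof. by rewrite ltr_wpDl// divr_gt0. Qed.

Definition dirac2 : operator R n := op_comp (dirac_op gamma) (dirac_op gamma).

(* Eigenspinors of |D|, graded by the sign of D: [al i = |lam i|]. *)
Record eigs (i : nat) p : Prop := Eigs {
  es_harm : harm_spin (uphalf i) p;
  es_harmU : harm_spin (dgU i) (uspin p);
  es_abs : forall T, is_op_sqrt dirac2 T -> T p (fun x => (al i)%:C *: p x) }.

Lemma eigs_L2 i p : eigs i p -> in_L2 p.
Proof. by move=> h; exact/bspin_L2/(harm_bspin (es_harm h)). Qed.

Lemma eigp_eigs d i p : eigp (gA gamma) (gB gamma) d i p -> eigs i p.
Proof.
move=> hp; split; [exact: eigp_harm hp|exact: eigp_harmU hp|].
move=> T [sT nT TT]; apply: sa_sqrt => //; first exact: al_gt0.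
apply/TT; exists (fun x => (lam m i)%:C *: p x); first exact: eigp_dirac hp.
have := eigp_dirac cl (eigpZ (lam m i)%:C hp).
rewrite (_ : (fun x => _ *: (_ *: _)) = fun x => (al i ^+ 2)%:C *: p x)//.
apply/funext => x; rewrite scalerA -rmorphM /=; congr (_%:C *: _).
by rewrite /lam /al; case: (odd i); ring.
Qed.

Lemma eigs_lin i p q s : eigs i p -> eigs i q -> eigs i (fun x => p x + s%:C *: q x).
Proof.
move=> [p1 p2 p3] [q1 q2 q3]; split; first exact: harm_spin_lin.
  by rewrite uspin_lin; exact: harm_spin_lin.
move=> T hT; have [sT _ _] := hT.
have := sa_lin sT s (p3 T hT) (q3 T hT).
rewrite (_ : (fun x => _ *: p x + _) = fun x => (al i)%:C *: (p x + s%:C *: q x))//.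
by apply/funext => x; rewrite scalerDr !scalerA [(al i)%:C * _]mulrC.
Qed.

Lemma eigs0 i : eigs i (fun _ => 0).
Proof.
have h0 k : harm_spin k (fun _ => 0 : V).
  by move=> l; split; apply: (eq_ind _ (harmonic_comp k) (harmonic_comp0 k)); apply/funext => x; rewrite /cRe /cIm mxE.
split=> //.
  by rewrite (_ : uspin _ = fun _ => 0)//; apply/funext => x; rewrite /uspin mulmx0.
move=> T [sT _ _]; rewrite (_ : (fun _ => _ *: _) = fun _ => 0); first exact: sa0.
by apply/funext => x; rewrite scaler0.
Qed.

Lemma eigs_sum (J : Type) (r : seq J) (P : pred J) (c : J -> R) (F : J -> spin) i :
  (forall j, P j -> eigs i (F j)) -> eigs i (fun x => \sum_(j <- r | P j) (c j)%:C *: F j x).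
Proof.
move=> hF; elim: r => [|j r ih].
  rewrite (_ : (fun x => _) = fun _ => 0); first exact: eigs0.
  by apply/funext => x; rewrite big_nil.
case h : (P j); last first.
  by rewrite (_ : (fun x => _) = fun x => \sum_(j <- r | P j) (c j)%:C *: F j x)//; apply/funext => x; rewrite big_cons h.
rewrite (_ : (fun x => _) = fun x => \sum_(j <- r | P j) (c j)%:C *: F j x + (c j)%:C *: F j x).
  by apply: eigs_lin => //; exact: hF.
by apply/funext => x; rewrite big_cons h addrC.
Qed.

(** Orthogonality is that of spherical harmonics, before or after the gauge transformation: the pair
    of degrees [uphalf i], [dgU i] determines i. *)
Lemma eigs_orth i j p q : eigs i p -> eigs j q -> i != j -> ip p q = 0.
Proof.
move=> [p1 p2 _] [q1 q2 _] ij; have [e1|e1] := eqVneq (uphalf i) (uphalf j); last exact: harm_spin_orth e1.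
rewrite -ip_uspin; apply: (harm_spin_orth p2 q2).
apply/eqP => e2; move/eqP: ij; apply.
move: e1 e2; rewrite /dgU !uphalf_half => e1 e2.
have := odd_double_half i; have := odd_double_half j.
by move: e1 e2; case: (odd i); case: (odd j); lia.
Qed.

Definition sqrt_op T := is_op_sqrt (abs_dirac gamma) T.

Lemma sqrt_op_eigs T i p : sqrt_op T -> eigs i p -> T p (fun x => (Num.sqrt (al i))%:C *: p x).
Proof.
move=> [sT nT TT] hp.
(* [T] alone provides a square root of D^2: T T maps 0 to 0, so the graph of |D| is inhabited. *)
have [T' hT' _] : abs_dirac gamma (fun _ => 0) (fun _ => 0).
  by apply/TT; exists (fun _ => 0); exact: sa0.
apply: sa_sqrt => //; first by rewrite sqrtr_gt0 al_gt0.
apply/TT; exists T' => //; rewrite sqr_sqrtr; last exact/ltW/al_gt0.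
exact: (es_abs hp).
Qed.

(** A finite sum of eigenspinors together with its components, from which norms and energies are
    computed. *)
Definition dec (K : nat) (phi : nat -> spin) q :=
  (forall i, eigs i (phi i)) /\ q = fun x => \sum_(i < K) phi i x.

Lemma dec_L2 K phi q : dec K phi q -> in_L2 q.
Proof. by move=> [h ->]; apply: L2_sum => i; exact: (eigs_L2 (h i)). Qed.

Lemma dec_ip K phi q i p : dec K phi q -> eigs i p -> (i < K)%N -> ip p q = ip p (phi i).
Proof.
move=> [h ->] hp iK; rewrite ip_sumr; [|exact: eigs_L2 hp|by move=> j; exact: (eigs_L2 (h j))].
rewrite (bigD1 (Ordinal iK))//= big1 ?addr0// => j ji.
apply: eigs_orth hp (h j) _; apply: contra ji => /eqP ij.
by apply/eqP/val_inj.
Qed.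

Lemma dec_wsum K phi q (c : nat -> R) : dec K phi q ->
  ip (fun x => \sum_(i < K) (c i)%:C *: phi i x) q = \sum_(i < K) c i * ip (phi i) (phi i).
Proof.
move=> hq; have [h qE] := hq; have lq := dec_L2 hq.
rewrite ipC ip_sumr//; last by move=> i; exact/L2Z/(eigs_L2 (h i)).
apply: eq_bigr => i _; rewrite ipZr//; last exact: (eigs_L2 (h i)).
by rewrite ipC (dec_ip hq (h i) (ltn_ord i)).
Qed.

Lemma dec_norm K phi q : dec K phi q -> ip q q = \sum_(i < K) ip (phi i) (phi i).
Proof.
move=> hq; have [h qE] := hq; have := dec_wsum (fun _ => 1) hq.
under eq_bigr do rewrite mul1r.
move=> <-; congr ip; rewrite {1}qE; apply/funext => x; apply: eq_bigr => i _.
by rewrite scale1r.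
Qed.

Lemma dec_add K phi q i p s : dec K phi q -> eigs i p -> (i < K)%N ->
  dec K (fun j => if j == i then fun x => phi j x + s%:C *: p x else phi j) (fun x => q x + s%:C *: p x).
Proof.
move=> [h ->] hp iK; split.
  by move=> j; case: eqP => [->|_]; [exact: eigs_lin|exact: h].
apply/funext => x; rewrite (bigD1 (Ordinal iK))//= [RHS](bigD1 (Ordinal iK))//= eqxx addrAC; congr (_ + _).
by apply: eq_bigr => j ji; rewrite (_ : (nat_of_ord j == i) = false)//; apply: contra_neqF ji => /eqP h2; exact/val_inj.
Qed.

Lemma dec_widen K K' phi q : dec K phi q -> (K <= K')%N ->
  dec K' (fun i => if (i < K)%N then phi i else fun _ => 0) q.
Proof.
move=> [h ->] KK; split; first by move=> i; case: ifP => _; [exact: h|exact: eigs0].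
apply/funext => x; rewrite (big_ord_widen K' (fun i => phi i x) KK) big_mkcond /=.
by apply: eq_bigr => i _; case: ifP.
Qed.

Lemma ip_pyth u w : in_L2 u -> in_L2 w -> ip u w = 0 ->
  ip u u <= ip (fun x => u x + 1%:C *: w x) (fun x => u x + 1%:C *: w x).
Proof. by move=> lu lw o; rewrite (ip_expand 1 lu lw) o mulr0 addr0 expr1n mul1r lerDl ip_ge0. Qed.

Definition dist2 p q : R := ip (fun x => p x + (-1)%:C *: q x) (fun x => p x + (-1)%:C *: q x).

(** Gram-Schmidt by induction, valid for dependent families: p and F k are first cleared of the
    first k vectors, and if the remainder of F k is null the last coefficient is 0. *)
Lemma projection (F : nat -> spin) k p : (forall j, in_L2 (F j)) -> in_L2 p ->
  exists c : nat -> R, forall j, (j < k)%N ->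
    ip (fun x => p x + (-1)%:C *: \sum_(i < k) (c i)%:C *: F i x) (F j) = 0.
Proof.
move=> lF; elim: k p => [|k ih] p lp; first by exists (fun _ => 0).
have [c hc] := ih p lp; have [d hd] := ih (F k) (lF k).
set g := fun x => p x + _ in hc; set f := fun x => F k x + _ in hd.
have lS e : in_L2 (fun x => \sum_(i < k) (e i)%:C *: F i x) by apply: L2_sum => i; exact: L2Z.
have lg : in_L2 g by apply: L2lin.
have lf : in_L2 f by apply: L2lin.
have orth w : (forall j, (j < k)%N -> ip w (F j) = 0) -> in_L2 w -> ip w (F k) = ip w f.
  move=> hw lw; rewrite /f (ip_lin (-1) (lF k) (lS d) lw).
  rewrite (ip_sumr _ lw (fun j : 'I_k => L2Z (d j)%:C (lF j))).
  by rewrite big1 ?mulr0 ?addr0// => j _; rewrite (ipZr _ (lF j) lw) hw ?mulr0.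
pose t := if ip f f == 0 then 0 else ip g f / ip f f.
have t0 : ip g f = t * ip f f.
  rewrite /t; case: eqP => [e|/eqP e]; first by rewrite mul0r ip_null.
  by rewrite divfK.
exists (fun i => if (i < k)%N then c i - t * d i else t) => j jk.
have -> : (fun x => p x + (-1)%:C *: \sum_(i < k.+1) (if (i < k)%N then c i - t * d i else t)%:C *: F i x) =
    (fun x => g x + (- t)%:C *: f x).
  apply/funext => x; rewrite big_ord_recr /= ltnn /g /f.
  have -> : \sum_(i < k) (if (i < k)%N then c i - t * d i else t)%:C *: F i x =
     \sum_(i < k) (c i)%:C *: F i x - t%:C *: \sum_(i < k) (d i)%:C *: F i x.
    rewrite scaler_sumr -sumrB; apply: eq_bigr => i _; rewrite ltn_ord rmorphB rmorphM /=.
    by rewrite scalerBl scalerA.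
  move: (\sum_(i < k) _) (\sum_(i < k) _) => a b.
  rewrite !rmorphN /= rmorph1 !scaleN1r scaleNr scalerDr scalerN.
  by rewrite -[RHS]addrA -opprD; congr (_ - _); rewrite -addrA [- _ + _]addrC.
have lr := L2lin (- t) lg lf.
have orth0 i : (i < k)%N -> ip (fun x => g x + (- t)%:C *: f x) (F i) = 0.
  by move=> ik; rewrite ipC ip_lin// ipC hc// ipC hd// mulr0 addr0.
move: jk; rewrite ltnS leq_eqVlt => /orP[/eqP ->|]; last exact: orth0.
by rewrite orth// ipC ip_lin// ipC t0 mulNr subrr.
Qed.

(** Members of the family with the same index are gathered into one component; optimality among all
    combinations is Pythagoras' theorem. *)
Lemma projection_dec (F : nat -> spin) (ix : nat -> nat) k p :
  (forall j, eigs (ix j) (F j)) -> in_L2 p ->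
  exists K phi q, [/\ dec K phi q, forall i, ip (fun x => p x + (-1)%:C *: q x) (phi i) = 0 &
   forall c : nat -> R, dist2 p q <= dist2 p (fun x => \sum_(j < k) (c j)%:C *: F j x)].
Proof.
move=> eF lp; have lF j : in_L2 (F j) by exact: eigs_L2 (eF j).
have [c hc] := projection k lF lp.
pose K := (\max_(j < k) ix j).+1.
pose phi i x := \sum_(j < k | ix j == i) (c j)%:C *: F j x.
pose q x := \sum_(j < k) (c j)%:C *: F j x.
have lq : in_L2 q by apply: L2_sum => i; exact: L2Z.
have lr := L2lin (-1) lp lq.
have orth (J : pred 'I_k) (e : 'I_k -> R) : ip (fun x => p x + (-1)%:C *: q x) (fun x => \sum_(j < k | J j) (e j)%:C *: F j x) = 0.
  have -> : (fun x => \sum_(j < k | J j) (e j)%:C *: F j x) =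
      (fun x => \sum_(j < k) (if J j then e j else 0)%:C *: F j x).
    by apply/funext => x; rewrite big_mkcond; apply: eq_bigr => j _; case: ifP => //; rewrite scale0r.
  rewrite (ip_sumr _ lr (fun j : 'I_k => L2Z (if J j then e j else 0)%:C (lF j))).
  by rewrite big1// => j _; rewrite (ipZr _ (lF j) lr) hc ?mulr0.
exists K, phi, q; split.
- split.
    by move=> i; apply: eigs_sum => j /eqP <-.
  apply/funext => x; rewrite /q /phi.
  rewrite (partition_big (fun j : 'I_k => inord (ix j) : 'I_K) xpredT)//=.
  apply: eq_bigr => i _; apply: eq_bigl => j; rewrite -val_eqE /= inordK//.
  by rewrite ltnS; exact: (leq_bigmax j).
- by move=> i; exact: (orth (fun j => ix j == i)).
move=> e; rewrite /dist2.
have -> : (fun x => p x + (-1)%:C *: \sum_(j < k) (e j)%:C *: F j x) =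
    fun x => (p x + (-1)%:C *: q x) + 1%:C *: \sum_(j < k) (c j - e j)%:C *: F j x.
  apply/funext => x; rewrite /q scale1r.
  under [X in _ = _ + X]eq_bigr do rewrite rmorphB /= scalerBl.
  by rewrite sumrB rmorphN rmorph1 !scaleN1r addrA subrK.
have lw : in_L2 (fun x => \sum_(j < k) (c j - e j)%:C *: F j x) by apply: L2_sum => i; exact: L2Z.
have o : ip (fun x => p x + (-1)%:C *: q x) (fun x => \sum_(j < k) (c j - e j)%:C *: F j x) = 0.
  exact: (orth xpredT (fun j => c j - e j)).
exact: (ip_pyth lr lw o).
Qed.

End eigenspaces.

(** * Density of polynomials *)

Section polynomial_density.
Context {R : realType} (m : nat).
Local Notation n := m.+2.
Local Notation vol := (@sphere_volume R n).
Local Notation S := (@sphere R n).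
Local Notation X := 'rV[R]_n.+1.
Local Notation I f := (\int[vol]_(y in S) f y).
Local Notation omega := (@omega R m).
Implicit Types (x : X) (f g : X -> R).

Let mS : measurable S := @measurable_sphere R n.

Lemma Int_small (F : nat -> X -> R) (g : X -> R) (e : R) :
  (forall j, measurable_fun S (F j)) -> vol.-integrable S (EFin \o g) ->
  (forall j x, S x -> `|F j x| <= g x) -> (forall x, S x -> F j x @[j --> \oo] --> (0 : R)) ->
  0 < e -> exists j, I (F j) <= e.
Proof.
move=> mF ig Fg F0 e0.
have h : (\int[vol]_(x in S) (F j x)%:E)%E @[j --> \oo] --> (\int[vol]_(x in S) (fun=> 0%:E) x)%E.
  apply: (@dominated_cvg _ _ _ vol S mS (fun j x => (F j x)%:E) _ (fun x => (g x)%:E)).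
  - by move=> j; apply/measurable_EFinP.
  - by move=> x Sx; apply: cvg_EFin; [exact: nearW|exact: F0].
  - by [].
  - exact: ig.
  - by move=> j x Sx; rewrite lee_fin Fg.
rewrite integral0 in h.
have h2 : I (F j) @[j --> \oo] --> (0 : R) by exact: (fine_cvg h).
have [N _ hN] := cvgr_lt 0 h2 _ e0.
by exists N; apply: ltW; apply: hN => /=.
Qed.

Lemma Int_cst0 : I (fun _ => 0) = 0.
Proof. by rewrite /Rintegral integral0. Qed.

Inductive rpol : (X -> R) -> Prop :=
| rpol_cst c : rpol (fun _ => c)
| rpol_coord k f : rpol f -> rpol (fun x => x 0 k * f x)
| rpol_add f g : rpol f -> rpol g -> rpol (fun x => f x + g x).

Lemma rpol_eq f g : rpol f -> f =1 g -> rpol g.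
Proof. by move=> + /funext <-. Qed.

Lemma rpolZ c f : rpol f -> rpol (fun x => c * f x).
Proof.
elim=> {f} [c'|k f _ ih|f g _ ihf _ ihg]; first exact: rpol_cst.
  by apply: (rpol_eq (rpol_coord k ih)) => x; rewrite mulrCA.
by apply: (rpol_eq (rpol_add ihf ihg)) => x; rewrite mulrDr.
Qed.

Lemma rpolM f g : rpol f -> rpol g -> rpol (fun x => f x * g x).
Proof.
move=> hf hg; elim: hf => {f} [c|k f _ ih|f f' _ ihf _ ihg]; first exact: rpolZ.
  by apply: (rpol_eq (rpol_coord k ih)) => x; rewrite mulrA.
by apply: (rpol_eq (rpol_add ihf ihg)) => x; rewrite mulrDl.
Qed.

Lemma rpolX f k : rpol f -> rpol (fun x => f x ^+ k).
Proof.
move=> hf; elim: k => [|k ih]; first exact: rpol_cst.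
by apply: (rpol_eq (rpolM hf ih)) => x; rewrite exprS.
Qed.

Lemma rpol_hpol f : rpol f -> exists D (h : nat -> X -> R),
  (forall d, hpol d (h d)) /\ forall x, f x = \sum_(d < D) h d x.
Proof.
elim=> {f} [c|k f _ [D [h [hh fE]]]|f g _ [D [h [hh fE]]] _ [D' [h' [hh' gE]]]].
- exists 1%N, (fun d => if d == 0%N then fun _ => c else fun _ => 0); split.
    by case=> [|d]; [exact: hpol_cst|exact: hpol0].
  by move=> x; rewrite big_ord_recl big_ord0 addr0.
- exists D.+1, (fun d => if d is d'.+1 then fun x => x 0 k * h d' x else fun _ => 0); split.
    by case=> [|d]; [exact: hpol0|exact: hpol_coord].
  by move=> x; rewrite big_ord_recl add0r fE mulr_sumr; apply: eq_bigr.
exists (maxn D D'), (fun d x => (if (d < D)%N then h d x else 0) + (if (d < D')%N then h' d x else 0)); split.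
  move=> d; have hi (b : bool) (k : X -> R) : hpol d k -> hpol d (fun x => if b then k x else 0).
    by case: b => // _; exact: hpol0.
  by apply: hpol_add; apply: hi.
move=> x; rewrite big_split /= fE gE.
rewrite (big_ord_widen _ (fun d => h d x) (leq_maxl D D')) (big_ord_widen _ (fun d => h' d x) (leq_maxr D D')).
by congr (_ + _); rewrite big_mkcond.
Qed.

Lemma rpol_bmeas f : rpol f -> bmeas f.
Proof.
elim=> {f} [c|k f _ ih|f g _ ihf _ ihg]; first exact: bmeas_cst.
  by apply: bmeasM => //; exact: bmeas_coord.
exact: bmeasD.
Qed.

(** Approximation in L^1 by polynomials with values in [0, 1]. The bound makes the class stable
    under products, complements and pointwise limits of functions with values in [0, 1]. *)
Definition papprox g := forall e : R, 0 < e -> exists f,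
  [/\ rpol f, forall x, S x -> 0 <= f x <= 1 & I (fun x => `|f x - g x|) <= e].

Definition ind (A : set X) x : R := (x \in A)%:R.

Lemma bmeas_ind A : measurable A -> bmeas (ind A).
Proof.
move=> mA; split; last by exists 1 => x _; rewrite /ind; case: (x \in A); rewrite ?normr0 ?normr1.
rewrite (_ : ind A = \1_A); first exact: measurable_indic.
by apply/funext => x; rewrite indicE.
Qed.

Lemma Int_abs_tri (f g h : X -> R) : bmeas f -> bmeas g -> bmeas h ->
  I (fun x => `|f x - h x|) <= I (fun x => `|f x - g x|) + I (fun x => `|g x - h x|).
Proof.
move=> bf bg bh; have b1 := bmeas_norm (bmeasB bf bg); have b2 := bmeas_norm (bmeasB bg bh).
rewrite -IntD//; apply: le_Int; [exact/bmeas_norm/bmeasB|exact: bmeasD|move=> x _].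
by rewrite (le_trans _ (ler_normD _ _))// addrA subrK.
Qed.

Lemma papprox_limit (G : nat -> X -> R) g : bmeas g -> (forall j, bmeas (G j)) -> (forall j, papprox (G j)) ->
  (forall j x, S x -> 0 <= G j x <= 1) -> (forall x, S x -> 0 <= g x <= 1) ->
  (forall x, S x -> G j x @[j --> \oo] --> g x) -> papprox g.
Proof.
move=> bg bG pG G01 g01 Gg e e0.
have [j hj] : exists j, I (fun x => `|G j x - g x|) <= e / 2.
  apply: (@Int_small (fun j x => `|G j x - g x|) (fun _ => 1)).
  - by move=> j; apply: measurable_funTS; have [] := bmeas_norm (bmeasB (bG j) bg).
  - exact: bmeas_int (bmeas_cst m 1).
  - move=> j x Sx; rewrite normr_id ler_norml; have /andP[a1 a2] := G01 j x Sx; have /andP[b1 b2] := g01 x Sx.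
    by apply/andP; split; lra.
  - move=> x Sx; rewrite -[X in _ --> X](@normr0 _ R) -(subrr (g x)).
    by apply: cvg_norm; apply: cvgB; [exact: Gg|exact: cvg_cst].
  by rewrite divr_gt0.
have [f [hf f01 fe]] := pG j (e / 2) (divr_gt0 e0 (ltr0n _ 2)).
exists f; split=> //; apply: le_trans (Int_abs_tri (rpol_bmeas hf) (bG j) bg) _.
by rewrite (splitr e) lerD.
Qed.

Lemma papprox_ext g g' : papprox g -> (forall x, S x -> g x = g' x) -> papprox g'.
Proof.
move=> pg gg e e0; have [f [hf f01 fe]] := pg e e0; exists f; split=> //.
by rewrite (eq_Int (g := fun x => `|f x - g x|))// => x Sx; rewrite gg.
Qed.

Lemma papproxC g : bmeas g -> papprox g -> papprox (fun x => 1 - g x).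
Proof.
move=> bg pg e e0; have [f [hf f01 fe]] := pg e e0; exists (fun x => 1 + -1 * f x); split.
- by apply: rpol_add; [exact: rpol_cst|exact: rpolZ].
- by move=> x /f01 /andP[h1 h2]; apply/andP; split; lra.
rewrite (eq_Int (g := fun x => `|f x - g x|))// => x _.
by rewrite -normrN; congr (`|_|); ring.
Qed.

Lemma papproxM g h : bmeas g -> bmeas h -> (forall x, S x -> 0 <= g x <= 1) -> (forall x, S x -> 0 <= h x <= 1) ->
  papprox g -> papprox h -> papprox (fun x => g x * h x).
Proof.
move=> bg bh g01 h01 pg ph e e0.
have [f [hf f01 fe]] := pg (e / 2) (divr_gt0 e0 (ltr0n _ 2)).
have [k [hk k01 ke]] := ph (e / 2) (divr_gt0 e0 (ltr0n _ 2)).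
have bf := rpol_bmeas hf; have bk := rpol_bmeas hk.
exists (fun x => f x * k x); split; first exact: rpolM.
  move=> x Sx; have /andP[a1 a2] := f01 x Sx; have /andP[b1 b2] := k01 x Sx.
  by rewrite mulr_ge0//= mulr_ile1.
have b1 := bmeas_norm (bmeasB bf bg); have b2 := bmeas_norm (bmeasB bk bh).
apply: (@le_trans _ _ (I (fun x => `|f x - g x| + `|k x - h x|))); last first.
  by rewrite IntD// (splitr e) lerD.
apply: le_Int; [exact/bmeas_norm/bmeasB/bmeasM/bh/bg/bmeasM|exact: bmeasD|move=> x Sx].
have /andP[a1 a2] := f01 x Sx; have /andP[c1 c2] := k01 x Sx.
have /andP[d1 d2] := g01 x Sx; have /andP[e1 e2] := h01 x Sx.
have -> : f x * k x - g x * h x = (f x - g x) * k x + g x * (k x - h x) by ring.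
rewrite (le_trans (ler_normD _ _))// !normrM lerD//.
  by rewrite ler_piMr// ger0_norm.
by rewrite ler_piMl// ger0_norm.
Qed.

(** Write z = w^2: then j w^j <= 1 / (1 - w), and the remaining factor w^j tends to 0. *)
Lemma cvg_natmul_geometric (z : R) : 0 <= z -> z < 1 -> (j%:R * z ^+ j) @[j --> \oo] --> (0 : R).
Proof.
move=> z0 z1; pose w := Num.sqrt z.
have w0 : 0 <= w by exact: sqrtr_ge0.
have ww : w ^+ 2 = z by rewrite sqr_sqrtr.
have w1 : w < 1 by rewrite -(ltr_pXn2r (n := 2)) ?nnegrE// ww expr1n.
have h1 : ((1 - w)^-1 * w ^+ j) @[j --> \oo] --> (0 : R).
  rewrite -(mulr0 (1 - w)^-1); apply: cvgM; first exact: cvg_cst.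
  by apply: cvg_expr; rewrite ger0_norm.
apply: (squeeze_cvgr _ (cvg_cst (0 : R)) h1); apply: nearW => j.
rewrite mulr_ge0 ?exprn_ge0//= -ww -exprM mulnC exprM -[X in X ^+ 2]mulr1 expr2 mulr1 mulrA.
rewrite ler_wpM2r ?exprn_ge0// -[X in _ <= X]mul1r ler_pdivlMr ?subr_gt0//.
elim: j => [|j ih]; first by rewrite mul0r mul0r.
have p1 : w ^+ j <= 1 by rewrite exprn_ile1// ltW.
have p0 : 0 <= w ^+ j by rewrite exprn_ge0.
rewrite exprS -natr1; move: (w ^+ j) (j%:R : R) ih p0 p1 => v k ih p0 p1.
have : w * (k * v * (1 - w)) <= w * 1 by rewrite ler_wpM2l.
have : 0 <= w * (1 - v) by rewrite mulr_ge0// subr_ge0.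
nra.
Qed.

(** Bernoulli's inequality from both sides, with y = u^j and exponent k = j 2^j: k y = j (2 u)^j
    tends to 0 for u < 1/2 and is at least j otherwise. *)
Lemma threshold_cvg (u : R) : 0 <= u -> u <= 1 ->
  ((1 - u ^+ j) ^+ (j * 2 ^ j)) @[j --> \oo] --> ((u < 2^-1)%R%:R : R).
Proof.
move=> u0 u1; have b01 j : 0 <= 1 - u ^+ j <= 1.
  by rewrite subr_ge0 exprn_ile1//= gerBl exprn_ge0.
have bern (y : R) k : 0 <= y <= 1 -> 1 - k%:R * y <= (1 - y) ^+ k.
  case/andP=> y0 y1; elim: k => [|k ih]; first by rewrite mul0r subr0.
  have h : 0 <= (k%:R : R) by [].
  rewrite exprS -natr1; apply: (@le_trans _ _ ((1 - y) * (1 - k%:R * y))); last by rewrite ler_wpM2l// subr_ge0.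
  by nra.
have bern2 (y : R) k : 0 <= y <= 1 -> (1 - y) ^+ k * (1 + k%:R * y) <= 1.
  case/andP=> y0 y1; elim: k => [|k ih]; first by rewrite mul0r addr0 mul1r.
  have p0 : 0 <= (1 - y) ^+ k by rewrite exprn_ge0// subr_ge0.
  have h : 0 <= (k%:R : R) by [].
  apply: le_trans ih.
  have -> : (1 - y) ^+ k.+1 * (1 + k.+1%:R * y) = (1 - y) ^+ k * ((1 - y) * (1 + (k%:R + 1) * y)).
    by rewrite exprS -natr1; ring.
  rewrite ler_wpM2l//; move: (k%:R : R) h => c c0.
  have : 0 <= (c + 1) * y ^+ 2 by rewrite mulr_ge0 ?sqr_ge0// addr_ge0.
  by nra.
have kE j : (j * 2 ^ j)%:R * u ^+ j = j%:R * (2 * u) ^+ j :> R.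
  by rewrite natrM natrX exprMn mulrA.
have [uh|uh] := ltP u 2^-1.
  have h1 : (1 - j%:R * (2 * u) ^+ j) @[j --> \oo] --> (1 : R).
    rewrite -[X in _ --> X]subr0; apply: cvgB; first exact: cvg_cst.
    by apply: cvg_natmul_geometric; lra.
  apply: (squeeze_cvgr _ h1 (cvg_cst (1 : R))); apply: nearW => j.
  have /andP[c0 c1] := b01 j.
  rewrite -kE exprn_ile1// andbT; apply: bern.
  by rewrite exprn_ge0//= exprn_ile1.
have h1 : ((1 - j.+2%:R^-1 : R) @[j --> \oo] --> (1 : R)) by exact: cvg_1Binv.
have h2 : (j.+1%:R^-1 : R) @[j --> \oo] --> (0 : R) by exact: cvg_harmonic.
apply: (squeeze_cvgr _ (cvg_cst (0 : R)) h2); apply: nearW => j.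
have /andP[c0 c1] := b01 j; rewrite exprn_ge0//=.
rewrite -[X in _ <= X]mul1r ler_pdivlMr//.
apply: le_trans (bern2 (u ^+ j) (j * 2 ^ j)%N _); last by rewrite exprn_ge0//= exprn_ile1.
rewrite ler_wpM2l ?exprn_ge0// kE -natr1 addrC lerD2l ler_peMr//.
by rewrite exprn_ege1//; lra.
Qed.

Lemma papprox_half k (c : R) : papprox (ind [set x | x 0 k < c]).
Proof.
have mk : measurable [set x : X | x 0 k < c].
  rewrite (_ : [set x : X | x 0 k < c] = setT `&` (fun x : X => x 0 k) @^-1` `]-oo, c[%classic).
    exact: (@measurable_coord R n.+1 k measurableT).
  by rewrite setTI; apply/seteqP; split => x /=; rewrite in_itv.
have indE x : ind [set x | x 0 k < c] x = (x 0 k < c)%R%:R.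
  by rewrite /ind; congr (nat_of_bool _)%:R; apply/idP/idP; rewrite inE.
have cst1 (a : R) : 0 <= a <= 1 -> papprox (fun _ => a).
  move=> a01 e e0; exists (fun _ => a); split => //; first exact: rpol_cst.
  by under eq_Rintegral do rewrite subrr normr0; rewrite Int_cst0 ltW.
have [c1|c1] := ltP c (-1).
  apply: papprox_ext (cst1 0 _) _; first by rewrite lexx ler01.
  move=> x Sx; rewrite indE; have := sphere_coord_le k Sx; rewrite ler_norml => /andP[h _].
  by rewrite ltNge (le_trans (ltW c1) h).
have [c2|c2] := ltP 1 c.
  apply: papprox_ext (cst1 1 _) _; first by rewrite lexx ler01.
  move=> x Sx; rewrite indE; have := sphere_coord_le k Sx; rewrite ler_norml => /andP[_ h].
  by rewrite (le_lt_trans h c2).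
(* Affine in the coordinate, equal to 1/2 where the coordinate is c, and with values in [0, 1] on
   the sphere because c >= -1. *)
pose u x : R := (2 * (c + 3))^-1 * (3 + x 0 k * 1).
have c3 : 0 < 2 * (c + 3) by lra.
have ru : rpol u by apply/rpolZ/rpol_add; [exact: rpol_cst|apply: rpol_coord; exact: rpol_cst].
have u01 x : S x -> 0 <= u x <= 1.
  move=> Sx; have := sphere_coord_le k Sx; rewrite ler_norml => /andP[h1 h2].
  rewrite /u mulr1 mulrC divr_ge0 ?(ltW c3)//=; last lra.
  by rewrite ler_pdivrMr//; lra.
have ruj j : rpol (fun x => (1 + -1 * u x ^+ j) ^+ (j * 2 ^ j)).
  by apply: rpolX; apply: rpol_add; [exact: rpol_cst|apply: rpolZ; exact: rpolX].
have v01 j x : S x -> 0 <= (1 + -1 * u x ^+ j) ^+ (j * 2 ^ j) <= 1.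
  move=> /u01 /andP[h1 h2]; have e1 : 0 <= 1 + -1 * u x ^+ j <= 1.
    by rewrite mulN1r subr_ge0 exprn_ile1//= gerBl exprn_ge0.
  by case/andP: e1 => e1 e2; rewrite exprn_ge0//= exprn_ile1.
apply: (@papprox_limit (fun j x => (1 + -1 * u x ^+ j) ^+ (j * 2 ^ j))) => //.
- exact: bmeas_ind.
- by move=> j; exact/rpol_bmeas.
- move=> j e e0; exists (fun x => (1 + -1 * u x ^+ j) ^+ (j * 2 ^ j)); split=> //.
  + exact: v01.
  by under eq_Rintegral do rewrite subrr normr0; rewrite Int_cst0 ltW.
- by move=> x _; rewrite indE; case: (_ < _); rewrite ?lexx ?ler01.
move=> x Sx; rewrite indE.
have -> : (x 0 k < c) = (u x < 2^-1).
  rewrite /u mulr1 mulrC ltr_pdivrMr// [2^-1 * _]mulrA mulVf ?mul1r ?pnatr_eq0//.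
  by apply/idP/idP => ?; lra.
have /andP[h1 h2] := u01 x Sx.
by under eq_fun do rewrite mulN1r; exact: threshold_cvg.
Qed.

Let P (A : set X) := measurable A /\ papprox (ind A).

Let ind01 (A : set X) x : 0 <= ind A x <= 1.
Proof. by rewrite /ind; case: (_ \in _); rewrite ?lexx ?ler01. Qed.

Let P0 : P set0.
Proof.
split=> // e e0; exists (fun _ => 0); split; [exact: rpol_cst|by move=> x _; rewrite lexx ler01|].
rewrite (eq_Int (g := fun _ => 0)) ?Int_cst0 ?ltW// => x _.
by rewrite /ind in_set0 subrr normr0.
Qed.

Let PC A : P A -> P (~` A).
Proof.
move=> [mA pA]; split; first exact: measurableC.
apply: papprox_ext (papproxC (bmeas_ind mA) pA) _ => x _.
by rewrite /ind in_setC; case: (x \in A); rewrite /= ?subrr ?subr0.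
Qed.

Let P_bigcup (F : (set X)^nat) : (forall i, P (F i)) -> P (\bigcup_i F i).
Proof.
move=> PF; have mF i : measurable (F i) by case: (PF i).
split; first exact: bigcupT_measurable.
pose H j x : R := \prod_(i < j) (1 - ind (F i) x).
have H01 j x : 0 <= H j x <= 1.
  rewrite /H; elim: j => [|j /andP[h0 h1]]; first by rewrite big_ord0 ler01 lexx.
  rewrite big_ord_recr /=; have /andP[i0 i1] := ind01 (F j) x.
  by rewrite mulr_ge0 ?subr_ge0//= mulr_ile1// ?subr_ge0// gerBl.
have bC i : bmeas (fun x => 1 - ind (F i) x) by apply: bmeasB; [exact: bmeas_cst|exact: bmeas_ind].
have HS j : H j.+1 = fun x => H j x * (1 - ind (F j) x) by apply/funext => x; rewrite /H big_ord_recr.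
have bH j : bmeas (H j).
  elim: j => [|j ih]; last by rewrite HS; exact: bmeasM.
  by rewrite (_ : H 0%N = fun _ => 1); [exact: bmeas_cst|apply/funext => x; rewrite /H big_ord0].
have pH j : papprox (H j).
  elim: j => [|j ih].
    move=> e e0; exists (fun _ => 1); split; [exact: rpol_cst|by move=> x _; rewrite lexx ler01|].
    rewrite (eq_Int (g := fun _ => 0)) ?Int_cst0 ?ltW// => x _.
    by rewrite /H big_ord0 subrr normr0.
  rewrite HS; apply: papproxM => //; first by move=> x _; have /andP[? ?] := ind01 (F j) x; apply/andP; split; lra.
  by apply: papproxC; [exact: bmeas_ind|case: (PF j)].
apply: (@papprox_limit (fun j x => 1 - H j x)).
- exact/bmeas_ind/bigcupT_measurable.
- by move=> j; apply: bmeasB => //; exact: bmeas_cst.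
- by move=> j; exact: papproxC.
- by move=> j x _; have /andP[? ?] := H01 j x; apply/andP; split; lra.
- by move=> x _; exact: ind01.
move=> x _; have [[i _ Fi]|nF] := pselect ((\bigcup_i F i) x).
  apply: cvg_near_cst; exists i.+1 => // j /= ij.
  rewrite /H (bigD1 (Ordinal ij))//= {1}/ind mem_set//= subrr mul0r subr0.
  by rewrite /ind mem_set//; exists i.
apply: cvg_near_cst; apply: nearW => j.
rewrite [ind (\bigcup_i F i) x]/ind memNset//= /H big1 ?subrr// => i _.
by rewrite /ind memNset ?subr0// => Fi; apply: nF; exists i.
Qed.

(** The approximable measurable sets form a sigma-algebra that contains the half-spaces. *)
Lemma papprox_measurable A : measurable A -> papprox (ind A).
Proof.
move=> mA; suff : P A by case.
move: A mA; suff : g_sigma_preimage (@row_coord _ R n.+1) `<=` P by apply.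
have sP : sigma_algebra setT P.
  by split=> [|A PA|F PF]; [exact: P0|rewrite setTD; exact: PC|exact: P_bigcup].
apply: smallest_sub => //; rewrite -bigcup_seq; apply: bigcup_sub => k _ _ [B mB <-]; rewrite setTI.
suff : (@RGenInftyO.G R).-sigma.-measurable `<=` [set B | P (row_coord k @^-1` B)].
  by rewrite -RGenInftyO.measurableE; apply.
apply: smallest_sub; last first.
  move=> _ [c ->] /=; rewrite (_ : _ @^-1` _ = [set x : X | x 0 k < c]); last first.
    by apply/seteqP; split => x /=; rewrite in_itv.
  split; last exact: papprox_half.
  rewrite (_ : [set x : X | x 0 k < c] = setT `&` (fun x : X => x 0 k) @^-1` `]-oo, c[%classic).
    exact: (@measurable_coord R n.+1 k measurableT).
  by rewrite setTI; apply/seteqP; split => x /=; rewrite in_itv.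
split=> [|B' /= PB|F /= PF].
- by rewrite /= preimage_set0; exact: P0.
- by rewrite setTD preimage_setC; exact: PC.
by rewrite preimage_bigcup; exact: P_bigcup.
Qed.

(** Dyadic expansion: h is the mean of the indicator of h >= 1/2 and of 2 h minus that indicator,
    again with values in [0, 1], and the error halves at each step. *)
Lemma papprox_fun g : bmeas g -> (forall x, S x -> 0 <= g x <= 1) -> papprox g.
Proof.
move=> bg g01 e e0; have w0 : 0 <= omega := @omega_ge0 R m.
suff H k h (d : R) : bmeas h -> (forall x, S x -> 0 <= h x <= 1) -> 0 < d -> exists f,
    [/\ rpol f, forall x, S x -> 0 <= f x <= 1 & I (fun x => `|f x - h x|) <= 2^-1 ^+ k * omega + d].
  have [k hk] : exists k, 2^-1 ^+ k * omega <= e / 2.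
    have h2 : (2^-1 ^+ k * omega : R) @[k --> \oo] --> 0 * omega.
      by apply: cvgM; [apply: cvg_expr; rewrite ger0_norm; lra|exact: cvg_cst].
    rewrite mul0r in h2.
    have [K _ hK] := cvgr_lt 0 h2 _ (divr_gt0 e0 (ltr0n _ 2)).
    by exists K; apply: ltW; apply: hK => /=.
  have [f [hf f01 fe]] := H k g (e / 2) bg g01 (divr_gt0 e0 (ltr0n _ 2)).
  by exists f; split=> //; apply: le_trans fe _; lra.
elim: k h d => [|k ih] h d bh h01 d0.
  exists (fun _ => 0); split; [exact: rpol_cst|by move=> x _; rewrite lexx ler01|].
  rewrite expr0 mul1r (@le_trans _ _ omega) ?lerDl ?(ltW d0)//.
  apply: le_Int; [exact/bmeas_norm/bmeasB/bh/bmeas_cst|exact: bmeas_cst|move=> x Sx].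
  by have /andP[? ?] := h01 x Sx; rewrite sub0r normrN ger0_norm.
pose A := [set x : X | 2^-1 <= h x].
have mA : measurable A.
  rewrite (_ : A = setT `&` h @^-1` `[2^-1, +oo[%classic).
    by case: bh => mh _; exact: mh.
  by rewrite setTI; apply/seteqP; split => x /=; rewrite in_itv /= andbT.
have indA x : ind A x = (2^-1 <= h x)%R%:R.
  by rewrite /ind; congr (nat_of_bool _)%:R; apply/idP/idP; rewrite inE.
have bh' : bmeas (fun x => 2 * h x - ind A x) by apply: bmeasB; [exact: bmeasZ|exact: bmeas_ind].
have [|f [hf f01 fe]] := ih _ d bh' _ d0.
  move=> x Sx; have /andP[? ?] := h01 x Sx; rewrite indA.
  by case: (leP 2^-1 (h x)) => h1 /=; apply/andP; split; lra.
have [f' [hf' f01' fe']] := papprox_measurable mA d0.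
exists (fun x => 2^-1 * (f x + f' x)); split; first by apply/rpolZ/rpol_add.
  by move=> x Sx; have /andP[? ?] := f01 x Sx; have /andP[? ?] := f01' x Sx; apply/andP; split; lra.
have b1 := bmeas_norm (bmeasB (rpol_bmeas hf) bh').
have b2 := bmeas_norm (bmeasB (rpol_bmeas hf') (bmeas_ind mA)).
apply: (@le_trans _ _ (I (fun x => 2^-1 * (`|f x - (2 * h x - ind A x)| + `|f' x - ind A x|)))).
  apply: le_Int; [|exact/bmeasZ/bmeasD|move=> x Sx].
    by apply/bmeas_norm/bmeasB => //; apply/bmeasZ/bmeasD; exact: rpol_bmeas.
  have -> : 2^-1 * (f x + f' x) - h x = 2^-1 * ((f x - (2 * h x - ind A x)) + (f' x - ind A x)) by field.
  by rewrite normrM ger0_norm ?invr_ge0// ler_wpM2l ?invr_ge0// ler_normD.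
rewrite IntZ ?IntD//; last exact: bmeasD.
by rewrite exprS -mulrA; move: (2^-1 ^+ k * omega) fe => z fe; move: fe fe'; lra.
Qed.

(** g is truncated at height j and rescaled to [0, 1], where the square of an error is at most the
    error, so that L^1 approximation suffices. *)
Lemma L2_poly g : measurable_fun S g -> vol.-integrable S (fun x => (g x ^+ 2)%:E) -> forall e : R, 0 < e ->
  exists f, rpol f /\ I (fun x => (g x - f x) ^+ 2) <= e.
Proof.
move=> mg ig e e0.
have [h [mh hg]] : exists h : X -> R, measurable_fun setT h /\ forall x, S x -> h x = g x.
  exists (g \_ S); split; first exact: ((measurable_restrictT g mS).1 mg).
  by move=> x Sx; rewrite patchE mem_set.
pose clip (M : R) (t : R) := Num.max (- M) (Num.min t M).
have mclip M : measurable_fun setT (fun x => clip M (h x)).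
  by apply: measurable_maxr => //; exact: measurable_minr.
have clipM (M t : R) : 0 <= M -> `|clip M t| <= M.
  by move=> M0; rewrite /clip ler_norml; case: (leP t M) => ?; [case: (leP (- M) t)|case: (leP (- M) M)] => ?; apply/andP; split; lra.
have clip_id (M t : R) : `|t| <= M -> clip M t = t.
  by rewrite ler_norml => /andP[? ?]; rewrite /clip min_l// max_r.
have clip_le (M t : R) : 0 <= M -> (t - clip M t) ^+ 2 <= t ^+ 2.
  by move=> M0; rewrite /clip; case: (leP t M) => ?; [case: (leP (- M) t)|case: (leP (- M) M)] => ?; nra.
have mF j : measurable_fun S (fun x => (h x - clip j%:R (h x)) ^+ 2).
  by apply: measurable_funTS; apply: measurable_funX; exact: measurable_funB.
have [j hj] : exists j : nat, I (fun x => (h x - clip j%:R (h x)) ^+ 2) <= e / 4.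
  apply: (@Int_small (fun j x => (h x - clip j%:R (h x)) ^+ 2) (fun x => g x ^+ 2)) => //.
  - by move=> j x Sx; rewrite ger0_norm ?sqr_ge0// -hg// clip_le.
  - move=> x Sx; apply: cvg_near_cst; near=> j.
    rewrite clip_id ?subrr ?expr0n//; near: j.
    exact: nbhs_infty_ger.
  by rewrite divr_gt0.
pose M : R := j%:R + 1; have M0 : 0 < M by rewrite ltr_wpDl.
have jM (t : R) : `|clip j%:R t| <= M by rewrite (le_trans (clipM _ _ _))// lerDl.
pose G x := (2 * M)^-1 * (clip j%:R (h x) + M).
have bcl : bmeas (fun x => clip j%:R (h x)) by split=> //; exists M => x _; exact: jM.
have bG : bmeas G by apply/bmeasZ/bmeasD => //; exact: bmeas_cst.
have M2 : 0 < 2 * M by rewrite mulr_gt0.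
have G01 x : S x -> 0 <= G x <= 1.
  move=> _; have := jM (h x); rewrite ler_norml => /andP[h1 h2].
  rewrite /G mulrC divr_ge0 ?(ltW M2)//=; last lra.
  by rewrite ler_pdivrMr//; lra.
(* The L^1 error is multiplied by 2 (2 M)^2 = 8 M^2, which gives e / 2; the truncation contributes 2
   (e / 4). *)
have d0 : 0 < e / (16 * M ^+ 2) by rewrite divr_gt0// mulr_gt0// exprn_gt0.
have [f [hf f01 fe]] := papprox_fun bG G01 d0.
exists (fun x => 2 * M * f x + - M); split.
  by apply: rpol_add; [exact: rpolZ|exact: rpol_cst].
have bN := bmeas_norm (bmeasB (rpol_bmeas hf) bG).
have i1 : vol.-integrable S (EFin \o (fun x => 2 * (h x - clip j%:R (h x)) ^+ 2)).
  apply: (le_integrable mS _ _ (integrableZl mS 2 ig)).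
    by apply/measurable_EFinP; exact: measurable_funM.
  move=> x Sx; have a1 (t : R) : 0 <= 2 * t ^+ 2 by exact: mulr_ge0 (ler0n _ 2) (sqr_ge0 _).
  by rewrite -EFinM !abse_EFin lee_fin (ger0_norm (a1 _)) (ger0_norm (a1 _)) -hg// ler_wpM2l// clip_le.
have i2 : vol.-integrable S (EFin \o (fun x => (8 * M ^+ 2) * `|f x - G x|)) by exact: bmeas_int (bmeasZ _ bN).
apply: (@le_trans _ _ (I (fun x => 2 * (h x - clip j%:R (h x)) ^+ 2 + (8 * M ^+ 2) * `|f x - G x|))).
  have pw x : S x -> (g x - (2 * M * f x + - M)) ^+ 2 <=
      2 * (h x - clip j%:R (h x)) ^+ 2 + (8 * M ^+ 2) * `|f x - G x|.
    move=> Sx; rewrite -hg//; have /andP[f0 f1] := f01 x Sx; have /andP[g0 g1] := G01 x Sx.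
    have cE : clip j%:R (h x) = 2 * M * G x - M by rewrite /G mulrA divff ?mul1r ?addrK// gt_eqF.
    have l1 : (f x - G x) ^+ 2 <= `|f x - G x|.
      rewrite -real_normK ?num_real// expr2 ler_piMl// ler_norml; apply/andP; split; lra.
    have -> : h x - (2 * M * f x + - M) = (h x - clip j%:R (h x)) - 2 * M * (f x - G x) by rewrite cE; ring.
    have l2 : (2 * M * (f x - G x)) ^+ 2 <= 4 * M ^+ 2 * `|f x - G x|.
      rewrite exprMn (_ : (2 * M) ^+ 2 = 4 * M ^+ 2); last by ring.
      by rewrite ler_wpM2l// mulr_ge0 ?sqr_ge0.
    move: (h x - clip j%:R (h x)) (2 * M * (f x - G x)) l2 => u v l2.
    by have := sqr_ge0 (u + v); nra.
  have i12 : vol.-integrable S (EFin \o (fun x => 2 * (h x - clip j%:R (h x)) ^+ 2 + (8 * M ^+ 2) * `|f x - G x|)).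
    apply: (eq_integrable mS _ _ _ (integrableD mS i1 i2)) => x _.
    by rewrite /= -EFinD.
  have i0 : vol.-integrable S (EFin \o (fun x => (g x - (2 * M * f x + - M)) ^+ 2)).
    apply: (le_integrable mS _ _ i12).
      apply/measurable_EFinP; apply: measurable_funX; apply: measurable_funB => //.
      by apply: measurable_funTS; have [] := rpol_bmeas (rpol_add (rpolZ (2 * M) hf) (rpol_cst (- M))).
    by move=> x Sx; rewrite !abse_EFin lee_fin ger0_norm ?sqr_ge0// (le_trans (pw x Sx))// ler_norm.
  exact: (le_Rintegral mS i0 i12 pw).
have i3 : vol.-integrable S (EFin \o (fun x => (h x - clip j%:R (h x)) ^+ 2)).
  apply: (le_integrable mS _ _ ig); first by apply/measurable_EFinP.
  by move=> x Sx; rewrite !abse_EFin lee_fin !ger0_norm ?sqr_ge0// -hg// clip_le.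
rewrite (RintegralD mS i1 i2) (IntZ _ bN) (RintegralZl _ mS i3).
have h3 : 8 * M ^+ 2 * I (fun x => `|f x - G x|) <= e / 2.
  apply: (@le_trans _ _ (8 * M ^+ 2 * (e / (16 * M ^+ 2)))).
    by rewrite ler_wpM2l// mulr_ge0 ?sqr_ge0.
  by rewrite le_eqVlt; apply/orP; left; apply/eqP; field; rewrite gt_eqF.
lra.
Unshelve. all: by end_near.
Qed.

End polynomial_density.

(** * Density of finite sums of eigenspinors in L^2 *)

Section spinor_density.
Context {R : realType} (m : nat).
Local Notation n := m.+2.
Local Notation N := (spinor_rank n).
Local Notation vol := (@sphere_volume R n).
Local Notation S := (@sphere R n).
Local Notation X := 'rV[R]_n.+1.
Local Notation C := R[i].
Local Notation V := 'cV[C]_N.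
Local Notation spin := (spinor R n).
Implicit Types (x : X) (p q u v w : spin) (s : R).
Variable gamma : 'I_n -> 'M[C]_N.
Hypothesis cl : clifford_rep gamma.

Let mS : measurable S := @measurable_sphere R n.

Definition decq q := exists K phi, dec gamma K phi q.

Lemma decq_lin p q s : decq p -> decq q -> decq (fun x => p x + s%:C *: q x).
Proof.
move=> [K [phi hp]] [K' [phi' hq]].
have [h1 h3] := dec_widen hp (leq_addr K' K); have [h2 h4] := dec_widen hq (leq_addl K K').
exists (K + K')%N, (fun (i : nat) (x : X) => (if (i < K)%N then phi i else fun _ => 0) x +
  s%:C *: (if (i < K')%N then phi' i else fun _ => 0) x); split; first by move=> i; exact: eigs_lin.
rewrite h3 h4.
by apply/funext => x; rewrite big_split /= scaler_sumr.
Qed.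

Lemma decq_eigs i p : eigs gamma i p -> decq p.
Proof.
move=> hp; exists i.+1, (fun j => if j == i then p else fun _ => 0); split.
  by move=> j; case: eqP => [->|_] //; exact: eigs0.
apply/funext => x; rewrite (bigD1 (Ordinal (ltnSn i)))//= eqxx big1 ?addr0// => j ji.
by rewrite (_ : (nat_of_ord j == i) = false)//; apply: contra_neqF ji => /eqP h2; exact/val_inj.
Qed.

Lemma decq0 : decq (fun _ => 0).
Proof. exact: decq_eigs (eigs0 gamma 0). Qed.

Lemma decq_sum (J : Type) (r : seq J) (F : J -> spin) : (forall j, decq (F j)) ->
  decq (fun x => \sum_(j <- r) F j x).
Proof.
move=> hF; elim: r => [|j r ih].
  rewrite (_ : (fun x => _) = fun _ => 0); first exact: decq0.
  by apply/funext => x; rewrite big_nil.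
rewrite (_ : (fun x => _) = fun x => \sum_(j <- r) F j x + 1%:C *: F j x); first exact: decq_lin.
by apply/funext => x; rewrite big_cons scale1r addrC.
Qed.

Lemma decq_hspin d p : hspin d p -> decq p.
Proof.
move=> hp; have [phi [h1 h2]] := eigp_decomp (gpair cl) hp.
rewrite (_ : p = fun x => \sum_(i < d.*2.+1) phi i x); last exact/funext.
by apply: decq_sum => i; apply: decq_eigs; exact: eigp_eigs (h1 i).
Qed.

Lemma decq_rpol (f : X -> R) (v : V) : rpol f -> decq (fun x => (f x)%:C *: v).
Proof.
move=> /rpol_hpol[D [h [hh fE]]].
rewrite (_ : (fun x => _) = fun x => \sum_(d < D) (h d x)%:C *: v).
  apply: decq_sum => d; apply: (@decq_hspin d) => i; split.
    apply: (hpol_eq (hpolZ (complex.Re (v i 0)) (hh d))) => x.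
    by rewrite mxE complex_ReM /= oppr0 mul0r addr0 mulrC.
  apply: (hpol_eq (hpolZ (complex.Im (v i 0)) (hh d))) => x.
  by rewrite mxE complex_ImM /= mul0r addr0 mulrC.
by apply/funext => x; rewrite fE rmorph_sum scaler_suml.
Qed.

Lemma dec_bspin K phi q : dec gamma K phi q -> bspin q.
Proof.
move=> [h ->] l.
have e1 : (fun x => complex.Re ((\sum_(i < K) phi i x) l 0)) = (fun x => \sum_(i < K) cRe (phi i) l x).
  by apply/funext => x; rewrite summxE raddf_sum.
have e2 : (fun x => complex.Im ((\sum_(i < K) phi i x) l 0)) = (fun x => \sum_(i < K) cIm (phi i) l x).
  by apply/funext => x; rewrite summxE raddf_sum.
split; [rewrite e1|rewrite e2]; apply: bmeas_sum => i; have [h1 h2] := es_harm (h i) l.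
  by case: h1.
by case: h2.
Qed.

Lemma decq_L2 q : decq q -> in_L2 q.
Proof. by move=> [K [phi /dec_L2]]. Qed.

Definition approx p := in_L2 p /\ forall e : R, 0 < e -> exists2 q, decq q & dist2 p q <= e.

Lemma ip_double f g : in_L2 f -> in_L2 g ->
  ip (fun x => f x + 1%:C *: g x) (fun x => f x + 1%:C *: g x) <= 2 * ip f f + 2 * ip g g.
Proof.
move=> lf lg; have := ip_ge0 (fun x => f x + (-1)%:C *: g x).
rewrite (ip_expand 1 lf lg) (ip_expand (-1) lf lg).
by move: (ip f f) (ip f g) (ip g g) => A B D; lra.
Qed.

Lemma dist2_tri p q u w : in_L2 p -> in_L2 q -> in_L2 u -> in_L2 w ->
  dist2 (fun x => p x + u x) (fun x => q x + w x) <= 2 * dist2 p q + 2 * dist2 u w.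
Proof.
move=> lp lq lu lw; have l1 := L2lin (-1) lp lq; have l2 := L2lin (-1) lu lw.
rewrite /dist2; have -> : (fun x => p x + u x + (-1)%:C *: (q x + w x)) =
  (fun x => (p x + (-1)%:C *: q x) + 1%:C *: (u x + (-1)%:C *: w x)).
  by apply/funext => x; rewrite scale1r scalerDr addrACA.
exact: ip_double.
Qed.

Lemma approx_add p u : approx p -> approx u -> approx (fun x => p x + u x).
Proof.
move=> [lp ap] [lu au]; split=> [|e e0]; first exact: L2D.
have e4 : 0 < e / 4 by rewrite divr_gt0.
have [q hq pq] := ap _ e4; have [w hw uw] := au _ e4.
exists (fun x => q x + 1%:C *: w x); first exact: decq_lin.
rewrite (_ : (fun x => q x + 1%:C *: w x) = fun x => q x + w x); last by apply/funext => x; rewrite scale1r.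
by have := dist2_tri lp (decq_L2 hq) lu (decq_L2 hw); lra.
Qed.

Lemma approx_sum (J : Type) (r : seq J) (F : J -> spin) : (forall j, approx (F j)) ->
  approx (fun x => \sum_(j <- r) F j x).
Proof.
move=> hF; elim: r => [|j r ih].
  rewrite (_ : (fun x => _) = fun _ => 0); last by apply/funext => x; rewrite big_nil.
  split=> [|e e0]; first exact: L20.
  exists (fun _ => 0); first exact: decq0.
  rewrite /dist2 (_ : (fun x => _) = fun _ => 0); last by apply/funext => x; rewrite scaler0 addr0.
  rewrite /ip (_ : (fun x => rdot 0 0) = fun _ => 0) ?Int_cst0 ?ltW//.
  by apply/funext => _; rewrite rdotE big1// => i _; rewrite mxE /= !mulr0 addr0.
rewrite (_ : (fun x => _) = fun x => F j x + \sum_(j <- r) F j x); first exact: approx_add.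
by apply/funext => x; rewrite big_cons.
Qed.

Lemma approx_fun (g : X -> R) (v : V) : in_L2 (fun x => (g x)%:C *: v) -> measurable_fun S g ->
  vol.-integrable S (fun x => (g x ^+ 2)%:E) -> approx (fun x => (g x)%:C *: v).
Proof.
move=> lg mg ig; split=> // e e0.
pose c := rdot v v; have c0 : 0 <= c by rewrite /c -cnorm_sqr sqr_ge0.
have d0 : 0 < e / (c + 1) by rewrite divr_gt0// ltr_wpDl.
have [f [hf fe]] := L2_poly mg ig d0.
exists (fun x => (f x)%:C *: v); first exact: decq_rpol.
rewrite /dist2 /ip.
have mf : measurable_fun S f by apply: measurable_funTS; have [] := rpol_bmeas hf.
have i2 : vol.-integrable S (EFin \o (fun x => (g x - f x) ^+ 2)).
  have if2 := bmeas_int (bmeasX 2 (rpol_bmeas hf)).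
  apply: (le_integrable mS _ _ (integrableD mS (integrableZl mS 2 ig) (integrableZl mS 2 if2))).
    by apply/measurable_EFinP; apply: measurable_funX; exact: measurable_funB.
  move=> x _; rewrite /= lee_fin ger0_norm ?sqr_ge0//.
  apply: le_trans (ler_norm _).
  by have := sqr_ge0 (g x + f x); move: (g x) (f x) => A B; nra.
rewrite (eq_Int (g := fun x => c * (g x - f x) ^+ 2)); last first.
  move=> x _; rewrite scalerA -rmorphM /= mulN1r -scalerDl -rmorphD /=.
  by rewrite rdotZl rdotC rdotZl -/c; ring.
rewrite (RintegralZl _ mS i2).
apply: le_trans (ler_wpM2l c0 fe) _.
by rewrite mulrA ler_pdivrMr ?ltr_wpDl//; nra.
Qed.

Lemma approx_L2 p : in_L2 p -> approx p.
Proof.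
move=> lp; have [mp _] := lp.
pose e (l : 'I_N) : V := delta_mx l 0.
rewrite (_ : p = fun x => \sum_l ((cRe p l x)%:C *: e l + (cIm p l x)%:C *: ((ci : C) *: e l))); last first.
  apply/funext => x; apply/colP => k; rewrite summxE (bigD1 k)//= big1 ?addr0 => [|j jk].
    rewrite !mxE !eqxx /= !mulr1 /cRe /cIm /ci; case: (p x k 0) => u w.
    by apply/eqP; rewrite eq_complex /= !(mul0r, mulr0, mulr1, subr0, addr0, add0r) !eqxx.
  by rewrite !mxE eq_sym (negPf jk) /= !mulr0 addr0.
have i2 l : vol.-integrable S (fun x => (cRe p l x ^+ 2)%:E) /\ vol.-integrable S (fun x => (cIm p l x ^+ 2)%:E).
  have h x : cRe p l x ^+ 2 + cIm p l x ^+ 2 <= cnorm (p x) ^+ 2.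
    rewrite cnorm_sqr rdotE (bigD1 l)//= -!expr2 lerDl sumr_ge0// => j _.
    by rewrite addr_ge0// -expr2 sqr_ge0.
  have [m1 m2] := mp l; split; apply: (le_integrable mS _ _ (L2_sqr lp)).
  - by apply/measurable_EFinP; exact: measurable_funX.
  - move=> x _; rewrite !abse_EFin lee_fin !ger0_norm ?sqr_ge0//; have := h x.
    by have := sqr_ge0 (cIm p l x); lra.
  - by apply/measurable_EFinP; exact: measurable_funX.
  move=> x _; rewrite !abse_EFin lee_fin !ger0_norm ?sqr_ge0//; have := h x.
  by have := sqr_ge0 (cRe p l x); lra.
have lL (g : X -> R) (v : V) : measurable_fun S g -> vol.-integrable S (fun x => (g x ^+ 2)%:E) ->
    in_L2 (fun x => (g x)%:C *: v).
  move=> mg ig; apply: in_L2E.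
    move=> i; split.
      rewrite (_ : (fun x => _) = fun x => g x * complex.Re (v i 0)); first exact: measurable_funM.
      by apply/funext => x; rewrite mxE complex_ReM /= oppr0 mul0r addr0.
    rewrite (_ : (fun x => _) = fun x => g x * complex.Im (v i 0)); first exact: measurable_funM.
    by apply/funext => x; rewrite mxE complex_ImM /= mul0r addr0.
  rewrite (_ : (fun x => _) = fun x => ((rdot v v)%:E * (g x ^+ 2)%:E)%E); first exact: integrableZl.
  by apply/funext => x; rewrite cnorm_sqr rdotZl rdotC rdotZl -EFinM; congr EFin; ring.
apply: approx_sum => l; have [m1 m2] := mp l; have [i1 i3] := i2 l.
by apply: approx_add; apply: approx_fun => //; exact: lL.
Qed.

(** Density upgraded to an orthogonal projection: that the residual is orthogonal to every component
    is what keeps energies and norms from increasing. *)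
Lemma L2_projection p (e : R) : in_L2 p -> 0 < e -> exists K phi q,
  [/\ dec gamma K phi q, forall i, ip (fun x => p x + (-1)%:C *: q x) (phi i) = 0 & dist2 p q <= e].
Proof.
move=> lp e0; have [_ /(_ e e0)[q' [K' [phi' [h1 qE]]] pq']] := approx_L2 lp.
have [K [phi [q [hq o hd]]]] := projection_dec (ix := id) K' h1 lp.
exists K, phi, q; split => //; apply: le_trans (hd (fun _ => 1)) _; apply: le_trans pq'.
by rewrite qE le_eqVlt; apply/orP; left; apply/eqP; congr dist2; apply/funext => x; apply: eq_bigr => j _; rewrite scale1r.
Qed.

End spinor_density.

(** * Fubini's theorem on the sphere *)

Section double_integral.
Context {R : realType} (m : nat).
Local Notation n := m.+2.
Local Notation vol := (@sphere_volume R n).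
Local Notation S := (@sphere R n).
Local Notation X := 'rV[R]_n.+1.
Local Notation I f := (\int[vol]_(y in S) f y).
Implicit Types (x y : X).

Let mS : measurable S := @measurable_sphere R n.

Lemma measurable_edot2 : measurable_fun setT (fun z : X * X => edot z.1 z.2).
Proof.
apply: measurable_sum => k; apply: measurable_funM.
  by apply: (measurableT_comp (f := fun x : X => x 0 k)); [exact: measurable_coord|exact: measurable_fst].
by apply: (measurableT_comp (f := fun x : X => x 0 k)); [exact: measurable_coord|exact: measurable_snd].
Qed.

Lemma measurable_section1 (f : X * X -> R) x : measurable_fun setT f -> measurable_fun setT (fun y => f (x, y)).
Proof. by move=> mf; apply: measurableT_comp mf _; exact: measurable_pair1. Qed.

Lemma measurable_section2 (f : X * X -> R) y : measurable_fun setT f -> measurable_fun setT (fun x => f (x, y)).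
Proof. by move=> mf; apply: measurableT_comp mf _; exact: measurable_pair2. Qed.

Lemma measurable_inner (f : X * X -> R) : measurable_fun setT f -> (forall z, 0 <= f z) ->
  measurable_fun setT (fun x => \int[vol]_(y in S) (f (x, y))%:E)%E.
Proof.
move=> mf f0; have mE : measurable_fun setT (EFin \o f) by apply/measurable_EFinP.
have := @measurable_fun_fubini_tonelli_F _ _ _ _ _ vol (EFin \o f) mE (fun z => f0 z).
rewrite (_ : fubini_F _ _ = fun x => \int[vol]_(y in S) (f (x, y))%:E)%E//.
apply/funext => x; rewrite /fubini_F integral_volT//.
by apply/measurable_EFinP; exact: measurable_section1.
Qed.

Lemma fubini_sphere (f K : X * X -> R) (C : R) : measurable_fun setT f -> measurable_fun setT K ->
  (forall z, 0 <= K z) -> (\int[vol]_(x in S) \int[vol]_(y in S) (K (x, y))%:E < +oo)%E ->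
  (forall x y, S x -> S y -> `|f (x, y)| <= C * K (x, y)) ->
  (forall x, S x -> vol.-integrable S (fun y => (f (x, y))%:E)) ->
  (forall y, S y -> vol.-integrable S (fun x => (f (x, y))%:E)) ->
  I (fun x => I (fun y => f (x, y))) = I (fun y => I (fun x => f (x, y))) /\
  vol.-integrable S (fun x => (I (fun y => f (x, y)))%:E).
Proof.
move=> mf mK K0 Koo fK i1 i2.
have mE : measurable_fun setT (EFin \o f) by apply/measurable_EFinP.
have mn : measurable_fun setT (fun z => `|f z|) by apply: measurableT_comp.
have ff : (vol \x vol)%E.-integrable setT (EFin \o f).
  apply/integrable12ltyP => //.
  have e x : (\int[vol]_y `|(EFin \o f) (x, y)| = \int[vol]_(y in S) (`|f (x, y)|)%:E)%E.
    by rewrite integral_volT//; apply/measurable_EFinP; exact: (measurable_section1 _ mn).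
  under eq_integral do rewrite e.
  rewrite integral_volT; last exact: (@measurable_inner (fun z => `|f z|)).
  apply: (@le_lt_trans _ _ (\int[vol]_(x in S) \int[vol]_(y in S) (`|C| * K (x, y))%:E)%E).
    apply: ge0_le_integral => //.
    - by move=> x _; apply: integral_ge0 => y _; rewrite lee_fin.
    - by apply: measurable_funTS; exact: (@measurable_inner (fun z => `|f z|)).
    - apply: measurable_funTS; apply: (@measurable_inner (fun z => `|C| * K z)).
        exact: measurable_funM.
      by move=> z; rewrite mulr_ge0.
    move=> x Sx; apply: ge0_le_integral => //.
    - by apply: measurable_funTS; apply/measurable_EFinP; exact: (measurable_section1 _ mn).
    - apply: measurable_funTS; apply/measurable_EFinP; apply: measurable_funM => //.
      exact: measurable_section1.
    by move=> y Sy; rewrite lee_fin (le_trans (fK _ _ Sx Sy))// ler_wpM2r// ler_norm.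
  under eq_integral => x _.
    under eq_integral do rewrite EFinM.
    rewrite ge0_integralZl//; last 2 first.
      by apply: measurable_funTS; apply/measurable_EFinP; exact: measurable_section1.
      by move=> y _; rewrite lee_fin.
    over.
  rewrite ge0_integralZl//; last 2 first.
    by apply: measurable_funTS; exact: measurable_inner.
    by move=> x _; apply: integral_ge0 => y _; rewrite lee_fin.
  by rewrite lte_mul_pinfty// lee_fin.
have E1 x : S x -> (I (fun y => f (x, y)))%:E = (\int[vol]_y (f (x, y))%:E)%E.
  move=> Sx; rewrite integral_volT; last by apply/measurable_EFinP; exact: measurable_section1.
  by rewrite /Rintegral fineK//; apply: integrable_fin_num => //; exact: i1.
have E2 y : S y -> (I (fun x => f (x, y)))%:E = (\int[vol]_x (f (x, y))%:E)%E.
  move=> Sy; rewrite integral_volT; last by apply/measurable_EFinP; exact: measurable_section2.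
  by rewrite /Rintegral fineK//; apply: integrable_fin_num => //; exact: i2.
split.
  have := Fubini ff; rewrite integral_volT; last exact: (measurable_fubini_F ff).
  rewrite integral_volT; last exact: (measurable_fubini_G ff).
  move=> h; rewrite /Rintegral.
  rewrite (eq_integral (fun x => \int[vol]_y (f (x, y))%:E)%E); last by move=> x /set_mem /E1.
  by rewrite h; congr fine; apply: eq_integral => y /set_mem /E2.
apply: (eq_integrable mS (fun x => \int[vol]_y (f (x, y))%:E)%E); first by move=> x /set_mem /E1.
exact: (integrableS measurableT mS (@subsetT _ _) (integrable_fubini_F ff)).
Qed.

End double_integral.

(** * Energies and the Newton form *)

Section kernel_form.
Context {R : realType} (m : nat).
Local Notation n := m.+2.
Local Notation N := (spinor_rank n).
Local Notation vol := (@sphere_volume R n).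
Local Notation S := (@sphere R n).
Local Notation X := 'rV[R]_n.+1.
Local Notation C := R[i].
Local Notation V := 'cV[C]_N.
Local Notation spin := (spinor R n).
Local Notation I f := (\int[vol]_(y in S) f y).
Implicit Types (x y : X) (u v w p q : spin) (f g : X * X -> R).

Let mS : measurable S := @measurable_sphere R n.

Definition bmeas2 f := measurable_fun setT f /\
  exists C : R, forall x y, S x -> S y -> `|f (x, y)| <= C.

Lemma bmeas2D f g : bmeas2 f -> bmeas2 g -> bmeas2 (fun z => f z + g z).
Proof.
move=> [mf [C hC]] [mg [D hD]]; split; first exact: measurable_funD.
by exists (C + D) => x y Sx Sy; rewrite (le_trans (ler_normD _ _))// lerD ?hC ?hD.
Qed.

Lemma bmeas2M f g : bmeas2 f -> bmeas2 g -> bmeas2 (fun z => f z * g z).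
Proof.
move=> [mf [C hC]] [mg [D hD]]; split; first exact: measurable_funM.
by exists (C * D) => x y Sx Sy; rewrite normrM ler_pM ?hC ?hD.
Qed.

Lemma bmeas2_fst (h : X -> R) : bmeas h -> bmeas2 (fun z => h z.1).
Proof.
move=> [mh [C hC]]; split; first by apply: measurableT_comp mh _; exact: measurable_fst.
by exists C => x y Sx _; exact: hC.
Qed.

Lemma bmeas2_snd (h : X -> R) : bmeas h -> bmeas2 (fun z => h z.2).
Proof.
move=> [mh [C hC]]; split; first by apply: measurableT_comp mh _; exact: measurable_snd.
by exists C => x y _ Sy; exact: hC.
Qed.

Lemma bmeas2Z (c : R) f : bmeas2 f -> bmeas2 (fun z => c * f z).
Proof. by apply: bmeas2M; exact: (bmeas2_fst (bmeas_cst m c)). Qed.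

Lemma bmeas2_sum (J : Type) (s : seq J) (F : J -> X * X -> R) :
  (forall j, bmeas2 (F j)) -> bmeas2 (fun z => \sum_(j <- s) F j z).
Proof.
move=> bF; elim: s => [|j s ih].
  by under eq_fun do rewrite big_nil; exact: (bmeas2_fst (bmeas_cst m 0)).
by under eq_fun do rewrite big_cons; exact: bmeas2D.
Qed.

Lemma bmeas2_swap f : bmeas2 f -> bmeas2 (fun z => f (z.2, z.1)).
Proof.
move=> [mf [C hC]]; split; last by exists C => x y Sx Sy; exact: hC.
apply: measurableT_comp mf _; apply: measurable_fun_pair; [exact: measurable_snd|exact: measurable_fst].
Qed.

Lemma bmeas2_section f x : bmeas2 f -> S x -> bmeas (fun y => f (x, y)).
Proof. by move=> [mf [C hC]] Sx; split; [exact: measurable_section1|exists C => y Sy; exact: hC]. Qed.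

Lemma bmeas2_rdot u v : bspin u -> bspin v -> bmeas2 (fun z => rdot (u z.1) (v z.2)).
Proof.
move=> bu bv; under eq_fun do rewrite rdotE.
apply: bmeas2_sum => l; have [u1 u2] := bu l; have [v1 v2] := bv l.
apply: bmeas2D; apply: bmeas2M; rewrite -?[fun z => complex.Re _]/(_ \o _).
- exact: (bmeas2_fst u1).
- exact: (bmeas2_snd v1).
- exact: (bmeas2_fst u2).
- exact: (bmeas2_snd v2).
Qed.

Section kernel.
Variables (k : R -> R) (kappa : R).
Hypotheses (mk : measurable_fun setT k) (k0 : forall t, 0 <= k t)
  (ik : forall x, S x -> vol.-integrable S (fun y => (k (edot x y))%:E))
  (Ik : forall x, S x -> I (fun y => k (edot x y)) = kappa).

Let mK : measurable_fun setT (fun z : X * X => k (edot z.1 z.2)).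
Proof. exact: (measurableT_comp mk (@measurable_edot2 R m)). Qed.

Definition kform f := I (fun x => I (fun y => k (edot x y) * f (x, y))).

Lemma integrable_kernelM (h : X -> R) x : S x -> bmeas h ->
  vol.-integrable S (fun y => (k (edot x y) * h y)%:E).
Proof.
move=> Sx [mh [C hC]].
have mkx : measurable_fun setT (fun y => k (edot x y)) by apply: measurableT_comp mk _; exact: measurable_edotl.
apply: (le_integrable mS _ _ (integrableZl mS C (ik Sx))).
  by apply/measurable_EFinP; apply: measurable_funTS; exact: measurable_funM.
move=> y Sy; rewrite -EFinM !abse_EFin lee_fin normrM (ger0_norm (k0 _)) mulrC.
rewrite normrM (ger0_norm (k0 _)) ler_wpM2r//.
by rewrite (le_trans (hC y Sy))// ler_norm.
Qed.

Lemma kernel_lty : (\int[vol]_(x in S) \int[vol]_(y in S) (k (edot x y))%:E < +oo)%E.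
Proof.
rewrite (eq_integral (fun _ => kappa%:E)); last first.
  move=> x /set_mem Sx; rewrite -(Ik Sx) /Rintegral fineK//.
  exact: integrable_fin_num (ik Sx).
have /integrableP[_] := bmeas_int (bmeas_cst m kappa); apply: le_lt_trans.
by apply: le_integral => //; [exact: bmeas_int (bmeas_cst m kappa)|apply: integrable_abse; exact: bmeas_int (bmeas_cst m kappa)|move=> x _; rewrite /= lee_fin ler_norm].
Qed.

Lemma kform_fubini f : bmeas2 f -> kform f = I (fun y => I (fun x => k (edot x y) * f (x, y))) /\
  vol.-integrable S (fun x => (I (fun y => k (edot x y) * f (x, y)))%:E).
Proof.
move=> bf; have [mf [C hC]] := bf.
apply: (@fubini_sphere _ _ (fun z => k (edot z.1 z.2) * f z) (fun z => k (edot z.1 z.2)) C).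
- exact: measurable_funM.
- exact: mK.
- by move=> z; exact: k0.
- exact: kernel_lty.
- by move=> x y Sx Sy /=; rewrite normrM (ger0_norm (k0 _)) mulrC ler_wpM2r// hC.
- by move=> x Sx; apply: integrable_kernelM => //; exact: bmeas2_section.
move=> y Sy /=.
have := integrable_kernelM Sy (bmeas2_section (bmeas2_swap bf) Sy).
by under eq_fun do rewrite edotC.
Qed.

Lemma kform_swap f : bmeas2 f -> kform (fun z => f (z.2, z.1)) = kform f.
Proof.
move=> bf; rewrite (kform_fubini bf).1; apply: eq_Int => y _; apply: eq_Int => x _.
by rewrite edotC.
Qed.

Lemma kformD f g : bmeas2 f -> bmeas2 g -> kform (fun z => f z + g z) = kform f + kform g.
Proof.
move=> bf bg; rewrite /kform -(RintegralD mS (kform_fubini bf).2 (kform_fubini bg).2).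
apply: eq_Int => x Sx.
rewrite -(RintegralD mS (integrable_kernelM Sx (bmeas2_section bf Sx)) (integrable_kernelM Sx (bmeas2_section bg Sx))).
by apply: eq_Int => y _; rewrite mulrDr.
Qed.

Lemma kformZ c f : bmeas2 f -> kform (fun z => c * f z) = c * kform f.
Proof.
move=> bf; rewrite /kform -(RintegralZl _ mS (kform_fubini bf).2).
apply: eq_Int => x Sx.
rewrite -(RintegralZl _ mS (integrable_kernelM Sx (bmeas2_section bf Sx))).
by apply: eq_Int => y _; rewrite mulrCA.
Qed.

Lemma kform_le f g : bmeas2 f -> bmeas2 g -> (forall x y, S x -> S y -> f (x, y) <= g (x, y)) ->
  kform f <= kform g.
Proof.
move=> bf bg fg; apply: (le_Rintegral mS (kform_fubini bf).2 (kform_fubini bg).2) => x Sx.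
apply: (le_Rintegral mS (integrable_kernelM Sx (bmeas2_section bf Sx)) (integrable_kernelM Sx (bmeas2_section bg Sx))) => y Sy.
by rewrite ler_wpM2l// fg.
Qed.

Lemma kform_fst (h : X -> R) : bmeas h -> kform (fun z => h z.1) = kappa * I h.
Proof.
move=> bh; rewrite -IntZ//; apply: eq_Int => x Sx /=.
under eq_Rintegral do rewrite mulrC.
by rewrite (RintegralZl _ mS (ik Sx)) Ik// mulrC.
Qed.

Lemma kform_snd (h : X -> R) : bmeas h -> kform (fun z => h z.2) = kappa * I h.
Proof. by move=> bh; rewrite -(kform_fst bh) -(kform_swap (bmeas2_fst bh)). Qed.

(** The integral operator with kernel k maps u to v; testing against constant spinors b keeps all
    integrals scalar. *)
Definition kconv u v := forall x (b : V), S x ->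
  I (fun y => k (edot x y) * rdot b (u y)) = rdot b (v x).

Lemma kform_kconv w u v : kconv u v -> kform (fun z => rdot (w z.1) (u z.2)) = ip w v.
Proof. by move=> h; apply: eq_Int => x Sx /=; exact: h. Qed.

Lemma kconv_sum (J : Type) (s : seq J) (F G : J -> spin) (c : J -> R) : (forall j, bspin (F j)) ->
  (forall j, kconv (F j) (G j)) ->
  kconv (fun x => \sum_(j <- s) (c j)%:C *: F j x) (fun x => \sum_(j <- s) (c j)%:C *: G j x).
Proof.
move=> bF hF x b Sx.
have bb j : bmeas (fun y => rdot b (F j y)).
  by apply: (bmeas_rdot _ (bF j)) => l; split; exact: bmeas_cst.
have rs (H : J -> V) r : rdot b (\sum_(j <- r) (c j)%:C *: H j) = \sum_(j <- r) c j * rdot b (H j).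
  elim: r => [|j r ih]; first by rewrite !big_nil rdotE big1// => l _; rewrite mxE /= !mulr0 addr0.
  by rewrite !big_cons rdotC rdotDl rdotZl !(rdotC _ b) ih.
rewrite rs; under eq_Rintegral do rewrite rs.
have bs r : bmeas (fun y => \sum_(j <- r) c j * rdot b (F j y)) by apply: bmeas_sum => j; exact: bmeasZ.
elim: s => [|j s ih].
  rewrite big_nil (eq_Int (g := fun _ => 0)) ?Int_cst0//.
  by move=> y _; rewrite big_nil mulr0.
rewrite big_cons -ih -(hF j x b Sx) -(RintegralZl _ mS (integrable_kernelM Sx (bb j))).
have ij := integrable_kernelM Sx (bmeasZ (c j) (bb j)).
rewrite -(@RintegralD _ _ _ vol S (fun y => c j * (k (edot x y) * rdot b (F j y))) (fun y => k (edot x y) * \sum_(j0 <- s) c j0 * rdot b (F j0 y)))//.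
- by apply: eq_Int => y _; rewrite big_cons mulrDr; congr (_ + _); rewrite mulrCA.
- by apply: (eq_integrable mS _ _ _ ij) => y _; rewrite mulrCA.
exact: (integrable_kernelM Sx (bs s)).
Qed.

Lemma kconv_harm u (c : R) l : harm_spin l u ->
  (forall h x, S x -> harmonic_comp l h -> I (fun y => k (edot x y) * h y) = c * h x) ->
  kconv u (fun x => c%:C *: u x).
Proof.
move=> hu hc x b Sx; rewrite rdotC rdotZl rdotC.
pose F j y := complex.Re (b j 0) * cRe u j y + complex.Im (b j 0) * cIm u j y.
have hF j : harmonic_comp l (F j).
  have [h1 h2] := hu j.
  have h0 := harmonic_comp_lin (-1) h1 h1.
  have z0 : harmonic_comp l (fun _ : X => 0).
    by rewrite (_ : (fun _ => 0) = fun x => cRe u j x + -1 * cRe u j x)//; apply/funext => y; rewrite mulN1r subrr.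
  have := harmonic_comp_lin (complex.Im (b j 0)) (harmonic_comp_lin (complex.Re (b j 0)) z0 h1) h2.
  by under eq_fun do rewrite add0r.
have rE y : rdot b (u y) = \sum_j F j y by rewrite rdotE.
rewrite rE; under eq_Rintegral do rewrite rE.
have bs r : bmeas (fun y => \sum_(j <- r) F j y) by apply: bmeas_sum => j; case: (hF j).
elim: (index_enum _) => [|j s ih].
  rewrite big_nil mulr0 (eq_Int (g := fun _ => 0)) ?Int_cst0//.
  by move=> y _; rewrite big_nil mulr0.
rewrite big_cons mulrDr -ih -(hc _ _ Sx (hF j)).
have bj : bmeas (F j) by case: (hF j).
rewrite -(RintegralD mS (integrable_kernelM Sx bj) (integrable_kernelM Sx (bs s))).
by apply: eq_Int => y _; rewrite big_cons mulrDr.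
Qed.

(** Schur's test: |u(x).u(y)| is at most the mean of |u(x)|^2 and |u(y)|^2, each of which integrates
    against the kernel to kappa |u|_2^2. *)
Lemma kform_schur u : bspin u -> - (kappa * ip u u) <= kform (fun z => rdot (u z.1) (u z.2)).
Proof.
move=> bu; have b1 := bmeas_rdot bu bu.
have b2 := bmeas2_rdot bu bu.
pose h x := rdot (u x) (u x).
have bh : bmeas h by exact: b1.
have e : kform (fun z => - 2^-1 * (h z.1 + h z.2)) = - (kappa * ip u u).
  rewrite kformZ; last by apply: bmeas2D; [exact: bmeas2_fst|exact: bmeas2_snd].
  rewrite kformD; [|exact: bmeas2_fst|exact: bmeas2_snd].
  by rewrite kform_fst// kform_snd// -/(ip u u); field.
rewrite -e; apply: kform_le => //.
  by apply: bmeas2Z; apply: bmeas2D; [exact: bmeas2_fst|exact: bmeas2_snd].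
move=> x y _ _ /=; have := rdot_le (u x) (u y); rewrite !cnorm_sqr -!/(h _).
by have := ler_norm (- rdot (u x) (u y)); rewrite normrN; lra.
Qed.

End kernel.
End kernel_form.

Section newton_energy.
Context {R : realType} (m : nat).
Local Notation n := m.+2.
Local Notation N := (spinor_rank n).
Local Notation vol := (@sphere_volume R n).
Local Notation S := (@sphere R n).
Local Notation X := 'rV[R]_n.+1.
Local Notation C := R[i].
Local Notation V := 'cV[C]_N.
Local Notation spin := (spinor R n).
Local Notation a := (m.+1%:R / 2 : R).
Local Notation omega := (@omega R m).
Local Notation I f := (\int[vol]_(y in S) f y).
Implicit Types (x y : X) (u v w p q : spin).
Variable gamma : 'I_n -> 'M[C]_N.
Hypothesis cl : clifford_rep gamma.

Let a_gt0 : 0 < a. Proof. by rewrite divr_gt0. Qed.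
Let k := kP a 1.
Let mk : measurable_fun setT k. Proof. exact: measurable_kP. Qed.
Let k0 t : 0 <= k t. Proof. exact: kP_ge0. Qed.
Let ik x : S x -> vol.-integrable S (fun y => (k (edot x y))%:E). Proof. exact: integrable_newton. Qed.
Let Ik x : S x -> I (fun y => k (edot x y)) = omega.
Proof.
move=> Sx; have := newton_formula Sx (@harmonic_comp1 R m); rewrite addr0 mulr1 mulfK ?gt_eqF// => <-.
by apply: eq_Int => y _; rewrite mulr1.
Qed.

Definition nform u v := kform k (fun z : X * X => rdot (u z.1) (v z.2)).

Lemma nform_conv w u v : kconv k u v -> nform w u = ip w v.
Proof. exact: kform_kconv. Qed.

Lemma nformC u v : bspin u -> bspin v -> nform u v = nform v u.
Proof.
move=> bu bv; rewrite -[RHS](kform_swap mk k0 ik Ik (bmeas2_rdot bv bu)).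
by apply: eq_Int => x _; apply: eq_Int => y _; rewrite /= rdotC.
Qed.

Lemma bspin_lin p q s : bspin p -> bspin q -> bspin (fun x => p x + s%:C *: q x).
Proof.
move=> hp hq l; have [p1 p2] := hp l; have [q1 q2] := hq l; split.
  rewrite (_ : (fun x => _) = fun x => cRe p l x + s * cRe q l x); first by apply: bmeasD => //; exact: bmeasZ.
  by apply/funext => x; rewrite /cRe !mxE raddfD /= complex_ReM /= oppr0 mul0r addr0.
rewrite (_ : (fun x => _) = fun x => cIm p l x + s * cIm q l x); first by apply: bmeasD => //; exact: bmeasZ.
by apply/funext => x; rewrite /cIm !mxE raddfD /= complex_ImM /= mul0r addr0.
Qed.

Lemma nform_linl u v w s : bspin u -> bspin v -> bspin w ->
  nform (fun x => u x + s%:C *: v x) w = nform u w + s * nform v w.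
Proof.
move=> bu bv bw; have b1 := bmeas2_rdot bu bw; have b2 := bmeas2_rdot bv bw.
rewrite /nform -(kformZ mk k0 ik Ik s b2) -(kformD mk k0 ik Ik b1 (bmeas2Z s b2)).
by apply: eq_Int => x _; apply: eq_Int => y _; rewrite /= rdotDl rdotZl.
Qed.

Lemma nform_square u v s : bspin u -> bspin v ->
  nform (fun x => u x + s%:C *: v x) (fun x => u x + s%:C *: v x) =
  nform u u + 2 * s * nform u v + s ^+ 2 * nform v v.
Proof.
move=> bu bv; have bl := bspin_lin s bu bv.
rewrite (nform_linl s bu bv bl) (nformC bu bl) (nformC bv bl) !nform_linl//.
rewrite (nformC bv bu); move: (nform u u) (nform u v) (nform v v) => A B D.
by ring.
Qed.

Lemma kconv_newton u l : harm_spin l u -> kconv k u (fun x => (omega * a / (a + l%:R))%:C *: u x).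
Proof.
move=> hu; apply: (kconv_harm mk k0 ik hu) => h x Sx hh.
exact: newton_formula.
Qed.

Lemma bspin_sum (K : nat) (F : nat -> spin) (c : nat -> R) : (forall i, bspin (F i)) ->
  bspin (fun x => \sum_(i < K) (c i)%:C *: F i x).
Proof.
move=> bF; elim: K => [|K ih].
  by move=> l; split; (rewrite (_ : (fun x => _) = fun _ => 0); [exact: bmeas_cst|apply/funext => x; rewrite big_ord0 mxE]).
rewrite (_ : (fun x => _) = fun x => \sum_(i < K) (c i)%:C *: F i x + (c K)%:C *: F K x); first exact: bspin_lin.
by apply/funext => x; rewrite big_ord_recr.
Qed.

Lemma ip_wsum (K : nat) (F : nat -> spin) (c : nat -> R) w : in_L2 w -> (forall i, in_L2 (F i)) ->
  ip w (fun x => \sum_(i < K) (c i)%:C *: F i x) = \sum_(i < K) c i * ip w (F i).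
Proof.
move=> lw lF; rewrite (ip_sumr _ lw (fun i : 'I_K => L2Z (c i)%:C (lF i))).
by apply: eq_bigr => i _; rewrite ipZr.
Qed.

Lemma kconv_wsum (K : nat) (F : nat -> spin) (dg : nat -> nat) (c : nat -> R) :
  (forall i, harm_spin (dg i) (F i)) ->
  kconv k (fun x => \sum_(i < K) (c i)%:C *: F i x)
    (fun x => \sum_(i < K) (c i * (omega * a / (a + (dg i)%:R)))%:C *: F i x).
Proof.
move=> hF; have := kconv_sum mk k0 ik (index_enum 'I_K) (fun i : 'I_K => c i)
  (fun i : 'I_K => harm_bspin (hF i)) (fun i : 'I_K => kconv_newton (hF i)).
rewrite [X in kconv k _ X -> _](_ : _ =
  fun x => \sum_(i < K) (c i * (omega * a / (a + (dg i)%:R)))%:C *: F i x)//.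
by apply/funext => x; apply: eq_bigr => i _; rewrite scalerA -rmorphM.
Qed.

(* If [q] is a projection of [z] and [d = z - q], then [nform q d = 0] and
   [nform d d] is small by Schur's test. *)
Lemma nform_ge0 z : bspin z -> 0 <= nform z z.
Proof.
move=> bz; have w0 : 0 <= omega := @omega_ge0 R m.
have lz := bspin_L2 bz.
apply/ler_addgt0Pr => e e0.
have d0 : 0 < e / (1 + omega) by rewrite divr_gt0// ltr_wpDr.
have [K [phi [q [hq o dq]]]] := L2_projection cl lz d0.
have [h qE] := hq; have bq := dec_bspin hq.
have bd := bspin_lin (-1) bz bq; set d := fun x => _ in bd.
have zE : z = fun x => q x + 1%:C *: d x.
  by apply/funext => x; rewrite /d scale1r rmorphN rmorph1 scaleN1r addrC subrK.
have hc : kconv k q (fun x => \sum_(i < K) (1 * (omega * a / (a + (uphalf i)%:R)))%:C *: phi i x).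
  have := kconv_wsum K (fun _ => 1) (fun i => es_harm (h i)).
  by rewrite qE; under eq_fun do under eq_bigr do rewrite scale1r.
set g := fun x => _ in hc.
have c0 i : 0 <= 1 * (omega * a / (a + (uphalf i)%:R)) by rewrite mul1r divr_ge0 ?addr_ge0 ?mulr_ge0 ?(ltW a_gt0).
have lphi i := eigs_L2 (h i).
have e1 : nform q d = 0.
  rewrite (nformC bq bd) (nform_conv d hc) /g (ip_wsum K (fun i => 1 * (omega * a / (a + (uphalf i)%:R))) (bspin_L2 bd) lphi).
  by rewrite big1// => i _; rewrite o mulr0.
have e2 : 0 <= nform q q.
  rewrite (nform_conv q hc) ipC /g (dec_wsum cl (fun i => 1 * (omega * a / (a + (uphalf i)%:R))) hq) sumr_ge0// => i _.
  by rewrite mulr_ge0 ?ip_ge0 ?c0.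
have e3 : - (omega * ip d d) <= nform d d := kform_schur mk k0 ik Ik bd.
rewrite {1 2}zE (nform_square 1 bq bd) e1.
have : omega * ip d d <= e.
  apply: le_trans (ler_wpM2l w0 dq) _.
  rewrite mulrA ler_pdivrMr ?ltr_wpDr// mulrC ler_wpM2l ?(ltW e0)//.
  by rewrite lerDr.
move: (nform q q) (nform d d) (omega * ip d d) e2 e3 => A B D e2 e3 h3; lra.
Qed.

Lemma Int_omega0 (h : X -> R) : omega = 0 -> bmeas h -> I h = 0.
Proof.
move=> w0 bh; have [_ [D hD]] := bh; apply/eqP; rewrite -normr_le0.
apply: le_trans (Int_norm bh) _.
rewrite (_ : 0 = I (fun _ => D * 1)); last by rewrite IntZ ?mulr0//; [rewrite -/omega w0 mulr0|exact: bmeas_cst].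
by apply: le_Int; [exact: bmeas_norm|exact: bmeas_cst|move=> x Sx; rewrite mulr1 hD].
Qed.

Section dilation_energy.
(** A gauge: [M] is isometric on the sphere, [Mi] is its right inverse, and [M] takes eigenspinors
    of index i to harmonics of degree [dg i]. The identity and [cv gB] give the two energies. *)
Variables (M Mi : X -> 'M[C]_N) (dg : nat -> nat).
Hypotheses (hMi : forall x (v : V), S x -> M x *m (Mi x *m v) = v)
  (hMr : forall x (u v : V), S x -> rdot (M x *m u) (M x *m v) = rdot u v)
  (bM : forall p, bspin p -> bspin (fun x => M x *m p x))
  (bMi : forall p, bspin p -> bspin (fun x => Mi x *m p x))
  (hM : forall i p, eigs gamma i p -> harm_spin (dg i) (fun x => M x *m p x)).

Let W p : spin := fun x => M x *m p x.

Definition mu (i : nat) : R := (dg i)%:R + a.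

(* For [dg = uphalf] this is <|D + 1/2| q, q>, for [dg = dgU] it is
   <|D - 1/2| q, q>, where [phi] are the components of [q]. *)
Definition energy K (phi : nat -> spin) : R := \sum_(i < K) mu i * ip (phi i) (phi i).

(** The dilation conjugated by the gauge. The weight kap^a preserves the L^p norm because a p =
    n. *)
Definition dilspin t p : spin := fun x => Mi x *m ((kap t x `^ a)%:C *: W p (dil t x)).

Let ipW p q : ip (W p) (W q) = ip p q.
Proof. by apply: eq_Int => x Sx; exact: hMr. Qed.

(** Up to the constant omega a, the Newton operator divides harmonics of degree [dg i] by a +
    [dg i], which is the weight [mu i]. *)
Let omega_a K (phi : nat -> spin) q : dec gamma K phi q ->
  kconv k (fun x => \sum_(i < K) (mu i)%:C *: W (phi i) x) (fun x => (omega * a)%:C *: W q x).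
Proof.
move=> [h ->]; have := kconv_wsum K mu (fun i => hM (h i)).
rewrite [X in kconv k _ X -> _](_ : _ = fun x => (omega * a)%:C *: W (fun x => \sum_(i < K) phi i x) x)//.
apply/funext => x; rewrite /W mulmx_sumr scaler_sumr; apply: eq_bigr => i _.
by congr (_%:C *: _); rewrite [mu i]addrC mulrC divfK// gt_eqF// ltr_wpDr.
Qed.

Lemma bspin_scale (f : X -> R) p : bmeas f -> bspin p -> bspin (fun x => (f x)%:C *: p x).
Proof.
move=> bf bp l; have [p1 p2] := bp l; split.
  rewrite (_ : (fun x => _) = fun x => f x * cRe p l x); first exact: bmeasM.
  by apply/funext => x; rewrite /cRe mxE complex_ReM /= oppr0 mul0r addr0.
rewrite (_ : (fun x => _) = fun x => f x * cIm p l x); first exact: bmeasM.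
by apply/funext => x; rewrite /cIm mxE complex_ImM /= mul0r addr0.
Qed.

Lemma bmeas_kap_powR t b : 1 <= t -> 0 <= b -> bmeas (fun x => kap t x `^ b).
Proof.
move=> t1 b0; apply: bmeas_powR => //; first exact: bmeas_kap.
by move=> y Sy; exact/ltW/kap_gt0.
Qed.

Lemma bspin_dil t p : 1 <= t -> bspin p -> bspin (fun x => p (dil t x)).
Proof. by move=> t1 bp l; have [p1 p2] := bp l; split; [exact: (bmeas_dil t1 p1)|exact: (bmeas_dil t1 p2)]. Qed.

Lemma bspin_dilspin t p : 1 <= t -> bspin p -> bspin (dilspin t p).
Proof.
move=> t1 bp; apply: bMi; apply: bspin_scale; first by apply: bmeas_kap_powR => //; exact: ltW.
by apply: (@bspin_dil t (W p)) => //; exact: bM.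
Qed.

(* With [w' = |D + 1/2| q] and [wt] the dilated [|D + 1/2| p], the inequality
   [0 <= nform (w' - wt) (w' - wt)] reads [E q - 2 E q + E p >= 0]. *)
Lemma energy_dilation t K K' (phi phi' : nat -> spin) p q : 1 <= t ->
  dec gamma K phi p -> dec gamma K' phi' q ->
  (forall i, ip (fun x => dilspin t p x + (-1)%:C *: q x) (phi' i) = 0) ->
  energy K' phi' <= energy K phi.
Proof.
move=> t1 hp hq o; have [h pE] := hp; have [h' qE] := hq.
have bp := dec_bspin hp; have bq := dec_bspin hq; have bt := bspin_dilspin t1 bp.
have bphi i : bspin (phi i) := harm_bspin (es_harm (h i)).
have bphi' i : bspin (phi' i) := harm_bspin (es_harm (h' i)).
pose w x := \sum_(i < K) (mu i)%:C *: W (phi i) x.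
pose w' x := \sum_(i < K') (mu i)%:C *: W (phi' i) x.
pose ut x : V := (kap t x `^ a)%:C *: W p (dil t x).
pose wt x : V := (kap t x `^ (a + 1))%:C *: w (dil t x).
have bw : bspin w by apply: (@bspin_sum K (fun i => W (phi i)) mu) => i; exact/bM/bphi.
have bw' : bspin w' by apply: (@bspin_sum K' (fun i => W (phi' i)) mu) => i; exact/bM/bphi'.
have but : bspin ut.
  apply: bspin_scale; first by apply: bmeas_kap_powR => //; exact: ltW.
  by apply: (@bspin_dil t (W p)) => //; exact: bM.
have bwt : bspin wt.
  apply: bspin_scale; first by apply: bmeas_kap_powR; rewrite // addr_ge0 ?(ltW a_gt0).
  exact: bspin_dil.
have cw : kconv k w (fun x => (omega * a)%:C *: W p x) := omega_a hp.
have cw' : kconv k w' (fun x => (omega * a)%:C *: W q x) := omega_a hq.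
(* Covariance of the Newton kernel: a charge dilated with weight a + 1 has the potential dilated
   with weight a. *)
have cwt : kconv k wt (fun x => (omega * a)%:C *: ut x).
  move=> x b Sx; have bb : bmeas (fun y => rdot b (w y)).
    by apply: (bmeas_rdot _ bw) => l; split; exact: bmeas_cst.
  have := newton_dil t1 Sx bb.
  rewrite (cw _ b (sphere_dil t1 Sx)) => e.
  rewrite (eq_Int (g := fun y => kP a 1 (edot x y) * (kap t y `^ (a + 1) * rdot b (w (dil t y))))); last first.
    by move=> y _; rewrite /wt rdotC rdotZl rdotC.
  by rewrite e /ut !(rdotC b) !rdotZl; ring.
have bz := bspin_lin (-1) bw' bwt.
have lphi i : in_L2 (W (phi i)) by exact/bspin_L2/bM.
have lphi' i : in_L2 (W (phi' i)) by exact/bspin_L2/bM.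
have lWq : in_L2 (W q) by exact/bspin_L2/bM.
have lut := bspin_L2 but.
have e1 : ip w' (W q) = energy K' phi'.
  rewrite ipC (ip_wsum _ _ lWq lphi'); apply: eq_bigr => i _.
  by rewrite ipW ipC (dec_ip cl hq (h' i) (ltn_ord i)).
(* [w'] is built from the components of q, to which the residual of the dilated p is orthogonal, so
   that [W q] may replace [ut]. *)
have e2 : ip w' ut = energy K' phi'.
  rewrite ipC (ip_wsum _ _ lut lphi'); apply: eq_bigr => i _; congr (_ * _).
  rewrite -(dec_ip cl hq (h' i) (ltn_ord i)).
  have -> : ip ut (W (phi' i)) = ip (dilspin t p) (phi' i).
    rewrite -[RHS]ipW; apply: eq_Int => x Sx; congr rdot.
    by rewrite /W /dilspin hMi.
  have := o i; rewrite ipC ip_lin; [|exact: bspin_L2|exact: bspin_L2|exact: bspin_L2].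
  rewrite mulN1r => /eqP; rewrite subr_eq0 ipC => /eqP.
  by [].
have e3 : ip wt ut = energy K phi.
  have -> : ip wt ut = ip w (W p).
    rewrite [RHS](Int_dil t1 (f := fun x => rdot (w x) (W p x))); last by have [] := bmeas_rdot bw (bM bp).
    apply: eq_Int => x Sx; rewrite /wt /ut rdotZl rdotC rdotZl rdotC mulrA mulrC.
    congr (_ * _); have kx := kap_gt0 t1 Sx.
    rewrite -powR_mulrn ?(ltW kx)// -powRD; last by rewrite (gt_eqF kx) implybT.
    by congr (_ `^ _); rewrite -!natr1; field.
  rewrite ipC (ip_wsum _ _ (bspin_L2 (bM bp)) lphi); apply: eq_bigr => i _.
  by rewrite ipW ipC (dec_ip cl hp (h i) (ltn_ord i)).
have := nform_ge0 bz; rewrite (nform_square (-1) bw' bwt).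
rewrite (nform_conv w' cw') (nform_conv w' cwt) (nform_conv wt cwt).
rewrite (ipZr (omega * a) lWq (bspin_L2 bw')) (ipZr (omega * a) lut (bspin_L2 bw')) (ipZr (omega * a) lut (bspin_L2 bwt)).
(* Were the volume 0, the integrals of bounded functions would vanish and both energies with
   them. *)
rewrite e1 e2 e3; have [w0|w0] := eqVneq omega 0.
  move=> _; rewrite /energy !big1// => i _.
    by rewrite [ip _ _](Int_omega0 w0 (bmeas_rdot (bphi i) (bphi i))) mulr0.
  by rewrite [ip _ _](Int_omega0 w0 (bmeas_rdot (bphi' i) (bphi' i))) mulr0.
have wa : 0 < omega * a by rewrite mulr_gt0// lt_neqAle eq_sym w0 omega_ge0.
by move: (energy K' phi') (energy K phi) => A B; nra.
Qed.

End dilation_energy.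
End newton_energy.

(** Young's inequality for t and s^(p - 1), with exponents p and p / (p - 1). *)
Lemma powR_tangent {R : realType} (s t p : R) : 0 <= s -> 0 <= t -> 1 < p ->
  s `^ p + p * s `^ (p - 1) * (t - s) <= t `^ p.
Proof.
move=> s0 t0 p1; have p0 : 0 < p by lra.
have q0 : 0 < p / (p - 1) by rewrite divr_gt0// subr_gt0.
have pq : p^-1 + (p / (p - 1))^-1 = 1 by field; rewrite !gt_eqF// subr_gt0.
have := conjugate_powR t0 (powR_ge0 s (p - 1)) p0 q0 pq.
have -> : (s `^ (p - 1)) `^ (p / (p - 1)) = s `^ p.
  by rewrite -powRrM; congr (_ `^ _); field; rewrite gt_eqF// subr_gt0.
have e : s `^ p = s * s `^ (p - 1) by rewrite mulr_powRB1.
rewrite e; move: (t `^ p) (s `^ (p - 1)) => A B h.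
have h2 : p * (t * B) <= p * (A / p + s * B / (p / (p - 1))) by rewrite ler_wpM2l// ltW.
have e2 : p * (A / p + s * B / (p / (p - 1))) = A + (p - 1) * (s * B).
  by field; rewrite !gt_eqF// subr_gt0.
by rewrite e2 in h2; lra.
Qed.

(** * L^p norms of spinors *)

Section spinor_Lp.
Context {R : realType} (m : nat).
Local Notation n := m.+2.
Local Notation N := (spinor_rank n).
Local Notation vol := (@sphere_volume R n).
Local Notation S := (@sphere R n).
Local Notation X := 'rV[R]_n.+1.
Local Notation C := R[i].
Local Notation V := 'cV[C]_N.
Local Notation spin := (spinor R n).
Local Notation a := (m.+1%:R / 2 : R).
Local Notation omega := (@omega R m).
Local Notation I f := (\int[vol]_(y in S) f y).
Implicit Types (x y : X) (u v w p q : spin).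

Let mS : measurable S := @measurable_sphere R n.
Definition pcrit : R := (2 * n)%:R / n.-1%:R.

Lemma pcrit_gt1 : 1 < pcrit.
Proof. by rewrite ltr_pdivlMr// mul1r ltr_nat; lia. Qed.

(** Under a dilation the weight kap^a, raised to the critical exponent, is exactly the Jacobian
    kap^n. *)
Lemma a_pcrit : a * pcrit = n%:R.
Proof.
rewrite /pcrit natrM /=; have z0 : m.+1%:R != 0 :> R by rewrite pnatr_eq0.
by move: (m.+1%:R : R) z0 => z z0; field.
Qed.

Lemma cnorm_eq0 (v : V) : cnorm v = 0 -> v = 0.
Proof.
move=> v0; have : rdot v v = 0 by rewrite -cnorm_sqr v0 expr0n.
rewrite rdotE => /eqP; rewrite psumr_eq0 => [/allP h|i _]; last first.
  by rewrite addr_ge0// -expr2 sqr_ge0.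
apply/colP => i; rewrite mxE; have := h i (mem_index_enum i).
rewrite paddr_eq0 -?expr2 ?sqr_ge0// !sqrf_eq0 => /andP[/eqP e1 /eqP e2].
by rewrite [v i 0]complexE e1 e2.
Qed.

Lemma rdot_le_cnorm (u v : V) : rdot u v <= cnorm u * cnorm v.
Proof.
have A0 := cnorm_ge0 u; have B0 := cnorm_ge0 v.
have [e|nz] := eqVneq (cnorm u * cnorm v) 0.
  rewrite e; move/eqP: e; rewrite mulf_eq0 => /orP[/eqP/cnorm_eq0 ->|/eqP/cnorm_eq0 ->].
    by rewrite rdotE big1// => l _; rewrite mxE /= !mul0r addr0.
  by rewrite rdotE big1// => l _; rewrite mxE /= !mulr0 addr0.
have AB : 0 < cnorm u * cnorm v by rewrite lt_neqAle eq_sym nz mulr_ge0.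
have := rdot_le ((cnorm v)%:C *: u) ((cnorm u)%:C *: v).
rewrite !cnorm_sqr !rdotZl (rdotC u (_ *: _)) (rdotC u (_ *: u)) (rdotC v (_ *: v)) !rdotZl -!cnorm_sqr (rdotC v u) => h.
have h2 := ler_norm (cnorm v * (cnorm u * rdot u v)).
move: (cnorm u) (cnorm v) (rdot u v) AB h h2 => A B r AB h h2.
have h3 : (A * B) * r <= (A * B) * (A * B) by lra.
by rewrite ler_pM2l in h3.
Qed.

Lemma cnorm_tri (u v : V) : cnorm (u + v) <= cnorm u + cnorm v.
Proof.
rewrite -(@ler_pXn2r _ 2)// ?nnegrE ?addr_ge0 ?cnorm_ge0//.
rewrite cnorm_sqr rdotDl !(rdotC _ (u + v)) !rdotDl (rdotC v u) -!cnorm_sqr.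
by have := rdot_le_cnorm u v; lra.
Qed.

Lemma cnormZ (c : R) (v : V) : cnorm (c%:C *: v) = `|c| * cnorm v.
Proof.
apply/eqP; rewrite -(@eqrXn2 _ 2)// ?mulr_ge0 ?cnorm_ge0// exprMn real_normK ?num_real//.
by rewrite !cnorm_sqr rdotZl rdotC rdotZl mulrA -expr2.
Qed.

Let cm_sqrt : measurable_fun setT (@Num.sqrt R).
Proof. by apply: continuous_measurable_fun; exact: sqrt_continuous. Qed.

Lemma measurable_cnorm p : measurable_spinor p -> measurable_fun S (fun x => cnorm (p x)).
Proof.
move=> mp; apply: (measurableT_comp (f := @Num.sqrt R)); first exact: cm_sqrt.
rewrite (_ : (fun x => _) = fun x => rdot (p x) (p x)) //; exact: measurable_rdot.
Qed.

Lemma bmeas_cnorm p : bspin p -> bmeas (fun x => cnorm (p x)).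
Proof.
move=> bp; have [mb [D hD]] := bmeas_rdot bp bp; split.
  exact: (measurableT_comp cm_sqrt mb).
exists (Num.sqrt D) => x Sx; rewrite ger0_norm ?cnorm_ge0// ler_wsqrtr//.
exact: le_trans (ler_norm _) (hD x Sx).
Qed.

Definition Lp_mass p : \bar R := (\int[vol]_(x in S) (cnorm (p x) `^ pcrit)%:E)%E.

Lemma bmeas_cnorm_powR p b : bspin p -> 0 <= b -> bmeas (fun x => cnorm (p x) `^ b).
Proof. by move=> bp b0; apply: bmeas_powR => //; [exact: bmeas_cnorm|move=> x _; exact: cnorm_ge0]. Qed.

Lemma Lp_massE p : bspin p -> Lp_mass p = (I (fun x => cnorm (p x) `^ pcrit))%:E.
Proof.
move=> bp; rewrite /Rintegral fineK//; apply: integrable_fin_num => //; apply: bmeas_int.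
by apply: bmeas_cnorm_powR => //; have := pcrit_gt1; lra.
Qed.

Lemma ip_cnorm p : ip p p = I (fun x => cnorm (p x) ^+ 2).
Proof. by apply: eq_Int => x _; rewrite cnorm_sqr. Qed.

(* Fatou's lemma for L^2-convergence: compare |q|^p with its tangent at
   |p| 1_{|p| <= L}. *)
Lemma Lp_mass_lsc p (M : R) : in_L2 p -> 0 <= M ->
  (forall e : R, 0 < e -> exists q, [/\ bspin q, dist2 p q <= e & (Lp_mass q <= M%:E)%E]) ->
  (Lp_mass p <= M%:E)%E.
Proof.
move=> lp M0 H; have [mp _] := lp; have p1 := pcrit_gt1; have p0 : 0 < pcrit by lra.
have w0 : 0 <= omega := @omega_ge0 R m.
have mF := measurable_cnorm mp.
pose F := (fun x => cnorm (p x)) \_ S.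
have mF' : measurable_fun setT F by exact: ((measurable_restrictT _ mS).1 mF).
have FE x : S x -> F x = cnorm (p x) by move=> Sx; rewrite /F patchE mem_set.
rewrite /Lp_mass (eq_integral (fun x => (F x `^ pcrit)%:E)); last by move=> x /set_mem/FE ->.
(* The cut F^-1 >= 1 / (j + 1) says 0 < F <= L with L = j + 1; where F = 0 the inverse power is 0 by
   convention, and the integrand vanishes anyway. *)
apply: (@integral_le_cut _ _ _ _ _ _ (fun x => F x `^ (-1))) => //.
- exact: (measurableT_comp (measurable_powR _)).
- exact: (measurableT_comp (measurable_powR _)).
- by move=> x _; exact: powR_ge0.
- move=> x Sx; have [-> _|Fn] := eqVneq (F x) 0; first by rewrite powR0// gt_eqF.
  by rewrite leNgt powR_gt0// lt_neqAle eq_sym Fn FE// cnorm_ge0.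
move=> j; set L : R := j.+1%:R.
have L0 : 0 < L by rewrite ltr0n.
apply/lee_addgt0Pr => e e0.
(* [D] bounds the slopes of the tangents. The error D |z| is split as D (d + |z|^2 / d); the choices
   of d and of the L^2 distance d e / (2 D) make each part at most e / 2. *)
pose D : R := pcrit * L `^ (pcrit - 1).
have D0 : 0 < D by rewrite mulr_gt0// powR_gt0.
pose d : R := e / (2 * D * (1 + omega)).
have w1 : 0 < 1 + omega by rewrite ltr_wpDr.
have d0 : 0 < d by apply: divr_gt0 => //; apply: mulr_gt0 => //; exact: mulr_gt0.
have dD : D * (d * omega) <= e / 2.
  have -> : D * (d * omega) = (e / 2) * (omega / (1 + omega)).
    by rewrite /d; field; rewrite !gt_eqF// ltr_wpDr.
  by rewrite ler_piMr ?divr_ge0 ?(ltW e0)// ler_pdivrMr ?ltr_wpDr//; lra.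
have r0 : 0 < d * e / (2 * D) by apply: divr_gt0; apply: mulr_gt0.
have [q [bq pq hq]] := H _ r0.
have lq := bspin_L2 bq; have ld := L2lin (-1) lp lq; have [md _] := ld.
set z := fun x => _ in ld md.
have zE : dist2 p q = ip z z by [].
have iz : vol.-integrable S (EFin \o (fun x => cnorm (z x) ^+ 2)) := L2_sqr ld.
have pw x : S x -> F x `^ pcrit * (L^-1 <= F x `^ (-1))%R%:R <=
    cnorm (q x) `^ pcrit + D * (d + d^-1 * cnorm (z x) ^+ 2).
  move=> Sx; have zp : 0 <= D * (d + d^-1 * cnorm (z x) ^+ 2).
    by rewrite mulr_ge0 ?(ltW D0)// addr_ge0 ?(ltW d0)// mulr_ge0 ?sqr_ge0 ?invr_ge0 ?(ltW d0).
  case h : (L^-1 <= _)%R => /=; last by rewrite mulr0 addr_ge0 ?powR_ge0.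
  rewrite mulr1.
  have F0 : 0 <= F x by rewrite FE ?cnorm_ge0.
  have FL : F x <= L.
    have [->|Fn] := eqVneq (F x) 0; first exact: ltW.
    have Fp : 0 < F x by rewrite lt_neqAle eq_sym Fn.
    by move: h; rewrite powR_inv1// lef_pV2.
  have t1 := powR_tangent F0 (cnorm_ge0 (q x)) p1.
  have t2 : F x - cnorm (q x) <= cnorm (z x).
    rewrite FE// lerBlDl; apply: le_trans (cnorm_tri _ _).
    by rewrite /z rmorphN rmorph1 scaleN1r addrC subrK.
  have t3 : F x `^ (pcrit - 1) <= L `^ (pcrit - 1).
    by apply: ge0_ler_powR; rewrite // ?nnegrE ?subr_ge0 ?(ltW p1) ?(ltW L0).
  have z0 := cnorm_ge0 (z x).
  have t4 : cnorm (z x) <= d + d^-1 * cnorm (z x) ^+ 2.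
    have := sqr_ge0 (cnorm (z x) - d); move: (cnorm (z x)) z0 => Z z0 h4.
    rewrite -(ler_pM2l d0) mulrDr mulVKf ?gt_eqF//; nra.
  have t5 : pcrit * F x `^ (pcrit - 1) * (F x - cnorm (q x)) <= D * cnorm (z x).
    apply: (@le_trans _ _ (pcrit * F x `^ (pcrit - 1) * cnorm (z x))).
      by rewrite ler_wpM2l// mulr_ge0 ?powR_ge0 ?(ltW p0).
    by rewrite ler_wpM2r// ler_wpM2l// ltW.
  have t6 : D * cnorm (z x) <= D * (d + d^-1 * cnorm (z x) ^+ 2) by rewrite ler_wpM2l// ltW.
  by move: t1 t5 t6; move: (pcrit * F x `^ (pcrit - 1)) (F x `^ pcrit) (cnorm (q x) `^ pcrit) (D * _) (D * cnorm (z x)) => A B E G Z; lra.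
apply: (@le_trans _ _ (\int[vol]_(x in S) ((cnorm (q x) `^ pcrit)%:E + (D * (d + d^-1 * cnorm (z x) ^+ 2))%:E))%E).
  apply: ge0_le_integral => //.
  - by move=> x _; rewrite lee_fin mulr_ge0 ?powR_ge0.
  - apply/measurable_EFinP; apply: measurable_funTS; apply: measurable_funM.
      exact: (measurableT_comp (measurable_powR _)).
    by apply: measurable_ge_nat; exact: (measurableT_comp (measurable_powR _)).
  - apply/measurable_EFinP; apply: measurable_funD.
      by apply: measurable_funTS; have [] := bmeas_cnorm_powR bq (ltW p0).
    apply: measurable_funM => //; apply: measurable_funD => //; apply: measurable_funM => //.
    by apply: measurable_funX; exact: measurable_cnorm.
have bc : bmeas (fun _ : X => D * d) by exact: bmeas_cst.
have ic : vol.-integrable S (EFin \o (fun x => D * d)) := bmeas_int bc.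
have iz2 : vol.-integrable S (EFin \o (fun x => (D * d^-1) * cnorm (z x) ^+ 2)).
  apply: (eq_integrable mS _ _ _ (integrableZl mS (D * d^-1) iz)) => x _.
  by rewrite /= EFinM.
have i2 : vol.-integrable S (EFin \o (fun x => D * (d + d^-1 * cnorm (z x) ^+ 2))).
  apply: (eq_integrable mS _ _ _ (integrableD mS ic iz2)) => x _.
  by rewrite /= -EFinD -(mulrA D) -mulrDr.
have i1 : vol.-integrable S (EFin \o (fun x => cnorm (q x) `^ pcrit)) := bmeas_int (bmeas_cnorm_powR bq (ltW p0)).
rewrite (integralD mS i1 i2) leeD//.
have := integrable_fin_num mS i2 => /fineK <-; rewrite lee_fin.
rewrite -[fine _]/(I (fun x => D * (d + d^-1 * cnorm (z x) ^+ 2))).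
rewrite (eq_Int (g := fun x => D * d + D * d^-1 * cnorm (z x) ^+ 2)); last by move=> x _; rewrite -(mulrA D) -mulrDr.
rewrite (RintegralD mS ic iz2) (RintegralZl _ mS iz) -ip_cnorm -zE.
have -> : I (fun _ => D * d) = D * (d * omega).
  by rewrite (eq_Int (g := fun _ => (D * d) * 1)) ?IntZ ?mulrA//; [exact: bmeas_cst|move=> x _; rewrite mulr1].
have : D / d * dist2 p q <= D / d * (d * e / (2 * D)) by rewrite ler_wpM2l// divr_ge0 ?ltW.
have -> : D / d * (d * e / (2 * D)) = e / 2 by field; rewrite !gt_eqF.
by move: (D / d * dist2 p q) => Z; lra.
Qed.

End spinor_Lp.

(** * Energy inequalities by concentration *)

Section dilation_claim.
Context {R : realType} (m : nat).
Local Notation n := m.+2.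
Local Notation N := (spinor_rank n).
Local Notation vol := (@sphere_volume R n).
Local Notation S := (@sphere R n).
Local Notation X := 'rV[R]_n.+1.
Local Notation C := R[i].
Local Notation V := 'cV[C]_N.
Local Notation spin := (spinor R n).
Local Notation a := (m.+1%:R / 2 : R).
Local Notation I f := (\int[vol]_(y in S) f y).
Local Notation pc := (@pcrit R m).
Implicit Types (x y : X) (u v w p q : spin).
Variable gamma : 'I_n -> 'M[C]_N.
Hypothesis cl : clifford_rep gamma.

Definition bexp : R := n.-1%:R / n%:R.

Lemma bexp_gt0 : 0 < bexp. Proof. by rewrite divr_gt0. Qed.

Definition Qform K (phi : nat -> spin) : R := \sum_(i < K) al m i * ip (phi i) (phi i).

Lemma projection_norm K phi p q : in_L2 p -> dec gamma K phi q ->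
  (forall i, ip (fun x => p x + (-1)%:C *: q x) (phi i) = 0) -> ip q q <= ip p p.
Proof.
move=> lp hq o; have [h qE] := hq; have lq := dec_L2 hq.
have ld := L2lin (-1) lp lq.
have o' : ip q (fun x => p x + (-1)%:C *: q x) = 0.
  have := ip_sumr (index_enum 'I_K) ld (fun i : 'I_K => eigs_L2 (h i)).
  by rewrite -qE ipC => ->; rewrite big1.
have := ip_pyth lq ld o'.
rewrite (_ : (fun x => q x + 1%:C *: _) = p)//.
by apply/funext => x; rewrite scale1r rmorphN rmorph1 scaleN1r addrC subrK.
Qed.

Variables (M Mi : X -> 'M[C]_N) (dg : nat -> nat).
Hypotheses (hMi : forall x (v : V), S x -> M x *m (Mi x *m v) = v)
  (hMr : forall x (u v : V), S x -> rdot (M x *m u) (M x *m v) = rdot u v)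
  (bM : forall p, bspin p -> bspin (fun x => M x *m p x))
  (bMi : forall p, bspin p -> bspin (fun x => Mi x *m p x))
  (hM : forall i p, eigs gamma i p -> harm_spin (dg i) (fun x => M x *m p x))
  (hdg : forall i, (i./2 <= dg i)%N).

Lemma cnorm_dilspin t p x : 1 <= t -> S x ->
  cnorm (dilspin M Mi t p x) = kap t x `^ a * cnorm (p (dil t x)).
Proof.
move=> t1 Sx; have hn y (v : V) : S y -> cnorm (M y *m v) = cnorm v.
  by move=> Sy; apply/eqP; rewrite -(@eqrXn2 _ 2)// ?cnorm_ge0// !cnorm_sqr hMr.
rewrite /dilspin -(hn x (Mi x *m _) Sx) hMi// cnormZ ger0_norm ?powR_ge0//.
by rewrite hn//; exact: sphere_dil.
Qed.

Lemma Lp_dil t p : 1 <= t -> bspin p ->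
  I (fun x => cnorm (dilspin M Mi t p x) `^ pc) = I (fun x => cnorm (p x) `^ pc).
Proof.
move=> t1 bp; have p0 : 0 <= pc by have := @pcrit_gt1 R m; lra.
rewrite [RHS](Int_dil t1 (f := fun x => cnorm (p x) `^ pc)); last by have [] := bmeas_cnorm_powR bp p0.
apply: eq_Int => x Sx; rewrite cnorm_dilspin// powRM ?powR_ge0 ?cnorm_ge0// mulrC; congr (_ * _).
by rewrite -powRrM a_pcrit powR_mulrn// kap_ge0// (le_trans ler01).
Qed.

Lemma L2_dil t p (D : R) : 1 <= t -> bspin p -> (forall x, S x -> cnorm (p x) ^+ 2 <= D) ->
  ip (dilspin M Mi t p) (dilspin M Mi t p) <= D * I (fun x => kap t x ^+ m.+1).
Proof.
move=> t1 bp hD; have bd := bspin_dilspin bM bMi t1 bp.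
have bk := bmeasX m.+1 (bmeas_kap m t1).
rewrite ip_cnorm -IntZ//; apply: le_Int; [exact/bmeasX/bmeas_cnorm|exact: bmeasZ|move=> x Sx].
rewrite cnorm_dilspin// exprMn mulrC.
have k0 : 0 <= kap t x by rewrite kap_ge0// (le_trans ler01).
have -> : (kap t x `^ a) ^+ 2 = kap t x ^+ m.+1.
  by rewrite -powR_mulrn ?powR_ge0// -powRrM divfK// powR_mulrn.
by rewrite ler_wpM2r ?exprn_ge0// hD//; exact: sphere_dil.
Qed.

(** Since n/2 = a + 1/2 and [i./2] is at most [dg i], the weight [al i] is at most [mu i] + 1/2; the
    L^2 norm accounts for the difference. *)
Lemma Qform_energy K phi q : dec gamma K phi q -> Qform K phi <= energy dg K phi + 2^-1 * ip q q.
Proof.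
move=> hq; rewrite (dec_norm cl hq) mulr_sumr -big_split /=; apply: ler_sum => i _.
rewrite -mulrDl ler_wpM2r ?ip_ge0// /al /mu.
have : (i./2%:R <= (dg i)%:R :> R) by rewrite ler_nat.
by rewrite -[n%:R]natr1; lra.
Qed.

Lemma energy_ge0 K (phi : nat -> spin) : 0 <= energy dg K phi.
Proof. by apply: sumr_ge0 => i _; rewrite mulr_ge0 ?ip_ge0// addr_ge0// ltW. Qed.

(* Strongly dilated copies of [p] have the same L^p-norm and no more energy,
   but their L^2-norm tends to 0, so that [Qform - energy] disappears. *)
Lemma sobolev_energy (c : R) : 0 <= c ->
  (forall K phi q, dec gamma K phi q -> c * I (fun x => cnorm (q x) `^ pc) `^ bexp <= Qform K phi) ->
  forall K phi p, dec gamma K phi p -> c * I (fun x => cnorm (p x) `^ pc) `^ bexp <= energy dg K phi.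
Proof.
move=> c0 hc K phi p hp; have b0 := bexp_gt0.
have E0 := energy_ge0 K phi.
move: c0; rewrite le_eqVlt => /orP[/eqP <-|c0]; first by rewrite mul0r.
have bp := dec_bspin hp.
have p0 : 0 <= pc by have := @pcrit_gt1 R m; lra.
apply/ler_addgt0Pr => e e0.
have [D D0 hD] : exists2 D : R, 0 < D & forall x, S x -> cnorm (p x) ^+ 2 <= D.
  have [_ [D hD]] := bmeasX 2 (bmeas_cnorm bp); exists (`|D| + 1); first by rewrite ltr_wpDl.
  by move=> x Sx; have := hD x Sx; rewrite ger0_norm ?sqr_ge0// => h; have := ler_norm D; lra.
have [t t1 ht] := kap_small m (divr_gt0 e0 D0).
have nt : ip (dilspin M Mi t p) (dilspin M Mi t p) <= e.
  apply: le_trans (L2_dil t1 bp hD) _; apply: le_trans (ler_wpM2l (ltW D0) ht) _.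
  by rewrite mulrCA divff ?mulr1// gt_eqF.
have bt := bspin_dilspin bM bMi t1 bp; have lt := bspin_L2 bt.
pose B := energy dg K phi + e.
have B0 : 0 <= B / c by rewrite divr_ge0 ?(ltW c0)// addr_ge0 ?(ltW e0).
have I0 (q : spin) : 0 <= I (fun x => cnorm (q x) `^ pc) by apply: Int_ge0 => x _; exact: powR_ge0.
have inv q : c * I (fun x => cnorm (q x) `^ pc) `^ bexp <= B <->
    I (fun x => cnorm (q x) `^ pc) <= (B / c) `^ bexp^-1.
  rewrite mulrC -ler_pdivlMr//; split=> h.
    have := @ge0_ler_powR _ bexp^-1 _ _ _ _ _ h; rewrite !nnegrE powR_ge0 B0 invr_ge0 (ltW b0).
    by rewrite -powRrM divff ?gt_eqF// powRr1//; apply.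
  have := @ge0_ler_powR _ bexp _ _ _ _ _ h; rewrite !nnegrE powR_ge0 I0 (ltW b0).
  by rewrite -powRrM mulVf ?gt_eqF// powRr1//; apply.
apply/inv; rewrite -lee_fin -(Lp_dil t1 bp) -Lp_massE//.
(* The hypothesis speaks of finite sums of eigenspinors only, so it is applied to the projections q
   of the dilated spinor, which satisfy the bound uniformly. *)
apply: Lp_mass_lsc => // [|d d0]; first exact: powR_ge0.
have [K' [phi' [q [hq o dq]]]] := L2_projection cl lt d0.
have bq := dec_bspin hq; exists q; split => //.
rewrite Lp_massE// lee_fin; apply/inv; apply: le_trans (hc _ _ _ hq) _.
apply: le_trans (Qform_energy hq) _.
have h1 := energy_dilation cl hMi hMr bM bMi hM t1 hp hq o.
have h2 := projection_norm lt hq o.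
by have := ip_ge0 q; rewrite /B; lra.
Qed.

End dilation_claim.

(** * Scalar inequalities for the Sobolev estimate *)

Section real_inequalities.
Context {R : realType}.
Implicit Types (u v d g L T A B : R).

Lemma sub1_itv u : 0 < u -> u <= 2^-1 -> 0 < 1 - u < 1 /\ 2^-1 <= 1 - u < 1.
Proof. by move=> h1 h2; split; apply/andP; split; lra. Qed.

Lemma le_sqr_weight u d T : 0 <= u -> u * T = 1 -> d <= 2^-1 * T + 2^-1 * u * d ^+ 2.
Proof.
move=> u0 uT; have h := mulr_ge0 u0 (sqr_ge0 (d - T)).
have e : u * (d - T) ^+ 2 = u * d ^+ 2 - 2 * d * (u * T) + T * (u * T) by ring.
by rewrite e uT in h; lra.
Qed.

Lemma sqr_le_split u v : u ^+ 2 <= 2 * (u - v) ^+ 2 + 2 * v ^+ 2.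
Proof. by have := sqr_ge0 (u - 2 * v); nra. Qed.

Lemma le_young_sum u v T A B : u - v <= 2^-1 * T + A -> v <= T + B -> u <= 3 / 2 * T + A + B.
Proof. lra. Qed.

Lemma mulr_young_sum L T A B d :
  L * (3 / 2 * T + 2^-1 * A * B + d) = (3 / 2 * T) * L + (2^-1 * A) * (L * B) + L * d.
Proof. by ring. Qed.

Lemma weight_bound u v T B g : 0 <= u -> 0 <= B -> 0 <= g -> u * v * g = T ->
  2^-1 * u * ((1 - (1 - v) ^+ 2) * (B * g)) <= B * T.
Proof.
move=> u0 B0 g0 <-; rewrite -subr_ge0.
rewrite (_ : _ - _ = 2^-1 * (u * B * g) * v ^+ 2); last by field.
by apply: mulr_ge0; [|exact: sqr_ge0]; apply: mulr_ge0; rewrite ?invr_ge0// !mulr_ge0.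
Qed.

Lemma add_bound T A B d L : A <= B * T -> 3 / 2 * T * L + (A + d * T) <= (3 / 2 * L + d + B) * T.
Proof. by move=> h; rewrite -subr_ge0 (_ : _ - _ = B * T - A) ?subr_ge0//; ring. Qed.

End real_inequalities.

(** * The Sobolev inequality *)

Section brezis.
Context {R : realType} (m : nat).
Local Notation n := m.+2.
Local Notation vol := (@sphere_volume R n).
Local Notation S := (@sphere R n).
Local Notation X := 'rV[R]_n.+1.
Local Notation a := (m.+1%:R / 2 : R).
Local Notation omega := (@omega R m).
Local Notation I f := (\int[vol]_(y in S) f y).
Local Notation pc := (@pcrit R m).
Implicit Types (x y : X) (F : X -> R) (r s g L : R).

Let p1 : 1 < pc := @pcrit_gt1 R m.
Let p0 : 0 < pc. Proof. exact: lt_trans ltr01 p1. Qed.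

Lemma pcrit_half_ge1 : 1 <= pc / 2.
Proof.
rewrite ler_pdivlMr// mul1r /pcrit ler_pdivlMr// -natrM ler_nat /=.
by rewrite leq_mul2l leqnSn.
Qed.

Definition poisson r t : R := (1 - r ^+ 2) * kP (a + 1) r t.

Lemma poisson_ge0 r t : 0 < r < 1 -> 0 <= poisson r t.
Proof. by move=> /andP[r0 r1]; rewrite mulr_ge0 ?kP_ge0// subr_ge0 exprn_ile1// ltW. Qed.

Lemma bmeas_poisson r x : 0 < r < 1 -> S x -> bmeas (fun y => poisson r (edot x y)).
Proof.
move=> /andP[r0 r1] Sx; apply: bmeasZ; by apply: bmeas_kP; rewrite ?gtr0_norm// addr_ge0// ltW.
Qed.

(** Combines 1 - r^2 <= 2 (1 - r) with 2 (a + 1) = n + 1. *)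
Lemma poisson_le r t : 0 < r < 1 -> -1 <= t -> t <= 1 -> poisson r t <= 2 * (1 - r) `^ (- n%:R).
Proof.
move=> /andP[r0 r1] t0 t1; have s0 : 0 < 1 - r by rewrite subr_gt0.
have b0 : 0 <= a + 1 by rewrite addr_ge0// ltW.
have rr : `|r| <= r by rewrite gtr0_norm.
have h := kP_le b0 r1 rr t0 t1.
apply: (@le_trans _ _ ((2 * (1 - r)) * ((1 - r) ^+ 2) `^ (- (a + 1)))).
  apply: ler_pM => //; first by rewrite subr_ge0 exprn_ile1// ltW.
    exact: kP_ge0.
  by rewrite -subr_ge0 (_ : _ - _ = (1 - r) ^+ 2) ?sqr_ge0//; ring.
rewrite -mulrA ler_wpM2l// -powR_mulrn ?(ltW s0)// -powRrM -{1}(powRr1 (ltW s0)) -powRD; last first.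
  by rewrite (gt_eqF s0) implybT.
by rewrite le_eqVlt; apply/orP; left; apply/eqP; congr (_ `^ _); rewrite -[n%:R]natr1; field.
Qed.

Lemma young_tau (f tau : R) : 0 <= f -> 0 < tau -> f <= tau + tau `^ (1 - pc) * f `^ pc.
Proof.
move=> f0 t0; have [h|h] := leP f tau; first by rewrite ler_wpDr// mulr_ge0 ?powR_ge0.
have fp : 0 < f by exact: lt_trans h.
apply: ler_wpDl; first exact: ltW.
have -> : f `^ pc = f * f `^ (pc - 1) by rewrite mulr_powRB1 ?(ltW fp).
have -> : 1 - pc = - (pc - 1) by rewrite opprB.
rewrite powRN mulrCA ler_peMr ?(ltW fp)//.
rewrite mulrC ler_pdivlMr ?powR_gt0// mul1r; apply: ge0_ler_powR; rewrite ?nnegrE ?subr_ge0 ?(ltW h) ?(ltW t0) ?(ltW fp) ?(ltW p1)//.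
Qed.

(** F(x) is written as F(x) - F(y) plus F(y) and averaged in y: the difference is absorbed by its
    square with weight u = 1 / T, the value F(y) by [young_tau] with threshold T, and D T^(1 - p) =
    2 T keeps the latter contribution of order T. *)
Lemma kernel_average (P F : X -> R) x (D T u E : R) : bmeas P -> bmeas F -> (forall y, S y -> 0 <= F y) ->
  I P = omega -> (forall y, S y -> 0 <= P y) -> (forall y, S y -> P y <= D) ->
  I (fun y => F y `^ pc) = 1 -> 0 < T -> 0 <= u -> u * T = 1 -> D * T `^ (1 - pc) = 2 * T ->
  I (fun y => P y * (F x - F y) ^+ 2) <= E ->
  omega * F x <= 3 / 2 * T * omega + (2^-1 * u * E + 2 * T).
Proof.
move=> bP bF F0 IP P0 PD IF T0 u0 uT DT IE.
have bFp : bmeas (fun y => F y `^ pc) by exact: bmeas_powR (ltW p0).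
have b1 : bmeas (fun y => P y * (F x - F y) ^+ 2).
  by apply: bmeasM => //; apply: bmeasX; apply: bmeasB => //; exact: bmeas_cst.
have b2 := bmeasZ (2 * T) bFp; have b3 := bmeasZ (3 / 2 * T) bP; have b4 := bmeasZ (2^-1 * u) b1.
have -> : omega * F x = I (fun y => F x * P y) by rewrite IntZ// IP mulrC.
apply: (@le_trans _ _ (I (fun y => (3 / 2 * T) * P y + ((2^-1 * u) * (P y * (F x - F y) ^+ 2) + 2 * T * F y `^ pc)))).
  apply: le_Int; [exact: bmeasZ|by apply: bmeasD => //; exact: bmeasD|move=> y Sy].
  have y1 := young_tau (F0 y Sy) T0.
  have y2 := le_sqr_weight (F x - F y) u0 uT.
  rewrite mulrC; apply: le_trans (ler_wpM2l (P0 y Sy) (le_young_sum y2 y1)) _.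
  rewrite mulr_young_sum -addrA !lerD2l -DT -mulrA.
  by rewrite ler_wpM2r ?PD// mulr_ge0 ?powR_ge0.
rewrite (IntD b3 (bmeasD b4 b2)) (IntD b4 b2) (IntZ _ bP) (IntZ _ b1) (IntZ _ bFp) IF IP mulr1.
by rewrite lerD2l lerD2r ler_wpM2l// mulr_ge0// invr_ge0.
Qed.

Lemma kernel_average2 (P F : X -> R) x (D E : R) : bmeas P -> bmeas F ->
  I P = omega -> (forall y, S y -> 0 <= P y) -> (forall y, S y -> P y <= D) ->
  I (fun y => P y * (F x - F y) ^+ 2) <= E ->
  omega * F x ^+ 2 <= 2 * E + 2 * D * I (fun y => F y ^+ 2).
Proof.
move=> bP bF IP P0 PD IE; have bF2 := bmeasX 2 bF.
have b1 : bmeas (fun y => P y * (F x - F y) ^+ 2).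
  by apply: bmeasM => //; apply: bmeasX; apply: bmeasB => //; exact: bmeas_cst.
have -> : omega * F x ^+ 2 = I (fun y => F x ^+ 2 * P y) by rewrite IntZ// IP mulrC.
apply: (@le_trans _ _ (I (fun y => 2 * (P y * (F x - F y) ^+ 2) + (2 * D) * F y ^+ 2))).
  apply: le_Int; [exact: bmeasZ|by apply: bmeasD; exact: bmeasZ|move=> y Sy].
  rewrite mulrC; apply: le_trans (ler_wpM2l (P0 y Sy) (sqr_le_split (F x) (F y))) _.
  rewrite mulrDr mulrCA lerD2l mulrCA -mulrA ler_wpM2l// ler_wpM2r ?sqr_ge0//.
  exact: PD.
rewrite (IntD (bmeasZ 2 b1) (bmeasZ _ bF2)) (IntZ _ b1) (IntZ _ bF2).
by rewrite lerD2r ler_wpM2l.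
Qed.

(* Brezis' argument: [F x] is compared with its Poisson average of parameter
   1 - s; the error terms balance for s = g^(-1/n). *)
Lemma sobolev_pointwise : 0 < omega -> exists2 C : R, 0 < C & forall F x g L,
  bmeas F -> (forall y, S y -> 0 <= F y) -> S x -> 0 <= g -> L <= 1 ->
  I (fun y => F y `^ pc) = 1 -> I (fun y => F y ^+ 2) = L ->
  (forall r, 2^-1 <= r < 1 -> I (fun y => poisson r (edot x y) * (F x - F y) ^+ 2) <= (1 - r ^+ 2) * (4 `^ (a + 1) * g)) ->
  F x `^ pc <= C * (g + L).
Proof.
move=> w0; set B : R := 4 `^ (a + 1); have B0 : 0 < B by exact: powR_gt0.
clearbody B.
pose C1 : R := (3 / 2 * omega + 2 + B) / omega.
have C10 : 0 < C1 by rewrite divr_gt0//; lra.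
pose C2 : R := 2 * (B + 2 * 2 `^ n%:R) / omega.
have C20 : 0 < C2 by rewrite divr_gt0// mulr_gt0// addr_gt0// mulr_gt0// powR_gt0.
pose C3 : R := C2 `^ (pc / 2) * (2 `^ n%:R + 1) `^ (pc / 2 - 1).
have C30 : 0 <= C3 by rewrite mulr_ge0 ?powR_ge0.
exists (C1 `^ pc + C3) => [|F x g L bF F0 Sx g0 L1 IF IL H]; first by rewrite ltr_wpDr// powR_gt0.
have L0 : 0 <= L by rewrite -IL; apply: Int_ge0 => y _; exact: sqr_ge0.
have bFp : bmeas (fun y => F y `^ pc) by exact: bmeas_powR (ltW p0).
have Fx := F0 x Sx.
have gL : 0 <= g + L by rewrite addr_ge0.
(* For g >= 2^n the parameter s = g^(-1/n) is at most 1/2; smaller g is treated with the fixed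
   kernel r = 1/2. *)
have [hg|hg] := leP (2 `^ n%:R) g.
  have gp : 0 < g by apply: lt_le_trans hg; exact: powR_gt0.
  pose s := g `^ (- n%:R^-1).
  have s0 : 0 < s by exact: powR_gt0.
  have s2 : s <= 2^-1.
    rewrite /s powRN lef_pV2 ?posrE ?powR_gt0//.
    have := @ge0_ler_powR _ n%:R^-1 _ _ _ _ _ hg; rewrite !nnegrE powR_ge0 g0 invr_ge0 ler0n.
    by rewrite -powRrM divff ?pnatr_eq0// powRr1//; apply.
  pose r := 1 - s; have [rI r2] : 0 < r < 1 /\ 2^-1 <= r < 1 := sub1_itv s0 s2.
  have bP := bmeas_poisson rI Sx.
  (* T is the expected size of F(x): since a p = n, T^p = s^(-n) = g. *)
  pose T := s `^ (- a); have T0 : 0 < T by exact: powR_gt0.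
  have TI : s `^ a * T = 1 by rewrite /T powRN divff// gt_eqF// powR_gt0.
  have sg : s `^ n%:R * g = 1.
    by rewrite /s -powRrM mulNr mulVf ?pnatr_eq0// powRN powRr1// mulVf// gt_eqF.
  have Tg : s `^ (a + 1) * g = T.
    have -> : T = s `^ (a + 1) * s `^ (- n%:R).
      rewrite -powRD; last by rewrite (gt_eqF s0) implybT.
      by congr (_ `^ _); rewrite -[n%:R]natr1; field.
    congr (_ * _); rewrite powRN -[LHS]mul1r -[X in X * g](mulVf (x := s `^ n%:R)) ?gt_eqF ?powR_gt0//.
    by rewrite -mulrA sg mulr1.
  have TT : T `^ (1 - pc) * s `^ (- n%:R) = T.
    rewrite /T -powRrM -powRD; last by rewrite (gt_eqF s0) implybT.
    by congr (_ `^ _); rewrite mulrBr mulr1 mulNr a_pcrit; ring.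
  have Tpc : T `^ pc = g.
    have sn : s `^ n%:R != 0 by rewrite gt_eqF// powR_gt0.
    by rewrite /T -powRrM mulNr a_pcrit powRN; apply: (mulfI sn); rewrite mulfV// sg.
  clearbody T.
  have P0 y : S y -> 0 <= poisson r (edot x y) by move=> Sy; exact: poisson_ge0.
  have PD y : S y -> poisson r (edot x y) <= 2 * s `^ (- n%:R).
    move=> Sy; have [t0 t1] := edot_itv Sx Sy; have := poisson_le rI t0 t1.
    by rewrite (_ : 1 - r = s)// /r opprB addrC subrK.
  have DT : 2 * s `^ (- n%:R) * T `^ (1 - pc) = 2 * T by rewrite -mulrA [s `^ _ * _]mulrC TT.
  have step := kernel_average bP bF F0 (poisson1 Sx rI) P0 PD IF T0 (powR_ge0 s a) TI DT (H r r2).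
  have h1 : 2^-1 * s `^ a * ((1 - r ^+ 2) * (B * g)) <= B * T.
    have e : s `^ a * s * g = T by rewrite -Tg powRD ?powRr1 ?(ltW s0)// (gt_eqF s0) implybT.
    exact: (weight_bound (powR_ge0 s a) (ltW B0) g0 e).
  have step2 : omega * F x <= C1 * omega * T.
    apply: le_trans step _; rewrite /C1 divfK ?gt_eqF//.
    exact: (add_bound _ _ h1).
  have F1 : F x <= C1 * T by rewrite -(ler_pM2l w0) (le_trans step2)// mulrA [omega * _]mulrC.
  have : F x `^ pc <= (C1 * T) `^ pc.
    apply: (ge0_ler_powR (ltW p0) _ _ F1); rewrite nnegrE//.
    exact: mulr_ge0 (ltW C10) (ltW T0).
  move=> /le_trans; apply.
  rewrite powRM ?(ltW C10) ?(ltW T0)//.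
  rewrite Tpc; apply: ler_pM; rewrite ?powR_ge0// ?lerDl//.
have i2 : 0 < (2^-1 : R) by rewrite invr_gt0.
have := sub1_itv i2 (lexx _).
have -> : 1 - 2^-1 = 2^-1 :> R by field.
move=> [rI r2].
have bP := bmeas_poisson rI Sx.
have P0 y : S y -> 0 <= poisson 2^-1 (edot x y) by move=> Sy; exact: poisson_ge0.
have PD y : S y -> poisson 2^-1 (edot x y) <= 2 * 2 `^ n%:R.
  move=> Sy; have [t0 t1] := edot_itv Sx Sy; have := poisson_le rI t0 t1.
  rewrite (_ : (1 - 2^-1) `^ (- n%:R) = 2 `^ n%:R)//.
  by rewrite (_ : 1 - 2^-1 = 2 `^ (-1)) -?powRrM ?mulrNN ?mul1r// powR_inv1//; field.
have step : omega * F x ^+ 2 <= C2 * omega * (g + L).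
  have h1 : I (fun y => poisson 2^-1 (edot x y) * (F x - F y) ^+ 2) <= B * g.
    by apply: le_trans (H _ r2) _; rewrite ler_piMl ?mulr_ge0 ?(ltW B0)// gerBl sqr_ge0.
  apply: le_trans (kernel_average2 bP bF (poisson1 Sx rI) P0 PD h1) _; rewrite IL.
  rewrite /C2 divfK ?gt_eqF//; have n0 := powR_ge0 (2 : R) n%:R.
  rewrite -subr_ge0 (_ : _ - _ = 2 * (B * L) + 4 * (2 `^ n%:R * g)); last by ring.
  by rewrite addr_ge0// mulr_ge0// mulr_ge0// ltW.
have F2 : F x ^+ 2 <= C2 * (g + L) by rewrite -(ler_pM2l w0) (le_trans step)// mulrA [omega * _]mulrC.
have -> : F x `^ pc = (F x ^+ 2) `^ (pc / 2).
  by rewrite -powR_mulrn// -powRrM; congr (_ `^ _); field.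
(* In this case g + L is at most 2^n + 1, so its power p/2 >= 1 is bounded by a multiple of g + L
   itself. *)
have pc2 := pcrit_half_ge1.
apply: (@le_trans _ _ (C3 * (g + L))); last first.
  by rewrite ler_wpM2r// lerDr powR_ge0.
apply: (@le_trans _ _ ((C2 * (g + L)) `^ (pc / 2))).
  apply: (ge0_ler_powR (le_trans ler01 pc2) _ _ F2); rewrite nnegrE ?sqr_ge0//.
  exact: mulr_ge0 (ltW C20) gL.
rewrite powRM ?(ltW C20)// /C3 -mulrA ler_wpM2l ?powR_ge0//.
have [->|gn] := eqVneq (g + L) 0; first by rewrite mulr0 powR0// gt_eqF// divr_gt0.
have -> : (g + L) `^ (pc / 2) = (g + L) `^ (pc / 2 - 1) * (g + L).
  by rewrite [RHS]mulrC mulr_powRB1// divr_gt0.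
rewrite ler_wpM2r//; apply: ge0_ler_powR; rewrite ?nnegrE ?subr_ge0 ?addr_ge0 ?powR_ge0//.
by rewrite lerD// ltW.
Qed.

End brezis.

Section sobolev.
Context {R : realType} (m : nat).
Local Notation n := m.+2.
Local Notation N := (spinor_rank n).
Local Notation vol := (@sphere_volume R n).
Local Notation S := (@sphere R n).
Local Notation X := 'rV[R]_n.+1.
Local Notation C := R[i].
Local Notation spin := (spinor R n).
Local Notation a := (m.+1%:R / 2 : R).
Local Notation omega := (@omega R m).
Local Notation I f := (\int[vol]_(y in S) f y).
Local Notation pc := (@pcrit R m).
Local Notation bexp := (@bexp R m).
Implicit Types (x y : X) (p q : spin) (f : X * X -> R) (r s : R).
Variable gamma : 'I_n -> 'M[C]_N.
Hypothesis cl : clifford_rep gamma.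

Let a_gt0 : 0 < a. Proof. by rewrite divr_gt0. Qed.
Let mS : measurable S := @measurable_sphere R n.
Let p1 : 1 < pc := @pcrit_gt1 R m.
Let p0 : 0 < pc. Proof. exact: lt_trans ltr01 p1. Qed.

Lemma kform_E (k : R -> R) (kappa : R) (mk : measurable_fun setT k) (k0 : forall t, 0 <= k t)
  (ik : forall x, S x -> vol.-integrable S (fun y => (k (edot x y))%:E))
  (Ik : forall x, S x -> I (fun y => k (edot x y)) = kappa) f : bmeas2 f ->
  (\int[vol]_(x in S) \int[vol]_(y in S) (k (edot x y) * f (x, y))%:E = (kform k f)%:E)%E.
Proof.
move=> bf; have [_ i2] := kform_fubini mk k0 ik Ik bf.
rewrite /kform /Rintegral fineK; last exact: (integrable_fin_num mS i2).
apply: eq_integral => x /set_mem Sx; rewrite fineK//.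
exact: integrable_fin_num (integrable_kernelM mk k0 ik Sx (bmeas2_section bf Sx)).
Qed.

Lemma integral_prod_sphere f : measurable_fun setT f -> (forall z, 0 <= f z) ->
  (\int[(vol \x vol)%E]_z (f z)%:E = \int[vol]_(x in S) \int[vol]_(y in S) (f (x, y))%:E)%E.
Proof.
move=> mf f0; have mE : measurable_fun setT (EFin \o f) by apply/measurable_EFinP.
have mF := @measurable_fun_fubini_tonelli_F _ _ _ _ _ vol (EFin \o f) mE (fun z => f0 z).
rewrite -[LHS]/(\int[(vol \x vol)%E]_z (EFin \o f) z)%E (@fubini_tonelli1 _ _ _ _ _ vol vol (EFin \o f) mE (fun z => f0 z)) (integral_volT mF).
apply: eq_integral => x _; rewrite /fubini_F integral_volT//.
by apply/measurable_EFinP; exact: measurable_section1.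
Qed.

Lemma bernoulli_le r k : 0 <= r -> r <= 1 -> 1 - r ^+ k <= k%:R * (1 - r).
Proof.
move=> r0 r1; elim: k => [|k ih]; first by rewrite expr0 subrr mul0r.
rewrite exprSr (_ : 1 - _ = (1 - r ^+ k) + r ^+ k * (1 - r)); last by ring.
by rewrite -natr1 mulrDl mul1r lerD// ler_piMl ?subr_ge0// exprn_ile1.
Qed.

Lemma Qform_ge0 K (phi : nat -> spin) : 0 <= Qform K phi.
Proof. by apply: sumr_ge0 => i _; rewrite mulr_ge0 ?ip_ge0// ltW// al_gt0. Qed.

Lemma ip_Qform K phi q : dec gamma K phi q -> ip q q <= Qform K phi.
Proof.
move=> hq; rewrite (dec_norm cl hq); apply: ler_sum => i _.
rewrite ler_peMl ?ip_ge0// /al ler_wpDl// ler_pdivlMr// mul1r ler_nat.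
by [].
Qed.

(** The Poisson kernel multiplies a component of degree k by omega r^k, and 1 - r^k <= k (1 - r)
    with k at most the eigenvalue of |D|. Passing from q to its pointwise norm only lowers the
    form. *)
Lemma poisson_energy K phi q r : dec gamma K phi q -> 0 < r < 1 ->
  kform (poisson m r) (fun z : X * X => (cnorm (q z.1) - cnorm (q z.2)) ^+ 2) <= 2 * omega * (1 - r) * Qform K phi.
Proof.
move=> hq rI; have [h qE] := hq; have bq := dec_bspin hq; have /andP[r0 r1] := rI.
have mk : measurable_fun setT (poisson m r) by apply: measurable_funM => //; exact: measurable_kP.
have k0 t : 0 <= poisson m r t by exact: poisson_ge0.
have ik x : S x -> vol.-integrable S (fun y => (poisson m r (edot x y))%:E).
  by move=> Sx; exact: bmeas_int (bmeas_poisson rI Sx).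
have Ik x : S x -> I (fun y => poisson m r (edot x y)) = omega by move=> Sx; exact: poisson1.
have bF := bmeas_cnorm bq; have bF2 := bmeasX 2 bF.
have b1 := bmeas2_fst bF2; have b2 := bmeas2_snd bF2.
have b3 := bmeas2_rdot bq bq.
have b4 : bmeas2 (fun z : X * X => (cnorm (q z.1) - cnorm (q z.2)) ^+ 2).
  have bb : bmeas2 (fun z : X * X => cnorm (q z.1) + -1 * cnorm (q z.2)).
    by apply: bmeas2D; [exact: (bmeas2_fst bF)|apply: bmeas2Z; exact: (bmeas2_snd bF)].
  by have := bmeas2M bb bb; under eq_fun do rewrite mulN1r -expr2.
have hc : kconv (poisson m r) q (fun x => \sum_(i < K) (omega * r ^+ uphalf i)%:C *: phi i x).
  have := kconv_sum mk k0 ik (index_enum 'I_K) (fun _ => 1) (fun i : 'I_K => harm_bspin (es_harm (h i)))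
    (fun i : 'I_K => kconv_harm mk k0 ik (es_harm (h i)) (fun hh x Sx hhh => poisson_formula Sx hhh rI)).
  rewrite qE; under eq_fun do under eq_bigr do rewrite scale1r.
  by under [X in kconv _ _ X -> _]eq_fun do under eq_bigr do rewrite scale1r.
have e1 : kform (poisson m r) (fun z : X * X => rdot (q z.1) (q z.2)) = \sum_(i < K) omega * r ^+ uphalf i * ip (phi i) (phi i).
  by rewrite (kform_kconv q hc) ipC (dec_wsum cl (fun i => omega * r ^+ uphalf i) hq).
have e2 : kform (poisson m r) (fun z : X * X => (cnorm (q z.1) ^+ 2 + cnorm (q z.2) ^+ 2) + (- 2) * rdot (q z.1) (q z.2)) =
    2 * omega * \sum_(i < K) (1 - r ^+ uphalf i) * ip (phi i) (phi i).
  rewrite (kformD mk k0 ik Ik (bmeas2D b1 b2) (bmeas2Z (-2) b3)) (kformD mk k0 ik Ik b1 b2) (kformZ mk k0 ik Ik _ b3).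
  rewrite (kform_fst ik Ik bF2) (kform_snd mk k0 ik Ik bF2) -ip_cnorm e1 (dec_norm cl hq) !mulr_sumr -!big_split /=.
  by apply: eq_bigr => i _; ring.
apply: (@le_trans _ _ (2 * omega * \sum_(i < K) (1 - r ^+ uphalf i) * ip (phi i) (phi i))).
  rewrite -e2; apply: (kform_le mk k0 ik Ik b4 (bmeas2D (bmeas2D b1 b2) (bmeas2Z (-2) b3))) => x y _ _ /=.
  rewrite -subr_ge0 (_ : _ - _ = 2 * (cnorm (q x) * cnorm (q y) - rdot (q x) (q y))); last by ring.
  by rewrite mulr_ge0// subr_ge0 rdot_le_cnorm.
rewrite -[X in _ <= X]mulrA ler_wpM2l ?mulr_ge0 ?omega_ge0// mulr_sumr; apply: ler_sum => i _.
rewrite mulrA ler_wpM2r ?ip_ge0//; apply: le_trans (bernoulli_le _ (ltW r0) (ltW r1)) _.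
rewrite mulrC ler_wpM2l ?subr_ge0 ?(ltW r1)// /al uphalf_half natrD addrC lerD2l.
apply: (@le_trans _ _ 1); first by case: (odd i).
by rewrite ler_pdivlMr// mul1r ler_nat.
Qed.

(** The integrand of the Gagliardo seminorm of |q| in H^(1/2): the kernel is |x - y|^(-n - 1), and
    the last factor removes the diagonal. *)
Definition singular_sqr q (z : X * X) : R :=
  (cnorm (q z.1) - cnorm (q z.2)) ^+ 2 * kP (a + 1) 1 (edot z.1 z.2) * (1 - (1 <= edot z.1 z.2)%R%:R).

Lemma singular_sqr_ge0 q z : 0 <= singular_sqr q z.
Proof.
rewrite /singular_sqr mulr_ge0//; first by rewrite mulr_ge0 ?kP_ge0 ?sqr_ge0.
by case: (1 <= _); rewrite /= ?subrr ?subr0.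
Qed.

Lemma measurable_cnorm2 q : bspin q -> measurable_fun setT (fun z : X * X => (cnorm (q z.1) - cnorm (q z.2)) ^+ 2).
Proof.
move=> bq; have bF := bmeas_cnorm bq; apply: measurable_funX; apply: measurable_funB.
  by have [] := bmeas2_fst bF.
by have [] := bmeas2_snd bF.
Qed.

Lemma measurable_singular_sqr q : bspin q -> measurable_fun setT (singular_sqr q).
Proof.
move=> bq; apply: measurable_funM; first apply: measurable_funM.
- exact: measurable_cnorm2.
- by apply: measurableT_comp; [exact: measurable_kP|exact: measurable_edot2].
apply: measurable_funB => //; apply: measurable_ge_nat; exact: measurable_edot2.
Qed.

(** [poisson_energy] divided by 1 - r^2: at a fixed distance from the diagonal the singular kernel
    is dominated by kP (a + 1) r for r close to 1, with a constant independent of r. *)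
Lemma singular_energy K phi q : dec gamma K phi q ->
  (\int[vol]_(x in S) \int[vol]_(y in S) (singular_sqr q (x, y))%:E <=
   (2 `^ (a + 1) * (2 * omega * Qform K phi))%:E)%E.
Proof.
move=> hq; have bq := dec_bspin hq; have ms := measurable_singular_sqr bq.
have Q0 := Qform_ge0 K phi; have w0 : 0 <= omega := @omega_ge0 R m.
rewrite -(integral_prod_sphere ms (singular_sqr_ge0 q)).
have me : measurable_fun setT (fun z : X * X => 2 - 2 * edot z.1 z.2).
  by apply: measurable_funB => //; apply: measurable_funM => //; exact: measurable_edot2.
apply: (@integral_le_cut _ _ _ _ _ _ (fun z => 2 - 2 * edot z.1 z.2)) => //.
- by move=> z _; exact: singular_sqr_ge0.
- by move=> z _ h; rewrite /singular_sqr (_ : (1 <= _) = true) ?subrr ?mulr0//; lra.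
move=> j; set c : R := j.+1%:R^-1.
have c0 : 0 < c by rewrite invr_gt0.
have c1 : c <= 1 by rewrite invf_le1// ler1n.
have [r rI rc] : exists2 r : R, 0 < r < 1 & (1 - r) ^+ 2 <= c.
  exists (1 - c / 2); first by apply/andP; split; lra.
  by rewrite opprB addrC subrK; nra.
have /andP[r0 r1] := rI.
have mk : measurable_fun setT (poisson m r) by apply: measurable_funM => //; exact: measurable_kP.
have k0 t : 0 <= poisson m r t by exact: poisson_ge0.
have ik x : S x -> vol.-integrable S (fun y => (poisson m r (edot x y))%:E).
  by move=> Sx; exact: bmeas_int (bmeas_poisson rI Sx).
have Ik x : S x -> I (fun y => poisson m r (edot x y)) = omega by move=> Sx; exact: poisson1.
have bF := bmeas_cnorm bq.
have b4 : bmeas2 (fun z : X * X => (cnorm (q z.1) - cnorm (q z.2)) ^+ 2).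
  have bb : bmeas2 (fun z : X * X => cnorm (q z.1) + -1 * cnorm (q z.2)).
    by apply: bmeas2D; [exact: (bmeas2_fst bF)|apply: bmeas2Z; exact: (bmeas2_snd bF)].
  by have := bmeas2M bb bb; under eq_fun do rewrite mulN1r -expr2.
have q2 : 0 < 1 - r ^+ 2 by rewrite subr_gt0 exprn_ilt1// ltW.
pose A : R := 2 `^ (a + 1) / (1 - r ^+ 2).
have A0 : 0 <= A by rewrite divr_ge0 ?powR_ge0// ltW.
have b5 := bmeas2Z A b4.
pose f z := singular_sqr q z * (c <= 2 - 2 * edot z.1 z.2)%R%:R.
have mf : measurable_fun setT f by apply: measurable_funM => //; exact: measurable_ge_nat.
have f0 z : 0 <= f z by rewrite mulr_ge0 ?singular_sqr_ge0.
rewrite [leLHS](integral_prod_sphere mf f0).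
apply: (@le_trans _ _ (kform (poisson m r) (fun z : X * X => A * (cnorm (q z.1) - cnorm (q z.2)) ^+ 2))%:E).
  rewrite -(kform_E mk k0 ik Ik b5); apply: ge0_le_integral => //.
  - by move=> x _; apply: integral_ge0 => y _; rewrite lee_fin.
  - by apply: measurable_funTS; exact: measurable_inner.
  - apply: measurable_funTS; apply: (@measurable_inner _ _ (fun z : X * X => poisson m r (edot z.1 z.2) * (A * (cnorm (q z.1) - cnorm (q z.2)) ^+ 2))).
      by apply: measurable_funM; [apply: (measurableT_comp mk); exact: measurable_edot2|have [] := b5].
    by move=> z; rewrite mulr_ge0// mulr_ge0 ?sqr_ge0.
  move=> x Sx; apply: ge0_le_integral => //.
  - by move=> y _; rewrite lee_fin.
  - by apply: measurable_funTS; apply/measurable_EFinP; exact: (measurable_section1 _ mf).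
  - apply: measurable_funTS; apply/measurable_EFinP.
    apply: (@measurable_section1 _ _ (fun z : X * X => poisson m r (edot z.1 z.2) * (A * (cnorm (q z.1) - cnorm (q z.2)) ^+ 2))).
    by apply: measurable_funM; [apply: (measurableT_comp mk); exact: measurable_edot2|have [] := b5].
  move=> y Sy; rewrite lee_fin /f /singular_sqr /=.
  have [_ t1] := edot_itv Sx Sy.
  have rhs0 : 0 <= poisson m r (edot x y) * (A * (cnorm (q x) - cnorm (q y)) ^+ 2) by rewrite mulr_ge0// mulr_ge0 ?sqr_ge0.
  case h : (c <= _) => /=; last by rewrite mulr0.
  rewrite mulr1; apply: (@le_trans _ _ ((cnorm (q x) - cnorm (q y)) ^+ 2 * kP (a + 1) 1 (edot x y))).
    apply: ler_piMr; first exact: (mulr_ge0 (sqr_ge0 _) (kP_ge0 _ _ _)).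
    by rewrite gerBl ler0n.
  have hh := @kP1_cut R (a + 1) r (edot x y) (addr_ge0 (ltW a_gt0) ler01) rI t1 (le_trans rc h).
  rewrite mulrC mulrA; apply: ler_wpM2r; first exact: sqr_ge0.
  apply: le_trans hh _.
  rewrite /poisson /A; move: (kP _ _ _) (2 `^ _) => u v.
  by rewrite le_eqVlt; apply/orP; left; apply/eqP; field; rewrite gt_eqF.
rewrite lee_fin (kformZ mk k0 ik Ik _ b4); apply: le_trans (ler_wpM2l A0 (poisson_energy hq rI)) _.
rewrite /A -!mulrA ler_wpM2l ?powR_ge0// mulrC -!mulrA.
apply: ler_wpM2l => //; apply: ler_wpM2l => //; rewrite mulrCA ler_piMr//.
rewrite ler_pdivrMr// mul1r -subr_ge0 (_ : _ - _ = r * (1 - r)); last by ring.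
by rewrite mulr_ge0 ?subr_ge0 ?ltW.
Qed.

(** [sobolev_pointwise] is integrated over x, with g the inner singular integral at x; the result
    bounds 1 by a multiple of the form. *)
Lemma sobolev_unit : 0 < omega -> exists2 c0 : R, 0 < c0 & forall K phi q,
  dec gamma K phi q -> I (fun x => cnorm (q x) `^ pc) = 1 -> c0 <= Qform K phi.
Proof.
move=> w0; have [C C0 hC] := @sobolev_pointwise R m w0.
pose D : R := C * (2 `^ (a + 1) * (2 * omega) + omega).
have D0 : 0 < D by rewrite mulr_gt0// ltr_wpDl// mulr_ge0 ?powR_ge0// mulr_ge0// ltW.
exists (Num.min 1 D^-1); first by rewrite lt_min ltr01 invr_gt0.
(* If the form is at least 1 nothing remains to prove; otherwise |q|_2^2 <= 1, as
   [sobolev_pointwise] demands. *)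
move=> K phi q hq I1; rewrite ge_min; have [//|Q1] := leP 1 (Qform K phi); rewrite /=.
have bq := dec_bspin hq; have bF := bmeas_cnorm bq; have ms := measurable_singular_sqr bq.
have qQ := ip_Qform hq.
pose G x := (\int[vol]_(y in S) (singular_sqr q (x, y))%:E)%E.
have G0 x : (0 <= G x)%E by apply: integral_ge0 => y _; rewrite lee_fin singular_sqr_ge0.
have mG : measurable_fun setT G by apply: measurable_inner => //; exact: singular_sqr_ge0.
have ms1 x : measurable_fun setT (fun y => singular_sqr q (x, y)) by exact: measurable_section1.
have pw x : S x -> ((cnorm (q x) `^ pc)%:E <= C%:E * (G x + (ip q q)%:E))%E.
  (* Where the singular integral is infinite the bound is void. *)
  move=> Sx; case GE : (G x) => [g||]; first last.
  - by have := G0 x; rewrite GE.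
  - by rewrite addye// gt0_muley ?leey// lte_fin.
  have g0 : 0 <= g by rewrite -lee_fin -GE.
  rewrite -EFinD -EFinM lee_fin; apply: (hC (fun y => cnorm (q y)) x g (ip q q)) => //.
  - by move=> y _; exact: cnorm_ge0.
  - exact: le_trans qQ (ltW Q1).
  - by rewrite ip_cnorm.
  move=> r /andP[r2 r1]; have rI : 0 < r < 1 by rewrite r1 andbT (lt_le_trans _ r2)// invr_gt0.
  have bP := bmeas_poisson rI Sx.
  have bd : bmeas (fun y => (cnorm (q x) - cnorm (q y)) ^+ 2).
    by apply: bmeasX; apply: bmeasB => //; exact: bmeas_cst.
  have b1 := bmeasM bP bd.
  have bge := bmeas_ge 1 (measurable_edotl x).
  have is1 : vol.-integrable S (EFin \o (fun y => singular_sqr q (x, y))).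
    apply/integrableP; split; first by apply/measurable_EFinP; exact: measurable_funTS.
    under eq_integral do rewrite /= ger0_norm ?singular_sqr_ge0//.
    by rewrite -/(G x) GE ltry.
  have GI : I (fun y => singular_sqr q (x, y)) = g by rewrite /Rintegral -/(G x) GE.
  have q2 : 0 <= 1 - r ^+ 2 by rewrite subr_ge0 exprn_ile1 ?(ltW r1)//; case/andP: rI => /ltW.
  rewrite mulrA -GI -(RintegralZl _ mS is1).
  (* The diagonal, absent from [singular_sqr], is a null set and can be removed here too. *)
  have -> : I (fun y => poisson m r (edot x y) * (cnorm (q x) - cnorm (q y)) ^+ 2) =
      I (fun y => poisson m r (edot x y) * (cnorm (q x) - cnorm (q y)) ^+ 2
         - (1 <= edot x y)%R%:R * (poisson m r (edot x y) * (cnorm (q x) - cnorm (q y)) ^+ 2)).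
    by rewrite (IntB b1 (bmeasM bge b1)) (Int_poleM Sx b1) subr0.
  apply: le_Rintegral => //; first by apply: bmeas_int; apply: bmeasB => //; exact: bmeasM.
    apply: (eq_integrable mS _ _ _ (integrableZl mS ((1 - r ^+ 2) * 4 `^ (a + 1)) is1)) => y _.
    by rewrite /= EFinM.
  move=> y Sy; have [_ t1] := edot_itv Sx Sy; rewrite /singular_sqr /=.
  have [h|h] := leP 1 (edot x y); first by rewrite mul1r !subrr mulr0 mulr0.
  rewrite mul0r !subr0 mulr1.
  have := @kP_dom R (a + 1) r (edot x y) (addr_ge0 (ltW a_gt0) ler01) r2 r1 t1.
  rewrite h mul1r => hh; rewrite /poisson.
  have hh2 := ler_wpM2l q2 (ler_wpM2r (sqr_ge0 (cnorm (q x) - cnorm (q y))) hh).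
  by rewrite -(mulrA (1 - r ^+ 2)); apply: le_trans hh2 _; rewrite -(mulrA (1 - r ^+ 2)) -(mulrA (4 `^ _)) [_ ^+ 2 * kP _ 1 _]mulrC.
have bFp := bmeas_cnorm_powR bq (ltW p0).
have : ((I (fun x => cnorm (q x) `^ pc))%:E <= C%:E * ((2 `^ (a + 1) * (2 * omega * Qform K phi))%:E + (omega * ip q q)%:E))%E.
  rewrite -Lp_massE//.
  apply: (@le_trans _ _ (\int[vol]_(x in S) (C%:E * (G x + (ip q q)%:E)))%E).
    apply: ge0_le_integral => //.
    - by move=> x _; rewrite lee_fin powR_ge0.
    - by apply/measurable_EFinP; apply: measurable_funTS; case: bFp.
    by apply: measurable_funTS; apply: measurable_funeM; exact: emeasurable_funD.
  have mGS : measurable_fun S G by exact: measurable_funTS.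
  rewrite ge0_integralZl//; last 3 first.
  - by apply: emeasurable_funD.
  - by move=> x _; rewrite adde_ge0// lee_fin ip_ge0.
  - by rewrite lee_fin ltW.
  rewrite lee_pmul2l ?lte_fin//.
  rewrite ge0_integralD//; last by move=> x _; rewrite lee_fin ip_ge0.
  rewrite leeD//; first exact: (singular_energy hq).
  have bc : bmeas (fun _ : X => ip q q) by exact: bmeas_cst.
  have := integrable_fin_num mS (bmeas_int bc) => /fineK <-; rewrite lee_fin.
  rewrite -[fine _]/(I (fun _ => ip q q)) (eq_Int (g := fun _ => ip q q * 1)); last by move=> x _; rewrite mulr1.
  by rewrite (IntZ _ (bmeas_cst m 1)) mulrC.
rewrite -EFinD -EFinM lee_fin I1 => h.
rewrite -[D^-1]mul1r ler_pdivrMr//; apply: le_trans h _.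
rewrite /D [X in _ <= X]mulrCA ler_wpM2l ?(ltW C0)// mulrDr lerD//; last by rewrite mulrC ler_wpM2r// ltW.
by rewrite [X in _ <= X]mulrC !mulrA.
Qed.

Lemma dec_scale K phi q s : dec gamma K phi q ->
  dec gamma K (fun i x => s%:C *: phi i x) (fun x => s%:C *: q x).
Proof.
move=> [h ->]; split; last by apply/funext => x; rewrite scaler_sumr.
move=> i; have := eigs_lin s (eigs0 gamma i) (h i).
by under eq_fun do rewrite add0r.
Qed.

(** Homogeneity reduces to |q|_p = 1; if the norm or the volume vanishes, only the positivity of the
    form is left to use. *)
Lemma sobolev_dec : exists2 c0 : R, 0 < c0 & forall K phi q,
  dec gamma K phi q -> c0 * I (fun x => cnorm (q x) `^ pc) `^ bexp <= Qform K phi.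
Proof.
have b0 : 0 < bexp := @bexp_gt0 R m.
have z0 K (phi : nat -> spin) q : I (fun x => cnorm (q x) `^ pc) = 0 -> forall c : R, c * I (fun x => cnorm (q x) `^ pc) `^ bexp <= Qform K phi.
  by move=> -> c; rewrite powR0 ?gt_eqF// mulr0 Qform_ge0.
have [w0|wn] := eqVneq omega 0.
  exists 1 => // K phi q hq; apply: z0; apply: Int_omega0 => //.
  exact: bmeas_cnorm_powR (dec_bspin hq) (ltW p0).
have w0 : 0 < omega by rewrite lt_neqAle eq_sym wn omega_ge0.
have [c0 c00 hc] := sobolev_unit w0; exists c0 => // K phi q hq.
set J := (\int[_]_(_ in _) _); have [j0|jn] := eqVneq J 0; first exact: z0.
have J0 : 0 < J by rewrite lt_neqAle eq_sym jn; apply: Int_ge0 => x _; exact: powR_ge0.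
pose s := J `^ (- pc^-1); have s0 : 0 < s by exact: powR_gt0.
have bFp := bmeas_cnorm_powR (dec_bspin hq) (ltW p0).
have h1 := hc _ _ _ (dec_scale s hq).
have {h1} := h1 _; rewrite (eq_Int (g := fun x => s `^ pc * cnorm (q x) `^ pc)); last first.
  by move=> x _; rewrite cnormZ (gtr0_norm s0) powRM ?cnorm_ge0// ltW.
rewrite (IntZ _ bFp) -/J.
have -> : s `^ pc * J = 1.
  by rewrite /s -powRrM mulNr mulVf ?gt_eqF// powRN powRr1 ?(ltW J0)// mulVf.
move=> /(_ erefl).
have -> : Qform K (fun i x => s%:C *: phi i x) = s ^+ 2 * Qform K phi.
  rewrite /Qform mulr_sumr; apply: eq_bigr => i _; have l := eigs_L2 (hq.1 i).
  by rewrite (ipZl s l (L2Z _ l)) (ipZr s l l); ring.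
have e : s ^+ 2 * J `^ bexp = 1.
  rewrite /s -powR_mulrn ?powR_ge0// -powRrM -powRD; last by rewrite (gt_eqF J0) implybT.
  rewrite (_ : _ + _ = 0) ?powRr0// /pcrit /spinor_rank.
  rewrite /bexp natrM /=; have z1 : m.+1%:R != 0 :> R by rewrite pnatr_eq0.
  have z2 : n%:R != 0 :> R by rewrite pnatr_eq0.
  by move: (m.+1%:R : R) (n%:R : R) z1 z2 => u v z1 z2; field; rewrite z1 z2.
move=> h1; have s2 : 0 < s ^+ 2 by rewrite exprn_gt0.
by rewrite -(ler_pM2l s2) mulrCA e mulr1.
Qed.

End sobolev.

Lemma half_sum_sqr {R : realType} (u v w : R) : 0 <= u -> 2 * u <= v + w -> 2 * u ^+ 2 <= v ^+ 2 + w ^+ 2.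
Proof.
move=> u0 h; have : (2 * u) ^+ 2 <= (v + w) ^+ 2.
  by rewrite ler_sqr ?nnegrE ?(le_trans _ h)// mulr_ge0.
by have := sqr_ge0 (v - w); nra.
Qed.

(** * The form of |D| and the convexity of the L^p norm *)

Section quadratic_form.
Context {R : realType} (m : nat).
Local Notation n := m.+2.
Local Notation N := (spinor_rank n).
Local Notation vol := (@sphere_volume R n).
Local Notation S := (@sphere R n).
Local Notation X := 'rV[R]_n.+1.
Local Notation C := R[i].
Local Notation spin := (spinor R n).
Local Notation I f := (\int[vol]_(y in S) f y).
Local Notation pc := (@pcrit R m).
Local Notation bexp := (@bexp R m).
Implicit Types (x y : X) (p q u v w : spin) (s : R).

Let mS : measurable S := @measurable_sphere R n.
Let p1 : 1 < pc := @pcrit_gt1 R m.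
Let p0 : 0 < pc. Proof. exact: lt_trans ltr01 p1. Qed.

(** The difference of two values is an image of 0, hence orthogonal to the dense domain: T is
    single-valued up to null sets. *)
Lemma sa_fun (T : operator R n) p q v : selfadjoint T -> T p q -> T p v ->
  ip (fun x => q x + (-1)%:C *: v x) (fun x => q x + (-1)%:C *: v x) = 0.
Proof.
move=> sT Tq Tv; have [lp lq] := sa_L2 sT Tq; have [_ lv] := sa_L2 sT Tv.
have T0 := sa_lin sT (-1) Tq Tv; set d := fun x => q x + _ in T0 *.
have ld : in_L2 d by exact: L2lin.
apply/eqP; rewrite eq_le ip_ge0 andbT; apply/ler_addgt0Pr => e e0; rewrite add0r.
have [u [w [Tu ue]]] := sT.1 d e ld e0; have [lu lw] := sa_L2 sT Tu.
have z : (fun x => p x + (-1)%:C *: p x) = fun _ => 0.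
  by apply/funext => x; rewrite rmorphN rmorph1 scaleN1r subrr.
rewrite z in T0; have := sa_sym sT T0 Tu.
have -> : ip w (fun _ => 0) = 0.
  rewrite /ip (eq_Int (g := fun _ => 0)) ?Int_cst0// => x _.
  by rewrite rdotE big1// => l _; rewrite mxE /= !mulr0 addr0.
move=> o; have := ip_expand (-1) ld lu.
rewrite (ipC d u) -o mulr0 addr0 sqrrN expr1n mul1r => h.
have e1 : (d \- u)%R = (fun x => d x + (-1)%:C *: u x).
  by apply/funext => x; rewrite rmorphN rmorph1 scaleN1r.
move: ue; rewrite e1 (l2norm2E (L2lin (-1) ld lu)) lte_fin h.
by have := ip_ge0 u; lra.
Qed.

Lemma ip_diff_null u v : in_L2 u -> in_L2 v ->
  ip (fun x => u x + (-1)%:C *: v x) (fun x => u x + (-1)%:C *: v x) = 0 -> ip u u = ip v v.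
Proof.
move=> lu lv; set d := fun x => _ => d0; have ld : in_L2 d by exact: L2lin.
have -> : u = fun x => v x + 1%:C *: d x.
  by apply/funext => x; rewrite /d scale1r rmorphN rmorph1 scaleN1r addrC subrK.
by rewrite (ip_expand 1 lv ld) (ip_null lv ld d0) d0 !mulr0 !addr0.
Qed.

Lemma spinor_eq0_Lp p : in_L2 p -> (spinor_eq0 p <-> Lp_mass p = 0%E).
Proof.
move=> lp; have [mp _] := lp.
have mc : measurable_fun S (fun x => (cnorm (p x) `^ pc)%:E).
  by apply/measurable_EFinP; apply: (measurableT_comp (measurable_powR _)); exact: measurable_cnorm.
have := ae_eq_integral_abs vol mS mc; under eq_integral do rewrite gee0_abs ?lee_fin ?powR_ge0//.
rewrite -/(Lp_mass p) => h; split.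
- move=> q0; have : ae_eq vol S (fun x => (cnorm (p x) `^ pc)%:E) (cst 0%E).
    apply: filterS q0 => x -> _; rewrite (_ : cnorm 0 = 0) ?powR0 ?gt_eqF//.
    by rewrite /cnorm (_ : cdot 0 0 = 0) ?sqrtr0//; rewrite /cdot big1// => i _; rewrite mxE mul0r.
  by move=> /h.
move=> /h ae0; have aeS : {ae vol, forall x, S x}.
  by exists (~` S); split; [exact: measurableC|exact: sphere_volumeC0|].
apply: filterS2 ae0 aeS => x px Sx; apply: cnorm_eq0.
by have [/eqP] := px Sx; rewrite powR_eq0 => /andP[/eqP].
Qed.

(** Holder's inequality for normalised F: the tangent inequality at F(x), evaluated at t G(x), is
    integrated with t the inverse norm of G. The summand d covers the case of norm 0. *)
Lemma Lp_holder (F G : X -> R) : bmeas F -> bmeas G -> (forall x, S x -> 0 <= F x) -> (forall x, S x -> 0 <= G x) ->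
  I (fun x => F x `^ pc) = 1 -> I (fun x => F x `^ (pc - 1) * G x) <= I (fun x => G x `^ pc) `^ pc^-1.
Proof.
move=> bF bG F0 G0 IF; set B := I (fun x => G x `^ pc).
have B0 : 0 <= B by apply: Int_ge0 => x _; exact: powR_ge0.
have bFp := bmeas_powR bF F0 (ltW p0); have bGp := bmeas_powR bG G0 (ltW p0).
have p10 : 0 <= pc - 1 by rewrite subr_ge0 ltW.
have bFG := bmeasM (bmeas_powR bF F0 p10) bG.
apply/ler_addgt0Pr => d d0.
have Z0 : 0 < B `^ pc^-1 + d by rewrite ltr_wpDl ?powR_ge0.
set Z := B `^ pc^-1 + d in Z0 *.
have ZB : B <= Z `^ pc.
  have : B `^ pc^-1 <= Z by rewrite lerDl ltW.
  move=> /(ge0_ler_powR (ltW p0)); rewrite !nnegrE powR_ge0 (ltW Z0) => /(_ isT isT).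
  by rewrite -powRrM mulVf ?gt_eqF// powRr1.
pose t := Z^-1; have t0 : 0 < t by rewrite invr_gt0.
have tB : t `^ pc * B <= 1.
  apply: le_trans (ler_wpM2l (powR_ge0 _ _) ZB) _.
  by rewrite -powRM ?(ltW t0) ?(ltW Z0)// /t mulVf ?gt_eqF// powR1.
have : I (fun x => F x `^ pc + (pc * t * (F x `^ (pc - 1) * G x) + - pc * F x `^ pc)) <= I (fun x => t `^ pc * G x `^ pc).
  apply: le_Int; [|exact: bmeasZ|move=> x Sx].
    by apply: bmeasD => //; apply: bmeasD; exact: bmeasZ.
  have h := powR_tangent (F0 x Sx) (mulr_ge0 (ltW t0) (G0 x Sx)) p1.
  rewrite -powRM ?(ltW t0) ?G0//; apply: le_trans h.
  have e : F x `^ pc = F x `^ (pc - 1) * F x by rewrite mulrC mulr_powRB1 ?F0.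
  by rewrite le_eqVlt; apply/orP; left; apply/eqP; rewrite e; move: (F x `^ (pc - 1)) => u; ring.
rewrite (IntD bFp (bmeasD (bmeasZ (pc * t) bFG) (bmeasZ (- pc) bFp))).
rewrite (IntD (bmeasZ (pc * t) bFG) (bmeasZ (- pc) bFp)) (IntZ _ bFG) (IntZ _ bFp) (IntZ _ bGp) IF -/B.
set J := (\int[_]_(_ in _) _) => h; have h2 : pc * (t * J) <= pc * 1 by move: tB h; rewrite mulrA; move: (pc * t * J) (t `^ pc * B) => u w; lra.
by move: h2; rewrite ler_pM2l// /t mulrC ler_pdivrMr// mul1r.
Qed.

(** Convexity of the squared L^p norm by duality: the power p - 1 of the normalised F is tested
    against G + H. The exponent [bexp] is 2 / p. *)
Lemma Lp_midpoint (F G H : X -> R) : bmeas F -> bmeas G -> bmeas H ->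
  (forall x, S x -> 0 <= F x) -> (forall x, S x -> 0 <= G x) -> (forall x, S x -> 0 <= H x) ->
  (forall x, S x -> 2 * F x <= G x + H x) ->
  2 * I (fun x => F x `^ pc) `^ bexp <= I (fun x => G x `^ pc) `^ bexp + I (fun x => H x `^ pc) `^ bexp.
Proof.
move=> bF bG bH F0 G0 H0 FGH; have bE : bexp = pc^-1 * 2%:R.
  rewrite /bexp /pcrit natrM /=.
  have z1 : m.+1%:R != 0 :> R by rewrite pnatr_eq0.
  have z2 : n%:R != 0 :> R by rewrite pnatr_eq0.
  by move: (m.+1%:R : R) (n%:R : R) z1 z2 => u v z1 z2; field; rewrite z1 z2.
have sq (z : R) : z `^ bexp = (z `^ pc^-1) ^+ 2 by rewrite bE powRrM powR_mulrn ?powR_ge0.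
rewrite !sq; set A := I (fun x => F x `^ pc).
have A0 : 0 <= A by apply: Int_ge0 => x _; exact: powR_ge0.
have key : 2 * A `^ pc^-1 <= I (fun x => G x `^ pc) `^ pc^-1 + I (fun x => H x `^ pc) `^ pc^-1.
  have [->|An] := eqVneq A 0.
    by rewrite powR0 ?mulr0 ?addr_ge0 ?powR_ge0// invr_eq0 gt_eqF.
  have Ap : 0 < A by rewrite lt_neqAle eq_sym An.
  pose M := A `^ pc^-1; have M0 : 0 < M by exact: powR_gt0.
  have MA : M `^ pc = A by rewrite /M -powRrM mulVf ?gt_eqF// powRr1.
  rewrite -/M; clearbody M.
  pose F' x := M^-1 * F x; have bF' : bmeas F' by exact: bmeasZ.
  have iM : 0 <= M^-1 by rewrite invr_ge0 ltW.
  have F'0 x : S x -> 0 <= F' x by move=> Sx; rewrite mulr_ge0 ?F0.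
  have IF' : I (fun x => F' x `^ pc) = 1.
    rewrite (eq_Int (g := fun x => M^-1 `^ pc * F x `^ pc)).
      rewrite (IntZ _ (bmeas_powR bF F0 (ltW p0))) -/A -MA -powRM ?(ltW M0)//.
      by rewrite mulVf ?powR1// gt_eqF.
    by move=> x Sx; rewrite powRM ?F0.
  have hG := Lp_holder bF' bG F'0 G0 IF'; have hH := Lp_holder bF' bH F'0 H0 IF'.
  have p10 : 0 <= pc - 1 by rewrite subr_ge0 ltW.
  have b1 := bmeas_powR bF' F'0 p10.
  apply: le_trans (lerD hG hH); rewrite -(IntD (bmeasM b1 bG) (bmeasM b1 bH)).
  have -> : 2 * M = I (fun x => 2 * (F' x `^ (pc - 1) * F x)).
    rewrite IntZ; last exact: bmeasM.
    rewrite (eq_Int (g := fun x => M * F' x `^ pc)).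
      by rewrite (IntZ _ (bmeas_powR bF' F'0 (ltW p0))) IF' mulr1.
    move=> x Sx; rewrite -(mulr_powRB1 (F'0 x Sx) p0) /F' mulrA.
    by rewrite mulrA mulfV ?gt_eqF// mul1r mulrC.
  apply: le_Int; [by apply: bmeasZ; exact: bmeasM|by apply: bmeasD; exact: bmeasM|move=> x Sx].
  by rewrite mulrCA -mulrDr ler_wpM2l ?powR_ge0 ?FGH.
exact: half_sum_sqr (powR_ge0 _ _) key.
Qed.

Variable gamma : 'I_n -> 'M[C]_N.
Hypothesis cl : clifford_rep gamma.

Lemma H12_app psi : H12 gamma psi -> exists2 T, sqrt_op gamma T &
  T psi (op_app (sqrt_abs_dirac gamma) psi).
Proof.
move=> [eta h]; have := @xgetI _ (fun=> 0) _ _ h; rewrite -/(op_app _ _) => -[T hT Tpsi].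
by exists T.
Qed.

Lemma abs_dirac_formE T psi eta : sqrt_op gamma T -> T psi eta ->
  H12 gamma psi -> exists2 eta', abs_dirac_form gamma psi = (ip eta' eta')%:E & exists2 T', sqrt_op gamma T' & T' psi eta'.
Proof.
move=> _ _ /H12_app[T' hT' T'psi]; eexists; last by exists T'; [exact: hT'|exact: T'psi].
by rewrite /abs_dirac_form l2norm2E//; have [sT _ _] := hT'; have [] := sa_L2 sT T'psi.
Qed.

Lemma sqrt_op_dec T K phi q : sqrt_op gamma T -> dec gamma K phi q ->
  T q (fun x => \sum_(i < K) (Num.sqrt (al m i))%:C *: phi i x).
Proof.
move=> hT [h ->]; have [sT _ _] := hT.
elim: K => [|K ih].
  have := sa0 sT; congr T; apply/funext => x; by rewrite big_ord0.
have := sa_lin sT 1 ih (sqrt_op_eigs hT (h K)).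
by congr T; apply/funext => x; rewrite scale1r big_ord_recr.
Qed.

Lemma dec_sqrt K phi q : dec gamma K phi q ->
  dec gamma K (fun i x => (Num.sqrt (al m i))%:C *: phi i x) (fun x => \sum_(i < K) (Num.sqrt (al m i))%:C *: phi i x).
Proof.
move=> [h _]; split=> // i; have := eigs_lin (Num.sqrt (al m i)) (eigs0 gamma i) (h i).
by under eq_fun do rewrite add0r.
Qed.

Lemma Qform_sqrt K phi q : dec gamma K phi q ->
  ip (fun x => \sum_(i < K) (Num.sqrt (al m i))%:C *: phi i x) (fun x => \sum_(i < K) (Num.sqrt (al m i))%:C *: phi i x) = Qform K phi.
Proof.
move=> hq; rewrite (dec_norm cl (dec_sqrt hq)); apply: eq_bigr => i _.
have l := eigs_L2 (hq.1 i); rewrite (ipZl _ l (L2Z _ l)) (ipZr _ l l) mulrA.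
by rewrite -expr2 sqr_sqrtr// ltW// al_gt0.
Qed.

Lemma abs_dirac_form_dec T K phi q : sqrt_op gamma T -> dec gamma K phi q ->
  H12 gamma q /\ abs_dirac_form gamma q = (Qform K phi)%:E.
Proof.
move=> hT hq; have Tq := sqrt_op_dec hT hq.
have Hq : H12 gamma q by exists (fun x => \sum_(i < K) (Num.sqrt (al m i))%:C *: phi i x), T.
split=> //; have [eta' -> [T' hT' T'q]] := abs_dirac_formE hT Tq Hq.
have [sT' _ _] := hT'; have T'q2 := sqrt_op_dec hT' hq.
rewrite -(Qform_sqrt hq); congr EFin; apply: ip_diff_null.
- by have [] := sa_L2 sT' T'q.
- by have [] := sa_L2 sT' T'q2.
exact: sa_fun T'q T'q2.
Qed.

(** Bessel's inequality for the form: with e0 = |D|^(1/2) q, symmetry and the orthogonality of the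
    residual give <eta, e0> = <e0, e0>, the form of q. *)
Lemma Qform_projection T psi eta K phi q : sqrt_op gamma T -> T psi eta -> dec gamma K phi q ->
  (forall i, ip (fun x => psi x + (-1)%:C *: q x) (phi i) = 0) -> Qform K phi <= ip eta eta.
Proof.
move=> hT Tpsi hq o; have [sT _ _] := hT; have [lpsi leta] := sa_L2 sT Tpsi.
have h := hq.1; have lq := dec_L2 hq.
pose e0 x := \sum_(i < K) (Num.sqrt (al m i))%:C *: phi i x.
have le0 : in_L2 e0 := dec_L2 (dec_sqrt hq).
have cross : ip eta e0 = Qform K phi.
  rewrite (ip_wsum K (fun i => Num.sqrt (al m i)) leta (fun i => eigs_L2 (h i))).
  apply: eq_bigr => i _; have l := eigs_L2 (h i).
  have := sa_sym sT Tpsi (sqrt_op_eigs hT (h i)); rewrite (ipZl _ l lpsi) (ipC eta) => <-.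
  rewrite mulrA -expr2 sqr_sqrtr; last by rewrite ltW// al_gt0.
  congr (_ * _); have := o i; rewrite ipC ip_lin// mulN1r => /eqP; rewrite subr_eq0 => /eqP ->.
  exact: (dec_ip cl hq (h i) (ltn_ord i)).
have := ip_ge0 (fun x => eta x + (-1)%:C *: e0 x).
rewrite (ip_expand (-1) leta le0) cross (Qform_sqrt hq) sqrrN expr1n.
by lra.
Qed.

End quadratic_form.

(* First variation: [E1 + E2 = 2 Qf] while the perturbations of [E1] and [E2]
   in opposite directions have weights that differ by [sg]. *)
Lemma minimizer_arith {R : realType} (Q Qf E1 E2 u1 u2 a s b bp g e sg c N0 N1 N2 : R) : Qf <= Q ->
  c * N1 <= E1 + u1 * (2 * s * b + s ^+ 2 * g) -> c * N2 <= E2 + u2 * (2 * - s * b + (- s) ^+ 2 * g) ->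
  E1 + E2 = 2 * Qf -> - (sg * (s * (bp - b))) <= e -> u1 - u2 = sg -> u1 + u2 = 2 * a ->
  0 <= c -> 2 * N0 <= N1 + N2 ->
  c * N0 <= Q + (s * (sg * bp) + s ^+ 2 * (a * g)) + e.
Proof.
move=> h1 h2 h3 h4 h5 h6 h7 c0 /(ler_wpM2l c0); rewrite mulrDr => h8.
have e1 : E1 + u1 * (2 * s * b + s ^+ 2 * g) + (E2 + u2 * (2 * - s * b + (- s) ^+ 2 * g)) =
    (E1 + E2) + 2 * ((u1 - u2) * (s * b)) + (u1 + u2) * (s ^+ 2 * g) by ring.
have := lerD h2 h3; rewrite e1 h4 h6 h7 => h9.
have e2 : sg * (s * (bp - b)) = s * (sg * bp) - sg * (s * b) by ring.
rewrite e2 in h5; have e3 : 2 * a * (s ^+ 2 * g) = 2 * (s ^+ 2 * (a * g)) by ring.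
rewrite e3 in h9; move: (sg * (s * b)) (s * (sg * bp)) (s ^+ 2 * (a * g)) h5 h9 => A B D h5 h9.
by move: h8; rewrite mulrCA; move: (c * N0) => E h8; lra.
Qed.

(** Comes from expanding the squared norm of the projection residual plus r sg s times the
    eigenspinor; it bounds the pairing of the residual with the perturbation. *)
Lemma cross_arith {R : realType} (e r sg s u v w : R) : 0 < r -> u <= e * r -> w <= r * e ->
  0 <= u + 2 * (r * (sg * s)) * v + w -> - (sg * (s * v)) <= e.
Proof.
move=> r0 h1 h2 h3; have e1 : r * (2 * (e + sg * (s * v))) = e * r + 2 * (r * (sg * s)) * v + r * e by ring.
have : 0 <= r * (2 * (e + sg * (s * v))) by rewrite e1; lra.
by rewrite pmulr_rge0// pmulr_rge0//; lra.
Qed.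

(** * The minimizer *)

Section minimizer.
Context {R : realType} (m : nat).
Local Notation n := m.+2.
Local Notation N := (spinor_rank n).
Local Notation vol := (@sphere_volume R n).
Local Notation S := (@sphere R n).
Local Notation X := 'rV[R]_n.+1.
Local Notation C := R[i].
Local Notation spin := (spinor R n).
Local Notation I f := (\int[vol]_(y in S) f y).
Local Notation pc := (@pcrit R m).
Local Notation bexp := (@bexp R m).
Implicit Types (x y : X) (p q u v w : spin) (s : R).
Variable gamma : 'I_n -> 'M[C]_N.
Hypothesis cl : clifford_rep gamma.

Let b0 : 0 < bexp := @bexp_gt0 R m.

Definition NR p : R := I (fun x => cnorm (p x) `^ pc).

Lemma NR_ge0 p : 0 <= NR p.
Proof. by apply: Int_ge0 => x _; exact: powR_ge0. Qed.

Lemma powR_le_inv (c A B : R) : 0 < c -> 0 <= A -> 0 <= B ->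
  (c * A `^ bexp <= B <-> A <= (B / c) `^ bexp^-1).
Proof.
move=> c0 A0 B0; have Bc : 0 <= B / c by rewrite divr_ge0 // ltW.
rewrite mulrC -ler_pdivlMr//; split=> h.
  have := @ge0_ler_powR _ bexp^-1 _ _ _ _ _ h; rewrite !nnegrE powR_ge0 Bc invr_ge0 (ltW b0).
  by rewrite -powRrM divff ?gt_eqF// powRr1//; apply.
have := @ge0_ler_powR _ bexp _ _ _ _ _ h; rewrite !nnegrE powR_ge0 A0 (ltW b0).
by rewrite -powRrM mulVf ?gt_eqF// powRr1//; apply.
Qed.

Lemma bspin_sumT (J : Type) (r : seq J) (F : J -> spin) : (forall j, bspin (F j)) ->
  bspin (fun x => \sum_(j <- r) F j x).
Proof.
move=> bF; elim: r => [|j r ih].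
  by move=> l; split; (rewrite (_ : (fun x => _) = fun _ => 0); [exact: bmeas_cst|apply/funext => x; rewrite big_nil mxE]).
rewrite (_ : (fun x => _) = fun x => \sum_(j <- r) F j x + 1%:C *: F j x); first exact: bspin_lin.
by apply/funext => x; rewrite big_cons scale1r addrC.
Qed.

Lemma bspin_mul (A : 'M[C]_N) p : bspin p -> bspin (fun x => A *m p x).
Proof.
move=> bp i; split.
  rewrite (_ : (fun x => _) = fun x => \sum_l (complex.Re (A i l) * cRe p l x + (- complex.Im (A i l)) * cIm p l x)).
    by apply: bmeas_sum => l; have [h1 h2] := bp l; apply: bmeasD; exact: bmeasZ.
  by apply/funext => x; rewrite mxE raddf_sum; apply: eq_bigr => l _; rewrite /= complex_ReM !mulNr.
rewrite (_ : (fun x => _) = fun x => \sum_l (complex.Re (A i l) * cIm p l x + complex.Im (A i l) * cRe p l x)).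
  by apply: bmeas_sum => l; have [h1 h2] := bp l; apply: bmeasD; exact: bmeasZ.
by apply/funext => x; rewrite mxE raddf_sum; apply: eq_bigr => l _; rewrite /= complex_ImM.
Qed.

Lemma bspin_cv (A : 'I_n.+1 -> 'M[C]_N) p : bspin p -> bspin (fun x => cv A x *m p x).
Proof.
move=> bp; rewrite (_ : (fun x => _) = fun x => \sum_j (x 0 j)%:C *: (A j *m p x)).
  by apply: bspin_sumT => j; apply: bspin_scale; [exact: bmeas_coord|exact: bspin_mul].
by apply/funext => x; rewrite /cv mulmx_suml; apply: eq_bigr => j _; rewrite scalemxAl.
Qed.

(** [sobolev_energy] in the two gauges; by [cv_mul] the inverse of [cv gB] on the sphere is minus
    [cv gA]. *)
Lemma energy_bounds (c : R) : 0 <= c ->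
  (forall K phi q, dec gamma K phi q -> c * NR q `^ bexp <= Qform K phi) ->
  forall K phi p, dec gamma K phi p ->
    c * NR p `^ bexp <= energy uphalf K phi /\ c * NR p `^ bexp <= energy dgU K phi.
Proof.
move=> c0 hc K phi p hp; split.
  apply: (@sobolev_energy R m gamma cl (fun _ => 1%:M) (fun _ => 1%:M) uphalf) hp => //.
  - by move=> x v _; rewrite !mul1mx.
  - by move=> x u v _; rewrite !mul1mx.
  - by move=> q; under [X in _ -> bspin X]eq_fun do rewrite mul1mx.
  - by move=> q; under [X in _ -> bspin X]eq_fun do rewrite mul1mx.
  - by move=> i q hq; under eq_fun do rewrite mul1mx; exact: es_harm hq.
  by move=> i; rewrite uphalf_half leq_addl.
apply: (@sobolev_energy R m gamma cl (fun x => cv (gB gamma) x) (fun x => - cv (gA gamma) x) dgU) hp => //.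
- move=> x v Sx; rewrite mulNmx mulmxN (cv_mul (clifford_pairC (gpair cl))) (_ : edot x x = 1)//.
  by rewrite scaleN1r opprK.
- by move=> x u v Sx; rewrite /rdot cdot_cvB.
- by move=> q; exact: bspin_cv.
- move=> q bq; rewrite (_ : (fun x => _) = fun x => (-1)%:C *: (cv (gA gamma) x *m q x)).
    by apply: (bspin_scale (f := fun _ => -1)); [exact: bmeas_cst|exact: bspin_cv].
  by apply/funext => x; rewrite mulNmx rmorphN rmorph1 scaleN1r.
- by move=> i q hq; exact: es_harmU hq.
by move=> i; rewrite leq_addr.
Qed.

Lemma Lp_mass_NR p : bspin p -> Lp_mass p = (NR p)%:E.
Proof. exact: Lp_massE. Qed.

Lemma quotientE p (Q J : R) : abs_dirac_form gamma p = Q%:E -> Lp_mass p = J%:E -> 0 < J ->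
  abs_dirac_quotient gamma p = (Q / J `^ bexp)%:E.
Proof.
move=> fQ mJ J0; rewrite /abs_dirac_quotient fQ -[X in (_ / X `^ _)%E]/(Lp_mass p) mJ.
by rewrite poweR_EFin inver gt_eqF ?powR_gt0// EFinM.
Qed.

Lemma L2_orth_eigs psi : in_L2 psi -> (forall i phi, eigs gamma i phi -> ip psi phi = 0) -> ip psi psi = 0.
Proof.
move=> lp o; apply/eqP; rewrite eq_le ip_ge0 andbT; apply/ler_addgt0Pr => e e0; rewrite add0r.
have [K [phi [q [hq _ dq]]]] := L2_projection cl lp e0; apply: le_trans dq.
have lq := dec_L2 hq; have [h qE] := hq.
have pq : ip psi q = 0.
  by rewrite qE (ip_sumr _ lp (fun i : 'I_K => eigs_L2 (h i))) big1// => i _; exact: o (h i).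
rewrite /dist2 (ip_expand (-1) lp lq) pq mulr0 addr0 sqrrN expr1n mul1r.
by rewrite lerDl ip_ge0.
Qed.

Lemma energy_add (dg : nat -> nat) K phi q i p s : dec gamma K phi q -> eigs gamma i p -> (i < K)%N ->
  energy dg K (fun j => if j == i then fun x => phi j x + s%:C *: p x else phi j) =
  energy dg K phi + mu (R := R) m dg i * (2 * s * ip q p + s ^+ 2 * ip p p).
Proof.
move=> hq hp iK; have [h _] := hq.
rewrite /energy (bigD1 (Ordinal iK))//= [X in _ = X + _](bigD1 (Ordinal iK))//= eqxx.
have -> : ip q p = ip (phi i) p by rewrite !(ipC _ p) (dec_ip cl hq hp iK).
rewrite (ip_expand s (eigs_L2 (h i)) (eigs_L2 hp)) [RHS]addrAC; congr (_ + _); first by ring.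
apply: eq_bigr => j ji; rewrite (_ : (nat_of_ord j == i) = false)//.
by apply: contra_neqF ji => /eqP h2; exact/val_inj.
Qed.

Lemma mu_add i : mu (R := R) m uphalf i + mu (R := R) m dgU i = 2 * al m i.
Proof.
rewrite /mu /al /dgU uphalf_half !natrD -[n%:R]natr1.
by case: (odd i) => /=; field.
Qed.

Lemma energy_sum K (phi : nat -> spin) : energy uphalf K phi + energy dgU K phi = 2 * Qform K phi.
Proof.
rewrite /energy /Qform mulr_sumr -big_split /=; apply: eq_bigr => i _.
by rewrite -mulrDl mu_add mulrA.
Qed.

Lemma mu_sub i : mu (R := R) m uphalf i - mu (R := R) m dgU i = (-1) ^+ ~~ odd i.
Proof.
rewrite /mu /dgU uphalf_half !natrD.
by case: (odd i) => /=; rewrite ?expr0 ?expr1; ring.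
Qed.

Theorem no_minimizer psi : H12 gamma psi -> ~ spinor_eq0 psi ->
  abs_dirac_quotient gamma psi <> abs_dirac_const gamma.
Proof.
move=> Hpsi npsi qc; have [T hT Teta] := H12_app Hpsi.
set eta := op_app _ _ in Teta; have [sT _ _] := hT; have [lpsi leta] := sa_L2 sT Teta.
have fE : abs_dirac_form gamma psi = (ip eta eta)%:E by rewrite /abs_dirac_form l2norm2E.
set Q := ip eta eta in fE.
have Q0 : 0 <= Q by exact: ip_ge0.
have [c0 c00 hc0] := sobolev_dec cl.
(* A bound on c |q|_p^2 along L^2 approximations q passes to psi by lower semicontinuity. *)
have approx c B : 0 < c -> 0 <= B -> (forall e : R, 0 < e -> exists q, [/\ bspin q, dist2 psi q <= e & c * NR q `^ bexp <= B]) ->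
    (Lp_mass psi <= ((B / c) `^ bexp^-1)%:E)%E.
  move=> c0' B0 H; apply: Lp_mass_lsc => // [|e e0]; first exact: powR_ge0.
  have [q [bq dq hq]] := H e e0; exists q; split => //.
  by rewrite Lp_mass_NR// lee_fin; apply/(powR_le_inv c0' (NR_ge0 q) B0).
(* The projections of psi have form at most that of psi, so the Sobolev inequality bounds their L^p
   norms uniformly. *)
have fin : (Lp_mass psi <= ((Q / c0) `^ bexp^-1)%:E)%E.
  apply: approx => // e e0; have [K [phi [q [hq o dq]]]] := L2_projection cl lpsi e0.
  exists q; split=> //; first exact: dec_bspin hq.
  exact: le_trans (hc0 _ _ _ hq) (Qform_projection cl hT Teta hq o).
have m0 : (0 <= Lp_mass psi)%E by apply: integral_ge0 => x _; rewrite lee_fin powR_ge0.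
have [J JE] : exists J : R, Lp_mass psi = J%:E.
  by exists (fine (Lp_mass psi)); rewrite fineK// ge0_fin_numE// (le_lt_trans fin)// ltry.
have J0 : 0 < J.
  rewrite lt_neqAle -lee_fin -JE m0 andbT eq_sym; apply/negP => /eqP j0.
  by apply: npsi; apply/(spinor_eq0_Lp lpsi); rewrite JE j0.
have JQ : c0 * J `^ bexp <= Q.
  by apply/(powR_le_inv c00 (ltW J0) Q0); rewrite -lee_fin -JE.
have Jb : 0 < J `^ bexp by exact: powR_gt0.
have Qp : 0 < Q by apply: lt_le_trans JQ; exact: mulr_gt0.
pose c := Q / J `^ bexp; have c_gt0 : 0 < c by exact: divr_gt0.
have cJ : c * J `^ bexp = Q by rewrite /c divfK// gt_eqF.
have cE : abs_dirac_const gamma = c%:E by rewrite -qc (quotientE fE JE J0).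
clearbody c.
(* Finite sums of eigenspinors are the only competitors for the infimum c that are needed. *)
have hc K phi q : dec gamma K phi q -> c * NR q `^ bexp <= Qform K phi.
  move=> hq; have bq := dec_bspin hq.
  have [n0|nn] := eqVneq (NR q) 0; first by rewrite n0 powR0 ?mulr0 ?Qform_ge0// gt_eqF.
  have NRp : 0 < NR q by rewrite lt_neqAle eq_sym nn NR_ge0.
  have [Hq fq] := abs_dirac_form_dec cl hT hq.
  rewrite -ler_pdivlMr ?powR_gt0// -lee_fin -cE -(quotientE fq (Lp_mass_NR bq) NRp).
  apply: ereal_inf_lbound; exists q => //; split=> // /(spinor_eq0_Lp (dec_L2 hq)).
  by rewrite Lp_mass_NR// => -[] z; move: NRp; rewrite z ltxx.
have hE := energy_bounds (ltW c_gt0) hc.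
apply: npsi; apply/(spinor_eq0E lpsi); apply: L2_orth_eigs => // i p hp.
have lp := eigs_L2 hp; have bp := harm_bspin (es_harm hp).
pose sg : R := (-1) ^+ ~~ odd i; pose D := al m i * ip p p.
have D0 : 0 <= D by rewrite mulr_ge0 ?ip_ge0// ltW// al_gt0.
(* A quadratic polynomial in s that is never negative has no linear term; D + 1 in place of D avoids
   a division by 0. *)
suff key s : 0 <= s * (sg * ip psi p) + s ^+ 2 * D.
  set z := ip psi p in key *; apply/eqP/negPn/negP => z0.
  have D1 : 0 < D + 1 by rewrite ltr_wpDl.
  have sg2 : sg ^+ 2 = 1 by rewrite -exprM mulnC exprM sqrrN !expr1n.
  have := key (- (sg * z) / (D + 1)).
  have -> : - (sg * z) / (D + 1) * (sg * z) + (- (sg * z) / (D + 1)) ^+ 2 * D =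
      - (sg ^+ 2 * z ^+ 2 / (D + 1) ^+ 2) by field; rewrite gt_eqF.
  rewrite sg2 mul1r oppr_ge0; apply/negP; rewrite -ltNge divr_gt0 ?(exprn_gt0 2 D1)//.
  by rewrite lt_neqAle sqr_ge0 andbT eq_sym sqrf_eq0.
(* Adding Q = c |psi|_p^2 turns the claim into an upper bound for |psi|_p, which can be checked on
   approximations. *)
apply/ler_addgt0Pr => e e0; rewrite -(lerD2l Q) addr0 addrA -{1}cJ.
set B := Q + _ + e.
suff H (d : R) : 0 < d -> exists q, [/\ bspin q, dist2 psi q <= d & c * NR q `^ bexp <= B].
  have B0 : 0 <= B.
    have [q [_ _]] := H 1 ltr01; apply: le_trans.
    exact: mulr_ge0 (ltW c_gt0) (powR_ge0 _ _).
  apply/(powR_le_inv c_gt0 (ltW J0) B0); rewrite -lee_fin -JE; exact: approx.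
move=> d0.
pose A := s ^+ 2 * ip p p + 1.
have sp0 : 0 <= s ^+ 2 * ip p p by apply: mulr_ge0 (sqr_ge0 _) (ip_ge0 _).
have A0 : 0 < A by rewrite ltr_wpDl.
pose r := e / A; have r0 : 0 < r by exact: divr_gt0.
(* The second bound makes the residual small enough for its pairing with s p to cost at most e. *)
have d1 : 0 < Num.min d (e * r) by rewrite lt_min d0 mulr_gt0.
have [K [phi [q [hq o dq]]]] := L2_projection cl lpsi d1.
have bq := dec_bspin hq; have lq := dec_L2 hq.
exists q; split=> //; first by apply: le_trans dq _; rewrite ge_min lexx.
have dr : dist2 psi q <= e * r by apply: le_trans dq _; rewrite ge_min lexx orbT.
have lw := L2lin (-1) lpsi lq.
(* The decomposition is padded with zeros so as to contain the index i of the perturbation. *)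
have hq' := dec_widen hq (leq_addr i.+1 K); set phi' := fun j => _ in hq'.
have iK : (i < K + i.+1)%N by rewrite addnS ltnS leq_addl.
have o' j : ip (fun x => psi x + (-1)%:C *: q x) (phi' j) = 0.
  rewrite /phi'; case: ifP => _ //; rewrite /ip (eq_Int (g := fun _ => 0)) ?Int_cst0// => x _.
  by rewrite rdotE big1// => l _; rewrite !mxE /= !mulr0 addr0.
have hQ := Qform_projection cl hT Teta hq' o'.
have hp1 := dec_add s hq' hp iK; have hp2 := dec_add (- s) hq' hp iK.
(* One energy is tested at q + s p, the other at q - s p; the first-order terms do not cancel,
   because the two weights at p differ by [sg]. *)
have [e1 _] := hE _ _ _ hp1; have [_ e2] := hE _ _ _ hp2.
rewrite (energy_add _ s hq' hp iK) in e1; rewrite (energy_add _ (- s) hq' hp iK) in e2.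
have es := energy_sum (K + i.+1) phi'.
have mid : 2 * NR q `^ bexp <= NR (fun x => q x + s%:C *: p x) `^ bexp + NR (fun x => q x + (- s)%:C *: p x) `^ bexp.
  apply: Lp_midpoint; [exact: bmeas_cnorm|exact/bmeas_cnorm/bspin_lin|exact/bmeas_cnorm/bspin_lin|..].
  - by move=> x _; exact: cnorm_ge0.
  - by move=> x _; exact: cnorm_ge0.
  - by move=> x _; exact: cnorm_ge0.
  move=> x _; apply: le_trans (cnorm_tri _ _).
  rewrite rmorphN scaleNr addrACA subrr addr0 -[q x in leRHS]scale1r -scalerDl -[1 + 1]/(2%:R) -(rmorph_nat (real_complex R)) cnormZ.
  by rewrite ger0_norm.
have cross : - (sg * (s * ip (fun x => psi x + (-1)%:C *: q x) p)) <= e.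
  have := ip_ge0 (fun x => (psi x + (-1)%:C *: q x) + (r * (sg * s))%:C *: p x).
  rewrite (ip_expand _ lw lp) -/(dist2 psi q).
  have sg2 : sg ^+ 2 = 1 by rewrite -exprM mulnC exprM sqrrN !expr1n.
  have -> : (r * (sg * s)) ^+ 2 * ip p p = r * (r * (s ^+ 2 * ip p p)) * sg ^+ 2 by ring.
  rewrite sg2 mulr1; have rA : r * (s ^+ 2 * ip p p) <= e.
    by apply: (@le_trans _ _ (r * A)); [rewrite ler_wpM2l ?lerDl ?(ltW r0)|rewrite /r divfK// gt_eqF].
  exact: cross_arith r0 dr (ler_wpM2l (ltW r0) rA).
have cr : ip (fun x => psi x + (-1)%:C *: q x) p = ip psi p - ip q p.
  by rewrite ipC ip_lin// mulN1r !(ipC p).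
rewrite cr in cross.
have ms := mu_sub i; have ma := mu_add i; rewrite -/sg in ms.
exact: minimizer_arith hQ e1 e2 es cross ms ma (ltW c_gt0) mid.
Qed.

End minimizer.

Theorem theoremA6 (R : realType) (n : nat) (gamma : 'I_n -> 'M[R[i]]_(spinor_rank n))
  (hn : (2 <= n)%N) (hgamma : clifford_rep gamma) :
  ~ exists psi : spinor R n,
      [/\ H12 gamma psi, ~ spinor_eq0 psi &
          abs_dirac_quotient gamma psi = abs_dirac_const gamma].
Proof.
case: n gamma hn hgamma => [|[|m]]// gamma _ cl [psi [h1 h2]].
exact: no_minimizer cl psi h1 h2.
Qed.
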